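(* Let $T>0$. For $h>0$ let the initial data $\varrho_{0,h},E_{0,h}\in Q_h(\Omega_h)$, $\mathbf m_{0,h}\in Q_h(\Omega_h;\mathbb R^N)$ satisfy $\varrho_{0,h}\ge\underline\varrho>0$ and $E_{0,h}-\frac12|\mathbf m_{0,h}|^2/\varrho_{0,h}>0$, with $\int_{\Omega_h}\varrho_{0,h}\,dx$ and $\int_{\Omega_h}E_{0,h}\,dx$ bounded uniformly in $h$ and initial entropy $s_h(0)>s_0$ for a constant $s_0\in\mathbb R$ independent of $h$. Let $[\varrho_h,\mathbf m_h,E_h]$ be the unique solution of the semi-discrete finite volume scheme (C), (M), (E) described in the context on the time interval $[0,T]$. Then there are error functionals $e_{1,h},e_{2,h},e_{3,h}$ such that for every $\tau\in[0,T]$: $$\Big[\int_{\Omega_h}\varrho_h\varphi\,dx\Big]_{t=0}^{t=\tau}=\int_0^\tau\int_{\Omega_h}\big[\varrho_h\partial_t\varphi+\mathbf m_h\cdot\nabla_x\varphi\big]dx\,dt+\int_0^\tau e_{1,h}(t,\varphi)\,dt$$ for any $\varphi\in C^1([0,T]\times\overline\Omega_h)$; $$\Big[\int_{\Omega_h}\mathbf m_h\cdot\boldsymbol\varphi\,dx\Big]_{t=0}^{t=\tau}=\int_0^\tau\int_{\Omega_h}\Big[\mathbf m_h\cdot\partial_t\boldsymbol\varphi+\frac{\mathbf m_h\otimes\mathbf m_h}{\varrho_h}:\nabla_x\boldsymbol\varphi+p_h\,{\rm div}_x\boldsymbol\varphi\Big]dx\,dt+\int_0^\tau e_{2,h}(t,\boldsymbol\varphi)\,dt$$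 for any $\boldsymbol\varphi\in C^1([0,T]\times\overline\Omega_h;\mathbb R^N)$ with $\boldsymbol\varphi\cdot\mathbf n|_{\partial\Omega_h}=0$; $$\int_{\Omega_h}E_h(\tau)\,dx=\int_{\Omega_h}E_{0,h}\,dx;$$ $$\Big[\int_{\Omega_h}\varrho_h\chi(s_h)\varphi\,dx\Big]_{t=0}^{t=\tau}\ge\int_0^\tau\int_{\Omega_h}\big[\varrho_h\chi(s_h)\partial_t\varphi+\chi(s_h)\mathbf m_h\cdot\nabla_x\varphi\big]dx\,dt+\int_0^\tau e_{3,h}(t,\varphi)\,dt$$ for any $\varphi\in C^1([0,T]\times\overline\Omega_h)$, $\varphi\ge0$, and any non-decreasing concave $\chi:\mathbb R\to\mathbb R$ with $\chi(s)\le\overline\chi$ for all $s\in\mathbb R$. If, in addition, $$h^\beta\lesssim\mu_h\lesssim1,\quad 0\le\beta<1,\qquad 0<\alpha<\frac43,$$ and there are constants $\underline\varrho,\overline\vartheta>0$ independent of $h$ with $$0<\underline\varrho\le\varrho_h(t),\quad\vartheta_h(t)\le\overline\vartheta\quad\text{for all }t\in[0,T]\text{ uniformly for }h\to0,$$ then for $j=1,2,3$ $$\|e_{j,h}(\cdot,\varphi)\|_{L^1(0,T)}\lesssim h^\delta\|\varphi\|_{C^1}\quad\text{for some }\delta>0 .$$ Here $A\lesssim B$ means $A\le cB$ with $c>0$ independent of $h$ (and of the test function $\varphi$, resp. $\boldsymbol\varphi$).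
   Context: Mesh. $\Omega_h\subset\mathbb R^N$, $N\in\{1,2,3\}$, is the polyhedral physical domain (regarded as fixed while the mesh size $h\to0$), $\overline{\Omega}_h=\bigcup_{K\in\mathcal T_h}K$ with $\mathcal T_h$ a finite regular mesh of compact elements (two elements share at most a common face, edge or vertex), $|K|\approx h^N$, $|\sigma|\approx h^{N-1}$ for elements $K$ and faces $\sigma$, uniformly in $h$. $\Sigma_{int}$ is the set of interior faces; each face carries a fixed unit normal $\mathbf n$. $Q_h(\Omega_h)$ (resp. $Q_h(\Omega_h;\mathbb R^N)$) is the set of scalar (resp. vector) functions constant on each element. Traces. On $\sigma\in\Sigma_{int}$: $v^{\rm out}(x)=\lim_{\delta\to0+}v(x+\delta\mathbf n)$, $v^{\rm in}(x)=\lim_{\delta\to0+}v(x-\delta\mathbf n)$, $\overline v=\frac12(v^{\rm in}+v^{\rm out})$, $[[v]]=v^{\rm out}-v^{\rm in}$. For a velocity $\mathbf u$: $Up[r,\mathbf u]=\overline r\,\overline{\mathbf u}\cdot\mathbf n-\frac12|\overline{\mathbf u}\cdot\mathbf n|[[r]]$ (componentwise for vector $r$). Parameters. $\gamma>1$, $c_v=1/(\gamma-1)$, $\alpha$ a fixed real parameter; $\mu_h\ge0$ is a face-wise numerical viscosity, typically $\mu_h=hM(h,\overline{\varrho_h},\overline{\mathbf m_h},\overline{E_h})$ with $M$ continuous, regular enough for standard ODE theory to give a unique maximal solution of the scheme for each admissible initial state ($\varrho>0$ and $E-\frac12|\mathbf m|^2/\varrho>0$ on every element). Numerical flux: $F_h(r,\mathbf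 u)=Up[r,\mathbf u]-\mu_h[[r]]$ (componentwise $\mathbf F_h$ for vectors). The scheme has a unique global solution for admissible initial data, with $\varrho_h>0$, $p_h>0$ for all times. Scheme (semi-discrete; unknowns $\varrho_h,E_h\in Q_h(\Omega_h)$, $\mathbf m_h\in Q_h(\Omega_h;\mathbb R^N)$ are functions of time $t$), with $\mathbf u_h=\mathbf m_h/\varrho_h$, $p_h=(\gamma-1)\big(E_h-\frac12|\mathbf m_h|^2/\varrho_h\big)$, temperature $\vartheta_h=p_h/\varrho_h$, entropy $s_h=\log(\vartheta_h^{c_v}/\varrho_h)$: (C) $\int_{\Omega_h}\frac{d}{dt}\varrho_h\,\Phi\,dx-\sum_{\sigma\in\Sigma_{int}}\int_\sigma F_h(\varrho_h,\mathbf u_h)[[\Phi]]\,dS_h=0$ for all $\Phi\in Q_h(\Omega_h)$; (M) $\int_{\Omega_h}\frac{d}{dt}\mathbf m_h\cdot\boldsymbol\Phi\,dx-\sum_{\sigma\in\Sigma_{int}}\int_\sigma\mathbf F_h(\mathbf m_h,\mathbf u_h)\cdot[[\boldsymbol\Phi]]\,dS_h-\sum_{\sigma\in\Sigma_{int}}\int_\sigma\overline{p_h}\,\mathbf n\cdot[[\boldsymbol\Phi]]\,dS_h=-h^{\alpha-1}\sum_{\sigma\in\Sigma_{int}}\int_\sigma[[\mathbf u_h]]\cdot[[\boldsymbol\Phi]]\,dS_h$ for all $\boldsymbol\Phi\in Q_h(\Omega_h;\mathbb R^N)$; (E) $\int_{\Omega_h}\frac{d}{dt}E_h\,\Phi\,dx-\sum_{\sigma\in\Sigma_{int}}\int_\sigma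 F_h(E_h,\mathbf u_h)[[\Phi]]\,dS_h-\sum_{\sigma\in\Sigma_{int}}\int_\sigma\overline{p_h}\,[[\Phi\mathbf u_h]]\cdot\mathbf n\,dS_h+\sum_{\sigma\in\Sigma_{int}}\int_\sigma\overline{p_h\Phi}\,[[\mathbf u_h]]\cdot\mathbf n\,dS_h=-h^{\alpha-1}\sum_{\sigma\in\Sigma_{int}}\int_\sigma[[\mathbf u_h]]\cdot\overline{\mathbf u_h}\,[[\Phi]]\,dS_h$ for all $\Phi\in Q_h(\Omega_h)$. Boundary conditions: no-flux, $\mathbf u_h\cdot\mathbf n=0$ on every face in $\partial\Omega_h$, with $\varrho_h,p_h$ extrapolated ($\partial\varrho_h/\partial\mathbf n=\partial p_h/\partial\mathbf n=0$).
   Formalization: The error functional e_3 and the constant in its bound may depend on χ (a χ-independent e_3 is impossible, as constant χ shows); (M) is required only for test functions with zero normal component at the boundary, since with u·n=0 there (M) for all Φ is overdetermined. *)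

(* Defs.v *)
From HB Require Import structures.
From mathcomp Require Import all_boot all_order all_algebra.
From mathcomp Require Import all_classical all_reals all_analysis.

Set Implicit Arguments.
Unset Strict Implicit.
Unset Printing Implicit Defensive.

Import Order.TTheory GRing.Theory Num.Theory.
Import numFieldNormedType.Exports.
Local Open Scope classical_set_scope.
Local Open Scope ring_scope.

Section Euclid.
Context {R : realType}.

Definition dot N (x y : 'rV[R]_N) : R := \sum_i x 0 i * y 0 i.

(* The Euclidean norm; the library norm of 'rV[R]_N is the max norm. *)
Definition enorm N (x : 'rV[R]_N) : R := Num.sqrt (dot x x).

(* Integration over R^N as an iterated one-dimensional Lebesgue integral. It
   is only applied to bounded Borel functions with bounded support, where by
   Fubini it is the Lebesgue integral. *)
Fixpoint integral_rV (N : nat) : ('rV[R]_N -> R) -> R :=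
  match N with
  | 0%N => fun f => f 0
  | n.+1 => fun f => \int[@lebesgue_measure R]_(x in [set: R])
      integral_rV (fun y : 'rV[R]_n => f (row_mx (x%:M : 'rV[R]_1) y))
  end.

Definition vol N (S : set 'rV[R]_N) : R := integral_rV (\1_S).

(* The (N-1)-dimensional measure of a set S lying in a hyperplane with unit
   normal n, as the volume of the right prism of height 1 over S; for N = 1
   the measure of a point is 1. *)
Definition area N (n : 'rV[R]_N) (S : set 'rV[R]_N) : R :=
  vol [set x | exists y s, [/\ S y, 0 <= s <= 1 & x = y + s *: n]].

Definition polytope N (K : set 'rV[R]_N) : Prop :=
  bounded_set K /\
  exists s : seq ('rV[R]_N * R), K = [set x | all (fun p => dot p.1 x <= p.2) s].

Definition bdry N (Om : set 'rV[R]_N) : set 'rV[R]_N :=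
  closure Om `\` interior Om.

(* The last condition says that the closure of Om is a polyhedron; with the
   preceding one, Om is the interior of that polyhedron. *)
Definition polyhedral_domain N (Om : set 'rV[R]_N) : Prop :=
  [/\ open Om, connected Om, Om !=set0, Om = interior (closure Om)
    & exists (k : nat) (P : 'I_k -> set 'rV[R]_N),
        (forall i, polytope (P i)) /\ closure Om = \bigcup_i P i].

(* The face of K exposed by a: the points of K maximizing x |-> a . x. For a
   polytope K and a != 0 these are exactly its nonempty proper faces. *)
Definition exposed_face N (K : set 'rV[R]_N) (a : 'rV[R]_N) : set 'rV[R]_N :=
  [set x | K x /\ forall y, K y -> dot a y <= dot a x].

(* n is the outer unit normal of a face of K of dimension N-1, which is then
   exposed_face K n. *)
Definition facet N (K : set 'rV[R]_N) (n : 'rV[R]_N) : Prop :=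
  dot n n = 1 /\ 0 < area n (exposed_face K n).

End Euclid.

(* T_h and the interior faces Sigma_int. The unit normal nrm s points from
   cell (ein s) to cell (eout s). *)
Record mesh (R : realType) (N : nat) := Mesh {
  elt : finType;
  cell : elt -> set 'rV[R]_N;
  face : finType;
  ein : face -> elt;
  eout : face -> elt;
  nrm : face -> 'rV[R]_N }.

Section MeshTheory.
Context {R : realType} {N : nat}.
Implicit Types (Om : set 'rV[R]_N) (M : mesh R N).

(* The elements are N-dimensional convex polytopes; two of them are disjoint
   or meet in a common proper face (vertex, edge or facet) of both. The type
   face M enumerates, once each, the facets of elements that do not lie in the
   boundary of Om. *)
Definition conforming_mesh Om M : Prop :=
  [/\ closure Om = \bigcup_K cell (m:=M) K,
      forall K : elt M, polytope (cell K) /\ interior (cell K) !=set0,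
      forall K L : elt M, K <> L ->
        cell K `&` cell L = set0 \/
        exists a b : 'rV[R]_N,
          [/\ a <> 0, b <> 0, cell K `&` cell L = exposed_face (cell K) a
            & cell K `&` cell L = exposed_face (cell L) b],
      forall s : face M,
        facet (cell (ein s)) (nrm s) /\
        exposed_face (cell (ein s)) (nrm s)
          = exposed_face (cell (eout s)) (- nrm s)
    & forall (K : elt M) (n : 'rV[R]_N), facet (cell K) n ->
        ~ (exposed_face (cell K) n `<=` bdry Om) ->
        exists! s : face M,
          (ein s = K /\ nrm s = n) \/ (eout s = K /\ nrm s = - n)].

Definition boundary_facet Om M (K : elt M) (n : 'rV[R]_N) : Prop :=
  facet (cell K) n /\ exposed_face (cell K) n `<=` bdry Om.

(* M h is a mesh of size h, for h in the set H of mesh sizes: the diameters of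
   the elements are bounded by a multiple of h, and |K| ~ h^N, |sigma| ~ h^(N-1)
   uniformly in h, for the interior and for the boundary faces. *)
Definition regular_mesh_family Om (H : set R) (M : R -> mesh R N) : Prop :=
  (forall h, H h -> 0 < h /\ conforming_mesh Om (M h)) /\
  exists2 c : R, 0 < c & forall h, H h ->
    [/\ forall (K : elt (M h)) x y, cell K x -> cell K y -> enorm (x - y) <= c * h,
        forall K : elt (M h), c^-1 * h ^+ N <= vol (cell K) <= c * h ^+ N
      & forall (K : elt (M h)) (n : 'rV[R]_N), facet (cell K) n ->
          c^-1 * h ^+ N.-1 <= area n (exposed_face (cell K) n) <= c * h ^+ N.-1].

End MeshTheory.

(* A function in Q_h is given by its values on the elements: Q_h(Omega_h) is
   elt M -> R and Q_h(Omega_h; R^N) is elt M -> 'rV[R]_N. *)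
Section Discrete.
Context {R : realType} {N : nat} {M : mesh R N}.

(* The integral over Omega_h of the function equal to g K on each element K;
   elements overlap in null sets only. *)
Definition intO (g : elt M -> 'rV[R]_N -> R) : R :=
  \sum_K integral_rV ((g K) \_ (cell K)).

(* The sum over Sigma_int of the integrals of a face-wise constant function. *)
Definition intS (g : face M -> R) : R :=
  \sum_s area (nrm s) (exposed_face (cell (ein s)) (nrm s)) * g s.

(* At a relative interior point x of the face s, x - d n lies in cell (ein s)
   and x + d n in cell (eout s) for all small d > 0, so that the traces are
   v^in = v (ein s) and v^out = v (eout s). *)
Definition avg (v : elt M -> R) (s : face M) : R := (v (ein s) + v (eout s)) / 2.
Definition jump (v : elt M -> R) (s : face M) : R := v (eout s) - v (ein s).
Definition avgv (v : elt M -> 'rV[R]_N) (s : face M) : 'rV[R]_N :=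
  2^-1 *: (v (ein s) + v (eout s)).
Definition jumpv (v : elt M -> 'rV[R]_N) (s : face M) : 'rV[R]_N :=
  v (eout s) - v (ein s).

Definition upwind (r : elt M -> R) (u : elt M -> 'rV[R]_N) (s : face M) : R :=
  avg r s * dot (avgv u s) (nrm s) - 2^-1 * `|dot (avgv u s) (nrm s)| * jump r s.

Definition flux (mu : face M -> R) r u (s : face M) : R :=
  upwind r u s - mu s * jump r s.

Definition fluxv (mu : face M -> R) (m u : elt M -> 'rV[R]_N) (s : face M)
  : 'rV[R]_N := \row_i flux mu (fun K => m K 0 i) u s.

End Discrete.

Record state (R : realType) (N : nat) (M : mesh R N) := State {
  dens : elt M -> R;
  mom : elt M -> 'rV[R]_N;
  ener : elt M -> R }.

Section Scheme.
Context {R : realType} {N : nat} (gamma : R) {M : mesh R N}.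
Implicit Types (U : state M).

Definition vel U (K : elt M) : 'rV[R]_N := (dens U K)^-1 *: mom U K.

Definition pres U (K : elt M) : R :=
  (gamma - 1) * (ener U K - 2^-1 * dot (mom U K) (mom U K) / dens U K).

Definition temp U (K : elt M) : R := pres U K / dens U K.

Definition entropy U (K : elt M) : R :=
  ln (temp U K `^ (gamma - 1)^-1 / dens U K).

Definition no_flux (Om : set 'rV[R]_N) (v : elt M -> 'rV[R]_N) : Prop :=
  forall K n, boundary_facet Om K n -> dot (v K) n = 0.

Definition ddt_dens (U : R -> state M) (t : R) (K : elt M) : R :=
  derive1 (fun t' => dens (U t') K) t.
Definition ddt_mom (U : R -> state M) (t : R) (K : elt M) : 'rV[R]_N :=
  \row_i derive1 (fun t' => mom (U t') K 0 i) t.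
Definition ddt_ener (U : R -> state M) (t : R) (K : elt M) : R :=
  derive1 (fun t' => ener (U t') K) t.

Definition scheme_continuity (mu : face M -> R) (U : R -> state M) (t : R) :=
  forall Phi : elt M -> R,
    intO (fun K _ => ddt_dens U t K * Phi K)
    - intS (fun s => flux mu (dens (U t)) (vel (U t)) s * jump Phi s) = 0.

(* The boundary condition u_h . n = 0 keeps m_h in the space of the fields with
   vanishing normal component on the boundary faces, and the momentum equation
   is posed in that space: its test functions satisfy the same condition. With
   arbitrary Phi the equation would overdetermine the constrained unknown; the
   equation for all Phi implies this one. *)
Definition scheme_momentum (Om : set 'rV[R]_N) (alpha h : R)
    (mu : face M -> R) (U : R -> state M) (t : R) :=
  forall Phi : elt M -> 'rV[R]_N, no_flux Om Phi ->
    intO (fun K _ => dot (ddt_mom U t K) (Phi K))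
    - intS (fun s => dot (fluxv mu (mom (U t)) (vel (U t)) s) (jumpv Phi s))
    - intS (fun s => avg (pres (U t)) s * dot (nrm s) (jumpv Phi s))
    = - (h `^ (alpha - 1)) * intS (fun s => dot (jumpv (vel (U t)) s) (jumpv Phi s)).

Definition scheme_energy (alpha h : R)
    (mu : face M -> R) (U : R -> state M) (t : R) :=
  forall Phi : elt M -> R,
    intO (fun K _ => ddt_ener U t K * Phi K)
    - intS (fun s => flux mu (ener (U t)) (vel (U t)) s * jump Phi s)
    - intS (fun s => avg (pres (U t)) s
                     * dot (jumpv (fun K => Phi K *: vel (U t) K) s) (nrm s))
    + intS (fun s => avg (fun K => pres (U t) K * Phi K) s
                     * dot (jumpv (vel (U t)) s) (nrm s))
    = - (h `^ (alpha - 1))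
      * intS (fun s => dot (jumpv (vel (U t)) s) (avgv (vel (U t)) s) * jump Phi s).

(* mu s t is the numerical viscosity on the face s at time t, i.e. the value of
   h M(h, avg rho_h, avg m_h, avg E_h) along the solution. *)
Definition fv_solution (Om : set 'rV[R]_N) (alpha h T : R)
    (mu : face M -> R -> R) (U0 : state M) (U : R -> state M) : Prop :=
  [/\ U 0 = U0,
      forall t K, t \in `[0, T] -> 0 < dens (U t) K /\ 0 < pres (U t) K,
      forall t, t \in `[0, T] -> no_flux Om (vel (U t)),
      forall K : elt M,
        [/\ {within `[0, T], continuous (fun t => dens (U t) K)},
            forall i, {within `[0, T], continuous (fun t => mom (U t) K 0 i)}
          & {within `[0, T], continuous (fun t => ener (U t) K)}]
    & forall t, t \in `]0, T[ ->
        (forall K : elt M,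
          [/\ derivable (fun t' => dens (U t') K) t 1,
              forall i, derivable (fun t' => mom (U t') K 0 i) t 1
            & derivable (fun t' => ener (U t') K) t 1]) /\
        [/\ scheme_continuity (mu^~ t) U t,
            scheme_momentum Om alpha h (mu^~ t) U t
          & scheme_energy alpha h (mu^~ t) U t]].

End Scheme.

(* C^1([0,T] x closure Om): the derivatives in the interior extend continuously
   to the closed cylinder; c1_dt and c1_grad are these extensions. *)
Record C1fun (R : realType) (N : nat) (T : R) (Om : set 'rV[R]_N) := MkC1fun {
  c1_val :> R -> 'rV[R]_N -> R;
  c1_dt : R -> 'rV[R]_N -> R;
  c1_grad : R -> 'rV[R]_N -> 'rV[R]_N;
  c1_val_cont : {within `[0, T] `*` closure Om,
    continuous (fun z : R * 'rV[R]_N => c1_val z.1 z.2)};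
  c1_dt_cont : {within `[0, T] `*` closure Om,
    continuous (fun z : R * 'rV[R]_N => c1_dt z.1 z.2)};
  c1_grad_cont : {within `[0, T] `*` closure Om,
    continuous (fun z : R * 'rV[R]_N => c1_grad z.1 z.2)};
  c1_dtE : forall t x, t \in `]0, T[ -> Om x ->
    is_derive t 1 (c1_val^~ x) (c1_dt t x);
  c1_gradE : forall t x i, t \in `]0, T[ -> Om x ->
    is_derive x (delta_mx 0 i) (c1_val t) (c1_grad t x 0 i) }.

Section TestFunctions.
Context {R : realType} {N : nat} {T : R} {Om : set 'rV[R]_N}.

Definition supnorm (g : R -> 'rV[R]_N -> R) : R :=
  sup [set `|g z.1 z.2| | z in `[0, T] `*` closure Om].

Definition C1norm (phi : C1fun T Om) : R :=
  supnorm phi + supnorm (c1_dt phi) + supnorm (fun t x => enorm (c1_grad phi t x)).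

Definition C1normv (phi : 'I_N -> C1fun T Om) : R := \sum_i C1norm (phi i).

Definition vval (phi : 'I_N -> C1fun T Om) t x : 'rV[R]_N := \row_i phi i t x.
Definition vdt (phi : 'I_N -> C1fun T Om) t x : 'rV[R]_N := \row_i c1_dt (phi i) t x.
Definition vdiv (phi : 'I_N -> C1fun T Om) t x : R := \sum_i c1_grad (phi i) t x 0 i.

(* A : grad phi, where (grad phi)_(i, j) is the j-th derivative of phi_i. *)
Definition ddgrad (A : 'M[R]_N) (phi : 'I_N -> C1fun T Om) t x : R :=
  \sum_i \sum_j A i j * c1_grad (phi i) t x 0 j.

(* phi . n = 0 on the boundary of Om, which is the union of the boundary faces
   of the mesh M. *)
Definition tangential (M : mesh R N) (phi : 'I_N -> C1fun T Om) : Prop :=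
  forall (K : elt M) n, boundary_facet Om K n ->
    forall t x, t \in `[0, T] -> exposed_face (cell K) n x ->
      dot (vval phi t x) n = 0.

Definition nonneg (phi : C1fun T Om) : Prop :=
  forall t x, t \in `[0, T] -> closure Om x -> 0 <= phi t x.

End TestFunctions.

Section Time.
Context {R : realType}.

Definition L1 (T : R) (e : R -> R) : Prop :=
  (@lebesgue_measure R).-integrable `[0, T] (fun t => (e t)%:E).

Definition L1norm (T : R) (e : R -> R) : R :=
  \int[@lebesgue_measure R]_(t in `[0, T]) `|e t|.

Definition increment (f : R -> R) (tau : R) : R := f tau - f 0.

Definition entropy_cutoff (chi : R -> R) : Prop :=
  [/\ {homo chi : x y / x <= y},
      convex_function [set: R^o] (fun x : R^o => - chi x : R^o)
    & exists chibar : R, forall s, chi s <= chibar].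

End Time.

(* Main.v *)
Require Import Defs.
From HB Require Import structures.
From mathcomp Require Import all_boot all_order all_algebra.
From mathcomp Require Import all_classical all_reals all_analysis.
From mathcomp Require Import measurable_realfun archimedean ring lra.
Set Implicit Arguments.
Unset Strict Implicit.
Unset Printing Implicit Defensive.
Import Order.TTheory GRing.Theory Num.Theory.
Import numFieldNormedType.Exports.
Local Open Scope classical_set_scope.
Local Open Scope ring_scope.

(* Test the scheme with the cell averages of the smooth test function. The velocity has no normal
   component at the boundary facets, so Green's formula on the cells writes the exact convective term
   as a sum over the interior faces, and the error becomes a sum over the faces of jumps of the
   solution times the oscillation O(h) of the test function; in the momentum equation the averages
   are first projected orthogonally to the boundary normals, of which there are finitely many.

   The entropy production of the scheme is a sum over the faces of relative entropies of the two
   traces, with the nonnegative in- and outflow rates as weights. With chi = min(s - s0, 0) this gives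
   the minimum entropy principle, hence an upper bound for the density and a lower bound for the
   temperature; with chi = id it bounds the time integral of the sum over the faces of
   (|u.n| + mu) ([[rho]]^2 + [[theta]]^2 + |[[u]]|^2) + h^(alpha - 1) |[[u]]|^2.

   Together with the energy bound and AM-GM this controls all the error terms by h^delta except
   h |u.n| |u| |[[rho]]|. There the faces with |u|^2 <= C h^(- kappa N), kappa < 2/3, are treated in
   the same way. The kinetic energy of the other cells is small: moving the part of |u|^2 living at
   scale r = h^kappa by a distance of order r changes its integral by at most r times the total
   variation of |u|^2, which is at most C h^(- alpha / 2) times the dissipation. *)

(** The term h |u.n| |u| |[[rho]]| resists because the dissipation weights [[rho]]^2 only by |u.n| +
    mu: its geometric mean with the energy term h |u|^2 is small only where h |u.n| is small, while
    the energy bounds |u| only in L^2. Between slow cells h |u| is at most C h^(1 - kappa N / 2), a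
    positive power of h for all N <= 3 when kappa < 2/3. On the other faces [[rho]] is bounded by
    the maximal density, and h times the face sum of |u|^2 is controlled by the cell sum, so that it
    suffices that the fast cells carry little kinetic energy; the bound obtained for it is small
    when kappa > alpha / 2. Both requirements can be met exactly when alpha < 4/3, and kappa is the
    midpoint of the interval.

    The error functionals are the exact residuals, so that the balances hold without any bound on
    them. Their constants must not depend on h although the number of facets of a cell is not
    prescribed: facet areas are summed through the volume of disjoint prisms erected outside the
    cell. *)

Lemma invS_gt0 (R : numFieldType) k : 0 < k.+1%:R^-1 :> R.
Proof. by rewrite invr_gt0 ltr0n. Qed.

(** * Lebesgue measure on row vectors *)

Section RowMeasurable.
Context {R : realType} (n : nat).

(** The sigma-algebra is the one generated by the coordinates; [open_measurable_rV] shows that it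
    contains the open sets, so that continuous functions are measurable. *)
Let coord (i : 'I_n) (x : 'rV[R]_n) : R := x 0 i.

Let rV_set0 : g_sigma_preimage coord set0.
Proof. exact: sigma_algebra0. Qed.

Let rV_setC A : g_sigma_preimage coord A -> g_sigma_preimage coord (~` A).
Proof. exact: sigma_algebraC. Qed.

Let rV_bigcup (F : _^nat) : (forall i, g_sigma_preimage coord (F i)) ->
  g_sigma_preimage coord (\bigcup_i (F i)).
Proof. exact: sigma_algebra_bigcup. Qed.

HB.instance Definition _ := @isMeasurable.Build default_measure_display
  'rV[R]_n (g_sigma_preimage coord) rV_set0 rV_setC rV_bigcup.

Lemma measurable_coord (i : 'I_n) :
  measurable_fun [set: 'rV[R]_n] (fun x => x 0 i).
Proof.
move=> _ Y mY; rewrite setTI; apply: sub_sigma_algebra => /=.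
rewrite -bigcup_seq/=; exists i => /=; first by rewrite mem_index_enum.
by exists Y => //; rewrite setTI.
Qed.

Lemma measurable_fun_rVP d (T : measurableType d) (f : T -> 'rV[R]_n) :
  (forall i, measurable_fun [set: T] (fun x => f x 0 i)) ->
  measurable_fun [set: T] f.
Proof.
move=> mf; suff prefS : g_sigma_preimage (fun i => coord i \o f) `<=` measurable.
  move=> _ A mA; rewrite setTI; apply: prefS.
  by rewrite g_sigma_preimage_comp; exists A => //; rewrite setTI.
apply: smallest_sub; first exact: sigma_algebra_measurable.
move=> A; rewrite -bigcup_seq => -[i _ [B mB <-]].
exact: mf.
Qed.

Lemma measurable_dot (a : 'rV[R]_n) : measurable_fun [set: 'rV[R]_n] (dot a).
Proof.
rewrite /dot; apply: measurable_sum => i.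
by apply: measurable_funM => //; exact: measurable_coord.
Qed.

Lemma measurable_add2 : measurable_fun [set: 'rV[R]_n * 'rV[R]_n]
  (fun p => p.1 + p.2).
Proof.
apply: measurable_fun_rVP => i.
under eq_fun do rewrite mxE.
by apply: measurable_funD; apply: (measurableT_comp (measurable_coord i)).
Qed.

(** An open set is the union of the cubes with rational centre and radius [p.2.+1%:R^-1] that it
    contains, and there are countably many of these. *)
Lemma open_measurable_rV (O : set 'rV[R]_n) : open O -> measurable O.
Proof.
move=> oO.
pose B (p : 'rV[rat]_n * nat) : set 'rV[R]_n :=
  [set x | forall i, `|ratr (p.1 0 i) - x 0 i| < p.2.+1%:R^-1].
have mB p : measurable (B p).
  rewrite (_ : B p = \bigcap_i
     [set x | `|ratr (p.1 0 i) - x 0 i| < p.2.+1%:R^-1]); last first.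
    by apply/seteqP; split => [x Bx i _|x Bx i]; apply: Bx.
  apply: fin_bigcap_measurable => // i _.
  rewrite (_ : [set x | _] =
    (fun x => `|ratr (p.1 0 i) - x 0 i|) @^-1` `]-oo, p.2.+1%:R^-1[); last first.
    by apply/seteqP; split => x /=; rewrite in_itv.
  rewrite -[X in measurable X]setTI.
  suff: measurable_fun setT (fun x : 'rV[R]_n => `|ratr (p.1 0 i) - x 0 i|).
    by apply => //; exact: measurable_itv.
  apply: measurableT_comp => //.
  by apply: measurable_funB => //; exact: measurable_coord.
rewrite (_ : O = \bigcup_(p in [set p | B p `<=` O]) B p); last first.
  apply/seteqP; split => [x Ox|x [p /= pO]]; last exact: pO.
  have /nbhs_ballP[e /= e0 eO] : nbhs x O by exact: open_nbhs_nbhs.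
  have [k ke] : exists k : nat, k.+1%:R^-1 < e / 2.
    exists (Num.truncn (e / 2)^-1).
    rewrite invf_plt ?posrE ?divr_gt0//.
    exact: truncnS_gt.
  have /choice[q qx] : forall i : 'I_n, exists q : rat, x 0 i < ratr q < x 0 i + k.+1%:R^-1.
    move=> i; have [|q] := @rat_in_itvoo R (x 0 i) (x 0 i + k.+1%:R^-1).
      by rewrite ltrDl invr_gt0 ltr0n.
    by rewrite in_itv/= => ?; exists q.
  exists (\row_i q i, k) => /=.
    move=> y By; apply: eO; split => // i j; rewrite (ord1 i).
    have := By j; have /= := qx j; rewrite mxE.
    rewrite /ball /= !ltr_norml => /andP[r1 r2] /andP[y1 y2].
    move: (x 0 j : R) (y 0 j : R) (ratr (q j) : R) (k.+1%:R^-1 : R) ke r1 r2 y1 y2.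
    by move=> *; apply/andP; split; lra.
  move=> i /=; rewrite mxE; have /andP[r1 r2] := qx i.
  move: (x 0 i : R) (ratr (q i) : R) (k.+1%:R^-1 : R) (invS_gt0 R k) r1 r2.
  by move=> *; rewrite ltr_norml; apply/andP; split; lra.
rewrite bigcup_mkcond; apply: countable_bigcupT_measurable.
  exact: countableP.
by move=> p; case: ifP.
Qed.

Lemma within_continuous_measurable_rV (K : set 'rV[R]_n) (f : 'rV[R]_n -> R) :
  measurable K -> {within K, continuous f} -> measurable_fun K f.
Proof.
move=> mK /continuousP cf; apply: (measurability _ (RGenOpens.measurableE R)).
move=> _ [_ [a [b ->] <-]].
have /open_subspaceP[V oV VE] : open (f @^-1` `]a, b[ : set (subspace K)).
  by apply: cf; exact: interval_open.
by rewrite setIC -VE; apply: measurableI => //; exact: open_measurable_rV.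
Qed.

End RowMeasurable.

Section RowCons.
Context {R : realType} (n : nat).

(** Splits off the first coordinate with the same [row_mx] as [integral_rV], so that iterated
    integrals and product measures match. *)
Definition row_cons (p : measurableTypeR R * 'rV[R]_n) : 'rV[R]_n.+1 :=
  row_mx (p.1%:M : 'rV[R]_1) p.2.

Definition row_uncons (x : 'rV[R]_n.+1) : measurableTypeR R * 'rV[R]_n :=
  (x 0 ord0, \row_i x 0 (lift ord0 i)).

Lemma row_cons0 p : row_cons p 0 ord0 = p.1.
Proof.
rewrite /row_cons (_ : ord0 = lshift n (ord0 : 'I_1)); last exact: val_inj.
by rewrite (row_mxEl (p.1%:M : 'rV[R]_1)) mxE eqxx.
Qed.

Lemma row_consS p i : row_cons p 0 (lift ord0 i) = p.2 0 i.
Proof.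
rewrite /row_cons (_ : lift ord0 i = rshift 1 i); last exact: val_inj.
by rewrite (row_mxEr (p.1%:M : 'rV[R]_1)).
Qed.

Lemma row_consK : cancel row_cons row_uncons.
Proof.
move=> [a y]; rewrite /row_uncons row_cons0; congr pair.
by apply/rowP => i; rewrite mxE row_consS.
Qed.

Lemma measurable_row_cons : measurable_fun [set: measurableTypeR R * 'rV[R]_n] row_cons.
Proof.
apply: measurable_fun_rVP => i; case: (unliftP ord0 i) => [j|] ->.
  under eq_fun do rewrite row_consS.
  by apply: (measurableT_comp (measurable_coord j)).
under eq_fun do rewrite row_cons0.
exact: measurable_fst.
Qed.

Lemma measurable_row_uncons : measurable_fun [set: 'rV[R]_n.+1] row_uncons.
Proof.
apply: measurable_fun_pair; first exact: measurable_coord.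
apply: measurable_fun_rVP => i; under eq_fun do rewrite mxE.
exact: measurable_coord.
Qed.

Definition leb_cons (m : {sigma_finite_measure set 'rV[R]_n -> \bar R}) :
    set 'rV[R]_n.+1 -> \bar R :=
  pushforward (@lebesgue_measure R \x m)%E row_cons.

Section Instance.
Variable m : {sigma_finite_measure set 'rV[R]_n -> \bar R}.
Let P : {measure set 'rV[R]_n.+1 -> \bar R} :=
  measure_function_pushforward__canonical__measure_function_Measure
    (@lebesgue_measure R \x m)%E measurable_row_cons.

Let leb_cons0 : leb_cons m set0 = 0%E. Proof. exact: (measure0 P). Qed.
Let leb_cons_ge0 A : (0 <= leb_cons m A)%E. Proof. exact: (measure_ge0 P). Qed.
Let leb_cons_sigma : semi_sigma_additive (leb_cons m).
Proof. exact: (@measure_semi_sigma_additive _ _ _ P). Qed.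

HB.instance Definition _ := isMeasure.Build _ _ _
  (leb_cons m) leb_cons0 leb_cons_ge0 leb_cons_sigma.

Let leb_cons_sigma_finite : sigma_finite setT (leb_cons m).
Proof.
have /sigma_finiteP[F [TF ndF Foo]] := sigma_finiteT (@lebesgue_measure R).
have /sigma_finiteP[G [TG ndG Goo]] := sigma_finiteT m.
exists (fun k => row_uncons @^-1` (F k `*` G k)).
  apply/seteqP; split => // x _ /=.
  have : (\bigcup_i F i) (row_uncons x).1 by rewrite -TF.
  have : (\bigcup_i G i) (row_uncons x).2 by rewrite -TG.
  move=> [j _ Gj] [i _ Fi]; exists (maxn i j) => //=; split => /=.
    by move: Fi; exact/subsetPset/ndF/leq_maxl.
  by move: Gj; exact/subsetPset/ndG/leq_maxr.
move=> k; have [mF Fk] := Foo k; have [mG Gk] := Goo k; split.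
  rewrite -[X in measurable X]setTI; apply: measurable_row_uncons => //.
  exact: measurableX.
rewrite /leb_cons /pushforward -comp_preimage.
rewrite (_ : _ @^-1` _ = F k `*` G k); last first.
  by rewrite (_ : _ \o _ = id) ?preimage_id//; apply/funext => x; exact: row_consK.
by rewrite product_measure1E// lte_mul_pinfty// ge0_fin_numE.
Qed.

HB.instance Definition _ := Measure_isSigmaFinite.Build _ _ _ (leb_cons m)
  leb_cons_sigma_finite.

End Instance.
End RowCons.

Section Leb.
Context {R : realType}.

Let dirac_sigma_finite : sigma_finite setT (@dirac _ 'rV[R]_0 0 R).
Proof.
by apply: fin_num_fun_sigma_finite; [rewrite measure0|exact: fin_num_measure].
Qed.

(** Follows the recursion of [integral_rV], which makes their agreement an induction with Fubini;
    sigma-finiteness is carried along for the next product. *)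
Fixpoint leb (n : nat) : {sigma_finite_measure set 'rV[R]_n -> \bar R} :=
  match n with
  | 0%N => \d_ (0 : 'rV[R]_0)
  | k.+1 => leb_cons (leb k)
  end.

Local Open Scope ereal_scope.

Lemma ge0_leb_cons n (f : 'rV[R]_n.+1 -> \bar R) :
  measurable_fun setT f -> (forall x, 0 <= f x) ->
  \int[leb n.+1]_x f x =
    \int[lebesgue_measure]_x \int[leb n]_y f (row_cons (x, y)).
Proof.
move=> mf f0; rewrite /= ge0_integral_pushforward//; last exact: measurable_row_cons.
rewrite preimage_setT fubini_tonelli1//; last by move=> x; exact: f0.
by apply: measurableT_comp => //; exact: measurable_row_cons.
Qed.

Lemma ge0_leb_cons_swap n (f : 'rV[R]_n.+1 -> \bar R) :
  measurable_fun setT f -> (forall x, 0 <= f x) ->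
  \int[leb n.+1]_x f x =
    \int[leb n]_y \int[lebesgue_measure]_x f (row_cons (x, y)).
Proof.
move=> mf f0; rewrite /= ge0_integral_pushforward//; last exact: measurable_row_cons.
rewrite preimage_setT fubini_tonelli2//; last by move=> x; exact: f0.
by apply: measurableT_comp => //; exact: measurable_row_cons.
Qed.

(** The pushforward of Lebesgue measure under the affine map, multiplied by [a], agrees with
    Lebesgue measure on half-open intervals, hence everywhere. *)
Lemma lebesgue_affine (a c : R) (f : R -> \bar R) : (0 < a)%R ->
  measurable_fun setT f -> (forall x, 0 <= f x) ->
  \int[lebesgue_measure]_x f (a * x + c)%R = a^-1%:E * \int[lebesgue_measure]_x f x.
Proof.
move=> a0 mf f0.
pose g (x : measurableTypeR R) : measurableTypeR R := (a * x + c)%R.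
have mg : measurable_fun setT g by apply: measurable_funD.
pose P : {measure set (measurableTypeR R) -> \bar R} :=
  measure_function_pushforward__canonical__measure_function_Measure lebesgue_measure mg.
have a00 : (0 <= a)%R by exact: ltW.
pose Q := mscale (NngNum a00) P.
have E : forall A, measurable A -> lebesgue_measure A = Q A.
  apply: lebesgue_measure_unique => _ [[x y] _ <-].
  rewrite /Q /= /mscale /P /= /pushforward.
  rewrite (_ : g @^-1` _ = `]((x - c) / a)%R, ((y - c) / a)%R]%classic); last first.
    apply/seteqP; split => z /=; rewrite !in_itv/= ltr_pdivrMr// ler_pdivlMr// (mulrC z).
      by rewrite ltrBlDr lerBrDr.
    by rewrite ltrBlDr lerBrDr.
  rewrite !lebesgue_measure_itv/= !lte_fin ltr_pM2r ?invr_gt0// ltrD2r.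
  case: ifP => _; last by rewrite mule0.
  by rewrite -!EFinB -EFinM; congr EFin; field; rewrite gt_eqF.
transitivity (\int[P]_x f x).
  by rewrite /P ge0_integral_pushforward.
have -> : \int[lebesgue_measure]_x f x = \int[Q]_x f x.
  by apply: eq_measure_integral => A mA _; exact: E.
rewrite ge0_integral_mscale//= muleA -EFinM mulVf ?mul1e//.
by rewrite gt_eqF.
Qed.

(** An elementary map: a single coordinate receives an affine function of all of them. Translations,
    stretches and the straightening of a hyperplane are built from such maps, so that no
    determinants are needed. *)
Definition coord_op n (i : 'I_n) (b : 'rV[R]_n) (c : R) (x : 'rV[R]_n) : 'rV[R]_n :=
  (x + (dot b x + c) *: delta_mx 0 i)%R.

Lemma coord_opE n (i : 'I_n) b c x j :
  (coord_op i b c x 0 j = x 0 j + (dot b x + c) * (j == i)%:R)%R.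
Proof. by rewrite !mxE eqxx. Qed.

Lemma measurable_coord_op n (i : 'I_n) b c : measurable_fun setT (coord_op i b c).
Proof.
apply: measurable_fun_rVP => j; under eq_fun do rewrite !mxE.
apply: measurable_funD; first exact: measurable_coord.
apply: measurable_funM => //; apply: measurable_funD => //; exact: measurable_dot.
Qed.

Lemma dot_row_cons n (b : 'rV[R]_n.+1) (p : measurableTypeR R * 'rV[R]_n) :
  dot b (row_cons p) = (b 0 ord0 * p.1 + dot (\row_i b 0 (lift ord0 i)) p.2)%R.
Proof.
rewrite /dot big_ord_recl row_cons0; congr (_ + _)%R.
by apply: eq_bigr => i _; rewrite row_consS mxE.
Qed.

(** Induction on the dimension. If the modified coordinate is not the first one, the first is frozen
    and enters the constant [c]; if it is, the order of integration is exchanged and an affine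
    substitution in one variable remains. *)
Lemma ge0_integral_coord_op n (i : 'I_n) (b : 'rV[R]_n) (c : R)
    (f : 'rV[R]_n -> \bar R) : (0 < 1 + b 0 i)%R ->
  measurable_fun setT f -> (forall x, 0 <= f x) ->
  \int[leb n]_x f (coord_op i b c x) = (1 + b 0 i)^-1%:E * \int[leb n]_x f x.
Proof.
elim: n => [|n IH] in i b c f *; first by case: i.
move=> bi mf f0.
have mfT : measurable_fun setT (fun x => f (coord_op i b c x)).
  by apply: measurableT_comp => //; exact: measurable_coord_op.
have mfy x : measurable_fun setT (fun y => f (row_cons (x, y))).
  apply: measurableT_comp => //; apply: measurableT_comp.
    exact: measurable_row_cons.
  exact: measurable_fun_pair.
have mfx y : measurable_fun setT (fun x => f (row_cons (x, y))).
  apply: measurableT_comp => //; apply: measurableT_comp.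
    exact: measurable_row_cons.
  exact: measurable_fun_pair.
case: (unliftP ord0 i) => [j|] iE.
  rewrite !ge0_leb_cons//.
  have bj : (0 < 1 + (\row_k b 0 (lift ord0 k)) 0 j)%R by rewrite mxE -iE.
  rewrite -ge0_integralZl//; last 3 first.
  - apply: (@measurable_fun_fubini_tonelli_F _ _ _ _ R (leb n) (f \o @row_cons R n)) => //.
    - by apply: measurableT_comp => //; exact: measurable_row_cons.
    - by move=> z; exact: f0.
  - by move=> x _; apply: integral_ge0 => y _; exact: f0.
  - by rewrite lee_fin invr_ge0 ltW.
  apply: eq_integral => x _.
  have := IH j (\row_k b 0%R (lift ord0 k)) (c + b 0%R ord0 * x)%R (fun y => f (row_cons (x, y))) bj (mfy x) (fun y => f0 _).
  rewrite mxE -iE => <-.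
  apply: eq_integral => y _; congr f.
  apply/rowP => k; rewrite coord_opE dot_row_cons /=.
  case: (unliftP ord0 k) => [l|] ->.
    rewrite !row_consS coord_opE iE (inj_eq (@lift_inj _ _)) /=.
    by congr (_ + _ * _)%R; ring.
  by rewrite !row_cons0 iE /= mulr0 addr0.
rewrite !ge0_leb_cons_swap//.
rewrite -ge0_integralZl//; last 3 first.
- apply: (@measurable_fun_fubini_tonelli_G _ _ _ _ R lebesgue_measure (f \o @row_cons R n)) => //.
  + by apply: measurableT_comp => //; exact: measurable_row_cons.
  + by move=> z; exact: f0.
- by move=> x _; apply: integral_ge0 => y _; exact: f0.
- by rewrite lee_fin invr_ge0 ltW.
apply: eq_integral => y _; rewrite iE in bi *.
rewrite -(lebesgue_affine (c + dot (\row_k b 0 (lift ord0 k)) y)%R bi (mfx y) (fun x => f0 _)).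
apply: eq_integral => x _; congr f.
apply/rowP => k; rewrite coord_opE dot_row_cons /=.
case: (unliftP ord0 k) => [l|] ->.
  by rewrite !row_consS /= mulr0 addr0.
by rewrite !row_cons0 /=; ring.
Qed.

End Leb.

Section Dot.
Context {R : realType} (n : nat).
Implicit Types (x y z : 'rV[R]_n).

Lemma dotC x y : dot x y = dot y x.
Proof. by apply: eq_bigr => i _; rewrite mulrC. Qed.

Lemma dotDr x y z : dot x (y + z) = dot x y + dot x z.
Proof. by rewrite -big_split; apply: eq_bigr => i _; rewrite mxE mulrDr. Qed.

Lemma dotZr a x y : dot x (a *: y) = a * dot x y.
Proof. by rewrite /dot mulr_sumr; apply: eq_bigr => i _; rewrite mxE mulrCA. Qed.

Lemma dotNr x y : dot x (- y) = - dot x y.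
Proof. by rewrite -scaleN1r dotZr mulN1r. Qed.

Lemma dotBr x y z : dot x (y - z) = dot x y - dot x z.
Proof. by rewrite dotDr dotNr. Qed.

Lemma dotDl x y z : dot (x + y) z = dot x z + dot y z.
Proof. by rewrite !(dotC _ z) dotDr. Qed.

Lemma dotZl a x y : dot (a *: x) y = a * dot x y.
Proof. by rewrite !(dotC _ y) dotZr. Qed.

Lemma dotNl x y : dot (- x) y = - dot x y.
Proof. by rewrite !(dotC _ y) dotNr. Qed.

Lemma dotBl x y z : dot (x - y) z = dot x z - dot y z.
Proof. by rewrite dotDl dotNl. Qed.

Lemma dot0r x : dot x 0 = 0.
Proof. by rewrite -(scale0r 0) dotZr mul0r. Qed.

Lemma dot0l x : dot 0 x = 0.
Proof. by rewrite dotC dot0r. Qed.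

Lemma dotxx_ge0 x : 0 <= dot x x.
Proof. by apply: sumr_ge0 => i _; rewrite -expr2 sqr_ge0. Qed.

Lemma dotxx_eq0 x : (dot x x == 0) = (x == 0).
Proof.
apply/idP/eqP => [|->]; last by rewrite dot0r.
rewrite psumr_eq0; last by move=> i _; rewrite -expr2 sqr_ge0.
move=> /allP x0; apply/rowP => i; rewrite mxE; apply/eqP.
by have := x0 i (mem_index_enum _); rewrite -expr2 sqrf_eq0.
Qed.

End Dot.

Section RowIntegral.
Context {R : realType} (n : nat).
Implicit Types (f g : 'rV[R]_n -> R) (T S : 'rV[R]_n -> 'rV[R]_n).

Definition intg f := (leb n).-integrable setT (EFin \o f).

Definition rint f : R := \int[leb n]_x f x.

Lemma intg_measurable f : intg f -> measurable_fun setT f.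
Proof. by move=> /integrableP[/measurable_EFinP]. Qed.

Lemma intgE f : intg f -> (\int[leb n]_x (f x)%:E = (rint f)%:E)%E.
Proof. by move=> fi; rewrite /rint /Rintegral fineK//; exact: integrable_fin_num. Qed.

Lemma intg0 : intg (fun=> 0).
Proof. exact: integrable0. Qed.

Lemma intgD f g : intg f -> intg g -> intg (fun x => f x + g x).
Proof. by move=> fi gi; apply: eq_integrable (integrableD _ fi gi). Qed.

Lemma intgN f : intg f -> intg (fun x => - f x).
Proof. by move=> fi; apply: eq_integrable (integrableN fi). Qed.

Lemma intgB f g : intg f -> intg g -> intg (fun x => f x - g x).
Proof. by move=> fi /intgN; exact: intgD. Qed.

Lemma intgZ c f : intg f -> intg (fun x => c * f x).
Proof. by move=> fi; apply: eq_integrable (integrableZl _ c fi). Qed.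

Lemma intg_sum (I : Type) (r : seq I) (P : pred I) (F : I -> 'rV[R]_n -> R) :
  (forall i, P i -> intg (F i)) -> intg (fun x => \sum_(i <- r | P i) F i x).
Proof.
move=> Fi; elim: r => [|i r IH].
  by under eq_fun do rewrite big_nil; exact: intg0.
have [Pi|Pi] := boolP (P i); last by under eq_fun do rewrite big_cons (negbTE Pi).
by under eq_fun do rewrite big_cons Pi; apply: intgD => //; exact: Fi.
Qed.

Lemma rintD f g : intg f -> intg g -> rint (fun x => f x + g x) = rint f + rint g.
Proof. by move=> fi gi; rewrite /rint RintegralD. Qed.

Lemma rintB f g : intg f -> intg g -> rint (fun x => f x - g x) = rint f - rint g.
Proof. by move=> fi gi; rewrite /rint RintegralB. Qed.

Lemma rintZ c f : intg f -> rint (fun x => c * f x) = c * rint f.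
Proof. by move=> fi; rewrite /rint RintegralZl. Qed.

Lemma rint0 : rint (fun=> 0) = 0.
Proof. by rewrite /rint /Rintegral integral0. Qed.

Lemma rint_sum (I : Type) (r : seq I) (P : pred I) (F : I -> 'rV[R]_n -> R) :
  (forall i, P i -> intg (F i)) ->
  rint (fun x => \sum_(i <- r | P i) F i x) = \sum_(i <- r | P i) rint (F i).
Proof.
move=> Fi; elim: r => [|i r IH].
  rewrite [RHS]big_nil -[RHS]rint0; congr rint.
  by apply/funext => x; rewrite big_nil.
rewrite big_cons; case: ifPn => Pi; last first.
  by rewrite -IH; congr rint; apply/funext => x; rewrite big_cons (negbTE Pi).
rewrite -IH -rintD//; [|exact: Fi|exact: intg_sum].
by congr rint; apply/funext => x; rewrite big_cons Pi.
Qed.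

Lemma le_rint f g : intg f -> intg g -> (forall x, f x <= g x) -> rint f <= rint g.
Proof. by move=> fi gi fg; apply: le_Rintegral => // x _; exact: fg. Qed.

Lemma rint_ge0 f : (forall x, 0 <= f x) -> 0 <= rint f.
Proof. by move=> f0; apply: Rintegral_ge0. Qed.

Lemma le_norm_rint f : intg f -> `|rint f| <= rint (fun x => `|f x|).
Proof. by move=> fi; apply: le_normr_Rintegral. Qed.

Lemma intg_norm f : intg f -> intg (fun x => `|f x|).
Proof. by move=> fi; apply: eq_integrable (integrable_abse fi). Qed.

Lemma intg_le f g : measurable_fun setT f -> intg g ->
  (forall x, `|f x| <= g x) -> intg f.
Proof.
move=> mf gi fg; apply: (le_integrable _ _ _ gi) => //; first exact/measurable_EFinP.
by move=> x _ /=; rewrite lee_fin (le_trans (fg x))// ler_norm.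
Qed.

Lemma ae_eq_rint f g N : measurable_fun setT f -> measurable_fun setT g ->
  (leb n).-negligible N -> (forall x, ~ N x -> f x = g x) -> rint f = rint g.
Proof.
move=> mf mg N0 fg; rewrite /rint /Rintegral; congr fine.
apply: ae_eq_integral => //; [exact/measurable_EFinP..|].
apply: negligibleS N0 => x /= /not_implyP[_ fgx].
by apply: contrapT => Nx; apply: fgx; rewrite fg.
Qed.

Lemma rint_dominated_cvg (F : nat -> 'rV[R]_n -> R) f g N :
  (forall k, measurable_fun setT (F k)) -> measurable_fun setT f -> intg g ->
  (leb n).-negligible N ->
  (forall k x, ~ N x -> `|F k x| <= g x) ->
  (forall x, ~ N x -> F k x @[k --> \oo] --> f x) ->
  rint (F k) @[k --> \oo] --> rint f.
Proof.
move=> mF mf gi N0 Fg Ff.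
have [] := @dominated_convergence _ _ _ (leb n) setT measurableT
  (fun k x => (F k x)%:E) (EFin \o f) (EFin \o g).
- by move=> k; exact/measurable_EFinP.
- exact/measurable_EFinP.
- apply: negligibleS N0 => x /= /not_implyP[_ h]; apply: contrapT => Nx.
  by apply: h; apply: cvg_EFin; [exact: nearW|exact: Ff].
- exact: gi.
- apply: negligibleS N0 => x /= /existsNP[k] /not_implyP[_ h].
  by apply: contrapT => Nx; apply: h; rewrite lee_fin; exact: Fg.
move=> fi _; rewrite (intgE fi) => /fine_cvgP[_].
by [].
Qed.

(** [a] is the Jacobian of [T]. Asking for integrability as well makes the property stable under
    composition. *)
Definition scales T (a : R) := forall f, intg f ->
  intg (f \o T) /\ rint (f \o T) = a^-1 * rint f.

Lemma scales_id : scales id 1.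
Proof. by move=> f fi; rewrite invr1 mul1r. Qed.

Lemma scales_comp T S a b : scales T a -> scales S b -> scales (T \o S) (a * b).
Proof.
move=> hT hS f fi; have [fT fTE] := hT f fi; have [fS fSE] := hS _ fT.
by split => //; rewrite -[f \o (T \o S)]/((f \o T) \o S) fSE fTE invfM mulrCA mulrA.
Qed.

Lemma scales_coord_op (i : 'I_n) (b : 'rV[R]_n) (c : R) : 0 < 1 + b 0 i ->
  scales (coord_op i b c) (1 + b 0 i).
Proof.
move=> bi f fi; have mf := intg_measurable fi.
have mfT : measurable_fun setT (f \o coord_op i b c).
  by apply: measurableT_comp => //; exact: measurable_coord_op.
split.
  apply/integrableP; split; first exact/measurable_EFinP.
  have := @ge0_integral_coord_op R n i b c (fun x => `|(f x)%:E|%E) bi.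
  move=> ->//; last by do 2 apply: measurableT_comp => //.
  have /integrableP[_ fioo] := fi.
  by rewrite lte_mul_pinfty// lee_fin invr_ge0 ltW.
rewrite /rint /Rintegral integralE [in RHS]integralE.
set fE := fun x => (f x)%:E.
have mfE : measurable_fun setT fE by exact/measurable_EFinP.
have E : forall g : 'rV[R]_n -> \bar R, measurable_fun setT g -> (forall x, 0 <= g x)%E ->
   (\int[leb n]_x g (coord_op i b c x) = (1 + b 0 i)^-1%:E * \int[leb n]_x g x)%E.
  by move=> g mg g0; apply: ge0_integral_coord_op.
have -> : (\int[leb n]_x ((fun x => ((f \o coord_op i b c) x)%:E)^\+ x) =
   (1 + b 0 i)^-1%:E * \int[leb n]_x (fE^\+ x))%E.
  rewrite -(E _ (measurable_funepos mfE) (funepos_ge0 fE)).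
  by apply: eq_integral => x _; rewrite !funeposE.
have -> : (\int[leb n]_x ((fun x => ((f \o coord_op i b c) x)%:E)^\- x) =
   (1 + b 0 i)^-1%:E * \int[leb n]_x (fE^\- x))%E.
  rewrite -(E _ (measurable_funeneg mfE) (funeneg_ge0 fE)).
  by apply: eq_integral => x _; rewrite !funenegE.
have fp : (\int[leb n]_x (fE^\+ x) \is a fin_num)%E.
  exact/integrable_fin_num/integrable_funepos.
have fn : (\int[leb n]_x (fE^\- x) \is a fin_num)%E.
  exact/integrable_fin_num/integrable_funeneg.
rewrite -(fineK fp) -(fineK fn) -!EFinM -!EFinB /=; ring.
Qed.

Lemma scales_translation (y : 'rV[R]_n) : scales (fun x => x + y) 1.
Proof.
suff H k : (k <= n)%N -> scales (fun x => x + \row_j (if (j < k)%N then y 0 j else 0)) 1.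
  have := H n (leqnn n); congr scales; apply/funext => x; congr (_ + _).
  by apply/rowP => j; rewrite mxE ltn_ord.
elim: k => [_|k IH kn].
  rewrite (_ : (fun _ => _) = id); first exact: scales_id.
  by apply/funext => x; apply/rowP => j; rewrite !mxE addr0.
pose i := Ordinal kn.
have := scales_comp (@scales_coord_op i 0 (y 0 i) _) (IH (ltnW kn)).
rewrite mxE addr0 mulr1 => /(_ ltr01); congr scales; apply/funext => x.
apply/rowP => j; rewrite /= coord_opE !mxE (_ : dot 0 _ = 0); last first.
  by rewrite /dot big1 // => l _; rewrite mxE mul0r.
rewrite add0r -addrA; congr (_ + _).
have [->|ji] := eqVneq j i; first by rewrite /= ltnn ltnS leqnn add0r mulr1.
rewrite mulr0 addr0 [in RHS]ltnS [in RHS]leq_eqVlt (_ : (j == k :> nat) = false)//.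
by apply/negbTE; apply: contra ji => /eqP jk; apply/eqP/val_inj.
Qed.

(** For a unit vector [u], the signed distance to the hyperplane [dot u x = b] is multiplied by
    [lam]. *)
Definition stretch (u : 'rV[R]_n) (b lam : R) (x : 'rV[R]_n) : 'rV[R]_n :=
  x + ((lam - 1) * (dot u x - b)) *: u.

(* The coordinates are updated one after the other; with
   D k = 1 + (lam - 1) * \sum_(j < k) u_j^2, the k-th update multiplies the
   volume by D (k + 1) / D k. *)
Lemma scales_stretch (u : 'rV[R]_n) (b lam : R) : dot u u = 1 -> 0 < lam ->
  scales (stretch u b lam) lam.
Proof.
move=> u1 lam0.
pose p k := \sum_(j < n | (j < k)%N) u 0 j * u 0 j.
pose D k := 1 + (lam - 1) * p k.
have p0 k : 0 <= p k by apply: sumr_ge0 => j _; rewrite -expr2 sqr_ge0.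
have p1 k : p k <= 1.
  rewrite -u1 /dot [leRHS](bigID (fun j : 'I_n => (j < k)%N)) /= lerDl.
  by apply: sumr_ge0 => j _; rewrite -expr2 sqr_ge0.
have D0 k : 0 < D k.
  rewrite /D (_ : _ + _ = (1 - p k) + lam * p k); last by ring.
  have := p1 k; rewrite le_eqVlt => /predU1P[->|pk1].
    by rewrite subrr add0r mulr1.
  by rewrite ltr_pwDl ?subr_gt0// mulr_ge0// ltW.
pose w k : 'rV[R]_n := \row_j (if (j < k)%N then u 0 j else 0).
have dw k : dot u (w k) = p k.
  rewrite /dot /p [RHS]big_mkcond /=; apply: eq_bigr => j _.
  by rewrite mxE; case: ifP => //; rewrite mulr0.
suff H k : (k <= n)%N -> scales (fun x => x + ((lam - 1) * (dot u x - b)) *: w k) (D k).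
  have := H n (leqnn n).
  rewrite (_ : D n = lam); last first.
    rewrite /D (_ : p n = 1); first by ring.
    by rewrite -u1 /p /dot; apply: eq_bigl => j; rewrite ltn_ord.
  congr scales; apply/funext => x; rewrite /stretch; congr (_ + _ *: _).
  by apply/rowP => j; rewrite mxE ltn_ord.
elim: k => [_|k IH kn].
  have -> : D 0%N = 1 by rewrite /D /p big1 ?mulr0 ?addr0 // => j; rewrite ltn0.
  rewrite (_ : (fun _ => _) = id); first exact: scales_id.
  by apply/funext => x; apply/rowP => j; rewrite !mxE mulr0 addr0.
pose i := Ordinal kn.
have pS : p k.+1 = p k + u 0 i * u 0 i.
  rewrite /p (bigD1 i) ?ltnSn//= addrC; congr (_ + _); apply: eq_bigl => j.
  rewrite ltnS [in LHS]leq_eqVlt; case: (eqVneq j i) => [->|ji]; first by rewrite /= ltnn andbF.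
  rewrite andbT (_ : (j == k :> nat) = false)//.
  by apply/negbTE; apply: contra ji => /eqP jk; apply/eqP/val_inj.
pose a := (lam - 1) * u 0 i / D k.
have Dk := D0 k; have Dk0 : D k != 0 by rewrite gt_eqF.
have aE : 1 + (a *: u) 0 i = D k.+1 / D k.
  by rewrite mxE /a /D pS -/(D k); rewrite /D in Dk0 *; field.
have a0 : 0 < 1 + (a *: u) 0 i by rewrite aE divr_gt0.
have := scales_comp (@scales_coord_op i (a *: u) (- (a * b)) a0) (IH (ltnW kn)).
rewrite aE divfK//; congr scales; apply/funext => x.
apply/rowP => j; rewrite /= coord_opE.
have -> : dot (a *: u) (x + ((lam - 1) * (dot u x - b)) *: w k) =
    a * (dot u x + (lam - 1) * (dot u x - b) * p k).
  by rewrite dotZl dotDr dotZr dw.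
have -> : a * (dot u x + (lam - 1) * (dot u x - b) * p k) + - (a * b) =
    (lam - 1) * (dot u x - b) * u 0 i.
  by rewrite /a /D; rewrite /D in Dk0 *; field.
rewrite !mxE -addrA; congr (_ + _).
have [->|ji] := eqVneq j i; first by rewrite /= ltnn ltnS leqnn mulr0 add0r mulr1.
rewrite mulr0 addr0 [in RHS]ltnS [in RHS]leq_eqVlt (_ : (j == k :> nat) = false)//.
by apply/negbTE; apply: contra ji => /eqP jk; apply/eqP/val_inj.
Qed.

Lemma coord_null (i : 'I_n) : leb n [set x : 'rV[R]_n | x 0 i = 0] = 0%E.
Proof.
suff H m (j : 'I_m) : leb m [set x : 'rV[R]_m | x 0 j = 0] = 0%E by exact: H.
elim: m j => [[]//|m IH] j.
rewrite /= /leb_cons /pushforward; case: (unliftP ord0 j) => [k|] ->.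
  rewrite (_ : _ @^-1` _ = setT `*` [set x : 'rV[R]_m | x 0 k = 0]); last first.
    by apply/seteqP; split => p /=; rewrite row_consS => // -[].
  rewrite product_measure1E//=.
    by rewrite [X in (_ * X)%E](IH k) mule0.
  rewrite (_ : [set x : 'rV[R]_m | _] = (fun x => x 0 k) @^-1` [set 0])//.
  by rewrite -[X in measurable X]setTI; apply: measurable_coord.
rewrite (_ : _ @^-1` _ = [set 0] `*` setT); last first.
  by apply/seteqP; split => p /=; rewrite row_cons0 => // -[].
by rewrite product_measure1E//= [X in (X * _)%E]lebesgue_measure_set1 mul0e.
Qed.

Lemma measurable_hyperplane (a : 'rV[R]_n) c : measurable [set x | dot a x = c].
Proof.
rewrite (_ : [set x | _] = dot a @^-1` [set c])//.
by rewrite -[X in measurable X]setTI; apply: measurable_dot.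
Qed.

Lemma measurable_halfspace (a : 'rV[R]_n) c : measurable [set x | dot a x <= c].
Proof.
rewrite (_ : [set x | _] = dot a @^-1` `]-oo, c]); last first.
  by apply/seteqP; split => x /=; rewrite in_itv.
by rewrite -[X in measurable X]setTI; apply: measurable_dot.
Qed.

(** For some i with a_i nonzero, the map replacing x_i by (a . x - c) / a_i is a [coord_op] with
    volume factor 1, and the hyperplane is the preimage under it of a coordinate hyperplane. *)
Lemma hyperplane_null (a : 'rV[R]_n) c : a != 0 -> (leb n).-negligible [set x | dot a x = c].
Proof.
move=> a0; have [i ai] : exists i, a 0 i != 0.
  apply: contrapT => h; case/eqP: a0; apply/rowP => i; rewrite mxE.
  by apply: contrapT => /eqP ai; apply: h; exists i.
pose b := (a 0 i)^-1 *: a - delta_mx 0 i.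
have bi : b 0 i = 0 by rewrite !mxE !eqxx mulVf// subrr.
have bi1 : 0 < 1 + b 0 i by rewrite bi addr0.
exists [set x | dot a x = c]; split => //; first exact: measurable_hyperplane.
pose Z : set 'rV[R]_n := [set x | x 0 i = 0].
have mZ : measurable Z.
  rewrite (_ : Z = (fun x => x 0 i) @^-1` [set 0])//.
  by rewrite -[X in measurable X]setTI; apply: measurable_coord.
have Z0 : (\int[leb n]_x (\1_Z x)%:E = 0)%E.
  by rewrite integral_indic// setIT; exact: coord_null.
have := @ge0_integral_coord_op R n i b (- (c / a 0 i)) (fun x => (\1_Z x)%:E) bi1.
rewrite Z0 mule0 => <-.
- rewrite (_ : (fun x => _) = (fun x => (\1_[set x | dot a x = c] x)%:E)).
    by rewrite integral_indic ?setIT//; exact: measurable_hyperplane.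
  apply/funext => x; rewrite !indicE; congr ((_%:R)%:E).
  have E : (coord_op i b (- (c / a 0 i)) x 0 i = 0) <-> (dot a x = c).
    rewrite coord_opE eqxx mulr1 /b dotBl dotZl.
    rewrite (_ : dot (delta_mx 0 i) x = x 0 i); last first.
      rewrite /dot (bigD1 i)//= mxE !eqxx mul1r big1 ?addr0// => j ji.
      by rewrite mxE (negbTE ji) andbF mul0r.
    rewrite (_ : _ + _ = (a 0 i)^-1 * (dot a x - c)); last by field.
    split => [/eqP|->]; last by rewrite subrr mulr0.
    by rewrite mulf_eq0 invr_eq0 (negbTE ai) /= subr_eq0 => /eqP.
  have [h|h] := pselect (dot a x = c).
    by rewrite !mem_set//; exact/E.
  by rewrite !memNset// => /E.
- exact/measurable_EFinP.
- by move=> x; rewrite lee_fin.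
Qed.

Definition box (c : 'rV[R]_n) (r : R) : set 'rV[R]_n :=
  [set x | forall i, `|x 0 i - c 0 i| <= r].

End RowIntegral.

Section Box.
Context {R : realType}.

Lemma measurable_box n (c : 'rV[R]_n) r : measurable (box c r).
Proof.
rewrite (_ : box c r = \bigcap_i [set x | `|x 0 i - c 0 i| <= r]); last first.
  by apply/seteqP; split => [x Bx i _|x Bx i]; apply: Bx.
apply: fin_bigcap_measurable => // i _.
rewrite (_ : [set x | _] = (fun x => `|x 0 i - c 0 i|) @^-1` `]-oo, r]); last first.
  by apply/seteqP; split => x /=; rewrite in_itv.
rewrite -[X in measurable X]setTI.
suff: measurable_fun setT (fun x : 'rV[R]_n => `|x 0 i - c 0 i|) by apply.
apply: measurableT_comp => //.
by apply: measurable_funB => //; exact: measurable_coord.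
Qed.

Lemma leb_box n (c : 'rV[R]_n) r : 0 <= r -> leb n (box c r) = ((2 * r) ^+ n)%:E.
Proof.
move=> r0; elim: n c => [|n IH] c.
  by rewrite /= diracE expr0 mem_set// => -[].
rewrite /= /leb_cons /pushforward.
pose c0 := c 0 ord0; pose c' := (row_uncons c).2.
rewrite (_ : _ @^-1` _ = `[c0 - r, c0 + r]%classic `*` box c' r); last first.
  apply/seteqP; split => -[x y] /=.
    move=> h; split => /=.
      by have := h ord0; rewrite row_cons0 /= in_itv/= ler_distl.
    by move=> i; have := h (lift ord0 i); rewrite row_consS /= mxE.
  move=> [/= x0 hy] i; case: (unliftP ord0 i) => [k|] ->.
    by rewrite row_consS /=; have := hy k; rewrite mxE.
  by rewrite row_cons0 /= ler_distl; move: x0; rewrite in_itv.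
rewrite product_measure1E//=; last exact: measurable_box.
rewrite [X in (X * _)%E]lebesgue_measure_itv/= [X in (_ * X)%E]IH lte_fin.
case: ifPn => [_|]; first by rewrite -EFinB -EFinM exprS; congr EFin; ring.
rewrite -leNgt => h; have -> : r = 0 by lra.
by rewrite mulr0 exprS mul0r mul0e.
Qed.

End Box.

Section BoundedSupport.
Context {R : realType}.

(** The class of functions on which [integral_rV] is identified with an integral against [leb]; one
    constant for the values and for the support passes unchanged to the slices. *)
Definition bbs n (C : R) (f : 'rV[R]_n -> R) :=
  [/\ measurable_fun setT f, forall x, `|f x| <= C &
      forall x, f x != 0 -> forall i, `|x 0 i| <= C].

Lemma intg_indic n (A : set 'rV[R]_n) (C : R) : measurable A ->
  (forall x, A x -> forall i, `|x 0 i| <= C) -> intg (\1_A : 'rV[R]_n -> R).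
Proof.
move=> mA AC.
suff Aoo : (leb n A < +oo)%E.
  apply/integrableP; split; first exact/measurable_EFinP/measurable_indic.
  rewrite (eq_integral (fun x => (\1_A x)%:E)); last first.
    by move=> x _ /=; rewrite indicE ger0_norm.
  by rewrite integral_indic// setIT.
apply: (@le_lt_trans _ _ (leb n (box 0 (Num.max C 0)))).
  apply: le_measure; rewrite ?inE//; first exact: measurable_box.
  by move=> x Ax i; rewrite mxE subr0 le_max (AC x Ax).
by rewrite leb_box ?ltry// le_max lexx orbT.
Qed.

Lemma bbs_intg n C (f : 'rV[R]_n -> R) : bbs C f -> intg f.
Proof.
move=> [mf fC fS]; apply: (@intg_le _ _ _ (fun x => C * \1_(box 0 C) x)) => //.
  apply: intgZ; apply: (@intg_indic _ _ C); first exact: measurable_box.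
  by move=> x xC i; have := xC i; rewrite mxE subr0.
move=> x; have [->|fx] := eqVneq (f x) 0.
  by rewrite normr0 mulr_ge0// (le_trans _ (fC x)).
rewrite indicE mem_set ?mulr1// => i; rewrite mxE subr0; exact: fS.
Qed.

Lemma integral_rVE n C (f : 'rV[R]_n -> R) : bbs C f -> integral_rV f = rint f.
Proof.
elim: n f => [|n IH] f fb.
  rewrite /= /rint /Rintegral integral_dirac//.
    by rewrite diracT mul1e.
  by have [mf _ _] := fb; exact/measurable_EFinP.
have fi := bbs_intg fb; have [mf fC fS] := fb.
have fbx x : bbs C (fun y => f (row_cons (x, y))).
  split => [||y fy i]; last 2 first.
  - by move=> y; exact: fC.
  - by have := fS _ fy (lift ord0 i); rewrite row_consS.
  apply: measurableT_comp => //; apply: measurableT_comp.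
    exact: measurable_row_cons.
  exact: measurable_fun_pair.
rewrite /= /rint /Rintegral; congr fine.
pose g : measurableTypeR R * 'rV[R]_n -> \bar R := fun p => (f (row_cons p))%:E.
have mg : measurable_fun setT g.
  by apply/measurable_EFinP; apply: measurableT_comp => //; exact: measurable_row_cons.
have gi : (@lebesgue_measure R \x leb n)%E.-integrable setT g.
  have /integrableP[_ fioo] := fi; apply/integrableP; split => //.
  apply: le_lt_trans fioo; rewrite /= ge0_integral_pushforward//.
  - exact: measurable_row_cons.
  - by apply/measurable_EFinP; apply: measurableT_comp.
rewrite integral_pushforward//; last 2 first.
- exact: measurable_row_cons.
- exact/measurable_EFinP.
rewrite preimage_setT -(integral12_prod_meas1 gi).
apply: eq_integral => x _; rewrite /fubini_F /g.
by rewrite (intgE (bbs_intg (fbx x))) (IH _ (fbx x)).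
Qed.

End BoundedSupport.

(** * Continuity on subsets and the topology of row vectors *)

Section WithinContinuity.

Lemma within_continuous_comp (T W S : topologicalType) (A : set T) (B : set W)
    (f : T -> S) (g : W -> T) :
  {within A, continuous f} -> {within B, continuous g} -> (forall w, B w -> A (g w)) ->
  {within B, continuous (f \o g)}.
Proof.
move=> /subspace_continuousP cf /subspace_continuousP cg BA.
apply/subspace_continuousP => w Bw U /(cf _ (BA _ Bw)) fU.
have := cg _ Bw _ fU; rewrite /= !nbhs_simpl /within /=.
by apply: filter_app; near=> z => h Bz; apply: h => //; exact: BA.
Unshelve. all: by end_near. Qed.

Lemma within_continuousW (T S : topologicalType) (A : set T) (f : T -> S) :
  continuous f -> {within A, continuous f}.
Proof. by move=> cf; apply: continuous_subspaceT. Qed.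

Lemma within_continuousS (T S : topologicalType) (A B : set T) (f : T -> S) :
  A `<=` B -> {within B, continuous f} -> {within A, continuous f}.
Proof. by move=> AB; apply: continuous_subspaceW. Qed.

Lemma within_cvg_seq (R : realType) (T : topologicalType) (A : set T) (f : T -> R)
    (x : T) (u : nat -> T) :
  {within A, continuous f} -> A x -> (\forall k \near \oo, A (u k)) ->
  u k @[k --> \oo] --> x -> f (u k) @[k --> \oo] --> f x.
Proof.
move=> /subspace_continuousP cf Ax Au ux U /(cf _ Ax) fU.
have := ux _ fU; rewrite /= !nbhs_simpl /within /=.
by apply: filter_app; apply: filterS Au => k Ak; apply.
Qed.

Lemma near_all (T : eqType) (L : seq T) (I : Type) (F : set_system I) (P : T -> I -> Prop) :
  Filter F -> (forall w, w \in L -> \forall k \near F, P w k) ->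
  \forall k \near F, forall w, w \in L -> P w k.
Proof.
move=> FF; elim: L => [_|w L IH h]; first by apply: nearW.
have := h w (mem_head _ _).
have := IH (fun w' wL => h w' (mem_behead (s := w :: L) wL)).
by apply: filter_app2; near=> k => hL hw w'; rewrite inE => /predU1P[->//|]; exact: hL.
Unshelve. all: by end_near. Qed.

Lemma cvg_sumr (R : realType) (I : Type) (r : seq I) (P : pred I) (T : Type)
    (F : set_system T) (f : I -> T -> R) (l : I -> R) : Filter F ->
  (forall i, P i -> f i x @[x --> F] --> l i) ->
  \sum_(i <- r | P i) f i x @[x --> F] --> \sum_(i <- r | P i) l i.
Proof.
move=> FF fl; elim: r => [|i r IH].
  by under eq_fun do rewrite big_nil; rewrite big_nil; exact: cvg_cst.
rewrite big_cons; have [Pi|Pi] := boolP (P i); under eq_fun do rewrite big_cons ?Pi ?(negbTE Pi).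
  by apply: cvgD => //; exact: fl.
by [].
Qed.

End WithinContinuity.

Section RowTopology.
Context {R : realType} (n : nat).
Implicit Types (u v x y : 'rV[R]_n) (K : set 'rV[R]_n).

Lemma dot_continuous u : continuous (dot u).
Proof.
move=> x; apply: (@cvg_sumr R _ _ _ _ (nbhs x) (fun i y => u 0 i * y 0 i)) => i _.
by apply: cvgM; [exact: cvg_cst|exact: coord_continuous].
Qed.

Lemma dot_delta i x : dot (delta_mx 0 i) x = x 0 i.
Proof.
rewrite /dot (bigD1 i)//= mxE !eqxx mul1r big1 ?addr0// => j ji.
by rewrite mxE (negbTE ji) andbF mul0r.
Qed.

Lemma unit_coord_le1 u i : dot u u = 1 -> `|u 0 i| <= 1.
Proof.
move=> u1; rewrite -(@expr_le1 _ 2)// real_normK ?num_real// -u1 /dot (bigD1 i)//= expr2 lerDl.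
by apply: sumr_ge0 => j _; rewrite -expr2 sqr_ge0.
Qed.

Lemma coord_le_norm x i : `|x 0 i| <= `|x|.
Proof.
rewrite [leRHS]/Num.norm /= mx_normrE.
by apply/bigmax_geP; right => /=; exists (0, i).
Qed.

Lemma norm_le_coord x (c : R) : 0 <= c -> (forall i, `|x 0 i| <= c) -> `|x| <= c.
Proof.
move=> c0 xc; rewrite [leLHS]/Num.norm /= mx_normrE.
by apply/bigmax_leP; split => // -[i j] _ /=; rewrite (ord1 i).
Qed.

Definition bounded_by (C : R) K := forall x, K x -> forall i, `|x 0 i| <= C.

Lemma bounded_set_by K : bounded_set K -> exists2 C : R, 0 <= C & bounded_by C K.
Proof.
move=> [C [_ KC]]; exists (Num.max C 0 + 1).
  by rewrite addr_ge0// le_max lexx orbT.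
move=> x Kx i; apply: le_trans (coord_le_norm x i) _.
by apply: (KC _ _ x Kx); rewrite (@le_lt_trans _ _ (Num.max C 0)) ?ltrDl// le_max lexx.
Qed.

Lemma bounded_by_set C K : bounded_by C K -> bounded_set K.
Proof.
move=> KC; exists (Num.max C 0); split; first exact: num_real.
move=> M CM x Kx; apply: norm_le_coord => [|i].
  by rewrite (le_trans _ (ltW CM))// le_max lexx orbT.
by rewrite (le_trans (KC x Kx i))// (le_trans _ (ltW CM))// le_max lexx.
Qed.

Lemma closed_bounded_by_compact C K : closed K -> bounded_by C K -> compact K.
Proof. by move=> cK /bounded_by_set bK; exact: bounded_closed_compact. Qed.

Lemma within_compact_bounded (T : topologicalType) (A : set T) (f : T -> R) :
  compact A -> {within A, continuous f} -> exists2 B : R, 0 <= B & forall z, A z -> `|f z| <= B.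
Proof.
move=> cA cf; have /compact_bounded[C [_ h]] := continuous_compact cf cA.
exists (Num.max C 0 + 1); first by rewrite addr_ge0// le_max lexx orbT.
move=> x Ax; apply: h; last by exists x.
by rewrite (@le_lt_trans _ _ (Num.max C 0)) ?ltrDl// le_max lexx.
Qed.

Lemma closed_halfspace u b : closed [set x | dot u x <= b].
Proof.
rewrite (_ : [set x | _] = dot u @^-1` [set t | t <= b])//.
by apply: closed_comp => [x _|]; [exact: dot_continuous|exact: closed_le].
Qed.

Lemma open_halfspace u b : open [set x | dot u x < b].
Proof.
rewrite (_ : [set x | _] = dot u @^-1` [set t | t < b])//.
by apply: open_comp => [x _|]; [exact: dot_continuous|exact: open_lt].
Qed.

Lemma closed_measurable_rV K : closed K -> measurable K.
Proof.
move=> cK; rewrite -(setCK K); apply: measurableC.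
by apply: open_measurable_rV; exact: closed_openC.
Qed.

Lemma intg_patch (K : set 'rV[R]_n) (C M : R) (f : 'rV[R]_n -> R) :
  measurable K -> bounded_by C K -> measurable_fun K f ->
  (forall x, K x -> `|f x| <= M) -> intg (f \_ K).
Proof.
move=> mK KC mf fM.
apply: (@intg_le _ _ _ (fun x => M * \1_K x)).
- exact/(measurable_restrictT _ _).1.
- by apply: intgZ; exact: (intg_indic mK KC).
- move=> x; rewrite patchE indicE; case: ifPn => [|_]; last by rewrite normr0 mulr0.
  by rewrite inE mulr1 => /fM.
Qed.

Lemma intg_continuous (C : R) K (f : 'rV[R]_n -> R) : closed K -> bounded_by C K ->
  {within K, continuous f} -> intg (f \_ K).
Proof.
move=> cK KC cf; have [M _ fM] := within_compact_bounded (closed_bounded_by_compact cK KC) cf.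
have mK := closed_measurable_rV cK.
by apply: (intg_patch mK KC _ fM); exact: within_continuous_measurable_rV.
Qed.

Lemma is_derive_line (f : 'rV[R]_n -> R) x v s d :
  is_derive (x + s *: v) v f d -> is_derive s 1 (fun r => f (x + r *: v)) d.
Proof.
move=> [df fd].
have E : (fun h : R => h^-1 *: (f (x + (h *: (1 : R) + s) *: v) - f (x + s *: v))) =
   (fun h : R => h^-1 *: (f (h *: v + (x + s *: v)) - f (x + s *: v))).
  apply/funext => h; congr (_ *: (f _ - _)).
  by rewrite [h%:A]mulr1 scalerDl addrCA.
apply: DeriveDef; first by rewrite /derivable E.
by rewrite -fd /derive E.
Qed.

End RowTopology.

(** * Facets of polytopes and the divergence theorem *)

Section Polytope.
Context {R : realType} (n : nat).
Implicit Types (u v w x y : 'rV[R]_n) (K : set 'rV[R]_n) (L : seq 'rV[R]_n).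

Definition supp K u : R := sup [set dot u y | y in K].

(** For [polyh K L] this is an explicit open part of [K] of full measure, given by finitely many
    strict inequalities; it replaces the topological interior. *)
Definition sint K L : set 'rV[R]_n := [set x | forall w, w \in L -> dot w x < supp K w].

(* L may contain normals that expose no facet of K. *)
Definition polyh K L : Prop :=
  [/\ exists C : R, bounded_by C K, uniq L, forall u, u \in L -> dot u u = 1,
      K = [set x | forall w, w \in L -> dot w x <= supp K w] & sint K L !=set0].

Definition proj u (b : R) x : 'rV[R]_n := x - (dot u x - b) *: u.

Lemma proj_continuous u b : continuous (proj u b).
Proof.
move=> x; apply: (@cvgB R 'rV[R]_n _ (nbhs x) _ id (fun y => (dot u y - b) *: u)).
  exact: cvg_id.
apply: (@cvgZr_tmp R 'rV[R]_n _ (nbhs x) _ (fun y => dot u y - b)).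
by apply: cvgB; [exact: dot_continuous|exact: cvg_cst].
Qed.

Lemma dot_proj u b x w : dot w (proj u b x) = dot w x - (dot u x - b) * dot w u.
Proof. by rewrite /proj dotBr dotZr. Qed.

Lemma dot_proj_unit u b x : dot u u = 1 -> dot u (proj u b x) = b.
Proof. by move=> u1; rewrite dot_proj u1; ring. Qed.

Lemma projN u b x : proj (- u) (- b) x = proj u b x.
Proof.
rewrite /proj dotNl scalerN opprK; congr (_ + _).
by rewrite -[RHS]scaleNr; congr (_ *: _); ring.
Qed.

Section OnePolytope.
Variables (K : set 'rV[R]_n) (L : seq 'rV[R]_n).
Hypothesis KL : polyh K L.

Lemma polyh_unit u : u \in L -> dot u u = 1.
Proof. by case: KL => _ _ + _ _; apply. Qed.

Lemma polyh_neq0 u : u \in L -> u != 0.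
Proof. by move=> /polyh_unit u1; rewrite -dotxx_eq0 u1 oner_neq0. Qed.

Lemma polyhE x : K x <-> forall w, w \in L -> dot w x <= supp K w.
Proof. by case: KL => _ _ _ + _ => {1}->. Qed.

Lemma sint_sub x : sint K L x -> K x.
Proof. by move=> Kx; apply/polyhE => w wL; exact/ltW/Kx. Qed.

Lemma polyh_sup w : has_sup [set dot w y | y in K].
Proof.
split; first by have [_ _ _ _ [x /sint_sub Kx]] := KL; exists (dot w x), x.
have [[C KC] _ _ _ _] := KL; exists (\sum_i `|w 0 i| * C) => _ [x Kx <-].
apply: ler_sum => i _; rewrite (le_trans (ler_norm _))// normrM ler_wpM2l//.
exact: KC.
Qed.

Lemma le_supp w x : K x -> dot w x <= supp K w.
Proof. by move=> Kx; apply: (ub_le_sup (polyh_sup w).2); exists x. Qed.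

Lemma polyh_closed : closed K.
Proof.
rewrite (_ : K = \bigcap_(w in [set` L]) [set x | dot w x <= supp K w]); last first.
  by apply/seteqP; split => x /polyhE.
by apply: closed_bigI => w _; exact: closed_halfspace.
Qed.

Lemma polyh_measurable : measurable K.
Proof. by apply: closed_measurable_rV; exact: polyh_closed. Qed.

Lemma polyh_compact : compact K.
Proof.
have [[C KC] _ _ _ _] := KL.
exact: closed_bounded_by_compact polyh_closed KC.
Qed.

Lemma sint_open : open (sint K L).
Proof.
rewrite openE => x Kx; apply: (@near_all _ _ _ (nbhs x)) => w wL.
by apply: open_nbhs_nbhs; split; [exact: open_halfspace|exact: Kx].
Qed.

Lemma sint_measurable : measurable (sint K L).
Proof. by apply: open_measurable_rV; exact: sint_open. Qed.

Lemma list_null (s : seq ('rV[R]_n * R)) : (forall p, p \in s -> p.1 != 0) ->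
  (leb n).-negligible [set x | exists2 p, p \in s & dot p.1 x = p.2].
Proof.
elim: s => [_|p s IH ps].
  apply: negligibleS (negligible_set0 (leb n)) => x /= [p].
  by rewrite in_nil.
have := negligibleU (hyperplane_null p.2 (ps p (mem_head _ _)))
  (IH (fun q qs => ps q (mem_behead (s := p :: s) qs))).
apply: negligibleS => x /= [q]; rewrite inE => /predU1P[->|qs] qx; first by left.
by right; exists q.
Qed.

Lemma boundary_null : (leb n).-negligible (K `\` sint K L).
Proof.
apply: negligibleS (@list_null [seq (w, supp K w) | w <- L] _).
  move=> x [/polyhE Kx] /existsNP[w] /not_implyP[wL /negP]; rewrite -leNgt => wx.
  by exists (w, supp K w); [exact: map_f|apply/le_anti; rewrite /= Kx].
by move=> p /mapP[w wL ->]; exact: polyh_neq0.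
Qed.

Lemma sint_convex x y s : sint K L x -> K y -> 0 <= s < 1 ->
  sint K L (x + s *: (y - x)).
Proof.
move=> Kx /polyhE Ky /andP[s0 s1] w wL; have := Kx w wL; have := Ky w wL.
rewrite dotDr dotZr dotBr; move: (dot w x) (dot w y) (supp K w) => a b c bc ac.
nra.
Qed.

Lemma sint_interior : sint K L `<=` interior K.
Proof.
move=> x Kx; apply: filterS (sint_sub) _; apply: open_nbhs_nbhs; split => //.
exact: sint_open.
Qed.

Lemma exposed_faceE u x : exposed_face K u x <-> K x /\ dot u x = supp K u.
Proof.
split => [[Kx ux]|[Kx ux]]; last by split => // y Ky; rewrite ux le_supp.
split => //; apply/le_anti; rewrite le_supp//=.
apply: ge_sup; first by exists (dot u x), x.
by move=> _ [y Ky <-]; exact: ux.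
Qed.

Lemma supp_opp_gt u : u \in L -> - supp K u < supp K (- u).
Proof.
move=> uL; have [_ _ _ _ [x Kx]] := KL.
apply: (@lt_le_trans _ _ (dot (- u) x)); last exact/le_supp/sint_sub.
by rewrite dotNl ltrN2; exact: Kx.
Qed.

(* Off this null set, the points projecting on the face of K with normal u do
   not project on the other faces. *)
Lemma proj_null u : u \in L -> (leb n).-negligible
  [set x | exists2 w, w \in L & w != u /\ dot w (proj u (supp K u) x) = supp K w].
Proof.
move=> uL; have u1 := polyh_unit uL; pose b := supp K u.
pose s := [seq (w - dot w u *: u, supp K w - b * dot w u) |
  w <- L & w - dot w u *: u != 0].
apply: negligibleS (@list_null s _); last first.
  by move=> p /mapP[w]; rewrite mem_filter => /andP[w0 _] ->.
move=> x /= [w wL [wu]]; rewrite dot_proj => wx.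
have [w0|w0] := eqVneq (w - dot w u *: u) 0; last first.
  exists (w - dot w u *: u, supp K w - b * dot w u).
    by apply/mapP; exists w; rewrite // mem_filter w0.
  by rewrite /= dotBl dotZl -wx /b; ring.
(* A unit vector parallel to [u] and different from it is [- u]; then [K] would lie between two
   coinciding parallel hyperplanes, against its nonempty interior. *)
exfalso; have wE : w = dot w u *: u by apply/eqP; rewrite -subr_eq0; exact/eqP.
have : dot w u ^+ 2 = 1.
  by have := polyh_unit wL; rewrite {1 2}wE dotZl dotZr u1 mulr1 expr2.
move/eqP; rewrite sqrf_eq1 => /orP[]/eqP wu1.
  by move/eqP: wu; apply; rewrite wE wu1 scale1r.
move: wx; rewrite wE wu1 scaleN1r dotNl dotNl u1 => wx.
by have := supp_opp_gt uL; rewrite -wx; lra.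
Qed.

End OnePolytope.

(** The surface integral over a face, written as a volume integral over the prism of height 1 behind
    the face of a function that is constant along [u]. The height is half-open because [exits] is a
    strict inequality and membership in [K] is not. *)
Definition face_rint (u : 'rV[R]_n) (b : R) (F : set 'rV[R]_n) (phi : 'rV[R]_n -> R) : R :=
  rint ((phi \o proj u b) \_ [set x | -1 < dot u x - b <= 0 /\ F (proj u b x)]).

End Polytope.

Section FacetLimit.
Context {R : realType} (n : nat).
Implicit Types (u v w x y : 'rV[R]_n).

Lemma near_lt (a : nat -> R) (l b : R) : a k @[k --> \oo] --> l -> l < b ->
  \forall k \near \oo, a k < b.
Proof. by move=> /cvgr_lt; apply. Qed.

Lemma near_gt (a : nat -> R) (l b : R) : a k @[k --> \oo] --> l -> b < l ->
  \forall k \near \oo, b < a k.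
Proof. by move=> /cvgr_gt; apply. Qed.

Lemma mxBZ (y u : 'rV[R]_n) (s : R) i : (y - s *: u) 0 i = y 0 i - s * u 0 i.
Proof. by rewrite !mxE. Qed.

Lemma cvg_addt (x v : 'rV[R]_n) : x + (harmonic k : R) *: v @[k --> \oo] --> x.
Proof.
rewrite -[X in _ --> X]addr0; apply: cvgD; first exact: cvg_cst.
by rewrite -(scale0r v); apply: cvgZr_tmp; exact: cvg_harmonic.
Qed.

Lemma measurable_gtspace (a : 'rV[R]_n) (c : R) : measurable [set x | c < dot a x].
Proof.
rewrite (_ : [set x | _] = ~` [set x | dot a x <= c]); last first.
  by apply/seteqP; split => x /=; rewrite ltNge => /negP.
by apply: measurableC; exact: measurable_halfspace.
Qed.

Lemma measurable_stretch u (b lam : R) : measurable_fun setT (stretch u b lam).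
Proof.
apply: measurable_fun_rVP => i; under eq_fun do rewrite !mxE.
apply: measurable_funD; first exact: measurable_coord.
apply: measurable_funM => //; apply: measurable_funM => //.
by apply: measurable_funB => //; exact: measurable_dot.
Qed.

Lemma dot_stretch u (b lam : R) x w :
  dot w (stretch u b lam x) = dot w x + (lam - 1) * (dot u x - b) * dot w u.
Proof. by rewrite /stretch dotDr dotZr. Qed.

Variables (K : set 'rV[R]_n) (L : seq 'rV[R]_n) (KL : polyh K L).
Variables (phi : 'rV[R]_n -> R) (cphi : {within K, continuous phi}).

(** Moving [x] by [t *: v] violates the constraint with normal [w]. *)
Definition exits (t : R) v x w := supp K w < dot w x + t * dot w v.

Lemma measurable_exits t v w : measurable [set x | exits t v x w].
Proof.
rewrite (_ : [set x | _] = [set x | supp K w - t * dot w v < dot w x]).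
  exact: measurable_gtspace.
by apply/seteqP; split => x; rewrite /exits /= ltrBlDr.
Qed.

Lemma measurable_has_exits t v (s : seq 'rV[R]_n) : measurable [set x | has (exits t v x) s].
Proof.
elim: s => [|w s IH].
  by rewrite (_ : [set x | _] = set0)//; apply/seteqP; split.
rewrite (_ : [set x | _] = [set x | exits t v x w] `|` [set x | has (exits t v x) s]).
  by apply: measurableU => //; exact: measurable_exits.
by apply/seteqP; split => x /=; [move=> /orP[]; [left|right]|case=> ->; rewrite ?orbT].
Qed.

Lemma polyh_phi_bounded : exists2 B : R, 0 <= B & forall x, K x -> `|phi x| <= B.
Proof. exact: within_compact_bounded (polyh_compact KL) cphi. Qed.

Lemma intg_sub (B : set 'rV[R]_n) : measurable B -> intg (phi \_ (K `&` B)).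
Proof.
move=> mB; have [[C KC] _ _ _ _] := KL; have [M _ hM] := polyh_phi_bounded.
have mK := polyh_measurable KL.
apply: (intg_patch (C := C) (M := M)).
- exact: measurableI.
- by move=> x [/KC].
- apply: (measurable_funS mK); first by move=> x [].
  exact: within_continuous_measurable_rV.
- by move=> x [/hM].
Qed.

Definition slab u : set 'rV[R]_n :=
  [set x | -1 < dot u x - supp K u <= 0 /\ K (proj u (supp K u) x)].

Lemma measurable_slab_itv u (b : R) : measurable [set x | -1 < dot u x - b <= 0].
Proof.
rewrite (_ : [set x | _] = [set x | b - 1 < dot u x] `&` [set x | dot u x <= b]).
  by apply: measurableI; [exact: measurable_gtspace|exact: measurable_halfspace].
apply/seteqP; split => x /=; first by move=> /andP[? ?]; split; lra.
by move=> [? ?]; apply/andP; split; lra.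
Qed.

Lemma closed_proj_preimage u : closed [set x | K (proj u (supp K u) x)].
Proof.
rewrite (_ : [set x | _] = proj u (supp K u) @^-1` K)//.
apply: closed_comp => [x _|]; [exact: proj_continuous|exact: (polyh_closed KL)].
Qed.

Lemma measurable_slab u : measurable (slab u).
Proof.
rewrite /slab (_ : [set x | _] = [set x | -1 < dot u x - supp K u <= 0] `&`
   [set x | K (proj u (supp K u) x)])//.
apply: measurableI; first exact: measurable_slab_itv.
by apply: closed_measurable_rV; exact: closed_proj_preimage.
Qed.

Lemma measurable_slab_phi u (psi : 'rV[R]_n -> R) : {within K, continuous psi} ->
  measurable_fun setT ((psi \o proj u (supp K u)) \_ (slab u)).
Proof.
move=> cpsi; apply: (measurable_restrictT (psi \o proj u (supp K u)) (@measurable_slab u)).1.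
have mP := closed_measurable_rV (@closed_proj_preimage u).
apply: (measurable_funS mP); first by move=> x [].
apply: within_continuous_measurable_rV => //.
apply: within_continuous_comp cpsi _ _ => //.
by apply: within_continuousW; exact: proj_continuous.
Qed.

Lemma slab_bounded C u : bounded_by C K -> dot u u = 1 -> bounded_by (C + 1) (slab u).
Proof.
move=> KC u1 x [/andP[x1 x2] Kx] i.
have -> : x = proj u (supp K u) x + (dot u x - supp K u) *: u by rewrite /proj subrK.
rewrite mxE (le_trans (ler_normD _ _))// lerD ?(KC _ Kx)// mxE normrM.
rewrite -[leRHS]mulr1 ler_pM// ?unit_coord_le1//.
by rewrite ler_norml (ltW x1) (le_trans x2).
Qed.

Lemma intg_slab u (psi : 'rV[R]_n -> R) : dot u u = 1 -> {within K, continuous psi} ->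
  intg ((psi \o proj u (supp K u)) \_ (slab u)).
Proof.
move=> u1 cpsi; have [[C KC] _ _ _ _] := KL.
have [M _ hM] := within_compact_bounded (polyh_compact KL) cpsi.
apply: (intg_patch (@measurable_slab u) (slab_bounded KC u1) (M := M)).
  apply: (measurable_restrictT (psi \o proj u (supp K u)) (@measurable_slab u)).2.
  exact: measurable_slab_phi.
by move=> x [_ Kx]; exact: hM.
Qed.

(** The points that exit through [u] asymptotically fill a layer of thickness t (u . v)^+ behind the
    facet. Stretching this layer to thickness 1 gives integrals over nearly fixed slabs, to which
    dominated convergence applies. Removing the points that also exit through [L1] makes the layers
    of different facets disjoint, so that they can be added. *)
Lemma facet_limit u v (L1 : seq 'rV[R]_n) : u \in L -> u \notin L1 -> {subset L1 <= L} ->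
  (harmonic k)^-1 * rint (phi \_ (K `&`
     [set x | exits (harmonic k) v x u && ~~ has (exits (harmonic k) v x) L1]))
    @[k --> \oo] --> Num.max (dot u v) 0 * face_rint u (supp K u) K phi.
Proof.
move=> uL uL1 L1L; set a := dot u v; set b := supp K u.
have u1 := polyh_unit KL uL.
have [a0|a0] := leP a 0.
  rewrite mul0r; apply: cvg_near_cst; near=> k.
  rewrite (_ : _ `&` _ = set0) ?patch_set0; last first.
    apply/seteqP; split => // x [Kx /andP[]]; rewrite /exits -/a ltNge => /negP h _.
    apply: h; have := le_supp KL u Kx; have := @harmonic_ge0 R k.
    by move: (harmonic k) (dot u x) (supp K u) => t d s *; nra.
  by rewrite rint0 mulr0.
pose lam k : R := harmonic k * a.
have lam0 k : 0 < lam k by rewrite mulr_gt0// harmonic_gt0.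
pose D k := K `&` [set x | exits (harmonic k) v x u && ~~ has (exits (harmonic k) v x) L1].
have iD k : intg (phi \_ (D k)).
  apply: intg_sub; rewrite (_ : [set x | _] = [set x | exits (harmonic k) v x u] `\`
    [set x | has (exits (harmonic k) v x) L1]).
    by apply: measurableD; [exact: measurable_exits|exact: measurable_has_exits].
  by apply/seteqP; split => x /=; [move=> /andP[? /negP]|move=> [-> /negP]].
pose F k := (phi \_ (D k)) \o stretch u b (lam k).
have FE k : (harmonic k)^-1 * rint (phi \_ (D k)) = a * rint (F k).
  have [_ ->] := scales_stretch b u1 (lam0 k) (iD k).
  by rewrite /lam; field; rewrite gt_eqF//= gt_eqF// harmonic_gt0.
under eq_fun do rewrite FE.
apply: cvgMl_tmp.
have [[C KC] _ _ _ _] := KL; have [B B0 hB] := polyh_phi_bounded.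
have t1 k : harmonic k <= 1 :> R by rewrite /harmonic invf_le1 ?ler1n// ltr0n.
apply: (rint_dominated_cvg (g := fun x => B * \1_(box 0 (C + (a + 1))) x) _ _ _ (proj_null KL uL)).
- by move=> k; apply: measurableT_comp; [exact: (intg_measurable (iD k))|exact: measurable_stretch].
- exact: measurable_slab_phi.
- apply: intgZ; apply: (@intg_indic _ _ _ (C + (a + 1))); first exact: measurable_box.
  by move=> x xC i; have := xC i; rewrite mxE subr0.
- move=> k x _; rewrite /F /= patchE; case: ifPn => [|_]; last by rewrite normr0 mulr_ge0.
  rewrite inE => -[KT /andP[]]; rewrite /exits dot_stretch u1 mulr1 -/a -/b => c1 _.
  rewrite -[leLHS]mulr1 ler_pM ?hB// indicE mem_set// => i; rewrite mxE subr0.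
  have c2 := le_supp KL u KT; rewrite dot_stretch u1 mulr1 -/b in c2.
  have -> : x = stretch u b (lam k) x - ((lam k - 1) * (dot u x - b)) *: u.
    by rewrite /stretch addrK.
  rewrite mxBZ (le_trans (ler_normB _ _))// lerD ?(KC _ KT)// normrM.
  rewrite -[leRHS]mulr1 ler_pM// ?unit_coord_le1//.
  have := lam0 k; have : lam k <= a by rewrite /lam ler_piMl// ltW.
  move: c1 c2; rewrite -/(lam k); move: (lam k) (dot u x) => l d c1 c2 la l0.
  have d1 : d - b <= 0 by nra.
  have d2 : -1 < d - b by nra.
  by rewrite ler_norml; apply/andP; split; nra.
move=> x Nx; set c := dot u x - b.
have projx w : dot w (proj u b x) = dot w x - c * dot w u by rewrite dot_proj.
have TE w k : dot w (stretch u b (lam k) x) = dot w (proj u b x) + harmonic k * (a * c * dot w u).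
  by rewrite dot_stretch projx -/c /lam; ring.
have Tproj : stretch u b (lam k) x @[k --> \oo] --> proj u b x.
  rewrite (_ : (fun k => _) = (fun k => proj u b x + harmonic k *: ((a * c) *: u))).
    exact: cvg_addt.
  apply/funext => k; rewrite /stretch /proj -addrA; congr (_ + _).
  by rewrite scalerA -scaleNr -scalerDl; congr (_ *: _); rewrite -/c /lam; ring.
have cw w : dot w (stretch u b (lam k) x) @[k --> \oo] --> dot w (proj u b x).
  by apply: (cvg_comp _ _ Tproj); exact: dot_continuous.
have cw' w : dot w (stretch u b (lam k) x) + harmonic k * dot w v @[k --> \oo] --> dot w (proj u b x).
  rewrite -[X in _ --> X]addr0; apply: cvgD => //.
  by rewrite -(mul0r (dot w v)); apply: cvgMr_tmp; exact: cvg_harmonic.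
have [/andP[c1 c2]|c12] := boolP (-1 < c <= 0); last first.
  rewrite patchE memNset; last by move=> [] /=; rewrite -/b -/c (negbTE c12).
  apply: cvg_near_cst; apply: nearW => k; rewrite /F /= patchE memNset// => -[KT /andP[]].
  rewrite /exits dot_stretch u1 mulr1 -/a -/b -/c => e1 _.
  have := le_supp KL u KT; rewrite dot_stretch u1 mulr1 -/b -/c => e2.
  move: c12; rewrite negb_and -leNgt -ltNge; have := lam0 k; rewrite -/(lam k) in e1 *.
  have d : dot u x = b + c by rewrite /c; ring.
  rewrite d in e1 e2; move: (lam k) e1 e2 => l e1 e2 l0 /orP[] ?; nra.
(* Off the null set of [proj_null], the projection either satisfies all other constraints strictly
   or violates one strictly, and both situations persist for small times. *)
have [allw|] := pselect (forall w, w \in L -> w != u -> dot w (proj u b x) < supp K w).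
  have Kp : K (proj u b x).
    apply/(polyhE KL) => w wL; have [->|wu] := eqVneq w u.
      by rewrite dot_proj_unit.
    exact/ltW/allw.
  rewrite patchE mem_set; last by split; rewrite //= -/b -/c c1.
  have nK : \forall k \near \oo, forall w, w \in L -> w != u ->
      dot w (stretch u b (lam k) x) < supp K w.
    apply: near_all => w wL; have [->|wu] := eqVneq w u; first exact: nearW.
    by apply: filterS (near_lt (cw w) (allw w wL wu)).
  have nKv : \forall k \near \oo, forall w, w \in L -> w != u ->
      dot w (stretch u b (lam k) x) + harmonic k * dot w v < supp K w.
    apply: near_all => w wL; have [->|wu] := eqVneq w u; first exact: nearW.
    by apply: filterS (near_lt (cw' w) (allw w wL wu)).
  have nD : \forall k \near \oo, D k (stretch u b (lam k) x).
    near=> k; split.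
      apply/(polyhE KL) => w wL; have [->|wu] := eqVneq w u.
        rewrite TE dot_proj_unit// u1 mulr1 -/b; have := lam0 k; rewrite /lam.
        have := @harmonic_gt0 R k; move: (harmonic k) => t *; nra.
      by apply: ltW; move: w wL wu; near: k.
    apply/andP; split.
      rewrite /exits TE dot_proj_unit// u1 mulr1 -/a -/b.
      have := @harmonic_gt0 R k; move: (harmonic k) => t t0.
      have : 0 < t * (a * (c + 1)) by rewrite !mulr_gt0//; lra.
      by nra.
    apply/hasPn => w wL1; rewrite /exits -leNgt; apply: ltW.
    have wL := L1L _ wL1; have : w != u by apply: contraNneq uL1 => <-.
    by move: w wL {wL1}; near: k.
  have nKT : \forall k \near \oo, K (stretch u b (lam k) x) by apply: filterS nD => k [].
  have : phi (stretch u b (lam k) x) @[k --> \oo] --> phi (proj u b x).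
    exact: (within_cvg_seq cphi Kp nKT Tproj).
  apply: cvg_trans; apply: near_eq_cvg; apply: filterS nD => k Dk.
  by rewrite /F /= patchE mem_set.
move=> /existsNP[w] /not_implyP[wL] /not_implyP[wu /negP]; rewrite -leNgt le_eqVlt.
move=> /orP[/eqP ew|sw].
  by case: Nx; exists w => //; split=> //; exact/eqP.
rewrite patchE memNset; last first.
  by move=> [_ /= Kp]; have := le_supp KL w Kp; rewrite leNgt sw.
apply: cvg_near_cst.
apply: filterS (near_gt (cw w) sw) => k sk.
rewrite /F /= patchE memNset// => -[KT _].
by have := le_supp KL w KT; rewrite leNgt sk.
Unshelve. all: by end_near. Qed.

Lemma exit_limit v (L1 : seq 'rV[R]_n) : uniq L1 -> {subset L1 <= L} ->
  (harmonic k)^-1 * rint (phi \_ (K `&` [set x | has (exits (harmonic k) v x) L1]))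
    @[k --> \oo] --> \sum_(u <- L1) Num.max (dot u v) 0 * face_rint u (supp K u) K phi.
Proof.
elim: L1 => [_ _|u L1 IH /= /andP[uL1 uq] sL].
  rewrite big_nil; apply: cvg_near_cst; apply: nearW => k.
  rewrite (_ : _ `&` _ = set0) ?patch_set0 ?rint0 ?mulr0//.
  by apply/seteqP; split => // x [].
have uL : u \in L by apply: sL; exact: mem_head.
have sL1 : {subset L1 <= L} by move=> w wL1; apply: sL; rewrite inE wL1 orbT.
rewrite big_cons.
apply: (cvg_trans _ (cvgD (@facet_limit u v L1 uL uL1 sL1) (IH uq sL1))).
apply: near_eq_cvg; apply: nearW => k; rewrite fctE -mulrDr -rintD; last 2 first.
- apply: intg_sub; rewrite (_ : [set x | _] = [set x | exits (harmonic k) v x u] `\`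
    [set x | has (exits (harmonic k) v x) L1]).
    by apply: measurableD; [exact: measurable_exits|exact: measurable_has_exits].
  by apply/seteqP; split => x /=; [move=> /andP[? /negP]|move=> [-> /negP]].
- by apply: intg_sub; exact: measurable_has_exits.
congr (_ * rint _); apply/funext => x; rewrite !patchE.
have [Kx|Kx] := pselect (K x); last first.
  by rewrite !memNset ?addr0// => -[].
rewrite !in_setI !(mem_set Kx) /=.
have E (p : 'rV[R]_n -> bool) : (x \in [set y | p y]) = p x.
  by apply/idP/idP; rewrite inE.
rewrite !E; case: (exits _ _ _ _) => //=; case: (has _ _) => //=; by rewrite ?addr0 ?add0r.
Qed.

Lemma exitsP t v x : K x -> has (exits t v x) L <-> ~ K (x + t *: v).
Proof.
move=> Kx; split=> [/hasP[w wL ex] Kxt|Kxt].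
  by have := le_supp KL w Kxt; rewrite dotDr dotZr leNgt; move: ex; rewrite /exits => ->.
apply: contrapT => /negP/hasPn h; apply: Kxt; apply/(polyhE KL) => w wL.
by have := h w wL; rewrite /exits -leNgt dotDr dotZr.
Qed.

Lemma derive_seq (psi : 'rV[R]_n -> R) x v (d : R) : is_derive x v psi d ->
  (harmonic k)^-1 * (psi (x + (harmonic k : R) *: v) - psi x) @[k --> \oo] --> d.
Proof.
move=> [dpsi <-]; have : (fun h : R => h^-1 *: (psi (h *: v + x) - psi x)) @ 0^' --> 'D_v psi x.
  exact: dpsi.
move=> /cvgr_dnbhsP /(_ harmonic); rewrite /=.
have H : (forall k, (harmonic k : R) != 0) /\ harmonic k @[k --> \oo] --> (0 : R).
  by split; [move=> k; rewrite gt_eqF// harmonic_gt0|exact: cvg_harmonic].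
move=> /(_ H); apply: cvg_trans; apply: near_eq_cvg; apply: nearW => k /=.
by rewrite (addrC x).
Qed.

(** Up to its end point the segment stays in [sint K L], where the derivative is given; at the end
    point the mean value theorem only needs continuity. *)
Lemma line_lipschitz x v (psi dpsi : 'rV[R]_n -> R) (B t : R) : 0 < t ->
  {within K, continuous psi} -> sint K L x -> K (x + t *: v) ->
  (forall y, sint K L y -> is_derive y v psi (dpsi y)) ->
  (forall y, K y -> `|dpsi y| <= B) ->
  `|psi (x + t *: v) - psi x| <= B * t.
Proof.
move=> t0 cpsi Kx Kxt dp dB.
have inK (s : R) : 0 <= s < t -> sint K L (x + s *: v).
  move=> /andP[s0 st].
  have := @sint_convex _ _ _ _ KL x (x + t *: v) (s / t) Kx Kxt.
  rewrite addrAC subrr add0r scalerA divfK ?gt_eqF//; apply.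
  by apply/andP; split; [rewrite divr_ge0// ltW|rewrite ltr_pdivrMr// mul1r].
have [||c] := @MVT R (fun s => psi (x + s *: v)) (fun s => dpsi (x + s *: v)) 0 t t0.
- move=> s; rewrite in_itv/= => /andP[s0 st]; apply: is_derive_line.
  by apply: dp; apply: inK; rewrite ltW.
- apply: (within_continuous_comp cpsi).
    apply: within_continuousW => s; apply: cvgD; first exact: cvg_cst.
    by apply: cvgZr_tmp; exact: cvg_id.
  move=> s /=; rewrite in_itv/= => /andP[s0]; rewrite le_eqVlt => /predU1P[->//|st].
  by apply: (sint_sub KL); apply: inK; rewrite s0.
rewrite in_itv/= => /andP[c0 ct]; rewrite scale0r addr0 subr0 => ->.
rewrite normrM (gtr0_norm t0) ler_wpM2r ?(ltW t0)// dB//.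
by apply: (sint_sub KL); apply: inK; rewrite ltW.
Qed.

(** With f equal to phi on K and 0 elsewhere, the integral of f(x + t v) - f(x) vanishes by
    translation invariance. The points where only one of x and x + t v belongs to K are split off:
    divided by t they produce the surface terms, with weights (u . v)^+ - (- u . v)^+ = u . v.
    Elsewhere the difference quotient is bounded and converges to the derivative. *)
Theorem divergence_dir v (dphi : 'rV[R]_n -> R) : {within K, continuous dphi} ->
  (forall x, sint K L x -> is_derive x v phi (dphi x)) ->
  rint (dphi \_ K) = \sum_(u <- L) dot u v * face_rint u (supp K u) K phi.
Proof.
move=> cdphi dp; have [_ uL _ _ _] := KL; have cK := polyh_closed KL.
have [[C KC] _ _ _ _] := KL.
have [B B0 hB] := within_compact_bounded (polyh_compact KL) cdphi.
have mK := polyh_measurable KL.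
pose f := phi \_ K; have fi : intg f by exact: intg_continuous cK KC cphi.
pose Cf t v := phi \_ (K `&` [set x | has (exits t v x) L]).
have Ci t w : intg (Cf t w) by apply: intg_sub; exact: measurable_has_exits.
have tri (g : 'rV[R]_n -> R) y : intg g -> intg (fun x => g (x + y)) /\ rint (fun x => g (x + y)) = rint g.
  by move=> gi; have := scales_translation y gi; rewrite invr1 mul1r.
pose t k : R := harmonic k.
pose A k x := (f (x + t k *: v) - f x) - (Cf (t k) (- v) (x + t k *: v) - Cf (t k) v x).
have Ai k : intg (A k).
  by apply: intgB; apply: intgB => //; apply: (tri _ _ _).1.
have rA k : rint (A k) = rint (Cf (t k) v) - rint (Cf (t k) (- v)).
  rewrite rintB; [|by apply: intgB => //; apply: (tri _ _ _).1..].
  rewrite !rintB//; [|by apply: (tri _ _ _).1..].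
  by rewrite !(tri _ _ _).2//; ring.
have AE k x : A k x = if x \in K then (if x + t k *: v \in K then phi (x + t k *: v) - phi x else 0) else 0.
  have KE y (w : 'rV[R]_n) : Cf (t k) w y = if y \in K then (if y + t k *: w \in K then 0 else phi y) else 0.
    rewrite /Cf patchE; case: ifPn; rewrite ?inE.
      move=> [Ky /= /(exitsP _ _ Ky)] h; rewrite mem_set// memNset//.
    move=> h; case: ifPn; rewrite ?inE// => Ky; case: ifPn => //; rewrite notin_setE => h'.
    by move: h; rewrite notin_setE => -[]; split => //=; apply/(exitsP _ _ Ky).
  rewrite /A !KE /f !patchE; rewrite scalerN addrK.
  by case: (boolP (x \in K)) => Kx; case: (boolP (x + t k *: v \in K)) => Kxt; rewrite ?subr0 ?subrr ?sub0r ?oppr0 ?opprK ?addr0 ?addNr//; ring.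
have lim1 : (t k)^-1 * rint (A k) @[k --> \oo] --> \sum_(u <- L) dot u v * face_rint u (supp K u) K phi.
  have := cvgB (@exit_limit v L uL (fun _ => id)) (@exit_limit (- v) L uL (fun _ => id)).
  rewrite -sumrB (eq_bigr (fun u => dot u v * face_rint u (supp K u) K phi)); last first.
    move=> u _; rewrite -mulrBl dotNr; congr (_ * _).
    by case: (leP (dot u v) 0) => h; case: (leP (- dot u v) 0) => h'; lra.
  move=> cB; apply: cvg_trans (cB _); apply: near_eq_cvg; apply: nearW => k.
  by rewrite fctE /= rA mulrBr.
have lim2 : (t k)^-1 * rint (A k) @[k --> \oo] --> rint (dphi \_ K).
  have -> : (fun k => (t k)^-1 * rint (A k)) = (fun k => rint (fun x => (t k)^-1 * A k x)).
    by apply/funext => k; rewrite rintZ.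
  apply: (rint_dominated_cvg (g := fun x => B * \1_K x) _ _ _ (boundary_null KL)).
  - by move=> k; apply: intg_measurable; exact: intgZ.
  - by apply: (intg_measurable (intg_continuous cK KC cdphi)).
  - by apply: intgZ; exact: (intg_indic mK KC).
  - move=> k x Nx; rewrite AE indicE; case: ifPn => Kx; last by rewrite mulr0 normr0 mulr0.
    rewrite mulr1; case: ifPn => Kxt; last by rewrite mulr0 normr0.
    have t0 : 0 < t k by rewrite harmonic_gt0.
    rewrite !inE in Kx Kxt.
    have Sx : sint K L x by apply: contrapT => h; exact: Nx.
    rewrite normrM normfV (gtr0_norm t0) mulrC ler_pdivrMr//.
    exact: line_lipschitz cphi Sx Kxt dp hB.
  - move=> x Nx; rewrite patchE; case: ifPn => Kx; last first.
      apply: cvg_near_cst; apply: nearW => k; by rewrite AE (negbTE Kx) mulr0.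
    rewrite inE in Kx; have Sx : sint K L x by apply: contrapT => h; exact: Nx.
    apply: cvg_trans (derive_seq (dp x Sx)); apply: near_eq_cvg.
    have : \forall k \near \oo, sint K L (x + t k *: v).
      have nS : nbhs x (sint K L) by apply: open_nbhs_nbhs; split => //; exact: sint_open.
      exact: (@cvg_addt x v _ nS).
    apply: filterS => k Sk; rewrite AE !mem_set//; exact: (sint_sub KL).
exact: (cvg_unique _ lim2 lim1).
Qed.

End FacetLimit.

(** * Facets and their areas *)

Section PolytopeFacets.
Context {R : realType} (n : nat).
Implicit Types (u v w x y : 'rV[R]_n) (K : set 'rV[R]_n) (L : seq 'rV[R]_n).

Lemma enorm_sqr x : enorm x ^+ 2 = dot x x.
Proof. by rewrite /enorm sqr_sqrtr// dotxx_ge0. Qed.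

Lemma enorm_ge0 x : 0 <= enorm x.
Proof. exact: sqrtr_ge0. Qed.

Lemma coord_le_enorm x i : `|x 0 i| <= enorm x.
Proof.
rewrite -(@ler_pXn2r _ 2)// ?nnegrE ?enorm_ge0// enorm_sqr real_normK ?num_real//.
rewrite /dot (bigD1 i)//= expr2 lerDl.
by apply: sumr_ge0 => j _; rewrite -expr2 sqr_ge0.
Qed.

Lemma bounded_has_ubound (C : R) K w : bounded_by C K -> has_ubound [set dot w y | y in K].
Proof.
move=> KC; exists (\sum_i `|w 0 i| * C) => _ [x Kx <-].
apply: ler_sum => i _; rewrite (le_trans (ler_norm _))// normrM ler_wpM2l//.
exact: KC.
Qed.

Lemma interior_supp K w x : has_ubound [set dot w y | y in K] -> w != 0 ->
  interior K x -> dot w x < supp K w.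
Proof.
move=> ubK w0 Kx; have [k _ /(_ k (leqnn k)) /= Kk] := @cvg_addt R n x w _ Kx.
apply: (@lt_le_trans _ _ (dot w (x + (harmonic k : R) *: w))).
  rewrite dotDr dotZr ltrDl mulr_gt0 ?harmonic_gt0// lt_neqAle dotxx_ge0 andbT.
  by rewrite eq_sym dotxx_eq0.
by apply: ub_le_sup => //; exists (x + (harmonic k : R) *: w).
Qed.

(** Inequalities with zero normal are vacuous since [K] is not empty; the others are normalized and
    tightened to the support values, which interior points satisfy strictly. *)
Lemma polytope_polyh K : polytope K -> interior K !=set0 -> exists L, polyh K L.
Proof.
move=> [/bounded_set_by[C C0 KC] [s Ks]] [z Kz].
have Kz' : K z by exact: interior_subset.
pose nz (p : 'rV[R]_n) := (enorm p)^-1 *: p.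
have e0 p : p != 0 -> 0 < enorm p.
  by move=> p0; rewrite /enorm sqrtr_gt0 lt_neqAle dotxx_ge0 andbT eq_sym dotxx_eq0.
have unz p : p != 0 -> dot (nz p) (nz p) = 1.
  move=> p0; rewrite /nz dotZl dotZr mulrA -enorm_sqr -expr2 -exprMn mulVf ?expr1n//.
  by rewrite gt_eqF// e0.
pose L := undup [seq nz p.1 | p <- s & p.1 != 0].
have LP w : w \in L -> exists2 p, p \in s & p.1 != 0 /\ w = nz p.1.
  by rewrite mem_undup => /mapP[p]; rewrite mem_filter => /andP[p0 ps] ->; exists p.
have ubK w : has_ubound [set dot w y | y in K] by exact: (bounded_has_ubound _ KC).
exists L; split.
- by exists C.
- exact: undup_uniq.
- by move=> w /LP[p ps [p0 ->]]; exact: unz.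
- apply/seteqP; split => [x Kx w wL /=|x /= hx].
    by apply: ub_le_sup => //; exists x.
  rewrite Ks /=; apply/allP => p ps.
  have Kp y : K y -> dot p.1 y <= p.2 by rewrite Ks => /allP; apply.
  have [p0|p0] := eqVneq p.1 0.
    by have := Kp z Kz'; rewrite p0 !dot0l.
  have wL : nz p.1 \in L by rewrite mem_undup; apply/mapP; exists p; rewrite // mem_filter p0.
  have : dot (nz p.1) x <= p.2 / enorm p.1.
    apply: le_trans (hx _ wL) _; apply: ge_sup; first by exists (dot (nz p.1) z), z.
    move=> _ [y Ky <-]; rewrite /nz dotZl mulrC ler_pM2r ?invr_gt0 ?e0//.
    exact: Kp.
  by rewrite /nz dotZl mulrC ler_pM2r ?invr_gt0 ?e0.
- exists z => w /LP[p ps [p0 wE]]; apply: interior_supp => //.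
  rewrite -dotxx_eq0 wE unz ?oner_neq0//.
Qed.

Definition farea K u : R := face_rint u (supp K u) K (fun=> 1).

Section OnePolytope.
Variables (K : set 'rV[R]_n) (L : seq 'rV[R]_n).
Hypothesis KL : polyh K L.

Lemma polyh_cons u : dot u u = 1 -> u \notin L -> polyh K (u :: L).
Proof.
move=> u1 uL; have [hC uq un KE [z Kz]] := KL; split => //.
- by rewrite /= uL.
- by move=> w; rewrite inE => /predU1P[->//|]; exact: un.
- apply/seteqP; split => x.
    move=> Kx w _; exact: (le_supp KL).
  by move=> /= h; apply/(polyhE KL) => w wL; apply: h; rewrite inE wL orbT.
- exists z => w; rewrite inE => /predU1P[->|]; last exact: Kz.
  apply: interior_supp; [exact: (polyh_sup KL u).2|by rewrite -dotxx_eq0 u1 oner_neq0|].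
  exact: (sint_interior KL).
Qed.

Lemma cst_within (c : R) : {within K, continuous (fun=> c)}.
Proof. by apply: within_continuousW; exact: cst_continuous. Qed.

(** Adding [u] to [L] does not change [K]. Comparing the divergence theorem for the constant 1 in
    direction [u] with both lists shows that the additional face contributes nothing. *)
Lemma farea_notin u : dot u u = 1 -> u \notin L -> farea K u = 0.
Proof.
move=> u1 uL; have KL' := polyh_cons u1 uL.
have c0 := @cst_within 0; have c1 := @cst_within 1.
have d1 (x : 'rV[R]_n) : is_derive x u (fun=> 1 : R) 0 by exact: is_derive_cst.
have := divergence_dir KL c1 c0 (fun x _ => d1 x).
rewrite (divergence_dir KL' c1 c0 (fun x _ => d1 x)) big_cons u1 mul1r.
by move/eqP; rewrite -subr_eq0 addrK => /eqP.
Qed.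

Lemma dot_projD u (b : R) x : dot u u = 1 -> proj u b (x + u) = proj u b x.
Proof. by move=> u1; apply/rowP => i; rewrite !mxE dotDr u1; ring. Qed.

(** The closed prism in front of the face and the half-open one behind it differ by a translation
    along [u] and by a part of a hyperplane. *)
Lemma area_exposed u : dot u u = 1 -> area u (exposed_face K u) = farea K u.
Proof.
move=> u1; rewrite /area /vol; set b := supp K u.
pose A : set 'rV[R]_n := [set x | 0 <= dot u x - b <= 1 /\ K (proj u b x)].
rewrite (_ : [set x | _] = A); last first.
  apply/seteqP; split => [x [y [s [/(exposed_faceE KL)[Ky uy] s01 ->]]]|x [s01 Kp]] /=.
    have E : dot u (y + s *: u) - b = s by rewrite dotDr dotZr u1 uy -/b mulr1 addrAC subrr add0r.
    by rewrite /A /= /proj E; split => //; rewrite addrK.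
  exists (proj u b x), (dot u x - b); split => //; last by rewrite /proj subrK.
  by apply/(exposed_faceE KL); split => //; rewrite dot_proj_unit.
have mA : measurable A.
  rewrite /A (_ : [set x | _] = ([set x | dot u x <= b + 1] `\` [set x | ~ (b <= dot u x)])
     `&` [set x | K (proj u b x)]).
    apply: measurableI; last first.
      by apply: closed_measurable_rV; exact: (@closed_proj_preimage _ _ _ _ KL).
    apply: measurableD; first exact: measurable_halfspace.
    rewrite (_ : [set x | _] = ~` [set x | dot (- u) x <= - b]).
      by apply: measurableC; exact: measurable_halfspace.
    by apply/seteqP; split => x /=; rewrite dotNl lerN2.
  apply/seteqP; split => x /=.
    move=> [/andP[h1 h2] ?]; split => //; split; first by lra.
    by apply/contrapT => /contrapT; apply; lra.
  move=> [[h1 /contrapT h2] ?]; split => //; apply/andP; split; lra.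
have [[C KC] _ _ _ _] := KL.
have AC : bounded_by (C + 1) A.
  move=> x [/andP[x1 x2] Kx] i.
  have -> : x = proj u b x + (dot u x - b) *: u by rewrite /proj subrK.
  rewrite mxE (le_trans (ler_normD _ _))// lerD ?(KC _ Kx)// mxE normrM.
  by rewrite -[leRHS]mulr1 ler_pM// ?unit_coord_le1// ger0_norm.
have iA := intg_indic mA AC.
have bA : bbs (Num.max 1 (C + 1)) (\1_A : 'rV[R]_n -> R).
  split; first exact: intg_measurable.
    by move=> x; rewrite indicE le_max; apply/orP; left; case: (x \in A); rewrite ?normr1 ?normr0.
  move=> x; rewrite indicE; have [Ax|Ax] := boolP (x \in A); last by rewrite eqxx.
  by move=> _ i; rewrite le_max; apply/orP; right; apply: AC; rewrite inE in Ax.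
rewrite (integral_rVE bA).
have [i1] := scales_translation u iA; rewrite invr1 mul1r => <-.
apply: (ae_eq_rint _ _ (hyperplane_null (b - 1) (_ : u != 0))).
- exact: intg_measurable.
- exact: (intg_measurable (intg_slab KL u1 (@cst_within 1))).
- by rewrite -dotxx_eq0 u1 oner_neq0.
- move=> x /= xb; rewrite indicE patchE.
  have E : (x + u \in A) = (x \in [set x | -1 < dot u x - b <= 0 /\ K (proj u b x)]).
    apply/idP/idP; rewrite !inE /A /= dotDr u1 dot_projD// => -[/andP[h1 h2] ?].
      split => //; rewrite (_ : _ <= 0); last by lra.
      rewrite andbT lt_neqAle (_ : -1 <= _); last by lra.
      by rewrite andbT; apply/eqP => h; apply: xb; lra.
    by split => //; apply/andP; split; lra.
  by rewrite E; case: ifPn.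
Qed.

Lemma face_rint_le u (phi : 'rV[R]_n -> R) (c M : R) : dot u u = 1 -> {within K, continuous phi} ->
  (forall x, exposed_face K u x -> `|phi x - c| <= M) ->
  `|face_rint u (supp K u) K phi - c * farea K u| <= M * farea K u.
Proof.
move=> u1 cphi hM.
have i1 := intg_slab KL u1 (@cst_within 1); have ip := intg_slab KL u1 cphi.
rewrite /farea /face_rint -rintZ// -rintB//; last exact: intgZ.
apply: le_trans (le_norm_rint _) _; first by apply: intgB => //; exact: intgZ.
rewrite -rintZ//; apply: le_rint; first by apply: intg_norm; apply: intgB => //; exact: intgZ.
  exact: intgZ.
move=> x; rewrite !patchE; case: ifPn => [|_]; last by rewrite !mulr0 subr0 normr0.
rewrite inE => -[_ Kx] /=; rewrite !mulr1; apply: hM; apply/(exposed_faceE KL).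
by rewrite dot_proj_unit.
Qed.

Lemma farea_ge0 u : 0 <= farea K u.
Proof. by apply: rint_ge0 => x; rewrite patchE; case: ifP. Qed.

Lemma face_rint_null u (phi : 'rV[R]_n -> R) : dot u u = 1 -> {within K, continuous phi} ->
  farea K u = 0 -> face_rint u (supp K u) K phi = 0.
Proof.
move=> u1 cphi a0; have [B B0 hB] := within_compact_bounded (polyh_compact KL) cphi.
have := @face_rint_le u phi 0 B u1 cphi; rewrite a0 !mulr0 subr0 normr_le0 => h.
by apply/eqP/h => x [Kx _]; rewrite subr0 hB.
Qed.

Lemma facetE u : facet K u <-> u \in L /\ 0 < farea K u.
Proof.
split=> [[u1]|[uL u0]].
  rewrite area_exposed// => u0; split => //.
  by apply: contraT => uL; move: u0; rewrite farea_notin// ltxx.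
by have u1 := polyh_unit KL uL; split => //; rewrite area_exposed.
Qed.

Definition facets : seq 'rV[R]_n := [seq u <- L | 0 < farea K u].

Lemma mem_facets u : u \in facets <-> facet K u.
Proof. by rewrite facetE mem_filter; split => [/andP[-> ->]//|[-> ->]]. Qed.

Lemma facets_uniq : uniq facets.
Proof. by apply: filter_uniq; have [_ ? _ _ _] := KL. Qed.

Lemma sum_facets (F : 'rV[R]_n -> R) (phi : 'rV[R]_n -> R) : {within K, continuous phi} ->
  \sum_(u <- L) F u * face_rint u (supp K u) K phi =
  \sum_(u <- facets) F u * face_rint u (supp K u) K phi.
Proof.
move=> cphi; rewrite /facets big_filter [RHS]big_mkcond /=; apply: eq_big_seq => u uL.
case: ifPn => //; rewrite -leNgt => u0; rewrite face_rint_null ?mulr0//.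
  exact: (polyh_unit KL uL).
by apply/le_anti; rewrite u0 farea_ge0.
Qed.

End OnePolytope.
End PolytopeFacets.

Lemma subrBB (V : zmodType) (x y z : V) : (x - y) - (x - z) = z - y.
Proof. by rewrite opprB addrC addrA subrK. Qed.

Lemma half_open_shift (R : realType) (a b : R) : a <> b -> a <> b - 1 ->
  (-1 < - (a + 1) - - b <= 0) = (-1 < a - b <= 0).
Proof.
move=> h1 h2; apply/idP/idP => /andP[h3 h4].
  rewrite (_ : _ <= 0); last by lra.
  by rewrite andbT lt_neqAle (_ : -1 <= _) ?andbT; [apply/eqP => h; apply: h2; lra|lra].
rewrite (_ : _ <= 0); last by lra.
rewrite andbT lt_neqAle (_ : -1 <= _) ?andbT; last by lra.
by apply/eqP => h; apply: h1; lra.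
Qed.

Lemma slab_stretch (R : realType) (d b h : R) : 0 < h ->
  (0 < d + 1 + (h - 1) * (d + 1 - b) * 1 - b <= h) = (-1 < d - b <= 0).
Proof.
move=> h0; rewrite (_ : d + 1 + _ - b = h * (d - b + 1)); last by ring.
by rewrite pmulr_rgt0// ger_pMr//; apply/idP/idP => /andP[h3 h4]; apply/andP; split; lra.
Qed.

(** * Prisms over facets and Lipschitz bounds *)

Section PolytopeMetric.
Context {R : realType} (n : nat).
Implicit Types (u v w x y : 'rV[R]_n) (K : set 'rV[R]_n) (L : seq 'rV[R]_n).

(** The two slabs lie on opposite sides of the common face; translating one along [u] identifies
    them up to two hyperplanes. *)
Lemma face_rint_opp K1 L1 K2 L2 u (phi : 'rV[R]_n -> R) :
  polyh K1 L1 -> polyh K2 L2 -> dot u u = 1 ->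
  {within K1, continuous phi} -> {within K2, continuous phi} ->
  exposed_face K1 u = exposed_face K2 (- u) -> 0 < farea K1 u ->
  face_rint (- u) (supp K2 (- u)) K2 phi = face_rint u (supp K1 u) K1 phi.
Proof.
move=> KL1 KL2 u1 c1 c2 F12 a1.
have u1' : dot (- u) (- u) = 1 by rewrite dotNl dotNr opprK.
have [y Fy] : exposed_face K1 u !=set0.
  apply: contrapT => h; move: a1; rewrite /farea /face_rint.
  rewrite (_ : [set x | _] = set0) ?patch_set0 ?rint0 ?ltxx//.
  apply/seteqP; split => // x [_ Kx]; apply: h; exists (proj u (supp K1 u) x).
  by apply/(exposed_faceE KL1); split => //; rewrite dot_proj_unit.
have [_ y1] := (exposed_faceE KL1 u y).1 Fy.
have [_ y2] : K2 y /\ dot (- u) y = supp K2 (- u) by apply/(exposed_faceE KL2); rewrite -F12.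
have bE : supp K2 (- u) = - supp K1 u by rewrite -y1 -y2 dotNl.
have KE x : K2 (proj u (supp K1 u) x) <-> K1 (proj u (supp K1 u) x).
  split => Kx.
    have [] : exposed_face K1 u (proj u (supp K1 u) x) by rewrite F12; apply/(exposed_faceE KL2);
      split => //; rewrite bE dotNl dot_proj_unit.
    by [].
  have [] : exposed_face K2 (- u) (proj u (supp K1 u) x).
    by rewrite -F12; apply/(exposed_faceE KL1); rewrite dot_proj_unit.
  by [].
have i2 := intg_slab KL2 u1' c2; have i1 := intg_slab KL1 u1 c1.
have [i2'] := scales_translation u i2.
rewrite invr1 mul1r => r2; rewrite /face_rint -r2.
have u0 : u != 0 by rewrite -dotxx_eq0 u1 oner_neq0.
apply: (ae_eq_rint _ _ (negligibleU (hyperplane_null (supp K1 u) u0) (hyperplane_null (supp K1 u - 1) u0))).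
- exact: (intg_measurable i2').
- exact: (intg_measurable i1).
- move=> x /= /not_orP[h1 h2]; rewrite !patchE /= bE projN dot_projD//.
  have -> : (x + u \in slab K2 (- u)) = (x \in [set x | -1 < dot u x - supp K1 u <= 0 /\ K1 (proj u (supp K1 u) x)]); last by [].
  apply/idP/idP; rewrite !inE /slab /= bE projN dotNl dotDr u1 dot_projD//;
    by rewrite half_open_shift// => -[-> /KE ?].
Qed.

Section OnePolytope.
Variables (K : set 'rV[R]_n) (L : seq 'rV[R]_n).
Hypothesis KL : polyh K L.

Definition prism u (h : R) : set 'rV[R]_n :=
  [set x | 0 < dot u x - supp K u <= h /\ K (proj u (supp K u) x)].

Lemma measurable_prism u (h : R) : measurable (prism u h).
Proof.
rewrite /prism (_ : [set x | _] = [set x | supp K u < dot u x] `&`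
   [set x | dot u x <= supp K u + h] `&` [set x | K (proj u (supp K u) x)]).
  apply: measurableI; last by apply: closed_measurable_rV; exact: (@closed_proj_preimage _ _ _ _ KL).
  by apply: measurableI; [exact: measurable_gtspace|exact: measurable_halfspace].
apply/seteqP; split => x /=; first by move=> [/andP[? ?] ?]; split => //; split; lra.
by move=> [[? ?] ?]; split => //; apply/andP; split; lra.
Qed.

Lemma prism_bounded (C h : R) u : bounded_by C K -> dot u u = 1 -> bounded_by (C + h) (prism u h).
Proof.
move=> KC u1 x [/andP[x1 x2] Kx] i.
have -> : x = proj u (supp K u) x + (dot u x - supp K u) *: u by rewrite /proj subrK.
rewrite mxE (le_trans (ler_normD _ _))// lerD ?(KC _ Kx)// mxE normrM.
rewrite -[leRHS]mulr1 ler_pM// ?unit_coord_le1//.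
by rewrite ger0_norm// ltW.
Qed.

Lemma rint_prism u (h : R) : dot u u = 1 -> 0 < h -> rint (\1_(prism u h)) = h * farea K u.
Proof.
move=> u1 h0; have [[C KC] _ _ _ _] := KL.
have ip h' : intg (\1_(prism u h') : 'rV[R]_n -> R).
  exact: intg_indic (measurable_prism u h') (prism_bounded KC u1).
have [is1 rs] := scales_stretch (supp K u) u1 h0 (ip h).
have -> : rint (\1_(prism u h)) = h * (h^-1 * rint (\1_(prism u h) : 'rV[R]_n -> R)).
  by rewrite mulrA mulfV ?mul1r ?gt_eqF.
rewrite -rs; congr (_ * _).
have [_] := scales_translation u is1; rewrite invr1 mul1r => <-.
rewrite /farea /face_rint; congr rint; apply/funext => x; rewrite /= patchE indicE.
have pS y : proj u (supp K u) (stretch u (supp K u) h y) = proj u (supp K u) y.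
  rewrite /proj dot_stretch u1 /stretch -addrA -scaleNr -scalerDl; congr (_ + _).
  by rewrite -scaleNr; congr (_ *: _); ring.
have -> : (stretch u (supp K u) h (x + u) \in prism u h) =
  (x \in [set x | -1 < dot u x - supp K u <= 0 /\ K (proj u (supp K u) x)]).
  by apply/idP/idP; rewrite !inE /prism /= pS dot_projD// dot_stretch dotDr u1 slab_stretch.
by case: ifP.
Qed.

(** The feet y and z are both nearest points of [K] to x: adding the support inequalities at the two
    feet gives |z - y|^2 <= 0, so that the feet and hence the unit normals coincide. *)
Lemma prism_disjoint u w (h : R) x : dot u u = 1 -> dot w w = 1 ->
  prism u h x -> prism w h x -> u = w.
Proof.
move=> u1 w1 [/andP[x1 _]]; set y := proj _ _ _ => Ky [/andP[x2 _]]; set z := proj _ _ _ => Kz.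
set c := dot u x - supp K u in x1 *; set d := dot w x - supp K w in x2 *.
have yE : x - y = c *: u by rewrite /y /proj opprB addrC subrK.
have zE : x - z = d *: w by rewrite /z /proj opprB addrC subrK.
have uy : dot u y = supp K u by rewrite dot_proj_unit.
have wz : dot w z = supp K w by rewrite dot_proj_unit.
have h1 := le_supp KL u Kz; have h2 := le_supp KL w Ky.
have : dot (z - y) (z - y) <= 0.
  clearbody y z.
  have E : z - y = c *: u - d *: w by rewrite -yE -zE [RHS]subrBB.
  rewrite {1}E dotBl !dotZl !dotBr uy wz.
  by rewrite -subr_ge0 in h1; rewrite -subr_ge0 in h2; nra.
move=> hzy; have {hzy} : dot (z - y) (z - y) == 0 by rewrite eq_le hzy dotxx_ge0.
rewrite dotxx_eq0 subr_eq0 => /eqP zy.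
have E : c *: u = d *: w by rewrite -yE -zE zy.
have cd : c = d.
  have := congr1 (fun v => dot v v) E; rewrite !dotZl !dotZr u1 w1 !mulr1 -!expr2.
  by move/eqP; rewrite eqrXn2// ?ltW// => /eqP.
by apply: (scalerI (_ : c != 0)); [rewrite gt_eqF|rewrite E cd].
Qed.

(** The prisms of height [h] erected outwards on all the facets are disjoint and fit into one cube,
    which bounds the total area without counting the facets. *)
Lemma sum_farea_le (d h : R) : 0 <= d -> 0 < h ->
  (forall x y, K x -> K y -> enorm (x - y) <= d) ->
  h * \sum_(u <- L) farea K u <= (2 * (d + h)) ^+ n.
Proof.
move=> d0 h0 Kd; have [[C KC] uL L1 _ [z /(sint_sub KL) Kz]] := KL.
have dh0 : 0 <= d + h by rewrite addr_ge0// ltW.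
have BC : bounded_by (C + (d + h)) (box z (d + h)).
  move=> x xz i; rewrite -[x 0 i](subrK (z 0 i)) addrC (le_trans (ler_normD _ _))// lerD//.
  exact: KC.
have iB := intg_indic (measurable_box z (d + h)) BC.
have -> : (2 * (d + h)) ^+ n = rint (\1_(box z (d + h)) : 'rV[R]_n -> R).
  apply: EFin_inj; rewrite -intgE// integral_indic ?setIT//.
    by symmetry; exact: leb_box.
  exact: measurable_box.
rewrite mulr_sumr big_seq (eq_bigr (fun u => rint (\1_(prism u h) : 'rV[R]_n -> R))); last first.
  by move=> u /L1 u1; rewrite rint_prism.
have ip u : u \in L -> intg (\1_(prism u h) : 'rV[R]_n -> R).
  by move=> uL'; exact: intg_indic (measurable_prism u h) (prism_bounded KC (L1 u uL')).
rewrite -rint_sum//; apply: le_rint => //; first exact: intg_sum.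
move=> x; have [[u uL' ux]|nx] := pselect (exists2 u, u \in L & prism u h x); last first.
  rewrite big1 ?indicE// => u uL'; rewrite indicE memNset// => ux; apply: nx; by exists u.
rewrite -big_seq (bigD1_seq u)//= big_seq_cond big1 ?addr0; last first.
  move=> w /andP[wL wu]; rewrite indicE memNset// => wx; move/eqP: wu; apply.
  exact: prism_disjoint (L1 _ wL) (L1 _ uL') wx ux.
rewrite !indicE mem_set// mem_set// => i.
have [/andP[c1 c2] Kp] := ux.
have -> : x 0 i - z 0 i = (proj u (supp K u) x - z) 0 i + (dot u x - supp K u) * u 0 i.
  by rewrite !mxE; ring.
rewrite (le_trans (ler_normD _ _))// lerD//.
  by rewrite (le_trans (coord_le_enorm _ _))// Kd.
rewrite normrM -[leRHS]mulr1 ler_pM// ?unit_coord_le1//; last exact: L1.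
by rewrite ger0_norm// ltW.
Qed.

Section Lipschitz.
Variables (phi : 'rV[R]_n -> R) (g : 'rV[R]_n -> 'rV[R]_n) (G : R).
Hypothesis cphi : {within K, continuous phi}.
Hypothesis dphi : forall x i, sint K L x -> is_derive x (delta_mx 0 i) phi (g x 0 i).
Hypothesis gG : forall x i, K x -> `|g x 0 i| <= G.

Let axis_step x i (a : R) : sint K L x -> sint K L (x + a *: delta_mx 0 i) ->
  `|phi (x + a *: delta_mx 0 i) - phi x| <= G * `|a|.
Proof.
move=> Sx Sa; have [a0|a0|->] := ltgtP a 0.
- have := @line_lipschitz _ _ _ _ KL (x + a *: delta_mx 0 i) (delta_mx 0 i) phi
    (fun y => g y 0 i) G (- a) _ cphi Sa.
  rewrite scaleNr addrK oppr_gt0 => H; rewrite distrC (ltr0_norm a0); apply: H => //.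
  + exact: (sint_sub KL).
  + by move=> y; exact: gG.
- have := @line_lipschitz _ _ _ _ KL x (delta_mx 0 i) phi (fun y => g y 0 i) G a a0 cphi Sx.
  rewrite (gtr0_norm a0) => H; apply: H => //.
  + exact: (sint_sub KL).
  + by move=> y; exact: gG.
- by rewrite scale0r addr0 subrr normr0 mulr0.
Qed.

Let box_step x (d : 'rV[R]_n) :
  (forall k, sint K L (x + \row_j (if (j < k)%N then d 0 j else 0))) ->
  `|phi (x + d) - phi x| <= G * \sum_i `|d 0 i|.
Proof.
move=> Sk; pose w k : 'rV[R]_n := \row_j (if (j < k)%N then d 0 j else 0).
suff H k : (k <= n)%N -> `|phi (x + w k) - phi x| <= G * \sum_(i < n | (i < k)%N) `|d 0 i|.
  have := H n (leqnn n); rewrite (eq_bigl xpredT); last by move=> i; rewrite ltn_ord.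
  by rewrite (_ : w n = d)//; apply/rowP => i; rewrite mxE ltn_ord.
elim: k => [_|k IH kn].
  rewrite (_ : w 0%N = 0) ?addr0 ?subrr ?normr0; last by apply/rowP => i; rewrite !mxE.
  by rewrite big1 ?mulr0// => i; rewrite ltn0.
pose i := Ordinal kn.
have wS : w k.+1 = w k + d 0 i *: delta_mx 0 i.
  apply/rowP => j; rewrite !mxE eqxx /= ltnS leq_eqVlt.
  have [->|ji] := eqVneq j i; first by rewrite eqxx ltnn mulr1 add0r.
  rewrite mulr0 addr0 (_ : (j == k :> nat) = false)//.
  by apply/negbTE; apply: contra ji => /eqP jk; apply/eqP/val_inj.
rewrite (bigD1 i) ?ltnSn//= mulrDr.
rewrite (_ : phi (x + w k.+1) - phi x =
  (phi (x + w k.+1) - phi (x + w k)) + (phi (x + w k) - phi x)); last by ring.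
rewrite (le_trans (ler_normD _ _))// lerD//.
  rewrite wS addrA; apply: axis_step; first exact: Sk.
  by rewrite -addrA -wS; exact: Sk.
apply: le_trans (IH (ltnW kn)) _; rewrite le_eqVlt; apply/orP; left; apply/eqP.
congr (_ * _); apply: eq_bigl => j.
rewrite [in RHS]ltnS [in RHS]leq_eqVlt; have [->|ji] := eqVneq j i; first by rewrite /= ltnn andbF.
rewrite andbT (_ : (j == k :> nat) = false)//.
by apply/negbTE; apply: contra ji => /eqP jk; apply/eqP/val_inj.
Qed.

(** Only derivatives along the axes are given, so the segment is replaced by staircases with
    axis-parallel steps; their length is the l^1 distance. *)
Let sint_lipschitz x y : sint K L x -> sint K L y ->
  `|phi y - phi x| <= G * \sum_i `|y 0 i - x 0 i|.
Proof.
move=> Sx Sy; pose D := \sum_i `|y 0 i - x 0 i|.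
have D0 : 0 <= D by exact: sumr_ge0.
(* The segment is cut into [m.+1] pieces, each shorter than the distance of the end points to the
   constraints, so that the staircase along each piece stays in [sint K L]. *)
have [m mP] : exists m : nat, forall w, w \in L ->
    D * harmonic m < Num.min (supp K w - dot w x) (supp K w - dot w y).
  have H : \forall k \near \oo, forall w, w \in L ->
      D * harmonic k < Num.min (supp K w - dot w x) (supp K w - dot w y).
    apply: near_all => w wL; apply: (near_lt (l := 0)).
      by rewrite -(mulr0 D); apply: cvgMl_tmp; exact: cvg_harmonic.
    by rewrite lt_min !subr_gt0 Sx// Sy.
  by have [m _ /(_ m (leqnn m)) h] := H; exists m.
pose e : R := harmonic m; have e0 : 0 < e by exact: harmonic_gt0.
have em : e * m.+1%:R = 1 by rewrite /e /harmonic /= mulVf// pnatr_eq0.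
pose d := e *: (y - x); pose p k := x + (k%:R * e) *: (y - x).
have pS k : p k.+1 = p k + d.
  by rewrite /p /d -addrA -scalerDl -natr1 mulrDl mul1r.
have sd : \sum_i `|d 0 i| = D * e.
  rewrite mulr_suml; apply: eq_bigr => i _.
  by rewrite !mxE normrM (gtr0_norm e0) mulrC.
have step k : (k <= m)%N -> `|phi (p k.+1) - phi (p k)| <= G * (D * e).
  move=> km; rewrite pS -sd; apply: box_step => l w wL.
  have ke : 0 <= k%:R * e <= 1.
    rewrite mulr_ge0 ?(ltW e0)//=; apply: (@le_trans _ _ (m.+1%:R * e)).
      by rewrite ler_pM2r// ler_nat leqW.
    by rewrite mulrC em.
  have := mP w wL; rewrite lt_min -/e => /andP[mx my].
  rewrite dotDr; apply: (@le_lt_trans _ _ (dot w (p k) + D * e)).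
    rewrite lerD2l -sd; apply: ler_sum => i _; rewrite mxE.
    have := unit_coord_le1 i (polyh_unit KL wL) => w1.
    case: ifP => _; last by rewrite mulr0.
    by rewrite (le_trans (ler_norm _))// normrM -[leRHS]mul1r ler_pM.
  rewrite /p dotDr dotZr dotBr; move: ke; move: (k%:R * e) => s /andP[s0 s1].
  by move: mx my; move: (dot w x) (dot w y) (supp K w) (D * e) => a b c f *; have [s2|s2] := leP s 2^-1; nra.
have tel k : (k <= m.+1)%N -> `|phi (p k) - phi x| <= k%:R * (G * (D * e)).
  elim: k => [_|k IH km]; first by rewrite /p !mul0r scale0r addr0 subrr normr0.
  rewrite (_ : phi (p k.+1) - phi x = (phi (p k.+1) - phi (p k)) + (phi (p k) - phi x)); last by ring.
  rewrite (le_trans (ler_normD _ _))// -natr1 mulrDl mul1r addrC lerD//.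
    exact: IH (ltnW km).
  exact: step.
have := tel m.+1 (leqnn _).
have -> : p m.+1 = y by rewrite /p mulrC em scale1r addrC subrK.
by rewrite mulrC -!mulrA em mulr1.
Qed.

(** Boundary points are approached along segments to a point of [sint K L], and the bound passes to
    the limit by continuity of [phi] on [K]. *)
Lemma polyh_lipschitz x y : K x -> K y ->
  `|phi y - phi x| <= G * \sum_i `|y 0 i - x 0 i|.
Proof.
move=> Kx Ky; have [_ _ _ _ [z Sz]] := KL.
pose q (x : 'rV[R]_n) k := x + (harmonic k : R) *: (z - x).
have Sq a k : K a -> sint K L (q a k).
  move=> Ka; have := @sint_convex _ _ _ _ KL z a (1 - harmonic k) Sz Ka.
  have -> : z + (1 - harmonic k) *: (a - z) = q a k.
    by apply/rowP => i; rewrite !mxE; ring.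
  apply; have := @harmonic_gt0 R k; rewrite subr_ge0 gtrBl => ->; rewrite andbT.
  by rewrite /harmonic invf_le1 ?ler1n// ltr0n.
have cq a : q a k @[k --> \oo] --> a by exact: cvg_addt.
have cp a : K a -> phi (q a k) @[k --> \oo] --> phi a.
  move=> Ka; apply: (within_cvg_seq cphi Ka _ (cq a)).
  by apply: nearW => k; apply: (sint_sub KL); exact: Sq.
have l1 : `|phi (q y k) - phi (q x k)| @[k --> \oo] --> `|phi y - phi x|.
  by apply: cvg_norm; apply: cvgB; exact: cp.
have l2 : G * \sum_i `|q y k 0 i - q x k 0 i| @[k --> \oo] --> G * \sum_i `|y 0 i - x 0 i|.
  apply: cvgMl_tmp; apply: cvg_sumr => i _; apply: cvg_norm.
  apply: cvgB; first exact: (cvg_comp _ _ (cq y) (@coord_continuous _ _ _ 0 i y)).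
  exact: (cvg_comp _ _ (cq x) (@coord_continuous _ _ _ 0 i x)).
apply: (ler_cvg_to l1 l2); apply: nearW => k.
by apply: sint_lipschitz; exact: Sq.
Qed.

End Lipschitz.
End OnePolytope.
End PolytopeMetric.

(** * Green's formula on a mesh *)

Section MeshGreen.
Context {R : realType} {n : nat}.
Variables (Om : set 'rV[R]_n) (M : mesh R n).
Hypothesis OmO : Om = interior (closure Om).
Hypothesis cM : conforming_mesh Om M.
Variable L : elt M -> seq 'rV[R]_n.
Hypothesis LP : forall K, polyh (cell K) (L K).

Lemma cell_sub K : cell (m := M) K `<=` closure Om.
Proof. by have [-> _ _ _ _] := cM; move=> x Kx; exists K. Qed.

Lemma sint_Om K : sint (cell K) (L K) `<=` Om.
Proof.
move=> x /(sint_interior (LP K)) Kx; rewrite OmO.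
by apply: interiorS Kx; exact: cell_sub.
Qed.

Lemma face_facet (s : face M) : facet (cell (ein s)) (nrm s).
Proof. by have [_ _ _ /(_ s)[]] := cM. Qed.

Lemma face_twin (s : face M) :
  exposed_face (cell (ein s)) (nrm s) = exposed_face (cell (eout s)) (- nrm s).
Proof. by have [_ _ _ /(_ s)[]] := cM. Qed.

Lemma nrm_unit (s : face M) : dot (nrm s) (nrm s) = 1.
Proof. by have [] := face_facet s. Qed.

Lemma nrmN_unit (s : face M) : dot (- nrm s) (- nrm s) = 1.
Proof. by rewrite dotNl dotNr opprK nrm_unit. Qed.

Definition farea_s (s : face M) : R := farea (cell (ein s)) (nrm s).

Definition fint (s : face M) (phi : 'rV[R]_n -> R) : R :=
  face_rint (nrm s) (supp (cell (ein s)) (nrm s)) (cell (ein s)) phi.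

Lemma farea_s_gt0 s : 0 < farea_s s.
Proof. by have /(facetE (LP (ein s)))[] := face_facet s. Qed.

Lemma area_s s : area (nrm s) (exposed_face (cell (ein s)) (nrm s)) = farea_s s.
Proof. by rewrite (area_exposed (LP _)) ?nrm_unit. Qed.

Lemma fint_out s (phi : 'rV[R]_n -> R) :
  {within cell (ein s), continuous phi} -> {within cell (eout s), continuous phi} ->
  face_rint (- nrm s) (supp (cell (eout s)) (- nrm s)) (cell (eout s)) phi = fint s phi.
Proof.
move=> c1 c2; apply: (face_rint_opp (LP _) (LP _)) => //.
- exact: nrm_unit.
- exact: face_twin.
- exact: farea_s_gt0.
Qed.

Lemma farea_out s : farea (cell (eout s)) (- nrm s) = farea_s s.
Proof. by rewrite /farea fint_out//; exact: cst_within. Qed.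

Lemma facet_out (s : face M) : facet (cell (eout s)) (- nrm s).
Proof.
apply/(facetE (LP _)); have a0 : 0 < farea (cell (eout s)) (- nrm s).
  by rewrite farea_out farea_s_gt0.
split => //; apply: contraT => h; move: a0.
by rewrite (farea_notin (LP _)) ?nrmN_unit// ltxx.
Qed.

(** Almost every point of the slab over the face projects to a point that lies on no other facet of
    either cell, by [proj_null] applied on both sides. *)
Lemma face_relint (s : face M) : exists y,
  [/\ dot (nrm s) y = supp (cell (ein s)) (nrm s),
      supp (cell (eout s)) (- nrm s) = - supp (cell (ein s)) (nrm s),
      exposed_face (cell (ein s)) (nrm s) y,
      forall w, w \in L (ein s) -> w != nrm s -> dot w y < supp (cell (ein s)) w
    & forall w, w \in L (eout s) -> w != - nrm s -> dot w y < supp (cell (eout s)) w].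
Proof.
set u := nrm s; set K1 := cell (ein s); set K2 := cell (eout s); set b := supp K1 u.
have u1 : dot u u = 1 by exact: nrm_unit.
have uL : u \in L (ein s) by have /(facetE (LP _))[] := face_facet s.
have uL' : - u \in L (eout s) by have /(facetE (LP _))[] := facet_out s.
have N1 := proj_null (LP (ein s)) uL; have N2 := proj_null (LP (eout s)) uL'.
have [x [Sx Nx]] : exists x, slab K1 u x /\ ~ (
    [set x | exists2 w, w \in L (ein s) & w != u /\ dot w (proj u (supp K1 u) x) = supp K1 w] `|`
    [set x | exists2 w, w \in L (eout s) & w != - u /\
       dot w (proj (- u) (supp K2 (- u)) x) = supp K2 w]) x.
  apply: contrapT => h; have := farea_s_gt0 s; rewrite /farea_s /farea /face_rint.
  suff -> : rint (((fun=> 1 : R) \o proj u b) \_ (slab K1 u)) = 0 by rewrite ltxx.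
  rewrite -(@rint0 R n); apply: (ae_eq_rint _ _ (negligibleU N1 N2)) => //.
    exact: (intg_measurable (intg_slab (LP (ein s)) u1 (@cst_within _ _ _ 1))).
  move=> x Nx; rewrite patchE memNset// => Sx; by apply: h; exists x.
have [_ Kp] := Sx; set y := proj u b x.
have Fy : exposed_face K1 u y by apply/(exposed_faceE (LP _)); rewrite dot_proj_unit.
have Fy2 : exposed_face K2 (- u) y by rewrite -face_twin.
have bE : supp K2 (- u) = - b.
  by have [_ <-] := (exposed_faceE (LP (eout s)) (- u) y).1 Fy2; rewrite dotNl dot_proj_unit.
move: Nx => /not_orP[n1 n2]; exists y; split => //; first by rewrite dot_proj_unit.
- move=> w wL wu; rewrite lt_neqAle (le_supp (LP (ein s)))// andbT.
  by apply/eqP => e; apply: n1; exists w.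
- move=> w wL wu; have [Ky _] := Fy2.
  rewrite lt_neqAle (le_supp (LP (eout s)))// andbT.
  by apply/eqP => e; apply: n2; exists w => //; rewrite bE projN.
Qed.

(** The mesh axioms number the facets off the boundary, but that a numbered face is not in the
    boundary has to be derived: near a point given by [face_relint] the two cells fill a
    neighbourhood, which therefore lies in the closure of the domain. *)
Lemma face_notin_bdry (s : face M) : ~ exposed_face (cell (ein s)) (nrm s) `<=` bdry Om.
Proof.
move=> sub; have [y [uy bE Fy h1 h2]] := face_relint s.
have [_] := sub _ Fy; apply.
have cE : forall z, (forall w, w \in L (ein s) -> w != nrm s -> dot w z < supp (cell (ein s)) w) ->
   (forall w, w \in L (eout s) -> w != - nrm s -> dot w z < supp (cell (eout s)) w) -> closure Om z.
  move=> z z1 z2; have [uz|uz] := leP (dot (nrm s) z) (supp (cell (ein s)) (nrm s)).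
    apply: (@cell_sub (ein s)); apply/(polyhE (LP _)) => w wL.
    by have [->//|wu] := eqVneq w (nrm s); exact/ltW/z1.
  apply: (@cell_sub (eout s)); apply/(polyhE (LP _)) => w wL.
  have [->|wu] := eqVneq w (- nrm s); last exact/ltW/z2.
  by rewrite bE dotNl lerN2 ltW.
have oO : open Om by rewrite OmO; exact: open_interior.
have -> : interior Om = Om by apply/interior_id.
rewrite OmO; suff : \forall z \near nbhs y, closure Om z by [].
have e1 : \forall z \near nbhs y, forall w, w \in L (ein s) -> w != nrm s ->
    dot w z < supp (cell (ein s)) w.
  apply: (@near_all _ _ _ (nbhs y)) => w wL; have [wu|wu] := eqVneq w (nrm s).
    by apply: nearW.
  apply: filterS (open_nbhs_nbhs (conj (open_halfspace (u := w) (b := supp (cell (ein s)) w)) (h1 w wL wu))).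
  by [].
have e2 : \forall z \near nbhs y, forall w, w \in L (eout s) -> w != - nrm s ->
    dot w z < supp (cell (eout s)) w.
  apply: (@near_all _ _ _ (nbhs y)) => w wL; have [wu|wu] := eqVneq w (- nrm s).
    by apply: nearW.
  apply: filterS (open_nbhs_nbhs (conj (open_halfspace (u := w) (b := supp (cell (eout s)) w)) (h2 w wL wu))).
  by [].
by apply: filterS2 e1 e2 => z; exact: cE.
Qed.

Definition isbdry (K : elt M) (u : 'rV[R]_n) : bool := `[< exposed_face (cell K) u `<=` bdry Om >].

Definition cfacets (K : elt M) := facets (cell K) (L K).

Lemma sum_face_pick (F : elt M -> 'rV[R]_n -> R) (K0 : elt M) (u0 : 'rV[R]_n) :
  facet (cell K0) u0 -> ~~ isbdry K0 u0 ->
  \sum_(K : elt M) \sum_(u <- cfacets K | ~~ isbdry K u)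
    ((K == K0) && (u == u0))%:R * F K u = F K0 u0.
Proof.
move=> fu nb; rewrite (bigD1 K0)//= [X in _ + X]big1 ?addr0; last first.
  by move=> K /negbTE ->; rewrite big1// => u _; rewrite mul0r.
rewrite -big_filter (bigD1_seq u0)//=; last 2 first.
- by rewrite mem_filter nb; apply/(mem_facets (LP K0)).
- by apply: filter_uniq; exact: (facets_uniq (LP K0)).
rewrite !eqxx mul1r big1 ?addr0// => u /negbTE ->.
by rewrite andbF mul0r.
Qed.

Lemma face_in_nbdry (s : face M) : ~~ isbdry (ein s) (nrm s).
Proof. by apply/asboolP; exact: face_notin_bdry. Qed.

Lemma face_out_nbdry (s : face M) : ~~ isbdry (eout s) (- nrm s).
Proof. by apply/asboolP; rewrite -face_twin; exact: face_notin_bdry. Qed.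

(** A facet off the boundary is one side of exactly one face, and by the two lemmas before it both
    sides of every face are such facets. *)
Lemma sum_cfacets (F : elt M -> 'rV[R]_n -> R) :
  \sum_(K : elt M) \sum_(u <- cfacets K) F K u =
  \sum_(s : face M) (F (ein s) (nrm s) + F (eout s) (- nrm s)) +
  \sum_(K : elt M) \sum_(u <- cfacets K | isbdry K u) F K u.
Proof.
rewrite (eq_bigr (fun K => \sum_(u <- cfacets K | isbdry K u) F K u +
   \sum_(u <- cfacets K | ~~ isbdry K u) F K u)); last by move=> K _; rewrite (bigID (isbdry K)).
rewrite big_split /= addrC; congr (_ + _).
transitivity (\sum_(K : elt M) \sum_(u <- cfacets K | ~~ isbdry K u)
  \sum_(s : face M) (((K == ein s) && (u == nrm s))%:R * F K u +
                     ((K == eout s) && (u == - nrm s))%:R * F K u)).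
  apply: eq_bigr => K _; rewrite big_seq_cond [RHS]big_seq_cond.
  apply: eq_bigr => u /andP[/(mem_facets (LP K)) uK /asboolP nb].
  have [_ _ _ _ /(_ K u uK nb)[s [hs us]]] := cM.
  rewrite (bigD1 s)//= [X in _ = _ + X]big1 ?addr0; last first.
    move=> s' s's; have [/andP[/eqP h1 /eqP h2]|_] := boolP ((K == ein s') && (u == nrm s')).
      by move/eqP: s's; case; rewrite (us s')//; left.
    have [/andP[/eqP h1 /eqP h2]|_] := boolP ((K == eout s') && (u == - nrm s')).
      by move/eqP: s's; case; rewrite (us s')//; right; split => //; rewrite h2 opprK.
    by rewrite !mul0r addr0.
  (* Keeps the two indicators from being 1 together: a facet is not counted as both sides of its
     face. *)
  have NN : nrm s != - nrm s.
    apply/eqP => h; have := nrm_unit s; rewrite {1}h dotNl nrm_unit => /eqP.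
    by rewrite eq_sym -subr_eq0 opprK -(natrD _ 1 1) pnatr_eq0.
  case: hs => -[h1 h2].
    by rewrite -h1 -h2 !eqxx /= (negbTE NN) andbF mul1r mul0r addr0.
  have uE : u = - nrm s by rewrite h2 opprK.
  by rewrite -h1 uE !eqxx /= (eq_sym _ (nrm s)) (negbTE NN) andbF mul1r mul0r add0r.
rewrite (eq_bigr (fun K => \sum_(s : face M) \sum_(u <- cfacets K | ~~ isbdry K u)
    (((K == ein s) && (u == nrm s))%:R * F K u +
     ((K == eout s) && (u == - nrm s))%:R * F K u))); last by move=> K _; rewrite exchange_big.
rewrite exchange_big /=; apply: eq_bigr => s _.
under eq_bigr do rewrite big_split /=.
rewrite big_split /= sum_face_pick; [|exact: face_facet|exact: face_in_nbdry].
by rewrite sum_face_pick; [|exact: facet_out|exact: face_out_nbdry].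
Qed.

Definition bfint (K : elt M) (u : 'rV[R]_n) (phi : 'rV[R]_n -> R) : R :=
  face_rint u (supp (cell K) u) (cell K) phi.

Lemma cell_green (K : elt M) (a : 'rV[R]_n) (phi : 'rV[R]_n -> R) (g : 'rV[R]_n -> 'rV[R]_n) :
  {within cell K, continuous phi} ->
  (forall i, {within cell K, continuous (fun x => g x 0 i)}) ->
  (forall x i, sint (cell K) (L K) x -> is_derive x (delta_mx 0 i) phi (g x 0 i)) ->
  rint ((fun x => dot a (g x)) \_ (cell K)) = \sum_(u <- cfacets K) dot a u * bfint K u phi.
Proof.
move=> cphi cg dphi; have KL := LP K.
have [[C KC] _ _ _ _] := KL.
have ig i : intg ((fun x => g x 0 i) \_ (cell K)).
  exact: intg_continuous (polyh_closed KL) KC (cg i).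
rewrite (_ : _ \_ _ = (fun x => \sum_i a 0 i * ((fun x => g x 0 i) \_ (cell K)) x)); last first.
  apply/funext => x; rewrite patchE; case: ifPn => Kx.
    by apply: eq_bigr => i _; rewrite patchE Kx.
  by rewrite big1// => i _; rewrite patchE (negbTE Kx) mulr0.
rewrite rint_sum; last by move=> i _; exact: intgZ.
rewrite (eq_bigr (fun i => \sum_(u <- cfacets K) a 0 i * u 0 i * bfint K u phi)).
  rewrite exchange_big /=; apply: eq_bigr => u _.
  by rewrite -mulr_suml.
move=> i _; rewrite rintZ//.
rewrite (divergence_dir KL cphi (cg i) (fun x => dphi x i)).
rewrite (sum_facets KL (fun u => dot u (delta_mx 0 i)) cphi) mulr_sumr.
by apply: eq_bigr => u _; rewrite dotC dot_delta mulrA.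
Qed.

Lemma mesh_green (a : elt M -> 'rV[R]_n) (phi : 'rV[R]_n -> R) (g : 'rV[R]_n -> 'rV[R]_n) :
  (forall K : elt M, {within cell K, continuous phi}) ->
  (forall (K : elt M) i, {within cell K, continuous (fun x => g x 0 i)}) ->
  (forall (K : elt M) x i, sint (cell K) (L K) x -> is_derive x (delta_mx 0 i) phi (g x 0 i)) ->
  \sum_K rint ((fun x => dot (a K) (g x)) \_ (cell K)) =
  - \sum_s dot (jumpv a s) (nrm s) * fint s phi +
  \sum_(K : elt M) \sum_(u <- cfacets K | isbdry K u) dot (a K) u * bfint K u phi.
Proof.
move=> cphi cg dphi.
rewrite (eq_bigr (fun K => \sum_(u <- cfacets K) dot (a K) u * bfint K u phi)); last first.
  by move=> K _; exact: cell_green.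
rewrite sum_cfacets; congr (_ + _); rewrite -sumrN; apply: eq_bigr => s _.
rewrite [bfint (eout s) _ _]fint_out// -[bfint (ein s) _ _]/(fint s phi) /jumpv dotBl dotNr.
ring.
Qed.

Lemma mesh_green1 (a : elt M -> 'rV[R]_n) :
  \sum_s dot (jumpv a s) (nrm s) * farea_s s =
  \sum_(K : elt M) \sum_(u <- cfacets K | isbdry K u) dot (a K) u * farea (cell K) u.
Proof.
have := @mesh_green a (fun=> 1) (fun=> 0) (fun=> @cst_within _ _ _ 1).
have -> : \sum_K rint ((fun=> dot (a K) 0) \_ (cell K)) = 0.
  rewrite big1// => K _; rewrite -(@rint0 R n); congr rint; apply/funext => x.
  by rewrite patchE dot0r; case: ifP.
move=> H; apply/eqP; rewrite -subr_eq0 -oppr_eq0 opprB addrC; apply/eqP; apply/esym.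
apply: H => [K i|K x i _].
  by under eq_fun do rewrite mxE; exact: cst_within.
by rewrite mxE; exact: is_derive_cst.
Qed.

Section FaceSums.
Variables (c h : R).
Hypothesis c0 : 0 < c.
Hypothesis h0 : 0 < h.
Hypothesis diam : forall (K : elt M) x y, cell K x -> cell K y -> enorm (x - y) <= c * h.

Lemma sum_faces_le (f : elt M -> R) : (forall K, 0 <= f K) ->
  h * \sum_s farea_s s * (f (ein s) + f (eout s)) <=
  (2 * (c + 1)) ^+ n * (h ^+ n * \sum_K f K).
Proof.
move=> f0; have E : \sum_s farea_s s * (f (ein s) + f (eout s)) <=
    \sum_K \sum_(u <- cfacets K) farea (cell K) u * f K.
  rewrite sum_cfacets ler_wpDr//.
    by apply: sumr_ge0 => K _; apply: sumr_ge0 => u _; rewrite mulr_ge0// farea_ge0.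
  by apply: ler_sum => s _; rewrite farea_out -mulrDr.
apply: le_trans (ler_wpM2l (ltW h0) E) _.
rewrite !mulr_sumr; apply: ler_sum => K _.
rewrite -mulr_suml !mulrA ler_wpM2r//.
have KL := LP K; rewrite -exprMn -mulrA (_ : (c + 1) * h = c * h + h); last by ring.
apply: le_trans (sum_farea_le KL _ h0 (diam (K := K))); last by rewrite mulr_ge0// ltW.
rewrite ler_wpM2l ?(ltW h0)// /cfacets /facets big_filter big_mkcond /=.
by apply: ler_sum => u _; case: ifP => // _; exact: farea_ge0.
Qed.

End FaceSums.
End MeshGreen.

(** * Tangential projection at the boundary *)

Section BoundaryNormals.
Context {R : realType} {n : nat}.

Definition nzed (p : 'rV[R]_n) := (enorm p)^-1 *: p.

Lemma enorm_gt0 (p : 'rV[R]_n) : p != 0 -> 0 < enorm p.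
Proof.
by move=> p0; rewrite /enorm sqrtr_gt0 lt_neqAle dotxx_ge0 andbT eq_sym dotxx_eq0.
Qed.

Lemma parallel_unit (u p : 'rV[R]_n) : dot u u = 1 -> p != 0 -> p = dot p u *: u ->
  u = nzed p \/ u = - nzed p.
Proof.
move=> u1 p0 pE; have e0 := enorm_gt0 p0; move: (dot p u) pE => c pE.
have ec : enorm p ^+ 2 = c ^+ 2 by rewrite enorm_sqr {1 2}pE dotZl dotZr u1 mulr1 expr2.
move/eqP: ec; rewrite eqf_sqr => /orP[]/eqP ec.
  by left; rewrite /nzed {2}pE -ec scalerA mulVf ?scale1r// gt_eqF.
by right; rewrite /nzed {2}pE scalerA -scaleNr -mulrN -ec mulVf ?scale1r// gt_eqF.
Qed.

Lemma proj_list_null (u : 'rV[R]_n) (b : R) (s : seq ('rV[R]_n * R)) :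
  dot u u = 1 -> (forall p, p \in s -> p.1 != 0 /\ u <> nzed p.1 /\ u <> - nzed p.1) ->
  (leb n).-negligible [set x | exists2 p, p \in s & dot p.1 (proj u b x) = p.2].
Proof.
move=> u1 hs.
pose s' := [seq (p.1 - dot p.1 u *: u, p.2 - b * dot p.1 u) | p <- s].
apply: negligibleS (@list_null _ _ s' _).
  move=> x /= [p ps px]; exists (p.1 - dot p.1 u *: u, p.2 - b * dot p.1 u).
    by apply/mapP; exists p.
  by rewrite /= dotBl dotZl -px dot_proj; ring.
move=> q /mapP[p ps ->] /=; have [p0 [h1 h2]] := hs p ps.
rewrite subr_eq0; apply/eqP => pE.
by have [|] := parallel_unit u1 p0 pE.
Qed.

(** A point of the closure that lies on no facet hyperplane of the polytopes composing it is
    interior. A boundary facet is thus covered by finitely many hyperplanes, which would meet it in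
    null sets if its normal were not, up to sign, one of theirs. The list depends on the domain
    alone, which makes the projection constants uniform in h. *)
Lemma boundary_normals (Om : set 'rV[R]_n) : polyhedral_domain Om ->
  exists Nn : seq 'rV[R]_n, forall M : mesh R n, conforming_mesh Om M ->
    forall (K : elt M) u, boundary_facet Om K u -> u \in Nn.
Proof.
move=> [oO _ _ OmO [k [P [Ppol PE]]]].
have /choice[s sP] : forall i, exists s : seq ('rV[R]_n * R),
    P i = [set x | all (fun p => dot p.1 x <= p.2) s].
  by move=> i; have [_ [s ?]] := Ppol i; exists s.
pose S := flatten [seq [seq p <- s i | p.1 != 0] | i <- enum 'I_k].
exists ([seq nzed p.1 | p <- S] ++ [seq - nzed p.1 | p <- S]) => M cM K u [[u1 Fa] Fb].
apply: contraT => uN.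
have [_ /(_ K)[Kpol Kint] _ _ _] := cM.
have OmO' : interior Om = Om by apply/interior_id.
have [L KL] := polytope_polyh Kpol Kint.
have SP p : p \in S -> p.1 != 0 /\ exists i, p \in s i.
  move=> /flattenP[t /mapP[i _ ->]]; rewrite mem_filter => /andP[p0 ps].
  by split => //; exists i.
have uS p : p \in S -> p.1 != 0 /\ u <> nzed p.1 /\ u <> - nzed p.1.
  move=> pS; split; first by have [] := SP p pS.
  by split => uE; move: uN; rewrite mem_cat negb_or => /andP[/negP h1 /negP h2];
    [apply: h1|apply: h2]; apply/mapP; exists p.
have NS := proj_list_null (supp (cell K) u) u1 uS.
have Smem i p : p \in s i -> p.1 != 0 -> p \in S.
  move=> ps p0; apply/flattenP; exists [seq p <- s i | p.1 != 0].
    by apply/mapP; exists i; rewrite ?mem_enum.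
  by rewrite mem_filter p0.
have := Fa; rewrite (area_exposed KL)// /farea /face_rint.
suff -> : rint (((fun=> 1 : R) \o proj u (supp (cell K) u)) \_ (slab (cell K) u)) = 0.
  by rewrite ltxx.
rewrite -(@rint0 R n); apply: (ae_eq_rint _ _ NS) => //.
  exact: (intg_measurable (intg_slab KL u1 (@cst_within _ _ _ 1))).
move=> x Nx; rewrite patchE memNset// => -[_ Kx]; apply: Nx.
set y := proj u (supp (cell K) u) x in Kx *.
have Fy : exposed_face (cell K) u y by apply/(exposed_faceE KL); rewrite dot_proj_unit.
have [cy iy] := Fb _ Fy.
apply: contrapT => nS; apply: iy.
have [i _ Piy] : (\bigcup_i P i) y by rewrite -PE.
rewrite OmO' {1}OmO; suff : \forall z \near nbhs y, P i z.
  by apply: filterS => z Pz; rewrite PE; exists i.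
rewrite sP; have : \forall z \near nbhs y, forall p, p \in s i -> dot p.1 z <= p.2.
  apply: (@near_all _ _ _ (nbhs y)) => p ps.
  have yp : dot p.1 y <= p.2 by move: Piy; rewrite sP /= => /allP/(_ p ps).
  have [p0|p0] := eqVneq p.1 0; first by apply: nearW => z; rewrite p0 dot0l; rewrite p0 dot0l in yp.
  have lt : dot p.1 y < p.2.
    rewrite lt_neqAle yp andbT; apply/eqP => e; apply: nS; exists p => //; exact: (Smem i).
  by apply: filterS (open_nbhs_nbhs (conj (open_halfspace (u := p.1) (b := p.2)) lt)) => z /= /ltW.
by apply: filterS => z hz /=; apply/allP => p /hz.
Qed.

End BoundaryNormals.

Section TangentialProjection.
Context {R : realType} {n : nat}.

Lemma mulmx_rank1 (x w : 'rV[R]_n) : x *m (w^T *m w) = dot x w *: w.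
Proof.
rewrite mulmxA; apply/rowP => i; rewrite mxE big_ord1 !mxE; congr (_ * _).
by apply: eq_bigr => j _; rewrite mxE.
Qed.

Lemma norm_dot_le (x u : 'rV[R]_n) (C : R) : (forall i, `|x 0 i| <= C) ->
  `|dot x u| <= C * \sum_i `|u 0 i|.
Proof.
move=> xC; rewrite /dot mulr_sumr; apply: le_trans (ler_norm_sum _ _ _) _.
by apply: ler_sum => i _; rewrite normrM ler_wpM2r.
Qed.

(* Orthogonal projection onto the complement of [S], by Gram-Schmidt. *)
Lemma tangential_proj (S : seq 'rV[R]_n) : exists (P : 'M[R]_n) (C : R),
  [/\ 0 <= C, forall v u, u \in S -> dot (v *m P) u = 0,
      forall v z, (forall u, u \in S -> dot z u = 0) -> dot z (v *m P) = dot z v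
    & forall v i, `|(v - v *m P) 0 i| <= C * \sum_(u <- S) `|dot v u|].
Proof.
elim: S => [|u S [P [C [C0 PS Pz PC]]]].
  exists 1%:M, 0; split => // [v z _|v i]; first by rewrite mulmx1.
  by rewrite mulmx1 subrr mxE normr0 mul0r.
(* If the projection of [u] vanishes, everything orthogonal to [S] is orthogonal to [u], and [P] is
   kept; otherwise [G] removes the component along the projection of [u]. *)
have [wE|w0] := eqVneq (u *m P) 0.
  exists P, C; split => // [v u'|v z hz|v i].
  - rewrite inE => /orP[/eqP ->|]; last exact: PS.
    by rewrite -(Pz u) ?wE ?dot0r// => u'' h; rewrite PS.
  - by apply: Pz => u' h; apply: hz; rewrite inE h orbT.
  - by rewrite big_cons; apply: le_trans (PC v i) _; rewrite ler_wpM2l// lerDr.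
pose w := u *m P; rewrite -/w in w0.
have ww : dot w w != 0 by rewrite dotxx_eq0.
have uw v : dot (v *m P) u = dot (v *m P) w by rewrite -(Pz u)// => u' /PS ->.
pose G := 1%:M - (dot w w)^-1 *: (w^T *m w).
have GE v : v *m (P *m G) = v *m P - (dot w w)^-1 * dot (v *m P) w *: w.
  by rewrite mulmxA mulmxBr mulmx1 -scalemxAr mulmx_rank1 scalerA.
pose B := 1 + C * \sum_i `|u 0 i|; pose D := \sum_i `|w 0 i|.
have B0 : 0 <= B by rewrite addr_ge0// mulr_ge0// sumr_ge0.
have D0 : 0 <= D by exact: sumr_ge0.
exists (P *m G), (C + (dot w w)^-1 * B * D); split => [|v u'|v z hz|v i].
- by rewrite addr_ge0// !mulr_ge0// invr_ge0 dotxx_ge0.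
- rewrite inE GE dotBl dotZl => /orP[/eqP ->|u'S]; last first.
    by rewrite (PS _ _ u'S) (_ : dot w u' = 0) ?mulr0 ?subrr//; exact: PS.
  by rewrite !uw mulrAC mulVf// mul1r subrr.
- rewrite GE dotBr dotZr Pz => [|u' h]; last by apply: hz; rewrite inE h orbT.
  rewrite [X in _ * X](_ : _ = 0) ?mulr0 ?subr0// Pz => [|u' h]; last by apply: hz; rewrite inE h orbT.
  by apply: hz; rewrite inE eqxx.
- rewrite GE big_cons opprB addrA addrAC -/w; set X := \sum_(_ <- S) _.
  have X0 : 0 <= X by apply: sumr_ge0.
  have h1 : `|dot (v *m P) w| <= B * (`|dot v u| + X).
    rewrite -uw (_ : dot (v *m P) u = dot v u - dot (v - v *m P) u); last by rewrite dotBl opprB addrC subrK.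
    apply: le_trans (ler_normB _ _) _; rewrite /B mulrDl mul1r mulrDr.
    have := norm_dot_le u (PC v); rewrite -/X => h.
    have : 0 <= C * (\sum_i `|u 0 i|) * `|dot v u| by rewrite !mulr_ge0// sumr_ge0.
    have -> : C * (\sum_i `|u 0 i|) * X = C * X * (\sum_i `|u 0 i|) by ring.
    move: h; set q := C * X * _; set q' := C * _ * _; set q'' := `|_|; set q3 := `|_|.
    lra.
  have wi : `|w 0 i| <= D by rewrite /D (bigD1 i)//= lerDl sumr_ge0.
  have -> : (v - v *m P + (dot w w)^-1 * dot (v *m P) w *: w) 0 i =
     (v - v *m P) 0 i + (dot w w)^-1 * dot (v *m P) w * w 0 i by rewrite !mxE.
  apply: le_trans (ler_normD _ _) _; rewrite mulrDl lerD//.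
    by apply: le_trans (PC v i) _; rewrite ler_wpM2l// lerDr.
  rewrite !normrM (ger0_norm (x := (dot w w)^-1)) ?invr_ge0 ?dotxx_ge0//.
  rewrite -!mulrA ler_wpM2l ?invr_ge0 ?dotxx_ge0//.
  rewrite [D * _]mulrC mulrA; exact: ler_pM.
Qed.

(** There are finitely many sublists of [Nn], so that one constant serves all of them; [p] will
    select the normals of the boundary facets of a cell. *)
Lemma tangential_proj_unif (Nn : seq 'rV[R]_n) : exists2 C : R, 0 <= C &
  forall p : pred 'rV[R]_n, exists P : 'M[R]_n,
  [/\ forall v u, u \in Nn -> p u -> dot (v *m P) u = 0,
      forall v z, (forall u, u \in Nn -> p u -> dot z u = 0) -> dot z (v *m P) = dot z v
    & forall v i, `|(v - v *m P) 0 i| <= C * \sum_(u <- Nn | p u) `|dot v u|].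
Proof.
suff [C C0 h] : exists2 C : R, 0 <= C & forall p : pred 'rV[R]_n, exists P : 'M[R]_n,
    [/\ forall v u, u \in [::] ++ seq.filter p Nn -> dot (v *m P) u = 0,
      forall v z, (forall u, u \in [::] ++ seq.filter p Nn -> dot z u = 0) ->
        dot z (v *m P) = dot z v
    & forall v i, `|(v - v *m P) 0 i| <= C * \sum_(u <- [::] ++ seq.filter p Nn) `|dot v u|].
  exists C => // p; have [P [h1 h2 h3]] := h p; exists P; split => [v u uN pu|v z hz|v i].
  - by apply: h1; rewrite mem_filter pu.
  - by apply: h2 => u; rewrite mem_filter => /andP[pu uN]; exact: hz.
  - by rewrite -big_filter; exact: h3.
(* [A] collects the normals already selected. Each further normal opens two branches, whose
   constants are added. *)
elim: Nn [::] => [|u Nn IH] A.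
  have [P [C [C0 h1 h2 h3]]] := tangential_proj A.
  by exists C => // p; exists P; rewrite /= cats0.
have [C1 C10 h1] := IH A; have [C2 C20 h2] := IH (rcons A u).
exists (C1 + C2) => [|p]; first exact: addr_ge0.
have W (P : 'M[R]_n) (C : R) (v : 'rV[R]_n) i B : 0 <= C <= C1 + C2 ->
    `|(v - v *m P) 0 i| <= C * \sum_(u <- B) `|dot v u| ->
    `|(v - v *m P) 0 i| <= (C1 + C2) * \sum_(u <- B) `|dot v u|.
  move=> /andP[_ CC] h; apply: le_trans h _; rewrite ler_wpM2r//.
  by apply: sumr_ge0.
rewrite /=; have [pu|pu] := boolP (p u).
  have [P [a b c]] := h2 p; rewrite cat_rcons in a b c.
  exists P; split => // v i.
  by apply: (W _ C2); [rewrite C20 lerDr|exact: c].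
have [P [a b c]] := h1 p; exists P; split => // v i.
by apply: (W _ C1); [rewrite C10 lerDl|exact: c].
Qed.

End TangentialProjection.

(** * One-dimensional calculus *)

Section Calculus.
Context {R : realType}.
Notation mu := (@lebesgue_measure R).
Implicit Types (f g F : R -> R) (a b c t : R).

Definition ig a b f : R := \int[mu]_(t in `[a, b]) f t.

Lemma continuous_itv_integrable a b f : {within `[a, b], continuous f} ->
  mu.-integrable `[a, b] (EFin \o f).
Proof. by move=> cf; apply: continuous_compact_integrable => //; exact: segment_compact. Qed.

Lemma ig_set1 a f : ig a a f = 0.
Proof. by rewrite /ig set_itv1 /Rintegral integral_set1. Qed.

Lemma ftc a b f F : a <= b -> {within `[a, b], continuous f} -> {within `[a, b], continuous F} ->
  (forall x, a < x < b -> is_derive x 1 F (f x)) -> ig a b f = F b - F a.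
Proof.
rewrite le_eqVlt => /predU1P[<-|ab] cf cF dF; first by rewrite ig_set1 subrr.
rewrite /ig /Rintegral (@continuous_FTC2 _ f F)//.
  have /(continuous_within_itvP _ ab)[_ ca cb] := cF; split => // x.
  by rewrite in_itv /= => /dF[].
by move=> x; rewrite in_itv /= => /dF[_]; rewrite derive1E.
Qed.

Lemma ig_continuous a b f : a <= b -> {within `[a, b], continuous f} ->
  {within `[a, b], continuous (fun x => ig a x f)}.
Proof. by move=> ab /continuous_itv_integrable/(parameterized_integral_continuous ab). Qed.

Lemma ig_is_derive a b f x : a < x < b -> {within `[a, b], continuous f} ->
  is_derive x 1 (fun y => ig a y f) (f x).
Proof.
move=> /andP[ax xb] cf; have ab := lt_trans ax xb.
have /(continuous_within_itvP _ ab)[ci _ _] := cf.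
have xab : x \in `]a, b[ by rewrite in_itv /= ax.
have H := continuous_FTC1_closed xb (continuous_itv_integrable cf) ax (ci x xab).
exact: (DeriveDef (proj1 H) (etrans (esym (derive1E _ _)) (proj2 H))).
Qed.

Lemma igD a b f g : {within `[a, b], continuous f} -> {within `[a, b], continuous g} ->
  ig a b (fun t => f t + g t) = ig a b f + ig a b g.
Proof. by move=> cf cg; rewrite /ig RintegralD//; exact: continuous_itv_integrable. Qed.

Lemma igB a b f g : {within `[a, b], continuous f} -> {within `[a, b], continuous g} ->
  ig a b (fun t => f t - g t) = ig a b f - ig a b g.
Proof. by move=> cf cg; rewrite /ig RintegralB//; exact: continuous_itv_integrable. Qed.

Lemma igZ a b c f : {within `[a, b], continuous f} ->
  ig a b (fun t => c * f t) = c * ig a b f.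
Proof. by move=> cf; rewrite /ig RintegralZl//; exact: continuous_itv_integrable. Qed.

Lemma le_ig a b f g : {within `[a, b], continuous f} -> {within `[a, b], continuous g} ->
  (forall t, t \in `[a, b] -> f t <= g t) -> ig a b f <= ig a b g.
Proof.
by move=> cf cg fg; apply: le_Rintegral => //; exact: continuous_itv_integrable.
Qed.

Lemma eq_ig a b f g : (forall t, t \in `[a, b] -> f t = g t) -> ig a b f = ig a b g.
Proof.
by move=> fg; rewrite /ig /Rintegral; congr fine; apply: eq_integral => x; rewrite inE => /fg ->.
Qed.

Lemma ig_cst a b c : a <= b -> ig a b (fun=> c) = c * (b - a).
Proof.
move=> ab; have h (F : R -> R) : continuous F -> {within `[a, b], continuous F}.
  by move=> cF; apply: within_continuousW.
rewrite (_ : c * (b - a) = c * b - c * a); last by ring.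
refine (@ftc a b (fun=> c) (fun x => c * x) ab _ _ _).
- by apply: h; exact: cst_continuous.
- by apply: h => x; apply: cvgM; [exact: cvg_cst|exact: cvg_id].
- move=> x _; have : is_derive x 1 (c \*: id) (c *: 1) by exact: is_deriveZ.
  by rewrite /GRing.scale /= mulr1.
Qed.

Lemma is_derive_shift F (x y d : R) : is_derive (y + x) 1 F d -> is_derive x 1 (fun z => F (y + z)) d.
Proof.
move=> h; have [h1 h2] := h.
have E : (fun k : R => k^-1 *: (F (y + (k *: (1 : R) + x)) - F (y + x))) =
   (fun k : R => k^-1 *: (F (k *: (1 : R) + (y + x)) - F (y + x))).
  by apply/funext => k; rewrite addrCA.
by apply: DeriveDef; rewrite /derivable /derive /= E.
Qed.

(** The integral over a moving window is written with primitives starting at a fixed point to the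
    left of the window, which can be differentiated on both sides of y = 0. *)
Lemma ig_shift f a y : continuous f -> 0 < a -> `|y| < a ->
  ig 0 1 (fun s => f (y + s)) = ig (- a) (y + 1) f - ig (- a) y f.
Proof.
move=> cf a0; rewrite ltr_norml => /andP[y1 y2].
have cf' b c : {within `[b, c], continuous f} by apply: within_continuousW.
have F (s : R) : 0 <= s <= 1 -> is_derive s 1 (fun s => ig (- a) (y + s) f) (f (y + s)).
  move=> /andP[s0 s1]; refine (is_derive_shift _); apply: (@ig_is_derive _ (a + 2)); last exact: cf'.
  by apply/andP; split; lra.
rewrite -[in X in _ - X](addr0 y); refine (@ftc 0 1 _ (fun s => ig (- a) (y + s) f) ler01 _ _ _).
- apply: within_continuousW => s; apply: (@cvg_comp _ _ _ _ f _ (nbhs (y + s))); last exact: cf.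
  by apply: cvgD; [exact: cvg_cst|exact: cvg_id].
- apply/continuous_in_subspaceT => s; rewrite inE /= in_itv /= => /F[+ _].
  by move/derivable1_diffP/differentiable_continuous.
- by move=> s /andP[s0 s1]; apply: F; rewrite !ltW.
Qed.

Lemma ig_average_derive f : continuous f ->
  is_derive (0 : R) 1 (fun y => ig 0 1 (fun s => f (y + s))) (f 1 - f 0).
Proof.
move=> cf; apply: (@near_eq_is_derive _ R^o R^o (fun y : R => ig (- 1) (1 + y) f - ig (- 1) y f)).
  have h : \forall y \near (0 : R), `|y| < 1.
    by apply: (@cvgr0_norm_lt _ _ _ (nbhs (0 : R)) _ id) => //; exact: cvg_id.
  apply: (filterS _ h) => y y1; rewrite (ig_shift cf ltr01 y1).
  by rewrite (addrC y).
have cf' b c : {within `[b, c], continuous f} by apply: within_continuousW.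
apply: is_deriveB; last by apply: (@ig_is_derive _ 1) => //; lra.
refine (is_derive_shift _); rewrite addr0; apply: (@ig_is_derive _ 2) => //; lra.
Qed.

Lemma derive_gt0_left F (t d e : R) : is_derive t 1 F d -> 0 < d -> 0 < e ->
  exists s, t - e < s < t /\ F s < F t.
Proof.
move=> [dF <-] d0 e0; have h : \forall k \near (0 : R)^', 0 < k^-1 *: (F (k *: (1 : R) + t) - F t).
  by apply: (cvgr_gt _ dF).
have : \forall k \near (0 : R)^'-, 0 < k^-1 *: (F (k *: (1 : R) + t) - F t).
  by apply: (@filterS _ (nbhs (0 : R)) _ _ _ _ h) => k + k0; apply; rewrite lt_eqF.
move=> [r /= r0 H].
pose k := - (Num.min r e / 2); have m0 : 0 < Num.min r e by rewrite lt_min r0.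
have k0 : k < 0 by rewrite /k oppr_lt0 divr_gt0.
have kr : - k < r /\ - k < e.
  have h1 : Num.min r e <= r by rewrite ge_min lexx.
  have h2 : Num.min r e <= e by rewrite ge_min lexx orbT.
  rewrite /k opprK; split; lra.
exists (k + t); split; first by apply/andP; split; lra.
have := H k; rewrite /ball_ /= sub0r normrN ltr0_norm// => /(_ kr.1 k0).
by rewrite scaler1 /GRing.scale /= nmulr_rgt0 ?invr_lt0// subr_lt0.
Qed.

(** The minimum of [F] on [0, t] cannot lie at a positive time: the function touching [F] there from
    above has positive slope, so that it and hence [F] are smaller just before. *)
Lemma touch_nondecreasing (T : R) F : 0 < T -> {within `[0, T], continuous F} ->
  (forall t : R, 0 < t < T -> exists (L : R -> R) (d : R), [/\ is_derive t 1 L d, 0 < d, L t = F t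
     & forall s : R, 0 < s < T -> F s <= L s]) ->
  forall t : R, 0 <= t <= T -> F 0 <= F t.
Proof.
move=> T0 cF tF.
have H (t : R) : 0 < t < T -> F 0 <= F t.
  move=> /andP[t0 tT].
  have ct : {within `[0, t], continuous F}.
    by apply: within_continuousS cF; apply: subset_itvl; rewrite bnd_simp ltW.
  have [c] := EVT_min (ltW t0) ct; rewrite in_itv /= => /andP[c0 cTt] cmin.
  move: c0; rewrite le_eqVlt => /predU1P[->|c0].
    by apply: cmin; rewrite in_itv /= lexx ltW.
  have [L [d [dL d0 Lc FL]]] := tF c (introT andP (conj c0 (le_lt_trans cTt tT))).
  have [s [/andP[s0 sc] Ls]] := derive_gt0_left dL d0 c0.
  rewrite subrr in s0; have st := lt_le_trans sc cTt.
  have := cmin s; rewrite in_itv /= (ltW s0) (ltW st) => /(_ isT).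
  rewrite leNgt => /negP[]; rewrite -Lc; apply: le_lt_trans Ls.
  by apply: FL; rewrite s0 (lt_trans st).
move=> t /andP[]; rewrite le_eqVlt => /predU1P[<-//|t0].
rewrite le_eqVlt => /predU1P[->|tT]; last by apply: H; rewrite t0.
(* The end point, where no touching function is given, is reached by continuity; [k.+2] keeps the
   sequence strictly inside the interval. *)
pose u (k : nat) := T - T * k.+2%:R^-1.
have uk k : 0 < u k < T.
  have k0 : 0 < (k.+2%:R : R)^-1 by rewrite invr_gt0.
  have k1 : (k.+2%:R : R)^-1 < 1 by rewrite invf_lt1// ltr1n.
  by rewrite /u subr_gt0 gtr_pMr// k1 gtrBl mulr_gt0.
have uT : u k @[k --> \oo] --> T.
  rewrite -[X in _ --> X]subr0 -[X in _ - X](mulr0 T); apply: cvgB; first exact: cvg_cst.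
  apply: cvgM; first exact: cvg_cst.
  have := @cvg_harmonic R; rewrite -(cvg_shiftS (@harmonic R)); exact.
have TT : `[0, T]%classic T by rewrite /= in_itv /= lexx ltW.
have h : F (u k) @[k --> \oo] --> F T.
  apply: (within_cvg_seq cF TT) uT; apply: nearW => k.
  by have /andP[/ltW a1 /ltW a2] := uk k; rewrite /= in_itv /= a1.
rewrite leNgt; apply/negP => /(cvgr_lt _ h)[k _ /(_ k (leqnn k)) /=].
by apply/negP; rewrite -leNgt; apply: H.
Qed.

(* Dini's criterion: where [L] touches [f] from above its derivative controls the increments of
   [f] to the left, which is all that is needed. *)
Lemma touch_increment (T : R) (f g : R -> R) : 0 < T -> {within `[0, T], continuous f} ->
  {within `[0, T], continuous g} ->
  (forall t : R, 0 < t < T -> exists (L : R -> R) (d : R), [/\ is_derive t 1 L d, g t <= d, L t = f t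
     & forall s : R, 0 < s < T -> f s <= L s]) ->
  forall t : R, 0 <= t <= T -> ig 0 t g <= f t - f 0.
Proof.
move=> T0 cf cg tf t tT; have /andP[t0 t1] := tT.
have cG := ig_continuous (ltW T0) cg.
(* Adding [e * t] makes the slopes strictly positive, as [touch_nondecreasing] asks; [e] is then
   chosen against a supposed violation. *)
suff H (e : R) : 0 < e -> f 0 - ig 0 0 g <= f t - ig 0 t g + e * t.
  have [->|tn0] := eqVneq t 0; first by rewrite ig_set1 subrr.
  move: H; rewrite ig_set1 subr0 => H.
  rewrite leNgt; apply/negP => lt.
  have tp : 0 < t by rewrite lt_neqAle eq_sym tn0.
  pose e := (f 0 - (f t - ig 0 t g)) / (2 * t).
  have e0 : 0 < e by rewrite /e divr_gt0 ?mulr_gt0//; lra.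
  have := H e e0; rewrite (_ : e * t = (f 0 - (f t - ig 0 t g)) / 2).
    by move: lt; lra.
  by rewrite /e; field.
move=> e0; rewrite -[leLHS]addr0 -[X in _ + X <= _](mulr0 e).
have ce : {within `[0, T], continuous (fun s => e * s)}.
  by apply: within_continuousW => x; apply: cvgM; [exact: cvg_cst|exact: cvg_id].
apply: (@touch_nondecreasing T (fun s => f s - ig 0 s g + e * s)) => //.
  move=> x; apply: (@cvgD _ R^o); last exact: ce.
  by apply: (@cvgB _ R^o); [exact: cf|exact: cG].
move=> s sT; have [L [d [dL gd Lf fL]]] := tf s sT.
exists (fun x => L x - ig 0 x g + e * x), (d - g s + e); split.
- have h2 : is_derive s 1 (e \*: id) (e *: 1) by exact: is_deriveZ.
  move: h2; rewrite /GRing.scale /= mulr1 => h2.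
  exact: is_deriveD (is_deriveB dL (ig_is_derive sT cg)) h2.
- by rewrite ltr_wpDl ?subr_ge0.
- by rewrite Lf.
- by move=> x xT; rewrite !lerD2r fL.
Qed.
End Calculus.

(** * Concentration of piecewise constant densities *)

Section Cutoffs.
Context {R : realType} {n : nat}.
Implicit Types (x y z : 'rV[R]_n) (s : seq ('rV[R]_n * R)).

Definition clamp (a : R) : R := Num.min 1 (Num.max a 0).

Lemma clamp_ge0 a : 0 <= clamp a.
Proof. by rewrite /clamp le_min ler01 le_max lexx orbT. Qed.

Lemma clamp_le1 a : clamp a <= 1.
Proof. by rewrite /clamp ge_min lexx. Qed.

Lemma clamp_le0 a : a <= 0 -> clamp a = 0.
Proof. by move=> a0; rewrite /clamp (max_idPr a0); apply/min_idPr/ler01. Qed.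

Lemma clamp_ge1 a : 1 <= a -> clamp a = 1.
Proof.
by move=> a1; rewrite /clamp (max_idPl _) ?(le_trans ler01)//; apply/min_idPl.
Qed.

Lemma clamp_lip a b : `|clamp a - clamp b| <= `|a - b|.
Proof.
wlog ab : a b / a <= b.
  move=> h; have [/h//|/ltW/h] := leP a b.
  by rewrite distrC (distrC b).
have [a0|a0] := leP a 0; have [b0|b0] := leP b 0.
- by rewrite !clamp_le0// subrr normr0.
- have bb : clamp b <= b by rewrite /clamp (max_idPl (ltW b0)) ge_min lexx orbT.
  rewrite (clamp_le0 a0) sub0r normrN ger0_norm ?clamp_ge0// ler0_norm ?subr_le0//.
  by lra.
- by lra.
have [b1|b1] := leP 1 b; have [a1|a1] := leP 1 a.
- by rewrite !clamp_ge1// subrr normr0.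
- have -> : clamp a = a by rewrite /clamp (max_idPl (ltW a0)); apply/min_idPr/ltW.
  by rewrite (clamp_ge1 b1) !ler0_norm ?subr_le0//; lra.
- by lra.
have -> : clamp a = a by rewrite /clamp (max_idPl (ltW a0)); apply/min_idPr/ltW.
by have -> : clamp b = b by rewrite /clamp (max_idPl (ltW b0)); apply/min_idPr/ltW.
Qed.

Definition n1 x : R := \sum_i `|x 0 i|.

Lemma n1_ge0 x : 0 <= n1 x.
Proof. exact: sumr_ge0. Qed.

Lemma norm_dot_n1 x y : `|dot x y| <= n1 x * n1 y.
Proof.
have h i : `|y 0 i| <= n1 y by rewrite /n1 (bigD1 i)//= lerDl sumr_ge0.
by rewrite dotC mulrC; exact: norm_dot_le.
Qed.

Definition lip (f : 'rV[R]_n -> R) := exists2 C : R, 0 <= C &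
  forall x y, `|f x - f y| <= C * n1 (x - y).

Lemma lip_continuous f : lip f -> continuous f.
Proof.
move=> [C C0 hf] x; apply/(@cvgrPdist_le _ _ _ (nbhs x)) => e e0.
have h : (C * n1 (x - y)) @[y --> x] --> (0 : R).
  rewrite -(mulr0 C); apply: (@cvgM R _ (nbhs x) _ (fun=> C)); first exact: cvg_cst.
  rewrite [X in _ --> X](_ : _ = \sum_(i < n) (0 : R)); last by rewrite big1.
  apply: (@cvg_sumr _ _ _ _ _ (nbhs x) (fun i y => `|(x - y) 0 i|)) => i _.
  rewrite -[X in _ --> X](normr0 R) -(subrr (x 0 i)); apply: cvg_norm.
  under eq_fun do rewrite !mxE.
  by apply: cvgB; [exact: cvg_cst|exact: coord_continuous].
have h2 : \forall y \near nbhs x, C * n1 (x - y) < e by exact: (cvgr_lt _ h).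
by apply: (filterS _ h2) => y /ltW; exact: le_trans.
Qed.

Lemma lip_cst (c : R) : lip (fun=> c).
Proof. by exists 0 => // x y; rewrite subrr normr0 mul0r. Qed.

Lemma lip_sum (I : Type) (r : seq I) (P : pred I) (F : I -> 'rV[R]_n -> R) :
  (forall i, lip (F i)) -> lip (fun x => \sum_(i <- r | P i) F i x).
Proof.
move=> lF; elim: r => [|i r [C C0 h]].
  by under eq_fun do rewrite big_nil; exact: lip_cst.
under eq_fun do rewrite big_cons.
case: (P i); last by exists C.
have [D D0 hD] := lF i; exists (D + C) => [|x y]; first exact: addr_ge0.
rewrite mulrDl (_ : _ - _ = (F i x - F i y) +
  (\sum_(j <- r | P j) F j x - \sum_(j <- r | P j) F j y)); last by ring.
by apply: le_trans (ler_normD _ _) _; rewrite lerD.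
Qed.

Lemma lipM01 f g : lip f -> lip g -> (forall x, 0 <= f x <= 1) -> (forall x, 0 <= g x <= 1) ->
  lip (fun x => f x * g x).
Proof.
move=> [C C0 hC] [D D0 hD] f1 g1; exists (C + D) => [|x y]; first exact: addr_ge0.
have /andP[fx0 fx1] := f1 x; have /andP[gy0 gy1] := g1 y.
rewrite (_ : f x * g x - f y * g y = (f x - f y) * g y + f x * (g x - g y)); last by ring.
apply: le_trans (ler_normD _ _) _; rewrite !normrM mulrDl (ger0_norm fx0) (ger0_norm gy0).
apply: lerD.
  by apply: le_trans (hC x y); rewrite ler_piMr.
by apply: le_trans (hD x y); rewrite ler_piMl.
Qed.

Definition strict s : set 'rV[R]_n := [set x | forall p, p \in s -> dot p.1 x < p.2].

(** A Lipschitz cutoff which for [k > 0] vanishes outside [strict s]; as [k] grows it tends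
    pointwise to the indicator of that set. *)
Definition cut (k : R) s x : R := \prod_(p <- s) clamp (k * (p.2 - dot p.1 x)).

Lemma cut01 k s x : 0 <= cut k s x <= 1.
Proof.
rewrite /cut; elim: s => [|p s /andP[h0 h1]]; first by rewrite big_nil ler01 lexx.
by rewrite big_cons mulr_ge0 ?clamp_ge0//= mulr_ile1 ?clamp_ge0 ?clamp_le1.
Qed.

Lemma cut_neq0 k s x : 0 < k -> cut k s x != 0 -> strict s x.
Proof.
move=> k0 c0 p ps; rewrite ltNge; apply/negP => px.
move/negP: c0; apply; rewrite /cut prodf_seq_eq0; apply/hasP; exists p => //=.
by rewrite clamp_le0// pmulr_rle0// subr_le0.
Qed.

Lemma lip_cut k s : lip (cut k s).
Proof.
rewrite /cut; elim: s => [|p s IH].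
  by under eq_fun do rewrite big_nil; exact: lip_cst.
under eq_fun do rewrite big_cons.
apply: lipM01 => // [|x|x]; last exact: cut01.
  exists (`|k| * n1 p.1) => [|x y]; first by rewrite mulr_ge0// n1_ge0.
  apply: le_trans (clamp_lip _ _) _; rewrite -mulrBr normrM -mulrA ler_wpM2l//.
  rewrite (_ : _ - _ = dot p.1 (y - x)); last by rewrite dotBr; ring.
  apply: le_trans (norm_dot_n1 _ _) _; rewrite /n1 ler_wpM2l ?n1_ge0//.
  by apply: ler_sum => i _; rewrite !mxE distrC.
by rewrite clamp_ge0 clamp_le1.
Qed.

Lemma cut_cvg s x : strict s x -> cut k%:R s x @[k --> \oo] --> (1 : R).
Proof.
move=> sx; have h : \forall k \near \oo, forall p, p \in s -> clamp (k%:R * (p.2 - dot p.1 x)) = 1.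
  apply: (@near_all _ _ _ \oo) => p /sx px.
  have d0 : 0 < p.2 - dot p.1 x by rewrite subr_gt0.
  have := nbhs_infty_ger (p.2 - dot p.1 x)^-1; apply: filterS => k hk.
  by rewrite clamp_ge1// -ler_pdivrMr// mul1r.
apply: cvg_trans (@cvg_cst _ (1 : R) _ \oo _); apply: near_eq_cvg.
apply: filterS h => k h; rewrite /cut big_seq big1// => p ps; exact: h.
Qed.

Lemma open_strict s : open (strict s).
Proof.
rewrite openE => x sx; apply: (@near_all _ _ _ (nbhs x)) => p ps.
by apply: open_nbhs_nbhs; split; [exact: open_halfspace|exact: sx].
Qed.

Lemma strict_cat s1 s2 x : strict (s1 ++ s2) x <-> strict s1 x /\ strict s2 x.
Proof.
split=> [h|[h1 h2] p]; last by rewrite mem_cat => /orP[/h1|/h2].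
by split => p ps; apply: h; rewrite mem_cat ps ?orbT.
Qed.

End Cutoffs.

Lemma cst_itv (R : realType) (a b c : R) : {within `[a, b], continuous (fun=> c)}.
Proof. by apply: within_continuousW; exact: cst_continuous. Qed.

Section SegmentAverage.
Context {R : realType} {n : nat}.
Variables (Psi : 'rV[R]_n -> R) (y : 'rV[R]_n).
Hypothesis lipPsi : lip Psi.
Hypothesis Psi01 : forall x, 0 <= Psi x <= 1.

(** Its derivative along [y] is the increment of [Psi] over [y], although [Psi] is only Lipschitz;
    this turns translations into derivatives. *)
Definition segavg x : R := ig 0 1 (fun s => Psi (x + s *: y)).

Lemma line_continuous x : continuous (fun s : R => Psi (x + s *: y)).
Proof.
move=> s; apply: (@cvg_comp _ _ _ (fun s : R => x + s *: y) Psi _ (nbhs (x + s *: y))).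
  apply: (@cvgD R 'rV[R]_n _ (nbhs s) _ (fun=> x)); first exact: cvg_cst.
  by apply: (@cvgZr_tmp R 'rV[R]_n _ (nbhs s) _ id); exact: cvg_id.
exact: lip_continuous.
Qed.

Let line_within x a b : {within `[a, b], continuous (fun s : R => Psi (x + s *: y))}.
Proof. by apply: within_continuousW; exact: line_continuous. Qed.

Lemma segavg01 x : 0 <= segavg x <= 1.
Proof.
have c (c' : R) : {within `[0 : R, 1], continuous (fun=> c' : R)} by exact: cst_itv.
have e0 : ig 0 1 (fun=> 0 : R) = 0 by rewrite ig_cst// mul0r.
have e1 : ig 0 1 (fun=> 1 : R) = 1 by rewrite ig_cst// subr0 mulr1.
rewrite -{1}e0 -[X in _ && (_ <= X)]e1.
by apply/andP; split; apply: le_ig => // s _; have /andP[] := Psi01 (x + s *: y).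
Qed.

Lemma lip_segavg : lip segavg.
Proof.
have [C C0 h] := lipPsi; exists C => // a b.
have c (c' : R) : {within `[0 : R, 1], continuous (fun=> c' : R)} by exact: cst_itv.
have ci z : {within `[0 : R, 1], continuous (fun s => Psi (z + s *: y))} by exact: line_within.
rewrite /segavg -igB// -[leRHS]mulr1 -{2}(subr0 (1 : R)) ler_norml -mulNr.
rewrite -!(ig_cst _ ler01).
have cB : {within `[0 : R, 1], continuous (fun s => Psi (a + s *: y) - Psi (b + s *: y))}.
  by move=> s; apply: (@cvgB _ R^o); exact: ci.
by apply/andP; split; apply: le_ig => // s _; have := h (a + s *: y) (b + s *: y);
  rewrite opprD addrACA subrr addr0 ler_norml => /andP[].
Qed.

Lemma segavg_derive x : is_derive x y segavg (Psi (x + y) - Psi x).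
Proof.
have := ig_average_derive (@line_continuous x); rewrite scale1r scale0r addr0.
have E : (fun h : R => h^-1 *: (ig 0 1 (fun s => Psi (x + (h *: (1 : R) + 0 + s) *: y)) -
    ig 0 1 (fun s => Psi (x + (0 + s) *: y)))) =
   (fun h : R => h^-1 *: (segavg (h *: y + x) - segavg x)).
  apply/funext => h; congr (_ *: _); congr (_ - _).
    apply: eq_ig => s _; congr Psi; rewrite addr0 scaler1 scalerDl addrA.
    by rewrite (addrC x).
  by apply: eq_ig => s _; rewrite add0r.
move=> [d1 d2]; apply: DeriveDef.
  by move: d1; rewrite /derivable E.
by rewrite -d2 /derive E.
Qed.

Lemma segavg_eq0 x : (forall s, 0 <= s <= 1 -> Psi (x + s *: y) = 0) -> segavg x = 0.
Proof.
move=> h; rewrite /segavg (@eq_ig _ _ _ _ (fun=> 0)); first by rewrite ig_cst ?mul0r.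
by move=> s; rewrite in_itv /=; exact: h.
Qed.

End SegmentAverage.

Section Shift.
Context {R : realType} {n : nat}.
Variables (Om : set 'rV[R]_n) (M : mesh R n).
Hypothesis OmO : Om = interior (closure Om).
Hypothesis cM : conforming_mesh Om M.
Variable L : elt M -> seq 'rV[R]_n.
Hypothesis LP : forall K, polyh (cell K) (L K).

(** Distinct cells meet at most in an exposed face with nonzero normal, on which a linear function
    attains its maximum over the cell; it is not attained at interior points. *)
Lemma sint_disjoint (K K' : elt M) x : K != K' -> sint (cell K) (L K) x ->
  sint (cell K') (L K') x -> False.
Proof.
move=> /eqP KK' Kx K'x; have [_ _ /(_ K K' KK') h _ _] := cM.
have I : (cell K `&` cell K') x by split; [exact: (sint_sub (LP K))|exact: (sint_sub (LP K'))].
case: h => [E|[a [b [/eqP a0 _ E _]]]]; first by rewrite E in I.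
rewrite E in I; have [_ aE] := (exposed_faceE (LP K) a x).1 I.
have := interior_supp (polyh_sup (LP K) a).2 a0 (sint_interior (LP K) Kx).
by rewrite aE ltxx.
Qed.

(* Testing the divergence theorem with the averages of [Psi] along the segments [x, x + y]. *)
Lemma shift_bound (w : elt M -> R) (Psi : 'rV[R]_n -> R) (y : 'rV[R]_n) :
  lip Psi -> (forall x, 0 <= Psi x <= 1) ->
  (forall x (s : R), 0 <= s <= 1 -> Psi (x + s *: y) != 0 -> ~ bdry Om x) ->
  `|\sum_K w K * rint ((fun x => Psi (x + y) - Psi x) \_ (cell K))| <=
  n1 y * \sum_s farea_s s * `|jump w s|.
Proof.
move=> lP P01 Pb; pose phi := segavg Psi y.
have lphi : lip phi by exact: lip_segavg.
have cphi A : {within A, continuous phi} by apply: within_continuousW; exact: lip_continuous.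
have cd A : {within A, continuous (fun x => Psi (x + y) - Psi x)}.
  apply: within_continuousW => x; apply: (@cvgB R R^o _ (nbhs x) _ (fun x => Psi (x + y))); last exact: lip_continuous.
  apply: (@cvg_comp _ _ _ (fun x => x + y) Psi _ (nbhs (x + y))); last exact: lip_continuous.
  by apply: (@cvgD R 'rV[R]_n _ (nbhs x) _ id (fun=> y)); [exact: cvg_id|exact: cvg_cst].
have phi0 x : bdry Om x -> phi x = 0.
  move=> bx; apply: segavg_eq0 => s s01; apply/eqP; apply: contraT => h.
  by have := Pb x s s01 h.
have E (K : elt M) : w K * rint ((fun x => Psi (x + y) - Psi x) \_ (cell K)) =
    \sum_(u <- cfacets L K) w K * dot u y * bfint K u phi.
  rewrite (divergence_dir (LP K) (cphi _) (cd _) (fun x _ => segavg_derive y lP x)).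
  rewrite (sum_facets (LP K) (fun u => dot u y) (cphi _)) mulr_sumr.
  by apply: eq_bigr => u _; rewrite mulrA.
rewrite (eq_bigr _ (fun K _ => E K)) (sum_cfacets OmO cM LP) [X in _ + X]big1 ?addr0; last first.
  move=> K _; rewrite big_seq_cond big1// => u /andP[/(mem_facets (LP K))[u1 _] /asboolP ub].
  rewrite [bfint _ _ _](_ : _ = 0) ?mulr0//.
  have := @face_rint_le _ _ _ _ (LP K) u phi 0 0 u1 (cphi _).
  rewrite !mul0r subr0 normr_le0 => h; apply/eqP; apply: h => x /ub bx.
  by rewrite phi0// subrr normr0.
apply: le_trans (ler_norm_sum _ _ _) _; rewrite mulr_sumr; apply: ler_sum => s _.
rewrite [bfint (eout s) _ _](fint_out cM LP) // -[bfint (ein s) _ _]/(fint s phi).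
rewrite (_ : _ + _ = - (jump w s * dot (nrm s) y * fint s phi)); last first.
  by rewrite /jump dotNl; ring.
have s1 := nrm_unit cM s.
have f1 : `|fint s phi| <= farea_s s.
  have := @face_rint_le _ _ _ _ (LP (ein s)) (nrm s) phi 0 1 s1 (cphi _).
  rewrite !mul0r mul1r subr0; apply => x _; rewrite subr0.
  by have /andP[h0 h1] := segavg01 (Psi := Psi) y lP P01 x; rewrite ger0_norm.
have d1 : `|dot (nrm s) y| <= n1 y.
  rewrite dotC -[leRHS]mul1r; rewrite dotC; apply: le_trans (ler_norm_sum _ _ _) _.
  rewrite mul1r; apply: ler_sum => i _; rewrite normrM ler_piMl//.
  exact: unit_coord_le1.
rewrite normrN !normrM mulrC [leRHS]mulrCA mulrC.
rewrite [leLHS](_ : _ = `|fint s phi| * (`|jump w s| * `|dot (nrm s) y|)); last by ring.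
rewrite ler_pM// ?mulr_ge0// mulrC ler_wpM2r//.
Qed.

End Shift.

Section Convolution.
Context {R : realType} {n : nat}.

(** Tonelli and translation invariance: integrating over all shifts decouples the two functions. *)
Lemma convolution (f g : 'rV[R]_n -> R) : intg f -> intg g ->
  (forall x, 0 <= f x) -> (forall x, 0 <= g x) ->
  measurable_fun setT (fun y => \int[leb n]_x (f x * g (x + y))%:E)%E /\
  (\int[leb n]_y \int[leb n]_x (f x * g (x + y))%:E = (rint f * rint g)%:E)%E.
Proof.
move=> fi gi f0 g0; pose F (p : 'rV[R]_n * 'rV[R]_n) : \bar R := (f p.2 * g (p.2 + p.1))%:E.
have mf := intg_measurable fi; have mg := intg_measurable gi.
have mF : measurable_fun setT F.
  apply/measurable_EFinP; apply: measurable_funM.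
    by apply: measurableT_comp => //; exact: measurable_snd.
  apply: measurableT_comp => //; rewrite (_ : (fun _ => _) = (fun p => p.1 + p.2)).
    exact: measurable_add2.
  by apply/funext => p; rewrite addrC.
have F0 p : (0 <= F p)%E by rewrite lee_fin mulr_ge0.
split; first exact: (@measurable_fun_fubini_tonelli_F _ _ _ _ _ (leb n) F mF F0).
rewrite (@fubini_tonelli _ _ _ _ _ (leb n) (leb n) F mF F0) /F /=.
transitivity (\int[leb n]_x ((f x)%:E * (rint g)%:E))%E.
  apply: eq_integral => x _; under eq_integral do rewrite EFinM.
  rewrite ge0_integralZl//.
  - congr (_ * _)%E; have [h1 h2] := scales_translation x gi.
    rewrite -[rint g]mul1r -[X in X * _]invr1 -h2 -intgE//.
    by apply: eq_integral => y _; rewrite /= addrC.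
  - apply/measurable_EFinP; have [h1 _] := scales_translation x gi.
    have := intg_measurable h1; rewrite (_ : _ \o _ = fun y => g (x + y))//.
    by apply/funext => y; rewrite /= addrC.
  - by move=> y _; rewrite lee_fin.
  - by rewrite lee_fin.
rewrite integralZr//; by rewrite intgE// EFinM.
Qed.

End Convolution.

Section Region.
Context {R : realType} {n : nat}.
Variables (Om : set 'rV[R]_n) (M : mesh R n).
Hypothesis OmO : Om = interior (closure Om).
Hypothesis cM : conforming_mesh Om M.
Variable L : elt M -> seq 'rV[R]_n.
Hypothesis LP : forall K, polyh (cell K) (L K).

Definition cvol (K : elt M) : R := rint (\1_(cell K) : 'rV[R]_n -> R).

Lemma cvol_ge0 K : 0 <= cvol K.
Proof. by apply: rint_ge0 => x; rewrite indicE ler0n. Qed.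

Lemma intg_cell K : intg (\1_(cell (m := M) K) : 'rV[R]_n -> R).
Proof.
have [[C KC] _ _ _ _] := LP K; apply: (@intg_indic _ _ _ C) => //.
exact: polyh_measurable (LP K).
Qed.

Variables (w : elt M -> R) (q : seq ('rV[R]_n * R)) (c0 : 'rV[R]_n) (r D : R).
Hypothesis r0 : 0 < r.
Hypothesis w0 : forall K, 0 <= w K.
Hypothesis Hq : forall x y (s : R), strict q x -> box c0 r y -> 0 <= s <= 1 -> Om (x - s *: y).
Hypothesis HD : forall y, box c0 r y -> n1 y <= D.

Let W := \sum_K cvol K * w K.
Let V := (2 * r) ^+ n.
(** [W / V] is the density of the total mass spread over the box of shifts, whose volume is [V]; the
    selected cells exceed it by a factor 2. *)
Let S K := 2 * W < V * w K.
Let J := \sum_s farea_s s * `|jump w s|.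
Let cs K := [seq (u, supp (cell K) u) | u <- L K] ++ q.
Let psi (k : R) K := cut k (cs K).
Let Psi (k : R) x := \sum_(K | S K) psi k K x.
Let A (k : R) := \sum_(K | S K) w K * rint (psi k K).

Let csE K x : strict (cs K) x <-> sint (cell K) (L K) x /\ strict q x.
Proof.
rewrite strict_cat; split=> -[h1 h2]; split => //.
  by move=> u uL; apply: (h1 (u, supp (cell K) u)); apply: map_f.
by move=> p /mapP[u uL ->]; exact: h1.
Qed.

Let psi01 k K x : 0 <= psi k K x <= 1. Proof. exact: cut01. Qed.

Let psi_cell k K x : 0 < k -> psi k K x != 0 -> cell K x.
Proof. by move=> k0 /(cut_neq0 k0)/csE[/(sint_sub (LP K))]. Qed.

Let Psi01 k x : 0 < k -> 0 <= Psi k x <= 1.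
Proof.
move=> k0; rewrite /Psi sumr_ge0//=; last by move=> K _; have /andP[] := psi01 k K x.
have [[K0 K0x]|h] := pselect (exists K, psi k K x != 0); last first.
  rewrite big1 ?ler01// => K _; apply: contrapT => /eqP Kx.
  by apply: h; exists K.
have z K : K != K0 -> psi k K x = 0.
  move=> KK0; apply: contrapT => /eqP Kx.
  have [K1 _] := (csE K x).1 (cut_neq0 k0 Kx); have [K2 _] := (csE K0 x).1 (cut_neq0 k0 K0x).
  exact: (sint_disjoint cM LP KK0 K1 K2).
apply: (@le_trans _ _ (psi k K0 x)); last by have /andP[] := psi01 k K0 x.
rewrite big_mkcond (bigD1 K0)//= big1 ?addr0.
  by case: ifP => // _; have /andP[] := psi01 k K0 x.
by move=> K /z ->; case: ifP.
Qed.

Let lip_psi k K : lip (psi k K). Proof. exact: lip_cut. Qed.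

Let lip_Psi k : lip (Psi k). Proof. by apply: lip_sum. Qed.

Let intg_lip K f : lip f -> intg (f \_ (cell (m := M) K)).
Proof.
have [[C KC] _ _ _ _] := LP K; move=> lf.
apply: intg_continuous (polyh_closed (LP K)) KC _.
by apply: within_continuousW; exact: lip_continuous.
Qed.

Let psiE k K : 0 < k -> psi k K = psi k K \_ (cell K).
Proof.
move=> k0; apply/funext => x; rewrite patchE; case: ifPn => // /negP nKx.
by apply: contrapT => /eqP h; apply: nKx; rewrite inE; exact: psi_cell h.
Qed.

Let intg_psi k K : 0 < k -> intg (psi k K).
Proof. by move=> k0; rewrite psiE//; exact: intg_lip. Qed.

Let J0 : 0 <= J.
Proof.
by apply: sumr_ge0 => s _; rewrite mulr_ge0//; exact/ltW/(farea_s_gt0 cM LP).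
Qed.

Let D0 : 0 <= D.
Proof.
by apply: le_trans (n1_ge0 c0) (HD _) => i; rewrite subrr normr0 ltW.
Qed.

Let lip_tr k y : lip (fun x => Psi k (x + y)).
Proof.
have [C C1 h] := lip_Psi k; exists C => // x x'.
by apply: le_trans (h _ _) _; rewrite opprD addrACA subrr addr0.
Qed.

(** At rest [Psi] catches at least the mass [A k], and by [shift_bound] a shift changes the caught
    mass by at most [n1 y * J]. [Hq] keeps the segments away from the boundary. *)
Let shift_ge k y : 0 < k -> box c0 r y ->
  A k - D * J <= \sum_K w K * rint ((fun x => Psi k (x + y)) \_ (cell K)).
Proof.
move=> k0 By; have Pb x (s : R) : 0 <= s <= 1 -> Psi k (x + s *: y) != 0 -> ~ bdry Om x.
  move=> s01 Px; have [K Kx] : exists K, psi k K (x + s *: y) != 0.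
    apply: contrapT => h; move/negP: Px; apply; rewrite /Psi big1// => K _.
    by apply: contrapT => /eqP h'; apply: h; exists K.
  have [_ qx] := (csE K _).1 (cut_neq0 k0 Kx).
  have := Hq qx By s01; rewrite addrK => Ox [_]; apply.
  have /interior_id -> // : open Om by rewrite OmO; exact: open_interior.
have := shift_bound OmO cM LP w (lip_Psi k) (fun x => Psi01 x k0) Pb.
have E K : rint ((fun x => Psi k (x + y) - Psi k x) \_ (cell (m := M) K)) =
    rint ((fun x => Psi k (x + y)) \_ (cell K)) - rint ((Psi k) \_ (cell K)).
  rewrite -rintB; [|exact: intg_lip|exact: intg_lip].
  by congr rint; apply/funext => x; rewrite !patchE; case: ifP; rewrite ?subrr.
under eq_bigr do rewrite E mulrBr.
rewrite sumrB distrC => /(le_trans (ler_norm _)) h.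
have h1 : n1 y * J <= D * J by rewrite ler_wpM2r// HD.
have h2 : A k <= \sum_K w K * rint ((Psi k) \_ (cell K)).
  rewrite /A big_mkcond; apply: ler_sum => K _; case: ifPn => SK; last first.
    rewrite mulr_ge0//; apply: rint_ge0 => x; rewrite patchE; case: ifP => // _.
    by have /andP[] := Psi01 x k0.
  rewrite ler_wpM2l// psiE//; apply: le_rint; [exact: intg_lip|exact: intg_lip|] => x.
  rewrite !patchE; case: ifP => // _; rewrite /Psi (bigD1 K)//= lerDl.
  by apply: sumr_ge0 => K' _; have /andP[] := psi01 k K' x.
move: h h1 h2; rewrite -/J; set X := \sum_K _; set Y := \sum_K _.
by lra.
Qed.

Let Psi_intg k : 0 < k -> intg (Psi k).
Proof. by move=> k0; apply: intg_sum => K _; exact: intg_psi. Qed.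

(** [shift_ge] is integrated over the box of shifts; the upper bound comes from enlarging the box to
    all shifts, where [convolution] gives the product of the masses. *)
Let average k : 0 < k -> (A k - D * J) * V <= W * rint (Psi k).
Proof.
move=> k0; have Psi0 x : 0 <= Psi k x by have /andP[] := Psi01 x k0.
have WP : 0 <= W * rint (Psi k).
  by rewrite mulr_ge0 ?rint_ge0// sumr_ge0// => K _; rewrite mulr_ge0// cvol_ge0.
have V0 : 0 < V by rewrite exprn_gt0// mulr_gt0.
have [c_le|c_gt] := leP (A k - D * J) 0; first by rewrite (le_trans _ WP)// mulr_le0_ge0// ltW.
have one0 K (x : 'rV[R]_n) : 0 <= \1_(cell (m := M) K) x :> R by rewrite indicE ler0n.
have cv K := convolution (intg_cell K) (Psi_intg k0) (one0 K) Psi0.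
pose g y : \bar R := (\sum_K (w K)%:E * \int[leb n]_x (\1_(cell K) x * Psi k (x + y))%:E)%E.
have in0 K y : (0 <= \int[leb n]_x (\1_(cell (m := M) K) x * Psi k (x + y))%:E)%E.
  by apply: integral_ge0 => x _; rewrite lee_fin mulr_ge0.
have mg : measurable_fun setT g.
  by apply: emeasurable_sum => K; apply: measurable_funeM; have [] := cv K.
have g0 y : (0 <= g y)%E.
  by apply: sume_ge0 => K _; rewrite mule_ge0// lee_fin.
have mB := measurable_box c0 r.
rewrite -lee_fin EFinM -(leb_box c0 (ltW r0)) -integral_cst//.
apply: (@le_trans _ _ (\int[leb n]_(y in box c0 r) g y)%E).
  apply: ge0_le_integral => //; first by move=> y _; rewrite lee_fin ltW.
    exact: measurable_funTS.
  move=> y By; apply: le_trans (_ : (\sum_K w K *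
      rint ((fun x => Psi k (x + y)) \_ (cell K)))%:E <= _)%E.
    by rewrite lee_fin; exact: shift_ge.
  rewrite /g -sumEFin le_eqVlt; apply/orP; left; apply/eqP; apply: eq_bigr => K _.
  rewrite EFinM -intgE; last by apply: intg_lip; exact: lip_tr.
  congr (_ * _)%E; apply: eq_integral => x _; congr EFin.
  by rewrite patchE indicE; case: ifP; rewrite ?mul1r ?mul0r.
apply: (@le_trans _ _ (\int[leb n]_y g y)%E).
  by apply: ge0_subset_integral => //; exact: measurableT.
rewrite /g ge0_integral_sum//; last 2 first.
- by move=> K; apply: measurable_funeM; have [] := cv K.
- by move=> K y _; rewrite mule_ge0// lee_fin.
rewrite /W mulr_suml -sumEFin; apply: lee_sum => K _.
rewrite ge0_integralZl//; last 2 first.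
- by have [] := cv K.
- by rewrite lee_fin.
by have [_ ->] := cv K; rewrite -EFinM lee_fin mulrA (mulrC (w K)).
Qed.

(** On the selected cells [W] is less than half of [V * w], so that the shifted mass is on average
    at most half of [A k]; the other half is paid for by the jumps. *)
Let region_cut k : 0 < k -> A k <= 2 * D * J.
Proof.
move=> k0; have h := average k0; have V0 : 0 < V by rewrite exprn_gt0// mulr_gt0.
have h2 : 2 * (W * rint (Psi k)) <= V * A k.
  rewrite /Psi rint_sum; last by move=> K _; exact: intg_psi.
  rewrite mulrA mulr_sumr /A mulr_sumr; apply: ler_sum => K SK.
  rewrite mulrA ler_wpM2r//; last exact: ltW.
  by apply: rint_ge0 => x; have /andP[] := psi01 k K x.
have : (A k - 2 * (D * J)) * V <= 0 by move: h h2; set X := W * _; nra.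
by rewrite pmulr_lle0// subr_le0 mulrA.
Qed.

Lemma region_bound :
  \sum_(K | S K) w K * rint (\1_(sint (cell K) (L K) `&` strict q) : 'rV[R]_n -> R) <= 2 * D * J.
Proof.
have h : A k.+1%:R @[k --> \oo] -->
    \sum_(K | S K) w K * rint (\1_(sint (cell K) (L K) `&` strict q) : 'rV[R]_n -> R).
  apply: cvg_sumr => K _; apply: cvgM; first exact: cvg_cst.
  apply: (@rint_dominated_cvg _ _ (fun k => psi k.+1%:R K) _ (\1_(cell K)) set0) => //.
  - by move=> k; exact: intg_measurable (intg_psi K (ltr0Sn _ _)).
  - apply: measurable_indic; apply: measurableI; first exact: sint_measurable.
    by apply: open_measurable_rV; exact: open_strict.
  - exact: intg_cell.
  - exact: negligible_set0.
  - move=> k x _; have /andP[h0 h1] := psi01 k.+1%:R K x; rewrite ger0_norm// indicE.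
    have [->|xK] := eqVneq (psi k.+1%:R K x) 0; first exact: ler0n.
    by rewrite mem_set ?h1//; apply: psi_cell xK; rewrite ltr0Sn.
  move=> x _; have [xs|xs] := pselect (strict (cs K) x).
    rewrite indicE mem_set; last exact/csE.
    by have := cut_cvg xs; rewrite -(cvg_shiftS (fun k => cut k%:R (cs K) x)).
  rewrite indicE memNset; last by move=> /csE.
  rewrite (_ : (fun _ => _) = fun=> 0); first exact: cvg_cst.
  apply/funext => k; apply: contrapT => /eqP xK.
  by apply: xs; apply: cut_neq0 xK; rewrite ltr0Sn.
apply: (cvgr_to_le h); apply: nearW => k; apply: region_cut; exact: ltr0Sn.
Qed.

End Region.

Section Concentration.
Context {R : realType} {n : nat}.

(* If [x] is within [rho] of [c], the shifts [y] in the box around [t (c - z)] move [x] towards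
   the ball of radius [2 rho] around the interior point [z]. *)
Lemma piece_regions (C rho : R) (s : seq ('rV[R]_n * R)) (z : 'rV[R]_n) : 0 < rho ->
  (forall y, box z (2 * rho) y -> strict s y) ->
  exists Q : seq (seq ('rV[R]_n * R) * 'rV[R]_n),
    (forall e, e \in Q -> forall x y (t a : R), strict e.1 x -> 0 < t <= 1 -> 0 <= a <= 1 ->
       box (t *: e.2) (t * rho) y -> strict s (x - a *: y)) /\
    (forall x, strict s x -> (forall i, `|x 0 i| <= C) -> exists2 e, e \in Q & strict e.1 x).
Proof.
move=> rho0 zs.
(* The open cube of radius [rho] around [c] as a list of half-spaces; by compactness finitely many
   of them cover the piece. *)
pose bc (c : 'rV[R]_n) : seq ('rV[R]_n * R) :=
  [seq (delta_mx 0 i, c 0 i + rho) | i <- enum 'I_n] ++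
  [seq (- delta_mx 0 i, rho - c 0 i) | i <- enum 'I_n].
have bcE c x : strict (bc c) x <-> forall i, `|x 0 i - c 0 i| < rho.
  rewrite strict_cat; split => [[h1 h2] i|h].
    have := h1 (delta_mx 0 i, c 0 i + rho) (map_f _ (mem_enum _ i)).
    have := h2 (- delta_mx 0 i, rho - c 0 i) (map_f _ (mem_enum _ i)).
    by rewrite /= dotNl !dot_delta ltr_norml => *; apply/andP; split; lra.
  by split => p /mapP[i _ ->] /=; rewrite ?dotNl dot_delta; have := h i;
    rewrite ltr_norml => /andP[]; lra.
have cB : compact (box (0 : 'rV[R]_n) C).
  apply: (@closed_bounded_by_compact _ _ C); last first.
    by move=> x xB i; have := xB i; rewrite mxE subr0.
  rewrite (_ : box 0 C = \bigcap_(i in [set: 'I_n]) ([set x | dot (delta_mx 0 i) x <= C] `&`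
     [set x | dot (- delta_mx 0 i) x <= C])).
    by apply: closed_bigI => i _; apply: closedI; exact: closed_halfspace.
  apply/seteqP; split => x h i.
    move=> _; have := h i; rewrite mxE subr0 ler_norml /= dotNl dot_delta => /andP[]; split; lra.
  have [] := h i I; rewrite /= dotNl dot_delta mxE subr0 ler_norml => *; apply/andP; split; lra.
move: cB; rewrite compact_cover => /(_ _ setT (fun c => strict (bc c)) (fun c _ => @open_strict _ _ _)).
case=> [x _|D' _ cov].
  by exists x => //; apply/bcE => i; rewrite subrr normr0.
exists [seq (s ++ bc c, c - z) | c <- finmap.enum_fset D']; split.
  move=> e /mapP[c _ ->] x y t a /= /strict_cat[sx /bcE cx] /andP[t0 t1] /andP[a0 a1] By.
  (* The point x - y / t is within [2 * rho] of [z], hence in the piece, and x - a y is the convex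
     combination of it and x with weight [a * t]. *)
  pose v : 'rV[R]_n := x - t^-1 *: y.
  have vs : strict s v.
    apply: zs => i; have := By i; rewrite !mxE => yi.
    have -> : x 0 i - t^-1 * y 0 i - z 0 i =
       (x 0 i - c 0 i) - t^-1 * (y 0 i - t * (c 0 i - z 0 i)) by field; rewrite gt_eqF.
    apply: le_trans (ler_normB _ _) _; rewrite mulr_natl mulr2n lerD//; first exact/ltW/cx.
    by rewrite normrM gtr0_norm ?invr_gt0// mulrC ler_pdivrMr// (mulrC rho).
  have -> : x - a *: y = x + (a * t) *: (v - x).
    by rewrite /v addrAC subrr add0r scalerN scalerA -mulrA mulfV ?mulr1// gt_eqF.
  have at0 : 0 <= a * t by rewrite mulr_ge0// ltW.
  have at1 : a * t <= 1 by rewrite mulr_ile1// ltW.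
  move=> p ps; have := sx p ps; have := vs p ps; rewrite dotDr dotZr dotBr.
  move: (dot p.1 v) (dot p.1 x) (p.2) (a * t) at0 at1 => A B b k k0 k1 Ab Bb.
  have [kk|kk] := leP k (1 / 2); nra.
move=> x sx xC; have [|c cD cx] := cov x; first by move=> i; rewrite mxE subr0.
exists (s ++ bc c, c - z); last exact/strict_cat.
by apply/mapP; exists c.
Qed.

Lemma box_strict (s : seq ('rV[R]_n * R)) z : strict s z ->
  \forall k \near \oo, forall y, box z (2 * harmonic k) y -> strict s y.
Proof.
move=> sz; have h : \forall k \near \oo, forall p, p \in s ->
    2 * harmonic k * n1 p.1 < p.2 - dot p.1 z.
  apply: (@near_all _ _ _ \oo) => p /sz pz.
  have c : 2 * @harmonic R k * n1 p.1 @[k --> \oo] --> (0 : R).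
    rewrite -(mul0r (n1 p.1)) -(mulr0 2); apply: cvgM; last exact: cvg_cst.
    by apply: cvgM; [exact: cvg_cst|exact: cvg_harmonic].
  by apply: (cvgr_lt _ c); rewrite subr_gt0.
apply: filterS h => k h y By p /h ph.
have : `|dot p.1 (y - z)| <= 2 * harmonic k * n1 p.1.
  by rewrite dotC; apply: norm_dot_le => i; rewrite !mxE; exact: By.
by rewrite dotBr => /(le_trans (ler_norm _)); lra.
Qed.

(** Up to the facet hyperplanes, the domain is a union of open convex pieces, each cut further by
    [piece_regions]. All data depend on the domain alone. *)
Lemma domain_regions (Om : set 'rV[R]_n) : polyhedral_domain Om ->
  exists (Q : seq (seq ('rV[R]_n * R) * 'rV[R]_n)) (rho D : R) (Z : set 'rV[R]_n),
  [/\ 0 < rho /\ 0 <= D,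
      forall e, e \in Q -> forall x y (t a : R), strict e.1 x -> 0 < t <= 1 -> 0 <= a <= 1 ->
       box (t *: e.2) (t * rho) y -> Om (x - a *: y),
      forall e, e \in Q -> forall y (t : R), 0 < t -> box (t *: e.2) (t * rho) y -> n1 y <= D * t,
      (leb n).-negligible Z
    & forall x, closure Om x -> ~ Z x -> exists2 e, e \in Q & strict e.1 x].
Proof.
move=> [oO _ _ OmO [k [P [Ppol PE]]]].
have /choice[s sP] : forall i, exists s : seq ('rV[R]_n * R),
    P i = [set x | all (fun p => dot p.1 x <= p.2) s].
  by move=> i; have [_ [s ?]] := Ppol i; exists s.
pose s' i := [seq p <- s i | p.1 != 0].
have sub i x : P i !=set0 -> strict (s' i) x -> Om x.
  move=> [y Py] sx; rewrite OmO; apply: filterS (open_nbhs_nbhs (conj (@open_strict _ _ (s' i)) sx)).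
  move=> v sv; rewrite PE; exists i => //; rewrite sP /=; apply/allP => p ps.
  have [p0|p0] := eqVneq p.1 0; last by apply/ltW/sv; rewrite mem_filter p0.
  by move: Py; rewrite sP /= => /allP/(_ p ps); rewrite p0 !dot0l.
(* Empty or flat polytopes are left out: they contribute no points off the exceptional
   hyperplanes. *)
pose good i := P i !=set0 /\ strict (s' i) !=set0.
have /choice[z zP] : forall i, exists z, good i -> strict (s' i) z.
  move=> i; have [g|g] := pselect (good i); last by exists 0.
  by have [_ [z sz]] := g; exists z.
have [m _ /(_ m (leqnn m)) hm] : \forall m \near \oo, forall i, i \in enum 'I_k -> good i ->
    forall y, box (z i) (2 * @harmonic R m) y -> strict (s' i) y.
  apply: (@near_all _ _ _ \oo) => i _; have [g|g] := pselect (good i); last by apply: nearW.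
  by apply: filterS (box_strict (zP i g)) => ? + _.
pose rho : R := harmonic m; have rho0 : 0 < rho by rewrite /rho /harmonic invr_gt0.
have /choice[C CP] : forall i, exists C : R, bounded_by C (P i).
  by move=> i; have [/bounded_set_by[C _ ?] _] := Ppol i; exists C.
have /choice[Q QP] : forall i, exists Q : seq (seq ('rV[R]_n * R) * 'rV[R]_n), good i ->
    (forall e, e \in Q -> forall x y (t a : R), strict e.1 x -> 0 < t <= 1 -> 0 <= a <= 1 ->
       box (t *: e.2) (t * rho) y -> strict (s' i) (x - a *: y)) /\
    (forall x, strict (s' i) x -> (forall j, `|x 0 j| <= C i) -> exists2 e, e \in Q & strict e.1 x).
  move=> i; have [g|g] := pselect (good i); last by exists [::].
  have [Q hQ] := @piece_regions (C i) rho (s' i) (z i) rho0 (hm i (mem_enum _ i) g).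
  by exists Q.
pose QQ := flatten [seq Q i | i <- enum 'I_k & `[< good i >]].
pose Zl := flatten [seq s' i | i <- enum 'I_k].
exists QQ, rho, (\sum_(e <- QQ) (n1 e.2 + n%:R * rho)), [set x | exists2 p, p \in Zl & dot p.1 x = p.2].
have e0 (e : seq ('rV[R]_n * R) * 'rV[R]_n) : 0 <= n1 e.2 + n%:R * rho.
  by rewrite addr_ge0 ?n1_ge0// mulr_ge0// ltW.
split.
- by split => //; apply: sumr_ge0 => e _; exact: e0.
- move=> e /flattenP[q /mapP[i]]; rewrite mem_filter => /andP[/asboolP g _ ->] eQ x y t a sx tt aa By.
  by apply: (@sub i); [exact: g.1|exact: (QP i g).1 eQ _ _ _ _ sx tt aa By].
- move=> e eQ y t t0 By; apply: (@le_trans _ _ ((n1 e.2 + n%:R * rho) * t)); last first.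
    apply: ler_wpM2r; first exact: ltW.
    by rewrite (big_rem e eQ)/= lerDl; apply: sumr_ge0 => ? _; exact: e0.
  apply: (@le_trans _ _ (\sum_(i < n) (t * `|e.2 0 i| + t * rho))).
    apply: ler_sum => i _; have := By i; rewrite !mxE => yi.
    rewrite (_ : y 0 i = t * e.2 0 i + (y 0 i - t * e.2 0 i)); last by ring.
    by apply: le_trans (ler_normD _ _) _; rewrite lerD// normrM gtr0_norm.
  rewrite big_split /= -mulr_sumr sumr_const card_ord -[(t * rho) *+ n]mulr_natl -/(n1 e.2).
  by rewrite (_ : _ + _ = (n1 e.2 + n%:R * rho) * t)//; ring.
- apply: list_null => p /flattenP[q /mapP[i _ ->]].
  by rewrite mem_filter => /andP[].
move=> x; rewrite PE => -[i _ Px] nZ.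
have six : strict (s' i) x.
  move=> p ps; have := ps; rewrite mem_filter => /andP[p0 psi].
  rewrite lt_neqAle; apply/andP; split; last by move: Px; rewrite sP => /allP/(_ p psi).
  apply/eqP => px; apply: nZ; exists p => //; apply/flattenP; exists (s' i) => //.
  by apply/mapP; exists i; rewrite ?mem_enum.
have g : good i by split; exists x.
have [e eQ ex] := (QP i g).2 x six (CP i x Px).
exists e => //; apply/flattenP; exists (Q i) => //.
by apply/mapP; exists i => //; rewrite mem_filter mem_enum andbT; apply/asboolP.
Qed.

(* The selected cells have a total volume of at most [t ^+ n / C], so that most of the shifts of length
   [t] move them off themselves, while a shift changes the integral by [t] times the total jump. *)
Lemma concentration (Om : set 'rV[R]_n) : polyhedral_domain Om ->
  exists2 C : R, 0 < C & forall (M : mesh R n) (L : elt M -> seq 'rV[R]_n) (w : elt M -> R) (t : R),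
    conforming_mesh Om M -> (forall K, polyh (cell K) (L K)) -> 0 < t <= 1 -> (forall K, 0 <= w K) ->
    \sum_(K | C * \sum_K' cvol K' * w K' < t ^+ n * w K) cvol K * w K <=
    C * t * \sum_s farea_s s * `|jump w s|.
Proof.
move=> hOm; have [Q [rho [D [Z [[rho0 D0] QO QD nZ cov]]]]] := domain_regions hOm.
have [oO _ _ OmO _] := hOm.
have d0 : 0 < (2 * rho) ^+ n by rewrite exprn_gt0// mulr_gt0.
(* The first summand adapts the selection threshold to the volume of the box of shifts, the second
   collects the bounds [2 * (D * t) * J] of the regions. *)
exists (2 / (2 * rho) ^+ n + 2 * D * (size Q)%:R) => [|M L w t cM LP tt w0].
  by rewrite ltr_pwDl ?divr_gt0// !mulr_ge0.
have /andP[t0 t1] := tt.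
set W := \sum_K' _; set J := \sum_s _; set C := 2 / _ + _.
have W0 : 0 <= W by apply: sumr_ge0 => K _; rewrite mulr_ge0// cvol_ge0.
have J0 : 0 <= J by apply: sumr_ge0 => s _; rewrite mulr_ge0//; exact/ltW/(farea_s_gt0 cM LP).
pose S K := 2 * W < (2 * (t * rho)) ^+ n * w K.
have CS K : C * W < t ^+ n * w K -> S K.
  move=> h; rewrite /S mulrCA exprMn mulrAC -ltr_pdivrMr//; apply: le_lt_trans h.
  by rewrite mulrAC ler_wpM2r// /C lerDl !mulr_ge0.
have QB e : e \in Q -> \sum_(K | S K) w K * rint (\1_(sint (cell K) (L K) `&` strict e.1) : 'rV[R]_n -> R)
     <= 2 * (D * t) * J.
  move=> eQ; apply: (@region_bound _ _ _ _ OmO cM L LP w e.1 (t *: e.2) (t * rho) (D * t)) => //.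
  - by rewrite mulr_gt0.
  - by move=> x y a sx By aa; exact: QO eQ _ _ _ _ sx tt aa By.
  - by move=> y; exact: QD.
apply: (@le_trans _ _ (\sum_(K | S K) cvol K * w K)).
  rewrite big_mkcond [leRHS]big_mkcond; apply: ler_sum => K _.
  case: ifP => [/CS -> //|_]; case: ifP => // _; by rewrite mulr_ge0// cvol_ge0.
(* The regions cover almost all of every cell; overlaps only enlarge the right-hand side. *)
apply: (@le_trans _ _ (\sum_(e <- Q) \sum_(K | S K) w K * rint (\1_(sint (cell K) (L K) `&` strict e.1) : 'rV[R]_n -> R))).
  rewrite exchange_big; apply: ler_sum => K _; rewrite -mulr_sumr mulrC ler_wpM2l//.
  have ms e : measurable (sint (cell (m := M) K) (L K) `&` strict (e : seq ('rV[R]_n * R) * 'rV[R]_n).1).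
    by apply: measurableI; [exact: sint_measurable|apply: open_measurable_rV; exact: open_strict].
  have [[B KB] _ _ _ _] := LP K.
  have ii e : intg (\1_(sint (cell K) (L K) `&` strict (e : seq ('rV[R]_n * R) * 'rV[R]_n).1) : 'rV[R]_n -> R).
    by apply: (@intg_indic _ _ _ B) => // x [/(sint_sub (LP K))/KB].
  rewrite -rint_sum; last by move=> e _; exact: ii.
  have NK := negligibleU nZ (boundary_null (LP K)).
  pose f x := \sum_(e <- Q) (\1_(sint (cell K) (L K) `&` strict e.1) x : R).
  have mf : measurable_fun setT f by apply: measurable_sum => e; exact: measurable_indic.
  have f0 x : 0 <= f x by apply: sumr_ge0 => e _; rewrite indicE ler0n.
  have mK : measurable_fun setT (\1_(cell K) : 'rV[R]_n -> R).
    by apply: measurable_indic; exact: polyh_measurable (LP K).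
  have mm : measurable_fun setT (fun x => Num.min (\1_(cell K) x) (f x)) by exact: measurable_minr.
  rewrite /cvol (@ae_eq_rint _ _ _ _ _ mK mm NK).
    apply: le_rint; last by move=> x; rewrite ge_min lexx orbT.
      apply: (intg_le mm (intg_cell LP K)) => x; rewrite ger0_norm ?ge_min ?lexx//.
      by rewrite le_min f0 indicE ler0n.
    by apply: intg_sum => e _; exact: ii.
  move=> x /not_orP[NZ Nb]; apply/esym/min_idPl; rewrite indicE.
  have [xK|_] := boolP (x \in cell K); last exact: f0.
  have Kx : cell K x by rewrite inE in xK.
  have sx : sint (cell K) (L K) x by apply: contrapT => h; apply: Nb.
  have [e eQ ex] := cov x (cell_sub cM Kx) NZ.
  by rewrite /f (big_rem e eQ)/= indicE mem_set// lerDl; apply: sumr_ge0 => e' _; rewrite indicE ler0n.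
apply: (@le_trans _ _ (\sum_(e <- Q) 2 * (D * t) * J)).
  by rewrite big_seq [leRHS]big_seq; apply: ler_sum => e; exact: QB.
rewrite big_const_seq count_predT iter_addr_0 -[X in X <= _]mulr_natl.
rewrite (_ : C * t * J = (size Q)%:R * (2 * (D * t) * J) + 2 / (2 * rho) ^+ n * t * J).
  by rewrite lerDl !mulr_ge0 ?invr_ge0 ?(ltW d0) ?(ltW t0).
by rewrite /C; ring.
Qed.

End Concentration.

(** * Test functions *)

Section Param.
Context {R : realType} {n : nat}.
Variables (K : set 'rV[R]_n) (L : seq 'rV[R]_n) (T : R).
Hypothesis KL : polyh K L.
Hypothesis T0 : 0 < T.

Definition jointly (A : set 'rV[R]_n) (W : topologicalType) (g : R -> 'rV[R]_n -> W) :=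
  {within `[0, T] `*` A, continuous (fun z : R * 'rV[R]_n => g z.1 z.2)}.

Lemma jointly_slice A (W : topologicalType) (g : R -> 'rV[R]_n -> W) t :
  jointly A g -> t \in `[0, T] -> {within A, continuous (g t)}.
Proof.
move=> jg tT; rewrite /jointly in jg.
apply: (@within_continuous_comp _ _ _ _ A _ (fun x => (t, x)) jg) => [|w Aw]; last by split.
apply: within_continuousW => x.
apply: (@cvg_pair _ _ _ (nbhs x) (nbhs t) (nbhs x) _ _ _ (fun=> t) id).
  exact: cvg_cst.
exact: cvg_id.
Qed.

Lemma jointly_time A (W : topologicalType) (g : R -> 'rV[R]_n -> W) x :
  jointly A g -> A x -> {within `[0, T], continuous (g^~ x)}.
Proof.
move=> jg Ax; rewrite /jointly in jg.
apply: (@within_continuous_comp _ _ _ _ `[0, T] _ (fun t => (t, x)) jg) => [|w Aw]; last by split.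
apply: within_continuousW => t.
apply: (@cvg_pair _ _ _ (nbhs t) (nbhs t) (nbhs x) _ _ _ id (fun=> x)).
  exact: cvg_id.
exact: cvg_cst.
Qed.

Lemma jointlyS A B (W : topologicalType) (g : R -> 'rV[R]_n -> W) : A `<=` B ->
  jointly B g -> jointly A g.
Proof. by move=> AB; apply: within_continuousS => -[t x] [/= ? /AB]; split. Qed.

Lemma jointly_comp A (W Z : topologicalType) (F : W -> Z) (g : R -> 'rV[R]_n -> W) :
  jointly A g -> continuous F -> jointly A (fun t x => F (g t x)).
Proof.
move=> jg cF; apply: (@within_continuous_comp _ _ _ setT _ F _ _ jg) => //.
exact: within_continuousW.
Qed.

Lemma jointly_bounded A (g : R -> 'rV[R]_n -> R) : compact A -> jointly A g ->
  exists2 B : R, 0 <= B & forall t x, t \in `[0, T] -> A x -> `|g t x| <= B.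
Proof.
move=> cA jg; have cT : compact (`[0, T] `*` A) by apply: compact_setX => //; exact: segment_compact.
have [B B0 h] := within_compact_bounded cT jg; exists B => // t x tT Ax.
exact: (h (t, x)).
Qed.

Lemma intg_slice (g : R -> 'rV[R]_n -> R) t : jointly K g -> t \in `[0, T] -> intg (g t \_ K).
Proof.
move=> jg tT; have [[C KC] _ _ _ _] := KL.
exact: intg_continuous (polyh_closed KL) KC (jointly_slice jg tT).
Qed.

(** Time derivatives are given at interior points only; omitting the null boundary allows
    differentiation under the integral. *)
Lemma rint_sint (f : 'rV[R]_n -> R) : {within K, continuous f} -> 
  rint (f \_ K) = \int[leb n]_(x in sint K L) f x.
Proof.
move=> cf; have [[C KC] _ _ _ _] := KL.
have i1 := intg_continuous (polyh_closed KL) KC cf.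
have mS : measurable_fun setT (f \_ (sint K L)).
  rewrite (_ : _ \_ _ = (fun x => (f \_ K) x * \1_(sint K L) x)).
    apply: measurable_funM; first exact: intg_measurable i1.
    by apply: measurable_indic; exact: sint_measurable.
  apply/funext => x; rewrite !patchE indicE; case: ifPn => xS; rewrite ?mulr0// mulr1.
  by rewrite mem_set//; apply: (sint_sub KL); rewrite inE in xS.
rewrite Rintegral_mkcond; apply: (ae_eq_rint (intg_measurable i1) mS (boundary_null KL)) => x Nx.
rewrite !patchE; case: ifPn => xK; case: ifPn => xS //.
  by case: Nx; split; [rewrite inE in xK|move=> h; rewrite mem_set in xS].
by rewrite inE in xS; rewrite mem_set in xK => //; exact: (sint_sub KL).
Qed.

Lemma param_continuous (g : R -> 'rV[R]_n -> R) : jointly K g ->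
  {within `[0, T], continuous (fun t => rint (g t \_ K))}.
Proof.
move=> jg; have [[C KC] _ _ _ _] := KL.
have [B B0 hB] := jointly_bounded (polyh_compact KL) jg.
(* Clamping the time to [[0, T]] extends the integrand continuously to an open interval around it,
   which settles the end points. *)
pose cl (t : R) := Num.max 0 (Num.min T t).
have clT t : cl t \in `[0, T].
  rewrite in_itv /= /cl le_max lexx /= ge_max (ltW T0) ge_min lexx.
  by [].
have ccl : continuous cl.
  move=> t; apply: (@continuous_max _ _ (fun=> 0) _ t); first exact: cst_continuous.
  by apply: (@continuous_min _ _ (fun=> T) id t); [exact: cst_continuous|exact: cvg_id].
have clE t : t \in `[0, T] -> cl t = t.
  by rewrite in_itv /= => /andP[h1 h2]; rewrite /cl (min_idPr h2) (max_idPr h1).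
have mK := polyh_measurable KL.
have Ig t : (leb n).-integrable K (EFin \o g (cl t)).
  by apply: (integrable_mkcond _ mK).2; rewrite restrict_EFin; exact: intg_slice.
have I1 : (leb n).-integrable K (EFin \o (fun=> B)).
  apply: (integrable_mkcond _ mK).2; rewrite restrict_EFin.
  by apply: intg_continuous (polyh_closed KL) KC _; exact: cst_within.
have H := @continuity_under_integral R _ _ (leb n) (fun t => g (cl t)) K mK (-1) (T + 1) (fun t _ => Ig t) _ (fun=> B) I1 _.
have H' : {in `](-1), (T + 1)[%classic, continuous (fun t => \int[leb n]_(x in K) g (cl t) x)}.
  apply: H.
    apply: aeW => x Kx t _.
    have h := jointly_time jg Kx.
    move/subspace_continuousP: h => /(_ (cl t) (clT t)) h U hU.
    have H' : nbhs t [set s | `[0, T]%classic (cl s) -> U (g (cl s) x)] := ccl t _ (h U hU).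
    by apply: (filterS _ H') => s; apply; exact: clT.
  by move=> t _; apply: aeW => x Kx; exact: hB.
have c2 : {within `[0, T], continuous (fun t => \int[leb n]_(x in K) g (cl t) x)}.
  apply: continuous_in_subspaceT => t; rewrite inE /= in_itv /= => /andP[h1 h2].
  by apply: H'; rewrite inE /= in_itv /=; apply/andP; split; lra.
apply: (subspace_eq_continuous _ c2) => t; rewrite inE => tT /=.
change (\int[leb n]_(x in K) g (cl t) x = rint (g t \_ K)).
by rewrite (clE _ tT) Rintegral_mkcond.
Qed.

Lemma param_derive (g dg : R -> 'rV[R]_n -> R) : jointly K g -> jointly K dg ->
  (forall t x, 0 < t < T -> sint K L x -> is_derive t 1 (g^~ x) (dg t x)) ->
  forall t, 0 < t < T -> is_derive t 1 (fun t => rint (g t \_ K)) (rint (dg t \_ K)).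
Proof.
move=> jg jdg dgE t /andP[t0 tT].
have [B B0 hB] := jointly_bounded (polyh_compact KL) jdg.
have [[C KC] _ _ _ _] := KL.
have mS : measurable (sint K L) by exact: sint_measurable.
have sK := sint_sub KL.
have It s : `]0, T[%classic s -> s \in `[0, T].
  by rewrite /= !in_itv /= => /andP[h1 h2]; rewrite !ltW.
have i1 (f : 'rV[R]_n -> R) : {within K, continuous f} -> (leb n).-integrable (sint K L) (EFin \o f).
  move=> cf; apply: (integrableS (polyh_measurable KL)) => //.
  apply: (integrable_mkcond _ (polyh_measurable KL)).2; rewrite restrict_EFin.
  exact: intg_continuous (polyh_closed KL) KC cf.
have Ia : `]0, T[%classic t by rewrite /= in_itv /= t0.
have D (s : R) x : `]0, T[%classic s -> sint K L x -> is_derive s 1 (g^~ x) (dg s x).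
  by rewrite /= in_itv /= => sT; exact: dgE.
have pE (s : R) x : `]0, T[%classic s -> sint K L x -> partial1of2 g s x = dg s x.
  by move=> sT Sx; rewrite partial1of2E; have [_ ->] := D s x sT Sx.
have ub (s : R) x : `]0, T[%classic s -> sint K L x -> `|partial1of2 g s x| <= B.
  by move=> sT Sx; rewrite pE//; apply: hB; [exact: It|exact: sK].
have ig s (sT : `]0, T[%classic s) : (leb n).-integrable (sint K L) (EFin \o g s).
  by apply: i1; exact: jointly_slice jg (It s sT).
have H := @cvg_differentiation_under_integral R _ _ (leb n) g (sint K L) mS t 0 T Ia
  ig (fun s x sT Sx => (D s x sT Sx).(ex_derive)) (fun=> B)
  (fun=> B0) (i1 _ (@cst_within _ _ _ B)) ub.
pose F s := \int[leb n]_(x in sint K L) g s x.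
apply: (@near_eq_is_derive _ R^o R^o F).
  have : t \in `]0, T[ by rewrite in_itv /= t0.
  move=> /near_in_itvoo; apply: filterS => s sT; rewrite /F rint_sint//.
  exact: jointly_slice jg (It s sT).
have dE : rint (dg t \_ K) = \int[leb n]_(x in sint K L) partial1of2 g t x.
  rewrite rint_sint; last exact: jointly_slice jdg (It t Ia).
  by apply: eq_Rintegral => x; rewrite inE => Sx; rewrite pE.
have E : (fun h : R => h^-1 *: (F (h *: (1 : R) + t) - F t)) = (fun h => h^-1 *: (F (h + t) - F t)).
  by apply/funext => h; rewrite scaler1.
apply: DeriveDef; first by apply/cvg_ex; exists (rint (dg t \_ K)); rewrite E dE.
by rewrite /derive E; apply/cvg_lim; rewrite ?dE.
Qed.

End Param.

Section C1Bounds.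
Context {R : realType} {n : nat} {T : R} {Om : set 'rV[R]_n}.
Hypothesis T0 : 0 < T.
Hypothesis hOm : polyhedral_domain Om.
Implicit Types (phi : C1fun T Om).

Lemma domain_compact : compact (closure Om).
Proof.
have [_ _ _ _ [k [P [Ppol PE]]]] := hOm.
have /choice[C CP] : forall i, exists C : R, bounded_by C (P i).
  by move=> i; have [/bounded_set_by[C _ ?] _] := Ppol i; exists C.
apply: (@closed_bounded_by_compact _ _ (\sum_i `|C i|)); first exact: closed_closure.
rewrite PE => x [i _ Px] j; apply: le_trans (CP i x Px j) _.
by apply: le_trans (ler_norm _) _; rewrite (bigD1 i)//= lerDl sumr_ge0.
Qed.

Lemma le_supnorm (g : R -> 'rV[R]_n -> R) t x : jointly T (closure Om) g ->
  t \in `[0, T] -> closure Om x -> `|g t x| <= supnorm (T := T) (Om := Om) g.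
Proof.
move=> jg tT Ox; have [B B0 hB] := jointly_bounded domain_compact jg.
apply: ub_le_sup; last by exists (t, x).
by exists B => _ [[s y] [sT Oy] <-]; exact: hB.
Qed.

Lemma supnorm_ge0 (g : R -> 'rV[R]_n -> R) : jointly T (closure Om) g ->
  0 <= supnorm (T := T) (Om := Om) g.
Proof.
have [_ _ [x Ox] _ _] := hOm => jg.
have tT : 0 \in `[0, T] by rewrite in_itv /= lexx ltW.
by apply: le_trans (le_supnorm jg tT (@subset_closure _ _ _ Ox)).
Qed.

Lemma grad_jointly phi i : jointly T (closure Om) (fun t x => c1_grad phi t x 0 i).
Proof.
apply: (@jointly_comp _ _ _ _ _ _ (fun v : 'rV[R]_n => v 0 i)); first exact: c1_grad_cont.
exact: coord_continuous.
Qed.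

Lemma grad_norm_jointly phi : jointly T (closure Om) (fun t x => enorm (c1_grad phi t x)).
Proof.
apply: (@jointly_comp _ _ _ _ _ _ (@enorm R n)); first exact: c1_grad_cont.
move=> z; apply: (@cvg_comp _ _ _ (fun v : 'rV[R]_n => dot v v) Num.sqrt _ (nbhs _)); last exact: sqrt_continuous.
apply: (@cvg_sumr R _ _ _ _ (nbhs z) (fun i (v : 'rV[R]_n) => v 0 i * v 0 i)) => i _.
by apply: (@cvgM R _ (nbhs z)); exact: coord_continuous.
Qed.

Lemma C1norm_ge0 phi : 0 <= C1norm phi.
Proof.
rewrite !addr_ge0//; apply: supnorm_ge0; [exact: c1_val_cont|exact: c1_dt_cont|].
exact: grad_norm_jointly.
Qed.

Lemma c1_grad_le phi t x i : t \in `[0, T] -> closure Om x -> `|c1_grad phi t x 0 i| <= C1norm phi.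
Proof.
move=> tT Ox; apply: le_trans (coord_le_enorm _ _) _.
apply: le_trans (ler_norm _) _; apply: le_trans (le_supnorm (@grad_norm_jointly phi) tT Ox) _.
rewrite /C1norm lerDr addr_ge0//; apply: supnorm_ge0; first exact: c1_val_cont.
exact: c1_dt_cont.
Qed.

End C1Bounds.

Section CellIntegrals.
Context {R : realType} {n : nat}.
Variables (Om : set 'rV[R]_n) (M : mesh R n).
Variable L : elt M -> seq 'rV[R]_n.
Hypothesis LP : forall K, polyh (cell K) (L K).
Implicit Types (K : elt M) (f : 'rV[R]_n -> R).

Definition cint K f : R := rint (f \_ (cell K)).

Lemma cell_intg K f : {within cell K, continuous f} -> intg (f \_ (cell K)).
Proof.
have [[C KC] _ _ _ _] := LP K.
exact: intg_continuous (polyh_closed (LP K)) KC.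
Qed.

Lemma cell_integral K f : {within cell K, continuous f} -> integral_rV (f \_ (cell K)) = cint K f.
Proof.
move=> cf; have [[C KC] _ _ _ _] := LP K.
have [B B0 hB] := within_compact_bounded (polyh_compact (LP K)) cf.
apply: (@integral_rVE _ _ (Num.max B C)); split.
- exact: intg_measurable (cell_intg cf).
- move=> x; rewrite patchE; case: ifPn => xK.
    by rewrite le_max hB//; rewrite inE in xK.
  by rewrite normr0 le_max B0.
- move=> x; rewrite patchE; case: ifPn => xK; last by rewrite eqxx.
  by move=> _ i; rewrite le_max orbC (KC x)//; rewrite inE in xK.
Qed.

Lemma cint_sum K (I : Type) (r : seq I) (a : I -> R) (f : I -> 'rV[R]_n -> R) :
  (forall i, {within cell K, continuous (f i)}) ->
  cint K (fun x => \sum_(i <- r) a i * f i x) = \sum_(i <- r) a i * cint K (f i).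
Proof.
move=> cf; rewrite /cint -(eq_bigr _ (fun i _ => rintZ (a i) (cell_intg (cf i)))).
rewrite -rint_sum; last by move=> i _; apply: intgZ; exact: cell_intg.
congr rint; apply/funext => x; rewrite patchE; case: ifPn => xK.
  by apply: eq_bigr => i _; rewrite patchE xK.
by rewrite big1// => i _; rewrite patchE (negbTE xK) mulr0.
Qed.

Lemma cintD K f g : {within cell K, continuous f} -> {within cell K, continuous g} ->
  cint K (fun x => f x + g x) = cint K f + cint K g.
Proof.
move=> cf cg; rewrite /cint -rintD; [|exact: cell_intg|exact: cell_intg].
by congr rint; apply/funext => x; rewrite !patchE; case: ifP; rewrite ?addr0.
Qed.

Lemma cintZ K (a : R) f : {within cell K, continuous f} ->
  cint K (fun x => a * f x) = a * cint K f.
Proof.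
move=> cf; rewrite /cint -rintZ; last exact: cell_intg.
by congr rint; apply/funext => x; rewrite !patchE; case: ifP; rewrite ?mulr0.
Qed.

Lemma cint_cst K (a : R) : cint K (fun=> a) = a * cvol K.
Proof.
rewrite /cint /cvol -rintZ; last exact: intg_cell.
by congr rint; apply/funext => x; rewrite patchE indicE; case: ifP; rewrite ?mulr1 ?mulr0.
Qed.

Lemma cell_vol K : vol (cell K) = cvol K.
Proof.
rewrite /vol (_ : (\1_(cell K) : 'rV[R]_n -> R) = (fun=> 1 : R) \_ (cell K)).
  by rewrite cell_integral ?cint_cst ?mul1r//; exact: cst_within.
by apply/funext => x; rewrite patchE indicE; case: ifP.
Qed.

Lemma intOE (g : elt M -> 'rV[R]_n -> R) : (forall K, {within cell K, continuous (g K)}) ->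
  intO g = \sum_K cint K (g K).
Proof. by move=> cg; apply: eq_bigr => K _; exact: cell_integral. Qed.

Lemma intO_cst (a : elt M -> R) : intO (fun K _ => a K) = \sum_K cvol K * a K.
Proof.
rewrite intOE => [|K]; last exact: cst_within.
by apply: eq_bigr => K _; rewrite cint_cst mulrC.
Qed.

Lemma intSE (cM : conforming_mesh Om M) (g : face M -> R) :
  Defs.intS g = \sum_s farea_s s * g s.
Proof. by apply: eq_bigr => s _; rewrite (area_s cM LP). Qed.

Definition cavg K f : R := (cvol K)^-1 * cint K f.

Lemma cavg_close K f (c M' : R) : 0 < cvol K -> {within cell K, continuous f} ->
  (forall x, cell K x -> `|f x - c| <= M') -> `|cavg K f - c| <= M'.
Proof.
move=> K0 cf h.
have cc : {within cell K, continuous (fun x => f x + - c)}.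
  by move=> x; apply: (@cvgD _ R^o); [exact: cf|exact: cvg_cst].
have cE : cint K (fun x => f x + - c) = cint K f - c * cvol K.
  by rewrite cintD ?cint_cst ?mulNr//; exact: cst_within.
have le1 : `|cint K (fun x => f x + - c)| <= M' * cvol K.
  apply: le_trans (le_norm_rint (cell_intg cc)) _.
  rewrite -cint_cst; apply: le_rint; [exact: intg_norm (cell_intg cc)|exact/cell_intg/cst_within|].
  move=> x; rewrite !patchE; case: ifPn => xK; last by rewrite normr0.
  by apply: h; rewrite inE in xK.
rewrite (_ : cavg K f - c = (cvol K)^-1 * cint K (fun x => f x + - c)).
  by rewrite normrM gtr0_norm ?invr_gt0// mulrC ler_pdivrMr.
by rewrite cE mulrBr mulrCA mulVf ?gt_eqF// mulr1.
Qed.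

End CellIntegrals.

Section C1Cells.
Context {R : realType} {n : nat} {T : R} {Om : set 'rV[R]_n}.
Hypothesis T0 : 0 < T.
Hypothesis hOm : polyhedral_domain Om.
Variable M : mesh R n.
Hypothesis cM : conforming_mesh Om M.
Variable L : elt M -> seq 'rV[R]_n.
Hypothesis LP : forall K, polyh (cell K) (L K).
Hypothesis vol0 : forall K : elt M, 0 < cvol K.
Variable d : R.
Hypothesis diam : forall (K : elt M) x y, cell K x -> cell K y -> enorm (x - y) <= d.
Variable phi : C1fun T Om.

Let OmO : Om = interior (closure Om). Proof. by have [_ _ _] := hOm. Qed.

Lemma cell_jointly (W : topologicalType) (g : R -> 'rV[R]_n -> W) (K : elt M) :
  jointly T (closure Om) g -> jointly T (cell K) g.
Proof. by apply: jointlyS; exact: cell_sub cM _. Qed.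

Lemma cell_val_within t (K : elt M) : t \in `[0, T] -> {within cell K, continuous (phi t)}.
Proof. by move=> tT; apply: (jointly_slice _ tT); apply: cell_jointly; exact: c1_val_cont. Qed.

Lemma cell_dt_within t (K : elt M) : t \in `[0, T] -> {within cell K, continuous (c1_dt phi t)}.
Proof. by move=> tT; apply: (jointly_slice _ tT); apply: cell_jointly; exact: c1_dt_cont. Qed.

Lemma cell_grad_within t (K : elt M) i : t \in `[0, T] ->
  {within cell K, continuous (fun x => c1_grad phi t x 0 i)}.
Proof.
move=> tT; apply: (@jointly_slice _ _ _ _ _ (fun t x => c1_grad phi t x 0 i) _ _ tT).
by apply: cell_jointly; exact: grad_jointly.
Qed.

Lemma c1_lipschitz t (K : elt M) x y : 0 < t < T -> cell K x -> cell K y ->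
  `|phi t y - phi t x| <= n%:R * d * C1norm phi.
Proof.
move=> tT Kx Ky; have tT' : t \in `[0, T] by rewrite in_itv /=; have /andP[] := tT; lra.
have h := @polyh_lipschitz _ _ _ _ (LP K) (phi t) (c1_grad phi t) (C1norm phi) (@cell_val_within t K tT').
apply: le_trans (h _ _ _ _ Kx Ky) _.
- move=> z i Sz; apply: c1_gradE; first by rewrite in_itv.
  exact: (sint_Om OmO cM LP Sz).
- by move=> z i Kz; apply: c1_grad_le => //; exact: cell_sub cM _ _ Kz.
rewrite [leRHS]mulrC ler_wpM2l ?C1norm_ge0//.
rewrite -[n in n%:R]card_ord mulr_natl -sumr_const; apply: ler_sum => i _.
have := coord_le_enorm (y - x) i; rewrite [(y - x) 0 i]mxE [(- x) 0 i]mxE => /le_trans; apply.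
exact: (diam Ky Kx).
Qed.

Lemma cint_val_derive t (K : elt M) : 0 < t < T ->
  is_derive t 1 (fun t => cint K (phi t)) (cint K (c1_dt phi t)).
Proof.
rewrite /cint => tT; apply: (param_derive (LP K) (g := c1_val phi) (dg := c1_dt phi)) => //.
- by apply: cell_jointly; exact: c1_val_cont.
- by apply: cell_jointly; exact: c1_dt_cont.
move=> s x sT Sx; apply: c1_dtE; first by rewrite in_itv.
exact: (sint_Om OmO cM LP Sx).
exact: tT.
Qed.

Lemma cint_val_continuous (K : elt M) : {within `[0, T], continuous (fun t => cint K (phi t))}.
Proof.
by apply: (param_continuous (LP K) T0); apply: cell_jointly; exact: c1_val_cont.
Qed.

Lemma cint_dt_continuous (K : elt M) : {within `[0, T], continuous (fun t => cint K (c1_dt phi t))}.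
Proof.
by apply: (param_continuous (LP K) T0); apply: cell_jointly; exact: c1_dt_cont.
Qed.

Lemma cint_grad_continuous (K : elt M) i :
  {within `[0, T], continuous (fun t => cint K (fun x => c1_grad phi t x 0 i))}.
Proof.
apply: (@param_continuous _ _ _ _ _ (LP K) T0 (fun t x => c1_grad phi t x 0 i)).
by apply: cell_jointly; exact: grad_jointly.
Qed.

End C1Cells.

(** * Entropy production at a face *)

Section FaceAlgebra.
Context {R : realType} {n : nat}.
Implicit Types (u v x : 'rV[R]_n).

(** With x = y^2 and ln x <= 2 (y - 1), what remains to be shown is (y - 1)^4 >= 0. This is the
    coercivity that turns relative entropies into squares of jumps. *)
Lemma ln_gap (x : R) : 0 < x -> (x - 1) ^+ 2 <= 2 * (x + 1) * (x - 1 - ln x).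
Proof.
move=> x0; pose y := Num.sqrt x; have y0 : 0 < y by rewrite sqrtr_gt0.
have xE : x = y ^+ 2 by rewrite sqr_sqrtr// ltW.
have l1 : ln x <= 2 * (y - 1).
  rewrite xE lnXn// mulr_natl ler_wMn2r//.
  have := @le_ln1Dx R (y - 1); rewrite (_ : 1 + (y - 1) = y); last by ring.
  by apply; lra.
have l2 : (x - 1) ^+ 2 <= 2 * (x + 1) * (x - 1 - 2 * (y - 1)).
  rewrite -subr_ge0 xE (_ : _ - _ = ((y - 1) ^+ 2) ^+ 2); last by ring.
  exact: sqr_ge0.
apply: le_trans l2 _; rewrite ler_wpM2l ?lerB//.
by rewrite mulr_ge0// addr_ge0// ltW.
Qed.

(* The relative entropy of the state i with respect to the state o, times [b = Phi kappa / theta]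
   at o; it is the production carried by the convective flux from i to o. *)
Definition rel_prod (cv ri ro Xi Xo Po bo ti to J : R) : R :=
  ri * Po * (Xo - Xi) + bo * ri * (2^-1 * J + cv * (ti - to)) + bo * to * (ro - ri).

(** [A] and [B] are the out- and inflow rates, [e] is the factor of the velocity penalty. The left
    side is the flux of the three equations tested with the derivatives of the entropy in the
    conserved variables; the last term on the right sums to zero over the faces. Since [A - B] is
    the mean normal velocity, [A] can be eliminated and a polynomial identity remains. *)
Lemma entropy_face (A B e cv ri ro Xi Xo Pi Po bi bo ti to : R) (ui uo nn : 'rV[R]_n) :
  A - B = dot (2^-1 *: (ui + uo)) nn ->
  let P1 X P b t u := P * X + b * (2^-1 * dot u u - (cv + 1) * t) in
  let Ei := ri * (2^-1 * dot ui ui + cv * ti) in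
  let Eo := ro * (2^-1 * dot uo uo + cv * to) in
  (A * ri - B * ro) * (P1 Xo Po bo to uo - P1 Xi Pi bi ti ui)
  + dot (A *: (ri *: ui) - B *: (ro *: uo)) (- (bo *: uo) - - (bi *: ui))
  + (ri * ti + ro * to) / 2 * dot nn (- (bo *: uo) - - (bi *: ui))
  - e * dot (uo - ui) (- (bo *: uo) - - (bi *: ui))
  + ((A * Ei - B * Eo) * (bo - bi)
     + (ri * ti + ro * to) / 2 * dot (bo *: uo - bi *: ui) nn
     - (ri * ti * bi + ro * to * bo) / 2 * dot (uo - ui) nn
     - e * (dot (uo - ui) (2^-1 *: (ui + uo)) * (bo - bi)))
  = (A * (ri * Xi) - B * (ro * Xo)) * (Po - Pi)
    + (A * rel_prod cv ri ro Xi Xo Po bo ti to (dot (uo - ui) (uo - ui))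
       + B * rel_prod cv ro ri Xo Xi Pi bi to ti (dot (uo - ui) (uo - ui))
       + e * ((bi + bo) / 2 * dot (uo - ui) (uo - ui)))
    - dot ((bo * to * ro) *: uo - (bi * ti * ri) *: ui) nn.
Proof.
move=> AB; have {AB} -> : A = B + dot (2^-1 *: (ui + uo)) nn by rewrite -AB addrC subrK.
rewrite /rel_prod !(dotBl, dotBr, dotNl, dotNr, dotZl, dotZr, dotDl, dotDr) !(dotC nn) (dotC uo ui).
move: (dot ui ui) (dot uo uo) (dot ui uo) (dot ui nn) (dot uo nn) => a b c d f.
by field.
Qed.

(** After inserting the entropies, the difference of the two sides is exactly [ri * Po] times the
    slack in the supergradient inequality [Xi <= Xo + ko * (si - so)]. *)
Lemma rel_prod_ge (cv ri ro si so Po ko ti to J Xi Xo : R) : 0 <= cv -> 0 < ri -> 0 < ro ->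
  0 < ti -> 0 < to -> 0 <= Po -> 0 <= ko -> 
  si = cv * ln ti - ln ri -> so = cv * ln to - ln ro -> Xi <= Xo + ko * (si - so) ->
  Po * ko * (ri * (2^-1 * J / to + cv * (ti / to - 1 - ln (ti / to)))
             + ri * (ro / ri - 1 - ln (ro / ri)))
  <= rel_prod cv ri ro Xi Xo Po (Po * ko / to) ti to J.
Proof.
move=> cv0 ri0 ro0 ti0 to0 P0 k0 -> -> hX.
rewrite /rel_prod !ln_div ?posrE// -subr_ge0.
rewrite [X in 0 <= X](_ : _ = ri * Po *
   (Xo + ko * (cv * ln ti - ln ri - (cv * ln to - ln ro)) - Xi)); last first.
  by field; rewrite !gt_eqF.
by rewrite mulr_ge0 ?mulr_ge0 ?subr_ge0// ltW.
Qed.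

Lemma rel_prod_ge0 (cv ri ro si so Po ko ti to J Xi Xo : R) : 0 <= cv -> 0 < ri -> 0 < ro ->
  0 < ti -> 0 < to -> 0 <= Po -> 0 <= ko -> 0 <= J ->
  si = cv * ln ti - ln ri -> so = cv * ln to - ln ro -> Xi <= Xo + ko * (si - so) ->
  0 <= rel_prod cv ri ro Xi Xo Po (Po * ko / to) ti to J.
Proof.
move=> cv0 ri0 ro0 ti0 to0 P0 k0 J0 hi ho hX; apply: le_trans (rel_prod_ge _ _ _ _ _ _ _ _ hi ho hX) => //.
have g (x : R) : 0 < x -> 0 <= x - 1 - ln x.
  move=> x0; have h := ln_gap x0; have xx : 0 < 2 * (x + 1) by rewrite mulr_gt0// addr_gt0.
  by rewrite -(pmulr_rge0 _ xx); apply: le_trans h; rewrite sqr_ge0.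
by rewrite !mulr_ge0// addr_ge0// mulr_ge0 ?g ?divr_gt0 ?(ltW ri0)//
   addr_ge0 ?mulr_ge0 ?g ?divr_gt0 ?invr_ge0 ?(ltW to0).
Qed.

End FaceAlgebra.

(** * Continuity in time and supergradients of entropy cutoffs *)

Section TimeContinuity.
Context {R : realType} (T : R).
Implicit Types (f g : R -> R).

Definition ct f := {within `[0, T], continuous f}.

Lemma ct_cst (c : R) : ct (fun=> c).
Proof. exact: cst_itv. Qed.

Lemma ctD f g : ct f -> ct g -> ct (fun t => f t + g t).
Proof. by move=> cf cg x; apply: (@cvgD _ R^o); [exact: cf|exact: cg]. Qed.

Lemma ctN f : ct f -> ct (fun t => - f t).
Proof. by move=> cf x; apply: (@cvgN _ R^o); exact: cf. Qed.

Lemma ctB f g : ct f -> ct g -> ct (fun t => f t - g t).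
Proof. by move=> cf cg; apply: ctD => //; exact: ctN. Qed.

Lemma ctM f g : ct f -> ct g -> ct (fun t => f t * g t).
Proof. by move=> cf cg x; apply: cvgM; [exact: cf|exact: cg]. Qed.

Lemma ct_norm f : ct f -> ct (fun t => `|f t|).
Proof. by move=> cf x; apply: (@cvg_norm _ R^o); exact: cf. Qed.

Lemma ct_sum (I : Type) (r : seq I) (P : pred I) (F : I -> R -> R) :
  (forall i, ct (F i)) -> ct (fun t => \sum_(i <- r | P i) F i t).
Proof.
move=> cF; elim: r => [|i r IH]; first by under eq_fun do rewrite big_nil; exact: ct_cst.
by under eq_fun do rewrite big_cons; case: (P i) => //; exact: ctD.
Qed.

Lemma ct_comp f g : ct f -> (forall t, t \in `[0, T] -> {for f t, continuous g}) ->
  ct (fun t => g (f t)).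
Proof.
move=> /subspace_continuousP cf cg; apply/subspace_continuousP => t tT.
by apply: (@cvg_comp _ _ _ f g _ (nbhs (f t))); [exact: cf|exact: cg].
Qed.

Lemma ctV f : ct f -> (forall t, t \in `[0, T] -> f t != 0) -> ct (fun t => (f t)^-1).
Proof. by move=> cf f0; apply: ct_comp => // t tT; apply: (@cvgV _ _ (nbhs (f t)) _ id); [exact: f0|exact: cvg_id]. Qed.

Lemma eq_ct f g : (forall t, t \in `[0, T] -> f t = g t) -> ct f -> ct g.
Proof. by move=> fg; apply: subspace_eq_continuous => t; rewrite inE => /fg. Qed.

Lemma ct_itv f t : t \in `[0, T] -> ct f -> {within `[0, t], continuous f}.
Proof.
rewrite in_itv /= => /andP[_ tT]; apply: within_continuousS.
by apply: subset_itvl; rewrite bnd_simp.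
Qed.

Lemma ct_ftc f F t : ct f -> ct F -> (forall x : R, 0 < x < T -> is_derive x 1 F (f x)) ->
  t \in `[0, T] -> ig 0 t f = F t - F 0.
Proof.
move=> cf cF dF tT; have /andP[t0 t1] : 0 <= t <= T by rewrite in_itv in tT.
refine (ftc t0 (ct_itv tT cf) (ct_itv tT cF) _).
by move=> x /andP[x0 xt]; apply: dF; rewrite x0 (lt_le_trans xt).
Qed.

End TimeContinuity.

Section Supergradient.
Context {R : realType}.

(** [kap] selects a supergradient at every point, which expresses concavity of [chi]; its sign
    expresses that [chi] is non-decreasing. *)
Definition supergradient (chi kap : R -> R) := forall x, 0 <= kap x /\ forall y, chi y <= chi x + kap x * (y - x).

Lemma supergradient_nonincreasing chi kap x y : supergradient chi kap -> x <= y -> kap y <= kap x.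
Proof.
move=> h; rewrite le_eqVlt => /predU1P[->//|xy].
have [_ /(_ y) h1] := h x; have [_ /(_ x) h2] := h y; nra.
Qed.

Lemma supergradient_continuous chi kap : supergradient chi kap -> continuous chi.
Proof.
(* Supergradients are non-increasing, so that [kap (x - 1)] bounds those at all points within
   distance 1 of [x]; adding 1 makes the divisor positive. *)
move=> h x; apply/cvgrPdist_le => e e0; pose C := kap (x - 1) + 1.
have C0 : 0 < C by rewrite ltr_wpDl//; have [] := h (x - 1).
have d0 : 0 < Num.min 1 (e / C) by rewrite lt_min ltr01 divr_gt0.
have : \forall y \near x, `|x - y| < Num.min 1 (e / C).
  by apply: (@cvgr_dist_lt _ _ _ (nbhs x) _ id) => //; exact: cvg_id.
apply: filterS => y; rewrite lt_min => /andP[y1 yC].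
have : C * `|x - y| <= e by rewrite mulrC -ler_pdivlMr// ltW.
apply: le_trans; have [kx0 /(_ y) h1] := h x; have [ky0 /(_ x) h2] := h y.
have kx : kap x <= C by rewrite /C ler_wpDr// (supergradient_nonincreasing h)//; lra.
have ky : kap y <= C.
  rewrite /C ler_wpDr// (supergradient_nonincreasing h)//.
  by move: y1; rewrite ltr_norml => /andP[]; lra.
have [xy|xy] := leP 0 (x - y).
  by rewrite (ger0_norm xy) ler_norml; apply/andP; split; nra.
by rewrite (ltr0_norm xy) ler_norml; apply/andP; split; nra.
Qed.

(** The supremum of the slopes to the right of a point is finite, since concavity bounds them by any
    slope to the left; monotonicity gives its sign. *)
Lemma cutoff_supergradient chi : entropy_cutoff chi -> exists kap, supergradient chi kap.
Proof.
move=> [hmono hconv _].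
have slope z x y : z < x -> x < y -> (chi y - chi x) / (y - x) <= (chi x - chi z) / (x - z).
  move=> zx xy; have yz : 0 < y - z by lra.
  have t0 : 0 <= (y - x) / (y - z) by rewrite divr_ge0 ?subr_ge0 ?ltW// -subr_gt0.
  have t1 : (y - x) / (y - z) <= 1 by rewrite ler_pdivrMr// mul1r; lra.
  have h : - chi ((y - x) / (y - z) * z + (1 - (y - x) / (y - z)) * y) <=
      (y - x) / (y - z) * - chi z + (1 - (y - x) / (y - z)) * - chi y.
    exact: (hconv (Itv01 t0 t1) z y (mem_set I) (mem_set I)).
  move: h.
  rewrite (_ : (y - x) / (y - z) * z + (1 - (y - x) / (y - z)) * y = x); last by field; rewrite gt_eqF.
  move=> h; rewrite ler_pdivrMr ?subr_gt0// mulrAC ler_pdivlMr ?subr_gt0//.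
  have : (y - z) * (- chi x) <= (y - z) * ((y - x) / (y - z) * - chi z + (1 - (y - x) / (y - z)) * - chi y).
    by rewrite ler_wpM2l// ltW.
  rewrite [X in _ <= X](_ : _ = - (y - x) * chi z - (x - z) * chi y); last by field; rewrite gt_eqF.
  by lra.
pose S x := [set (chi y - chi x) / (y - x) | y in [set y | x < y]].
have Sub x z : z < x -> ubound (S x) ((chi x - chi z) / (x - z)).
  by move=> zx _ [y xy <-]; exact: slope.
have S0 x : S x ((chi (x + 1) - chi x) / (x + 1 - x)) by exists (x + 1) => //=; lra.
have hs x : has_ubound (S x) by exists ((chi x - chi (x - 1)) / (x - (x - 1))); apply: Sub; lra.
exists (fun x => sup (S x)) => x; split.
  apply: le_trans (ub_le_sup (hs x) (S0 x)); rewrite divr_ge0 ?subr_ge0//; last by lra.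
  by apply: hmono; lra.
move=> y; have [xy|yx|->] := ltgtP x y; last by rewrite subrr mulr0 addr0.
  rewrite -lerBlDl -ler_pdivrMr ?subr_gt0//; apply: (ub_le_sup (hs x)).
  by exists y.
have : sup (S x) <= (chi x - chi y) / (x - y).
  by apply: ge_sup; [exists ((chi (x + 1) - chi x) / (x + 1 - x))|exact: Sub].
by rewrite ler_pdivlMr ?subr_gt0//; lra.
Qed.

End Supergradient.

(** * Interpolation inequalities at a face *)

Section Interpolation.
Context {R : realType} {n : nat}.

Lemma dot_sqr_le (x y : 'rV[R]_n) : dot x y ^+ 2 <= dot x x * dot y y.
Proof.
have [->|y0] := eqVneq y 0; first by rewrite !dot0r mulr0 expr0n.
have yy : 0 < dot y y by rewrite lt_neqAle dotxx_ge0 andbT eq_sym dotxx_eq0.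
have := dotxx_ge0 (dot y y *: x - dot x y *: y).
rewrite !(dotBl, dotBr, dotZl, dotZr) (dotC y x) (_ : _ - _ = dot y y * (dot x x * dot y y - dot x y ^+ 2)); last by ring.
by rewrite pmulr_rge0// subr_ge0.
Qed.

Lemma norm_dot_sqrt (x y : 'rV[R]_n) : `|dot x y| <= Num.sqrt (dot x x) * Num.sqrt (dot y y).
Proof.
rewrite -sqrtrM ?dotxx_ge0// -sqrtr_sqr ler_wsqrtr//; exact: dot_sqr_le.
Qed.

Lemma coord_le_sqrt (x : 'rV[R]_n) i : `|x 0 i| <= Num.sqrt (dot x x).
Proof.
rewrite -sqrtr_sqr ler_wsqrtr// /dot (bigD1 i)//= -expr2 lerDl.
by apply: sumr_ge0 => j _; rewrite -expr2 sqr_ge0.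
Qed.

Lemma ln_lipschitz (lo x y : R) : 0 < lo -> lo <= x -> lo <= y -> `|ln x - ln y| <= `|x - y| / lo.
Proof.
move=> lo0; wlog yx : x y / y <= x => [H lx ly|lx ly].
  by have [/H ->//|/ltW/H] := leP y x; rewrite distrC (distrC y); apply.
have y0 := lt_le_trans lo0 ly; have x0 := lt_le_trans y0 yx.
rewrite !ger0_norm ?subr_ge0 ?ler_ln ?posrE// -ln_div ?posrE//.
apply: (@le_trans _ _ ((x - y) / y)); last by rewrite ler_wpM2l ?subr_ge0// lef_pV2 ?posrE.
rewrite (_ : x / y = 1 + (x - y) / y); last by field; rewrite gt_eqF.
by apply: le_ln1Dx; rewrite (@lt_le_trans _ _ 0) ?ltrN10// divr_ge0 ?subr_ge0// ltW.
Qed.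

Lemma parallelogram (x y : 'rV[R]_n) :
  dot (x - y) (x - y) + dot (x + y) (x + y) = 2 * (dot x x + dot y y).
Proof. by rewrite !(dotBl, dotBr, dotDl, dotDr); ring. Qed.

Lemma powR_size (h H x y : R) : 0 < h <= H -> 1 <= H -> x <= y <= x + 2 ->
  h `^ y <= H ^+ 2 * h `^ x.
Proof.
move=> /andP[h0 hH] H1 /andP[xy y2].
rewrite -[y](subrK x) powRD; last by rewrite (gt_eqF h0) ?implybT.
rewrite ler_wpM2r ?powR_ge0//.
apply: (@le_trans _ _ (H `^ (y - x))).
  by apply: ge0_ler_powR; rewrite ?nnegrE ?subr_ge0// ltW// (lt_le_trans h0).
by rewrite -powR_mulrn ?(le_trans ler01)// ler_powR//; lra.
Qed.

(** z is at most sqrt(B) D times the geometric mean of P and Q, two parts of the same quantity Y;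
    the factor 1 + B dominates the square root of B. *)
Lemma sqr_interpolation (B D Y P Q z : R) : 0 <= B -> 0 <= D -> 0 <= P <= Y -> 0 <= Q <= Y ->
  z ^+ 2 <= B * D ^+ 2 * (P * Q) -> z <= (1 + B) * D * Y.
Proof.
move=> B0 D0 /andP[P0 PY] /andP[Q0 QY] zPQ.
have Y0 := le_trans P0 PY; have [z0|z0] := leP z 0.
  by apply: le_trans z0 _; rewrite !mulr_ge0// addr_ge0.
rewrite -(@ler_pXn2r _ 2) ?nnegrE ?(ltW z0)//; last by rewrite !mulr_ge0// addr_ge0.
apply: le_trans zPQ _; rewrite !exprMn.
apply: ler_pM; rewrite ?mulr_ge0 ?sqr_ge0//; last by rewrite expr2 ler_pM.
by rewrite ler_wpM2r ?sqr_ge0//; nra.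
Qed.

(** Here a is |u.n|, m the viscosity, v the speed, and j, r, t are the jumps of velocity, density
    and temperature. The product h a v r is left over: it is the term that needs [concentration]. *)
Lemma face_total (h a m v j r t K1 K2 K3 : R) : 0 <= h -> 0 <= a -> 0 <= j -> 0 <= r -> 0 <= t ->
  h * (a + m) * j <= K1 -> h * (a + m) * r <= K1 -> h * (a + m) * t <= K1 ->
  h * m * v * r <= K2 -> h * j <= K3 -> h * j * v <= K3 -> 0 <= K3 ->
  h * ((a + 2 * m) * (r + t + j + v * r) + 2^-1 * j * (1 + v)) <=
  6 * K1 + 2 * K2 + 2 * K3 + h * a * v * r.
Proof.
move=> h0 a0 j0 r0 t0; have := mulr_ge0 (mulr_ge0 h0 a0) j0.
have := mulr_ge0 (mulr_ge0 h0 a0) r0; have := mulr_ge0 (mulr_ge0 h0 a0) t0.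
lra.
Qed.

Section Face.
Variables (A D c h a m e v j r t : R).
Hypothesis A0 : 0 <= A.
Hypothesis D0 : 0 <= D.
Hypothesis c0 : 0 <= c.
Hypothesis h0 : 0 <= h.
Hypothesis am : 0 <= a <= v.
Hypothesis mc : 0 <= m <= c.
Hypothesis e0 : 0 <= e.
Hypothesis jrt : [/\ 0 <= j, 0 <= r & 0 <= t].
Hypothesis hD : h <= A * D ^+ 2.
Hypothesis hm : h <= A * D ^+ 2 * m.
Hypothesis hde : h <= A * D ^+ 2 * e.
Hypothesis hme : h * e <= A * D ^+ 2.

(** [Y] joins the energy part h (1 + v^2) and the dissipation at a face, with e = h^(alpha - 1) and
    D = h^delta in mind. Each bound below exhibits a product as a geometric mean of two summands of
    [Y], up to the factor [D]. *)
Let S := j ^+ 2 + r ^+ 2 + t ^+ 2.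
Let Y := h * (1 + v ^+ 2) + ((a + m) * S + e * j ^+ 2).

Let a0 : 0 <= a. Proof. by case/andP: am. Qed.
Let m0 : 0 <= m. Proof. by case/andP: mc. Qed.
Let v0 : 0 <= v. Proof. by case/andP: am => /le_trans; apply. Qed.
Let S0 : 0 <= S. Proof. by rewrite !addr_ge0 ?sqr_ge0. Qed.
Let ej0 : 0 <= e * j ^+ 2. Proof. by rewrite mulr_ge0 ?sqr_ge0. Qed.
Let aS0 : 0 <= (a + m) * S. Proof. by rewrite mulr_ge0// addr_ge0. Qed.
Let hv0 : 0 <= h * (1 + v ^+ 2). Proof. by rewrite mulr_ge0// addr_ge0// sqr_ge0. Qed.
Let hvY : 0 <= h * v ^+ 2 <= Y.
Proof. by rewrite mulr_ge0 ?sqr_ge0//= /Y mulrDr mulr1 -addrA addrCA lerDl !addr_ge0. Qed.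
Let hY : 0 <= h <= Y.
Proof. by rewrite h0 /Y mulrDr mulr1 -addrA lerDl !addr_ge0// mulr_ge0// sqr_ge0. Qed.
Let ejY : 0 <= e * j ^+ 2 <= Y. Proof. by rewrite ej0 /Y addrA lerDr addr_ge0. Qed.
Let hvvY : 0 <= h * (1 + v ^+ 2) <= Y. Proof. by rewrite hv0 /Y lerDl addr_ge0. Qed.
Let aSY x : 0 <= x -> x <= S -> 0 <= (a + m) * x <= Y.
Proof.
move=> x0 xS; rewrite mulr_ge0 ?addr_ge0//=; apply: (@le_trans _ _ ((a + m) * S)).
  by rewrite ler_wpM2l ?addr_ge0.
by rewrite /Y addrCA lerDl addr_ge0.
Qed.
Let amY x y : 0 <= x -> x <= S -> 0 <= y -> y <= a + m -> 0 <= y * x <= Y.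
Proof.
move=> x0 xS y0 ya; rewrite mulr_ge0//=; have /andP[_] := aSY x0 xS.
by apply: le_trans; rewrite ler_wpM2r.
Qed.
Let aam : a <= a + m. Proof. by rewrite lerDl. Qed.
Let mam : m <= a + m. Proof. by rewrite lerDr. Qed.
Let rS : r ^+ 2 <= S. Proof. by have := sqr_ge0 j; have := sqr_ge0 t; rewrite /S; lra. Qed.
Let D2 : 0 <= A * D ^+ 2. Proof. by rewrite mulr_ge0// sqr_ge0. Qed.

Lemma face_flow_jump x : x ^+ 2 <= S -> h * (a + m) * x <= (1 + A * (1 + c)) * D * Y.
Proof.
move=> xS; apply: (@sqr_interpolation _ _ _ (h * (1 + v ^+ 2)) ((a + m) * x ^+ 2)) => //.
- by rewrite mulr_ge0// addr_ge0.
- by apply: aSY => //; exact: sqr_ge0.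
have : a + m <= (1 + c) * (1 + v ^+ 2).
  have /andP[_ av] := am; have /andP[_ m1] := mc.
  by have h1 := sqr_ge0 (v - 1); have h2 := mulr_ge0 c0 (sqr_ge0 v); nra.
move=> le1; rewrite -subr_ge0.
rewrite (_ : _ - _ = h * ((a + m) * x ^+ 2) * (A * D ^+ 2 * ((1 + c) * (1 + v ^+ 2)) - h * (a + m))); last by ring.
apply: mulr_ge0; first by rewrite ?(sqr_ge0, mulr_ge0, addr_ge0).
by rewrite subr_ge0; apply: ler_pM; rewrite ?addr_ge0.
Qed.

Lemma face_jump x : x ^+ 2 <= S -> h * x <= (1 + A) * D * Y.
Proof.
move=> xS; apply: (@sqr_interpolation _ _ _ h (m * x ^+ 2)) => //.
  by apply: amY => //; exact: sqr_ge0.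
rewrite -subr_ge0 (_ : _ - _ = h * x ^+ 2 * (A * D ^+ 2 * m - h)); last by ring.
by apply: mulr_ge0; [rewrite ?(sqr_ge0, mulr_ge0)|rewrite subr_ge0].
Qed.

Lemma face_visc_jump : h * m * v * r <= (1 + c * A) * D * Y.
Proof.
apply: (@sqr_interpolation _ _ _ (h * v ^+ 2) (m * r ^+ 2)) => //; first by rewrite mulr_ge0.
  by apply: amY => //; exact: sqr_ge0.
rewrite -subr_ge0 (_ : _ - _ = h * v ^+ 2 * (m * r ^+ 2) * (c * (A * D ^+ 2) - m * h)); last by ring.
have /andP[_ m1] := mc.
by apply: mulr_ge0; [rewrite ?(sqr_ge0, mulr_ge0)|rewrite subr_ge0 ler_pM].
Qed.

Lemma face_vel_jump : h * j * v <= (1 + A) * D * Y.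
Proof.
apply: (@sqr_interpolation _ _ _ (h * v ^+ 2) (e * j ^+ 2)) => //.
rewrite -subr_ge0 (_ : _ - _ = h * v ^+ 2 * j ^+ 2 * (A * D ^+ 2 * e - h)); last by ring.
by apply: mulr_ge0; [rewrite ?(sqr_ge0, mulr_ge0)|rewrite subr_ge0].
Qed.

Lemma face_stress : h * e * j <= (1 + A) * D * Y.
Proof.
apply: (@sqr_interpolation _ _ _ h (e * j ^+ 2)) => //.
rewrite -subr_ge0 (_ : _ - _ = h * (e * j ^+ 2) * (A * D ^+ 2 - h * e)); last by ring.
by apply: mulr_ge0; [rewrite ?(sqr_ge0, mulr_ge0)|rewrite subr_ge0].
Qed.

(** The only bound that asks for a small [h * v], which holds between slow cells. *)
Lemma face_slow (B : R) : 0 <= B -> h * v <= B * D ^+ 2 -> h * a * v * r <= (1 + B) * D * Y.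
Proof.
move=> B0 hvB; apply: (@sqr_interpolation _ _ _ (h * v ^+ 2) (a * r ^+ 2)) => //.
  by apply: amY => //; exact: sqr_ge0.
have /andP[_ av] := am.
rewrite -subr_ge0 (_ : _ - _ = h * v ^+ 2 * (a * r ^+ 2) * (B * D ^+ 2 - h * a)); last by ring.
apply: mulr_ge0; [by rewrite ?(sqr_ge0, mulr_ge0)|rewrite subr_ge0].
apply: le_trans hvB; exact: ler_wpM2l.
Qed.

(** For [q] the length of the shifts: j v is comparable to the jump of |u|^2, and q^2 has to beat e
    h = h^alpha by a factor D^2. *)
Lemma face_energy_jump (q : R) : 0 <= q -> q ^+ 2 <= A * D ^+ 2 * (e * h) -> q * (j * v) <= (1 + A) * D * Y.
Proof.
move=> q0 qe; apply: (@sqr_interpolation _ _ _ (h * v ^+ 2) (e * j ^+ 2)) => //.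
rewrite -subr_ge0 (_ : _ - _ = v ^+ 2 * j ^+ 2 * (A * D ^+ 2 * (e * h) - q ^+ 2)); last by ring.
by apply: mulr_ge0; [rewrite ?(sqr_ge0, mulr_ge0)|rewrite subr_ge0].
Qed.

End Face.

End Interpolation.

(** The estimates come from derivatives and hold at interior times only; a primitive of [g] touches
    itself with slope at least [f], so that Dini's criterion applies. *)
Lemma le_ig_interior {R : realType} (T : R) (f g : R -> R) : 0 < T -> ct T f -> ct T g ->
  (forall t, 0 < t < T -> f t <= g t) -> ig 0 T f <= ig 0 T g.
Proof.
move=> T0 cf cg fg; have cG := ig_continuous (ltW T0) cg.
have := @touch_increment _ T (fun t => ig 0 t g) f T0 cG cf _ T.
rewrite ig_set1 subr0; apply; last by rewrite lexx ltW.
move=> t tT; exists (fun t => ig 0 t g), (g t); split=> //; last exact: fg.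
exact: (ig_is_derive tT cg).
Qed.

(** * The scheme and its entropy balance *)

Section RealDerivatives.
Context {R : realType}.
Implicit Types (f g : R -> R) (t : R).

Lemma isdD f g t a b : is_derive t 1 f a -> is_derive t 1 g b ->
  is_derive t 1 (fun x => f x + g x) (a + b).
Proof. by move=> df dg; exact: (is_deriveD df dg). Qed.

Lemma isdB f g t a b : is_derive t 1 f a -> is_derive t 1 g b ->
  is_derive t 1 (fun x => f x - g x) (a - b).
Proof. by move=> df dg; exact: (is_deriveB df dg). Qed.

Lemma isdM f g t (a b : R) : is_derive t 1 f a -> is_derive t 1 g b ->
  is_derive t 1 (fun x => f x * g x) (a * g t + f t * b).
Proof.
move=> df dg; have := is_deriveM df dg.
by rewrite /GRing.scale /= addrC (mulrC (g t)).
Qed.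

Lemma isdC (c t : R) : is_derive t 1 (fun=> c) (0 : R).
Proof. exact: is_derive_cst. Qed.

Lemma isdZ f t (c a : R) : is_derive t 1 f a -> is_derive t 1 (fun x => c * f x) (c * a).
Proof. by move=> df; have := isdM (isdC c t) df; rewrite mul0r add0r. Qed.

Lemma isd_sum (I : Type) (r : seq I) (F : I -> R -> R) (dF : I -> R) t :
  (forall i, is_derive t 1 (F i) (dF i)) ->
  is_derive t 1 (fun x => \sum_(i <- r) F i x) (\sum_(i <- r) dF i).
Proof.
move=> dFi; elim: r => [|i r IH].
  by rewrite big_nil; under eq_fun do rewrite big_nil; exact: isdC.
by rewrite big_cons; under eq_fun do rewrite big_cons; exact: isdD.
Qed.

Lemma isd_comp (f g : R -> R) t (a b : R) : is_derive t 1 f a -> is_derive (f t) 1 g b ->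
  is_derive t 1 (fun x => g (f x)) (b * a).
Proof. by move=> df dg; have := is_derive1_comp dg df. Qed.

Lemma isd_ln f t (a : R) : 0 < f t -> is_derive t 1 f a ->
  is_derive t 1 (fun x => ln (f x)) (a / f t).
Proof. by move=> f0 df; rewrite mulrC; apply: (isd_comp df); exact: is_derive1_ln. Qed.

Lemma isdV f t (a : R) : f t != 0 -> is_derive t 1 f a ->
  is_derive t 1 (fun x => (f x)^-1) (- (f t) ^- 2 * a).
Proof. by move=> f0 df; have := is_deriveV f0 df. Qed.

Lemma derivable_isd f t : derivable f t 1 -> is_derive t 1 f (derive1 f t).
Proof. by move=> df; apply: DeriveDef => //; rewrite derive1E. Qed.

End RealDerivatives.

Section Solution.
Context {R : realType} {n : nat}.
Variables (gamma alpha h T : R) (Om : set 'rV[R]_n) (M : mesh R n).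
Variables (mu : face M -> R -> R) (U0 : state M) (U : R -> state M).
Variable L : elt M -> seq 'rV[R]_n.
Hypothesis gamma1 : 1 < gamma.
Hypothesis T0 : 0 < T.
Hypothesis hOm : polyhedral_domain Om.
Hypothesis cM : conforming_mesh Om M.
Hypothesis LP : forall K, polyh (cell K) (L K).
Hypothesis vol0 : forall K : elt M, 0 < cvol K.
Hypothesis mu0 : forall s t, t \in `[0, T] -> 0 <= mu s t.
Hypothesis mu_ct : forall s, ct T (mu s).
Hypothesis sol : fv_solution gamma Om alpha h T mu U0 U.

Let OmO : Om = interior (closure Om). Proof. by have [_ _ _] := hOm. Qed.

Let in_cc (t : R) : 0 < t < T -> t \in `[0, T].
Proof. by rewrite in_itv /= => /andP[h1 h2]; rewrite !ltW. Qed.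

Notation rho t K := (dens (U t) K).
Notation u t := (vel (U t)).
Notation p t := (pres gamma (U t)).
Notation th t := (temp gamma (U t)).
Notation ent t := (entropy gamma (U t)).
Notation cv := ((gamma - 1)^-1).
Notation eps := (h `^ (alpha - 1)).

Let g1 : 0 < gamma - 1. Proof. by rewrite subr_gt0. Qed.

Definition nvel t (s : face M) : R := dot (avgv (u t) s) (nrm s).
(** With [inflow], the rates that write the numerical flux as outflow times the inner trace minus
    inflow times the outer trace. Upwinding and viscosity make both nonnegative, on which the sign
    of the entropy production rests. *)
Definition outflow t s : R := (`|nvel t s| + nvel t s) / 2 + mu s t.
Definition inflow t s : R := (`|nvel t s| - nvel t s) / 2 + mu s t.

Lemma flow_sub t s : outflow t s - inflow t s = nvel t s.
Proof. by rewrite /outflow /inflow; field. Qed.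

Lemma outflow_ge0 t s : t \in `[0, T] -> 0 <= outflow t s.
Proof.
move=> tT; rewrite addr_ge0 ?mu0// divr_ge0//.
by have := ler_norm (- nvel t s); rewrite normrN; lra.
Qed.

Lemma inflow_ge0 t s : t \in `[0, T] -> 0 <= inflow t s.
Proof.
move=> tT; rewrite addr_ge0 ?mu0// divr_ge0//.
by have := ler_norm (nvel t s); lra.
Qed.

Lemma flux_split t (r : elt M -> R) (s : face M) :
  flux (mu^~ t) r (u t) s = outflow t s * r (ein s) - inflow t s * r (eout s).
Proof. by rewrite /flux /upwind /avg /jump -/(nvel t s) /outflow /inflow; field. Qed.

Lemma fluxv_split t (m : elt M -> 'rV[R]_n) (s : face M) :
  fluxv (mu^~ t) m (u t) s = outflow t s *: m (ein s) - inflow t s *: m (eout s).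
Proof. by apply/rowP => i; rewrite !mxE flux_split. Qed.

Lemma rho_gt0 t K : t \in `[0, T] -> 0 < rho t K.
Proof. by case: sol => _ + _ _ _ tT => /(_ t K tT)[]. Qed.

Lemma p_gt0 t K : t \in `[0, T] -> 0 < p t K.
Proof. by case: sol => _ + _ _ _ tT => /(_ t K tT)[]. Qed.

Lemma th_gt0 t K : t \in `[0, T] -> 0 < th t K.
Proof. by move=> tT; rewrite divr_gt0 ?p_gt0 ?rho_gt0. Qed.

Lemma u_no_flux t : t \in `[0, T] -> no_flux Om (u t).
Proof. by case: sol => _ _ + _ _; apply. Qed.

Lemma presE t K : t \in `[0, T] -> p t K = rho t K * th t K.
Proof. by move=> tT; rewrite /temp mulrC divfK// gt_eqF// rho_gt0. Qed.

Lemma momE t K : t \in `[0, T] -> mom (U t) K = rho t K *: u t K.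
Proof. by move=> tT; rewrite /vel scalerA mulfV ?scale1r// gt_eqF// rho_gt0. Qed.

Lemma enerE t K : t \in `[0, T] ->
  ener (U t) K = rho t K * (2^-1 * dot (u t K) (u t K) + cv * th t K).
Proof.
move=> tT; have r0 := rho_gt0 K tT.
rewrite (_ : _ * _ = rho t K * (2^-1 * dot (u t K) (u t K)) + cv * (rho t K * th t K)); last by ring.
rewrite -presE// /pres (momE K tT) !(dotZl, dotZr); field.
by rewrite !gt_eqF.
Qed.

Lemma entE t K : t \in `[0, T] -> ent t K = cv * ln (th t K) - ln (rho t K).
Proof.
move=> tT; rewrite /entropy ln_div ?ln_powR// posrE ?rho_gt0//.
by rewrite powR_gt0// th_gt0.
Qed.

Lemma rho_ct K : ct T (fun t => rho t K).
Proof. by case: sol => _ _ _ /(_ K)[]. Qed.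

Lemma mom_ct K i : ct T (fun t => mom (U t) K 0 i).
Proof. by case: sol => _ _ _ /(_ K)[_ + _] _; apply. Qed.

Lemma ener_ct K : ct T (fun t => ener (U t) K).
Proof. by case: sol => _ _ _ /(_ K)[]. Qed.

Lemma rhoV_ct K : ct T (fun t => (rho t K)^-1).
Proof. by apply: ctV; [exact: rho_ct|move=> t tT; rewrite gt_eqF ?rho_gt0]. Qed.

Lemma u_ct K i : ct T (fun t => u t K 0 i).
Proof.
apply: (@eq_ct _ _ (fun t => (rho t K)^-1 * mom (U t) K 0 i)); first by move=> t _; rewrite mxE.
by apply: ctM; [exact: rhoV_ct|exact: mom_ct].
Qed.

Lemma dot_ct (f g : R -> 'rV[R]_n) : (forall i, ct T (fun t => f t 0 i)) ->
  (forall i, ct T (fun t => g t 0 i)) -> ct T (fun t => dot (f t) (g t)).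
Proof. by move=> cf cg; apply: ct_sum => i; exact: ctM. Qed.

Lemma p_ct K : ct T (fun t => p t K).
Proof.
apply: ctM; first exact: ct_cst.
apply: ctB; first exact: ener_ct.
apply: ctM; last exact: rhoV_ct.
by apply: ctM; [exact: ct_cst|apply: dot_ct; exact: mom_ct].
Qed.

Lemma th_ct K : ct T (fun t => th t K).
Proof. by apply: ctM; [exact: p_ct|exact: rhoV_ct]. Qed.

Lemma ent_ct K : ct T (fun t => ent t K).
Proof.
apply: (@eq_ct _ _ (fun t => cv * ln (th t K) - ln (rho t K))).
  by move=> t tT; rewrite entE.
apply: ctB; first apply: ctM; first exact: ct_cst.
  by apply: (@ct_comp _ _ _ (@ln R)); [exact: th_ct|move=> t tT; exact/continuous_ln/th_gt0].
by apply: (@ct_comp _ _ _ (@ln R)); [exact: rho_ct|move=> t tT; exact/continuous_ln/rho_gt0].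
Qed.

Lemma nvel_ct s : ct T (fun t => nvel t s).
Proof.
apply: dot_ct => i; last exact: ct_cst.
apply: (@eq_ct _ _ (fun t => 2^-1 * (u t (ein s) 0 i + u t (eout s) 0 i))).
  by move=> t _; rewrite !mxE.
by apply: ctM; [exact: ct_cst|apply: ctD; exact: u_ct].
Qed.

Lemma outflow_ct s : ct T (fun t => outflow t s).
Proof.
apply: ctD; last exact: mu_ct.
by apply: ctM; [apply: ctD; [apply: ct_norm|]; exact: nvel_ct|exact: ct_cst].
Qed.

Lemma inflow_ct s : ct T (fun t => inflow t s).
Proof.
apply: ctD; last exact: mu_ct.
by apply: ctM; [apply: ctB; [apply: ct_norm|]; exact: nvel_ct|exact: ct_cst].
Qed.

Lemma flux_ct (r : R -> elt M -> R) s : (forall K, ct T (r^~ K)) ->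
  ct T (fun t => flux (mu^~ t) (r t) (u t) s).
Proof.
move=> rc; apply: (@eq_ct _ _ (fun t => outflow t s * r t (ein s) - inflow t s * r t (eout s))).
  by move=> t _; rewrite flux_split.
by apply: ctB; apply: ctM => //; [exact: outflow_ct|exact: inflow_ct].
Qed.

(* [X], [k] and [P] are the values on the cells of [chi s], of a supergradient of [chi] at [s] and
   of the test function. *)
Definition production (X k P : elt M -> R) t (s : face M) : R :=
  let i := ein s in let o := eout s in
  let b K := P K * k K / th t K in
  let J := dot (jumpv (u t) s) (jumpv (u t) s) in
  outflow t s * rel_prod cv (rho t i) (rho t o) (X i) (X o) (P o) (b o) (th t i) (th t o) J
  + inflow t s * rel_prod cv (rho t o) (rho t i) (X o) (X i) (P i) (b i) (th t o) (th t i) J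
  + eps * ((b i + b o) / 2 * J).

Section At.
Variable t : R.
Hypothesis tT : 0 < t < T.

Let tcc : t \in `[0, T]. Proof. exact: in_cc. Qed.
Let atT : t \in `]0, T[. Proof. by rewrite in_itv. Qed.

Lemma rho_derive K : is_derive t 1 (fun t' => rho t' K) (ddt_dens U t K).
Proof. by case: sol => _ _ _ _ /(_ t atT)[/(_ K)[dr _ _] _]; exact: derivable_isd. Qed.

Lemma mom_derive K i : is_derive t 1 (fun t' => mom (U t') K 0 i) (ddt_mom U t K 0 i).
Proof.
case: sol => _ _ _ _ /(_ t atT)[/(_ K)[_ /(_ i) dm _] _].
by rewrite mxE; exact: derivable_isd.
Qed.

Lemma ener_derive K : is_derive t 1 (fun t' => ener (U t') K) (ddt_ener U t K).
Proof. by case: sol => _ _ _ _ /(_ t atT)[/(_ K)[_ _ dE] _]; exact: derivable_isd. Qed.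

Lemma continuity_eq (Phi : elt M -> R) :
  \sum_K cvol K * (ddt_dens U t K * Phi K) =
  \sum_s farea_s s * ((outflow t s * rho t (ein s) - inflow t s * rho t (eout s)) * jump Phi s).
Proof.
case: sol => _ _ _ _ /(_ t atT)[_ [eC _ _]].
have := eC Phi; rewrite (intO_cst LP) (intSE LP cM) => /eqP; rewrite subr_eq0 => /eqP ->.
by apply: eq_bigr => s _; rewrite flux_split.
Qed.

Lemma momentum_eq (Phi : elt M -> 'rV[R]_n) : no_flux Om Phi ->
  \sum_K cvol K * dot (ddt_mom U t K) (Phi K) =
  \sum_s farea_s s * (dot (outflow t s *: mom (U t) (ein s) - inflow t s *: mom (U t) (eout s))
      (jumpv Phi s) + avg (p t) s * dot (nrm s) (jumpv Phi s)
      - eps * dot (jumpv (u t) s) (jumpv Phi s)).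
Proof.
move=> nf; case: sol => _ _ _ _ /(_ t atT)[_ [_ eM _]].
have := eM Phi nf; rewrite (intO_cst LP) !(intSE LP cM) => E.
rewrite -[LHS](subrK (\sum_s farea_s s * dot (fluxv (mu^~ t) (mom (U t)) (u t) s) (jumpv Phi s))).
rewrite -[X in X + _](subrK (\sum_s farea_s s * (avg (p t) s * dot (nrm s) (jumpv Phi s)))).
rewrite E mulNr mulr_sumr -sumrN -!big_split /=; apply: eq_bigr => s _.
by rewrite fluxv_split; ring.
Qed.

Lemma energy_eq (Phi : elt M -> R) :
  \sum_K cvol K * (ddt_ener U t K * Phi K) =
  \sum_s farea_s s * ((outflow t s * ener (U t) (ein s) - inflow t s * ener (U t) (eout s)) * jump Phi s
     + avg (p t) s * dot (jumpv (fun K => Phi K *: u t K) s) (nrm s)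
     - avg (fun K => p t K * Phi K) s * dot (jumpv (u t) s) (nrm s)
     - eps * (dot (jumpv (u t) s) (avgv (u t) s) * jump Phi s)).
Proof.
case: sol => _ _ _ _ /(_ t atT)[_ [_ _ eE]].
have := eE Phi; rewrite (intO_cst LP) !(intSE LP cM); set X := \sum_K _.
set Y := \sum_s _; set Z := \sum_s _; set V := \sum_s _; set W := \sum_s _ => E.
have -> : X = Y + Z - V - eps * W by lra.
rewrite /Y /Z /V /W mulr_sumr -!sumrN -!big_split /=; apply: eq_bigr => s _.
by rewrite flux_split; ring.
Qed.

(** Green's formula for the constant 1. Such vanishing sums supply the terms that complete the face
    identities below. *)
Lemma no_flux_sum (a : elt M -> 'rV[R]_n) : no_flux Om a ->
  \sum_s farea_s s * dot (jumpv a s) (nrm s) = 0.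
Proof.
move=> nf; under eq_bigr do rewrite mulrC.
rewrite (mesh_green1 OmO cM LP) big1// => K _; rewrite big_seq_cond big1// => v.
by move=> /andP[/(mem_facets (LP K)) vK /asboolP vb]; rewrite nf ?mul0r.
Qed.

Lemma p_derive K : is_derive t 1 (fun t' => p t' K)
  ((gamma - 1) * (ddt_ener U t K - dot (u t K) (ddt_mom U t K) + 2^-1 * dot (u t K) (u t K) * ddt_dens U t K)).
Proof.
have r0 : rho t K != 0 by rewrite gt_eqF// rho_gt0.
have d1 : is_derive t 1 (fun t' => dot (mom (U t') K) (mom (U t') K))
    (\sum_i (ddt_mom U t K 0 i * mom (U t) K 0 i + mom (U t) K 0 i * ddt_mom U t K 0 i)).
  by apply: isd_sum => i; apply: isdM; exact: mom_derive.
have := isdZ (gamma - 1) (isdB (ener_derive K) (isdM (isdZ 2^-1 d1) (isdV r0 (rho_derive K)))).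
set e := (X in is_derive _ _ _ X -> _); set e' := (X in _ -> is_derive _ _ _ X); suff -> : e = e' by [].
have E : \sum_i (ddt_mom U t K 0 i * mom (U t) K 0 i + mom (U t) K 0 i * ddt_mom U t K 0 i) =
    2 * rho t K * dot (u t K) (ddt_mom U t K).
  rewrite mulr_sumr; apply: eq_bigr => i _; rewrite (momE K tcc) !mxE.
  by move: (derive1 _ _) => *; ring.
rewrite /e /e' E (momE K tcc) dotZl dotZr; field; exact: r0.
Qed.

Lemma ent_derive K : exists2 ds : R, is_derive t 1 (fun t' => ent t' K) ds &
  rho t K * ds = (ddt_ener U t K - dot (u t K) (ddt_mom U t K)
     + 2^-1 * dot (u t K) (u t K) * ddt_dens U t K) / th t K - (cv + 1) * ddt_dens U t K.
Proof.
have r0 := rho_gt0 K tcc; have p0 := p_gt0 K tcc.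
have d := isdB (isdZ cv (isd_ln (f := fun t' => p t' K) p0 (p_derive K))) (isdZ (cv + 1) (isd_ln (f := fun t' => rho t' K) r0 (rho_derive K))).
eexists.
  apply: (@near_eq_is_derive _ R^o R^o) d.
  apply: filterS (near_in_itvoo atT) => t' /= t'T.
  have t'cc : t' \in `[0, T] by apply: in_cc; rewrite in_itv in t'T.
  rewrite entE// /temp ln_div ?posrE ?p_gt0 ?rho_gt0//; ring.
by rewrite /temp; field; rewrite !gt_eqF.
Qed.

(** The equations are tested with [P] times the derivatives of rho chi(s) with respect to density,
    momentum and energy. The momentum test function is a multiple of the velocity on each cell,
    hence admissible at the boundary. *)
Lemma entropy_eq (X k P : elt M -> R) :
  let b K := P K * k K / th t K in
  \sum_K cvol K * (ddt_dens U t K * (P K * X K + b K * (2^-1 * dot (u t K) (u t K) - (cv + 1) * th t K))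
     + dot (ddt_mom U t K) (- (b K *: u t K)) + ddt_ener U t K * b K) =
  \sum_s farea_s s * (flux (mu^~ t) (fun K => rho t K * X K) (u t) s * jump P s + production X k P t s).
Proof.
move=> b; have nf : no_flux Om (fun K => - (b K *: u t K)).
  by move=> K v Kv; rewrite dotNl dotZl (u_no_flux tcc) ?mulr0 ?oppr0.
have nf2 : no_flux Om (fun K => (b K * th t K * rho t K) *: u t K).
  by move=> K v Kv; rewrite dotZl (u_no_flux tcc) ?mulr0.
rewrite (eq_bigr _ (fun K _ => mulrDr _ _ _)) big_split /=.
rewrite (eq_bigr _ (fun K _ => mulrDr _ _ _)) big_split /=.
rewrite continuity_eq momentum_eq// energy_eq.
(* Accounts for the last term of [entropy_face], the normal jump of [b * theta * rho * u]. *)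
rewrite -[RHS]subr0 -[X in _ = _ - X](no_flux_sum nf2) -sumrB -!big_split /=.
apply: eq_bigr => s _; rewrite -!mulrDr -mulrBr; congr (_ * _).
rewrite flux_split /production /jump /jumpv /avg /avgv !(momE _ tcc) !(presE _ tcc) !(enerE _ tcc).
have AB : outflow t s - inflow t s = dot (2^-1 *: (u t (ein s) + u t (eout s))) (nrm s).
  exact: flow_sub.
have := @entropy_face R n _ _ eps cv (rho t (ein s)) (rho t (eout s)) (X (ein s)) (X (eout s))
  (P (ein s)) (P (eout s)) (b (ein s)) (b (eout s)) (th t (ein s)) (th t (eout s))
  (u t (ein s)) (u t (eout s)) (nrm s) AB.
move=> /= E; refine (etrans _ (etrans E _)); first by ring.
by [].
Qed.

Lemma production_ge0 (chi kap : R -> R) (P : elt M -> R) s : supergradient chi kap ->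
  (forall K, 0 <= P K) ->
  0 <= production (fun K => chi (ent t K)) (fun K => kap (ent t K)) P t s.
Proof.
move=> sg P0; have cv0 : 0 <= cv by rewrite invr_ge0 ltW.
have kx x : 0 <= kap x by have [] := sg x.
have ky x y : chi y <= chi x + kap x * (y - x) by have [_] := sg x.
have J0 := dotxx_ge0 (jumpv (u t) s).
have rp i o : 0 <= rel_prod cv (rho t i) (rho t o) (chi (ent t i)) (chi (ent t o)) (P o)
    (P o * kap (ent t o) / th t o) (th t i) (th t o) (dot (jumpv (u t) s) (jumpv (u t) s)).
  apply: (rel_prod_ge0 cv0 _ _ _ _ _ _ _ (entE i tcc) (entE o tcc)) => //;
    by [exact: rho_gt0|exact: th_gt0].
have tk i : 0 <= P i * kap (ent t i) / th t i.
  by apply: divr_ge0; [exact: mulr_ge0|exact/ltW/th_gt0].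
by rewrite /production !addr_ge0// ?mulr_ge0 ?outflow_ge0 ?inflow_ge0 ?powR_ge0// addr_ge0.
Qed.

End At.

(* [chi] need not be differentiable: at time [t0] its values along the solution are dominated by the
   affine function of slope [kap] touching it, to which [touch_increment] applies. *)
Lemma entropy_balance (chi kap : R -> R) (P dP : R -> elt M -> R) (D : R -> R) :
  supergradient chi kap -> (forall K, ct T (P^~ K)) -> (forall K, ct T (dP^~ K)) ->
  (forall t K, 0 < t < T -> is_derive t 1 (P^~ K) (dP t K)) ->
  (forall t K, t \in `[0, T] -> 0 <= P t K) -> ct T D ->
  (forall t, 0 < t < T -> D t <= \sum_s farea_s s *
     production (fun K => chi (ent t K)) (fun K => kap (ent t K)) (P t) t s) ->
  let f t := \sum_K cvol K * (rho t K * chi (ent t K) * P t K) in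
  forall t, t \in `[0, T] ->
  ig 0 t (fun t => \sum_K cvol K * (rho t K * chi (ent t K) * dP t K)
     + \sum_s farea_s s * (flux (mu^~ t) (fun K => rho t K * chi (ent t K)) (u t) s * jump (P t) s)
     + D t) <= f t - f 0.
Proof.
move=> sg cP cdP dPE P0 cD hD f t tT.
have cX K : ct T (fun t => chi (ent t K)).
  by apply: ct_comp; [exact: ent_ct|move=> x _; exact: (supergradient_continuous sg)].
have crX K : ct T (fun t => rho t K * chi (ent t K)) by apply: ctM => //; exact: rho_ct.
apply: (touch_increment T0) => //.
- by apply: ct_sum => K; apply: ctM; [exact: ct_cst|apply: ctM].
- apply: ctD => //; apply: ctD.
    by apply: ct_sum => K; apply: ctM; [exact: ct_cst|apply: ctM].
  apply: ct_sum => s; apply: ctM; first exact: ct_cst.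
  apply: ctM; first exact: (flux_ct (r := fun t K => rho t K * chi (ent t K))).
  by apply: ctB; exact: cP.
move=> t0 t0T; have t0c := in_cc t0T.
have /choice[ds dsP] : forall K, exists ds : R, is_derive t0 1 (fun t' => ent t' K) ds /\
    rho t0 K * ds = (ddt_ener U t0 K - dot (u t0 K) (ddt_mom U t0 K)
     + 2^-1 * dot (u t0 K) (u t0 K) * ddt_dens U t0 K) / th t0 K - (cv + 1) * ddt_dens U t0 K.
  by move=> K; have [ds h1 h2] := ent_derive t0T K; exists ds.
pose Lf t' := \sum_K cvol K * (rho t' K * (chi (ent t0 K) + kap (ent t0 K) * (ent t' K - ent t0 K)) * P t' K).
exists Lf.
have dL : is_derive t0 1 Lf (\sum_K cvol K *
   ((ddt_dens U t0 K * (chi (ent t0 K) + kap (ent t0 K) * (ent t0 K - ent t0 K))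
     + rho t0 K * (0 + kap (ent t0 K) * (ds K - 0))) * P t0 K
    + rho t0 K * (chi (ent t0 K) + kap (ent t0 K) * (ent t0 K - ent t0 K)) * dP t0 K)).
  apply: isd_sum => K; apply: isdZ; apply: isdM; last exact: dPE.
  apply: isdM; first exact: rho_derive.
  exact: (isdD (isdC _ _) (isdZ _ (isdB (proj1 (dsP K)) (isdC _ _)))).
eexists; split; first exact: dL.
- have := entropy_eq t0T (fun K => chi (ent t0 K)) (fun K => kap (ent t0 K)) (P t0).
  rewrite (eq_bigr _ (fun s _ => mulrDr _ _ _)) big_split /= => E.
  apply: (@le_trans _ _ (\sum_K cvol K * (rho t0 K * chi (ent t0 K) * dP t0 K) +
     (\sum_s farea_s s * (flux (mu^~ t0) (fun K => rho t0 K * chi (ent t0 K)) (u t0) s * jump (P t0) s) +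
      \sum_s farea_s s * production (fun K => chi (ent t0 K)) (fun K => kap (ent t0 K)) (P t0) t0 s))).
    by rewrite -addrA lerD2l lerD2l; exact: hD.
  rewrite -E -big_split /= le_eqVlt; apply/orP; left; apply/eqP; apply: eq_bigr => K _.
  have [_ dE] := dsP K; rewrite -mulrDr; congr (_ * _).
  rewrite (_ : rho t0 K * (0 + kap (ent t0 K) * (ds K - 0)) = kap (ent t0 K) * (rho t0 K * ds K)); last by ring.
  rewrite dE subrr mulr0 addr0 dotNr dotZr (dotC (ddt_mom _ _ _)).
  by have t1 := th_gt0 K t0c; field; rewrite !gt_eqF.
- by apply: eq_bigr => K _; rewrite subrr mulr0 addr0.
- move=> t' t'T; have t'c := in_cc t'T; apply: ler_sum => K _.
  rewrite ler_wpM2l ?(ltW (vol0 K))// ler_wpM2r ?P0// ler_wpM2l ?(ltW (rho_gt0 K t'c))//.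
  by have [_] := sg (ent t0 K).
Qed.

Lemma mass_cons t : t \in `[0, T] -> \sum_K cvol K * rho t K = \sum_K cvol K * rho 0 K.
Proof.
move=> tT; have cf : ct T (fun t => \sum_K cvol K * rho t K).
  by apply: ct_sum => K; apply: ctM; [exact: ct_cst|exact: rho_ct].
apply/eqP; rewrite -subr_eq0; apply/eqP.
suff d x : 0 < x < T -> is_derive x 1 (fun t => \sum_K cvol K * rho t K) 0.
  by have := ct_ftc (@ct_cst R T 0) cf d tT; rewrite ig_cst ?mul0r//; move: tT; rewrite in_itv => /andP[].
move=> xT; have := isd_sum (index_enum (elt M)) (fun K => isdZ (cvol K) (rho_derive xT K)).
have := continuity_eq xT (fun=> 1); rewrite [X in _ = X]big1 => [|s _]; last first.
  by rewrite /jump subrr !mulr0.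
by under eq_bigr do rewrite mulr1; move=> ->.
Qed.

Lemma energy_cons t : t \in `[0, T] -> \sum_K cvol K * ener (U t) K = \sum_K cvol K * ener (U 0) K.
Proof.
move=> tT; have cf : ct T (fun t => \sum_K cvol K * ener (U t) K).
  by apply: ct_sum => K; apply: ctM; [exact: ct_cst|exact: ener_ct].
apply/eqP; rewrite -subr_eq0; apply/eqP.
suff d x : 0 < x < T -> is_derive x 1 (fun t => \sum_K cvol K * ener (U t) K) 0.
  by have := ct_ftc (@ct_cst R T 0) cf d tT; rewrite ig_cst ?mul0r//; move: tT; rewrite in_itv => /andP[].
move=> xT; have := isd_sum (index_enum (elt M)) (fun K => isdZ (cvol K) (ener_derive xT K)).
have := energy_eq xT (fun=> 1); rewrite [X in _ = X]big1 => [|s _]; last first.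
  by rewrite /jump /jumpv /avg subrr !scale1r !mulr1; ring.
by under eq_bigr do rewrite mulr1; move=> ->.
Qed.

(** * Consistency errors *)

Section Residuals.
Variable d : R.
Hypothesis diam : forall (K : elt M) x y, cell K x -> cell K y -> enorm (x - y) <= d.
Implicit Types phi : C1fun T Om.

(** The first summand measures upwinding and viscosity, the second the jump of the normal velocity;
    the test function has been factored out. *)
Definition conv_defect (eta : elt M -> R) t : R :=
  \sum_s farea_s s * ((outflow t s + inflow t s) * `|jump eta s|
    + 2^-1 * `|dot (jumpv (u t) s) (nrm s)| * (`|eta (ein s)| + `|eta (eout s)|)).

(** Subtracting the vanishing sum of the normal jumps of eta psi u leaves only the differences
    between the cell values [psi] and the face values [f]. *)
Lemma conv_residual t (eta psi : elt M -> R) (f : face M -> R) (dl : R) : t \in `[0, T] ->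
  (forall s, `|psi (ein s) - f s| <= dl /\ `|psi (eout s) - f s| <= dl) ->
  `|\sum_s farea_s s * (flux (mu^~ t) eta (u t) s * jump psi s)
    + \sum_s dot (jumpv (fun K => eta K *: u t K) s) (nrm s) * (farea_s s * f s)|
  <= dl * conv_defect eta t.
Proof.
move=> tT hf.
have nf : no_flux Om (fun K => (eta K * psi K) *: u t K).
  by move=> K v Kv; rewrite dotZl (u_no_flux tT) ?mulr0.
rewrite -[X in `|X|]subr0 -[X in _ - X](no_flux_sum nf) -big_split /= -sumrB.
apply: le_trans (ler_norm_sum _ _ _) _; rewrite /conv_defect mulr_sumr; apply: ler_sum => s _.
have a0 := farea_s_gt0 cM LP s; have [fi fo] := hf s.
have A0 := outflow_ge0 s tT; have B0 := inflow_ge0 s tT.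
have AB : inflow t s = outflow t s - dot (2^-1 *: (u t (ein s) + u t (eout s))) (nrm s).
  by rewrite -[dot _ _](flow_sub t s) opprB addrC subrK.
set i := ein s in fi AB *; set o := eout s in fo AB *.
rewrite (_ : _ - _ = farea_s s *
   ((psi o - f s) * (- (outflow t s * jump eta s) + - 2^-1 * dot (jumpv (u t) s) (nrm s) * eta o)
   - (psi i - f s) * (- (inflow t s * jump eta s) + 2^-1 * dot (jumpv (u t) s) (nrm s) * eta i))); last first.
  rewrite flux_split /jump /jumpv -/i -/o AB; move: (u t i) (u t o) => ui uo.
  by rewrite !(dotBl, dotDl, dotZl); move: (dot ui _) (dot uo _) => *; field.
rewrite normrM gtr0_norm// mulrCA ler_wpM2l ?(ltW a0)//.
apply: le_trans (ler_normB _ _) _; rewrite !normrM.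
have dl0 : 0 <= dl by apply: le_trans fi.
have h2 : `|2^-1 : R| = 2^-1 by rewrite ger0_norm// invr_ge0.
apply: (@le_trans _ _ (dl * (outflow t s * `|jump eta s| + 2^-1 * `|dot (jumpv (u t) s) (nrm s)| * `|eta o|)
  + dl * (inflow t s * `|jump eta s| + 2^-1 * `|dot (jumpv (u t) s) (nrm s)| * `|eta i|))).
  apply: lerD; apply: ler_pM => //; apply: le_trans (ler_normD _ _) _.
    by rewrite normrN !normrM normrN (ger0_norm A0) h2.
  by rewrite normrN !normrM (ger0_norm B0) h2.
by rewrite -mulrDr ler_wpM2l// le_eqVlt; apply/orP; left; apply/eqP; ring.
Qed.

Definition face_avg (f : 'rV[R]_n -> R) (s : face M) : R := (farea_s s)^-1 * fint s f.

Lemma fint_avg f s : fint s f = farea_s s * face_avg f s.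
Proof. by rewrite /face_avg mulVKf// gt_eqF// (farea_s_gt0 cM LP). Qed.

Lemma cavg_point phi t (K : elt M) x : 0 < t < T -> cell K x ->
  `|cavg K (phi t) - phi t x| <= n%:R * d * C1norm phi.
Proof.
move=> tT Kx; apply: (cavg_close LP) => // [|y Ky].
  exact: (@cell_val_within _ _ _ _ _ cM phi t K (in_cc tT)).
exact: (c1_lipschitz T0 hOm cM LP diam phi tT Kx Ky).
Qed.

Lemma avg_close phi t s : 0 < t < T ->
  `|cavg (ein s) (phi t) - face_avg (phi t) s| <= n%:R * d * C1norm phi /\
  `|cavg (eout s) (phi t) - face_avg (phi t) s| <= n%:R * d * C1norm phi.
Proof.
move=> tT; have tc := in_cc tT; have a0 := farea_s_gt0 cM LP s.
have cw (K : elt M) : {within cell K, continuous (phi t)} by exact: (@cell_val_within _ _ _ _ _ cM phi t K tc).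
have close (K : elt M) x : cell K x -> `|phi t x - cavg K (phi t)| <= n%:R * d * C1norm phi.
  by move=> Kx; rewrite distrC; exact: cavg_point.
have main (c : R) : `|fint s (phi t) - c * farea_s s| <= n%:R * d * C1norm phi * farea_s s ->
    `|c - face_avg (phi t) s| <= n%:R * d * C1norm phi.
  rewrite fint_avg (_ : _ - _ = (face_avg (phi t) s - c) * farea_s s); last by ring.
  by rewrite normrM (gtr0_norm a0) ler_pM2r// distrC.
split; apply: main.
  apply: (face_rint_le (LP (ein s)) (nrm_unit cM s)) => // x [Kx _]; exact: close.
rewrite -(fint_out cM LP (s := s) (cw _) (cw _)) -(farea_out cM LP s).
apply: (face_rint_le (LP (eout s)) (nrmN_unit cM s)) => // x [Kx _]; exact: close.
Qed.

Lemma green_no_flux (a : elt M -> 'rV[R]_n) phi t : 0 < t < T -> no_flux Om a ->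
  \sum_K cint K (fun x => dot (a K) (c1_grad phi t x)) =
  - \sum_s dot (jumpv a s) (nrm s) * (farea_s s * face_avg (phi t) s).
Proof.
move=> tT nf; have tc := in_cc tT.
have G := @mesh_green _ _ _ _ OmO cM _ LP a (phi t) (c1_grad phi t)
  (fun K => @cell_val_within _ _ _ _ _ cM phi t K tc)
  (fun K i => @cell_grad_within _ _ _ _ _ cM phi t K i tc).
have dG (K : elt M) x i : sint (cell K) (L K) x -> is_derive x (delta_mx 0 i) (phi t) (c1_grad phi t x 0 i).
  by move=> Kx; apply: c1_gradE; [rewrite in_itv|exact: (sint_Om OmO cM LP Kx)].
rewrite /cint (G dG).
rewrite [X in _ + X]big1 ?addr0; first by under eq_bigr do rewrite fint_avg.
move=> K _; rewrite big_seq_cond big1// => v /andP[/(mem_facets (LP K)) vK /asboolP vb].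
by rewrite nf ?mul0r.
Qed.

(** The numerical convective term tested with cell averages minus the exact one: the error of the
    continuity equation for X = 1, and of the entropy inequality for X = chi(s). *)
Definition residual (X : elt M -> R) phi t : R :=
  \sum_s farea_s s * (flux (mu^~ t) (fun K => rho t K * X K) (u t) s * jump (fun K => cavg K (phi t)) s)
  - \sum_K X K * cint K (fun x => dot (mom (U t) K) (c1_grad phi t x)).

Lemma residual_le X phi t : 0 < t < T ->
  `|residual X phi t| <= n%:R * d * C1norm phi * conv_defect (fun K => rho t K * X K) t.
Proof.
move=> tT; have tc := in_cc tT.
have cg (K : elt M) i : {within cell K, continuous (fun x => c1_grad phi t x 0 i)}.
  exact: (@cell_grad_within _ _ _ _ _ cM phi t K i tc).
have nf : no_flux Om (fun K => (rho t K * X K) *: u t K).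
  by move=> K v Kv; rewrite dotZl (u_no_flux tc) ?mulr0.
have E K : X K * cint K (fun x => dot (mom (U t) K) (c1_grad phi t x)) =
    cint K (fun x => dot ((rho t K * X K) *: u t K) (c1_grad phi t x)).
  rewrite (cint_sum LP (index_enum _) (fun i => mom (U t) K 0 i) (cg K)).
  rewrite (cint_sum LP (index_enum _) (fun i => ((rho t K * X K) *: u t K) 0 i) (cg K)) mulr_sumr.
  by apply: eq_bigr => i _; rewrite (momE K tc) !mxE; ring.
rewrite /residual (eq_bigr _ (fun K _ => E K)) green_no_flux// opprK.
by apply: conv_residual => // s; exact: avg_close.
Qed.

End Residuals.

Section Balances.
Implicit Types phi : C1fun T Om.

Let cav_ct phi (K : elt M) : ct T (fun t => cavg K (phi t)).
Proof. by apply: ctM; [exact: ct_cst|exact: (@cint_val_continuous _ _ _ _ T0 _ cM _ LP phi K)]. Qed.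

Let cav_dt_ct phi (K : elt M) : ct T (fun t => cavg K (c1_dt phi t)).
Proof. by apply: ctM; [exact: ct_cst|exact: (@cint_dt_continuous _ _ _ _ T0 _ cM _ LP phi K)]. Qed.

Let cav_derive phi (K : elt M) (t : R) : 0 < t < T -> is_derive t 1 (fun t => cavg K (phi t)) (cavg K (c1_dt phi t)).
Proof. by move=> tT; apply: isdZ; exact: (cint_val_derive hOm cM LP phi K tT). Qed.

Let volcav (K : elt M) (f : 'rV[R]_n -> R) : cvol K * cavg K f = cint K f.
Proof. by rewrite /cavg mulVKf// gt_eqF. Qed.

Let grad_ct phi (K : elt M) : ct T (fun t => cint K (fun x => dot (mom (U t) K) (c1_grad phi t x))).
Proof.
apply: (@eq_ct _ _ (fun t => \sum_i mom (U t) K 0 i * cint K (fun x => c1_grad phi t x 0 i))).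
  move=> t tT; rewrite (cint_sum LP (index_enum _) (fun i => mom (U t) K 0 i))// => i.
  exact: (@cell_grad_within _ _ _ _ _ cM phi t K i tT).
apply: ct_sum => i; apply: ctM; first exact: mom_ct.
exact: (@cint_grad_continuous _ _ _ _ T0 _ cM _ LP phi K i).
Qed.

Lemma residual_ct (X : R -> elt M -> R) phi : (forall K, ct T (X^~ K)) ->
  ct T (fun t => residual (X t) phi t).
Proof.
move=> cX; apply: ctB; [apply: ct_sum => s|apply: ct_sum => K; exact: ctM].
apply: ctM; first exact: ct_cst.
apply: ctM; last by apply: ctB; exact: cav_ct.
by apply: (flux_ct (r := fun t K => rho t K * X t K)) => K; apply: ctM => //; exact: rho_ct.
Qed.

Lemma cell_bulk (a b : R) phi K t : t \in `[0, T] ->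
  cint K (fun x => a * c1_dt phi t x + b * dot (mom (U t) K) (c1_grad phi t x)) =
  a * (cvol K * cavg K (c1_dt phi t)) + b * cint K (fun x => dot (mom (U t) K) (c1_grad phi t x)).
Proof.
move=> tT; have c1 : {within cell K, continuous (c1_dt phi t)}.
  exact: (@cell_dt_within _ _ _ _ _ cM phi t K tT).
have c2 : {within cell K, continuous (fun x => dot (mom (U t) K) (c1_grad phi t x))}.
  move=> x; apply: cvg_sumr => i _; apply: cvgM; first exact: cvg_cst.
  exact: (@cell_grad_within _ _ _ _ _ cM phi t K i tT).
have cZ (c : R) (f : 'rV[R]_n -> R) : {within cell K, continuous f} ->
    {within cell K, continuous (fun x => c * f x)}.
  by move=> cf x; apply: cvgM; [exact: cvg_cst|exact: cf].
by rewrite (cintD LP (cZ a _ c1) (cZ b _ c2)) !(cintZ LP)// volcav.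
Qed.

Lemma mass_balance phi t : t \in `[0, T] ->
  \sum_K rho t K * cint K (phi t) - \sum_K rho 0 K * cint K (phi 0) =
  ig 0 t (fun t => \sum_K cint K (fun x => rho t K * c1_dt phi t x + dot (mom (U t) K) (c1_grad phi t x)))
  + ig 0 t (residual (fun=> 1) phi).
Proof.
move=> tT.
have E t' : t' \in `[0, T] ->
    \sum_K cint K (fun x => rho t' K * c1_dt phi t' x + dot (mom (U t') K) (c1_grad phi t' x)) =
    \sum_K (rho t' K * (cvol K * cavg K (c1_dt phi t')) + cint K (fun x => dot (mom (U t') K) (c1_grad phi t' x))).
  move=> t'T; apply: eq_bigr => K _; rewrite -[X in _ = _ + X]mul1r -cell_bulk//.
  by congr cint; apply/funext => x; rewrite mul1r.
have cB : ct T (fun t => \sum_K cint K (fun x => rho t K * c1_dt phi t x + dot (mom (U t) K) (c1_grad phi t x))).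
  apply: (@eq_ct _ _ (fun t' => \sum_K (rho t' K * (cvol K * cavg K (c1_dt phi t'))
      + cint K (fun x => dot (mom (U t') K) (c1_grad phi t' x))))) => [t' t'T|]; first by rewrite E.
  apply: ct_sum => K; apply: ctD => //; apply: ctM; first exact: rho_ct.
  by apply: ctM; [exact: ct_cst|].
have cR : ct T (residual (fun=> 1) phi) by apply: (residual_ct (X := fun _ _ => 1)) => K; exact: ct_cst.
rewrite -igD; [|exact: ct_itv cB|exact: ct_itv cR].
apply/esym; rewrite (@ct_ftc _ _ _ (fun t => \sum_K rho t K * cint K (phi t)) _ _ _ _ tT)//.
- exact: ctD.
- by apply: ct_sum => K; apply: ctM; [exact: rho_ct|exact: (@cint_val_continuous _ _ _ _ T0 _ cM _ LP phi K)].
move=> x xT; have xc := in_cc xT.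
have := isd_sum (index_enum (elt M)) (fun K => isdM (rho_derive xT K) (cint_val_derive hOm cM LP phi K xT)).
rewrite big_split /=; set e := (X in is_derive _ _ _ X -> _) => D.
suff <- : e = (\sum_K cint K (fun y => rho x K * c1_dt phi x y + dot (mom (U x) K) (c1_grad phi x y)) +
   residual (fun=> 1) phi x) by [].
rewrite /e E// /residual big_split /= [X in _ = _ + (_ - X)](_ : _ = \sum_K cint K (fun y => dot (mom (U x) K) (c1_grad phi x y))); last first.
  by apply: eq_bigr => K _; rewrite mul1r.
have := continuity_eq xT (fun K => cavg K (phi x)).
rewrite (eq_bigr (fun K => ddt_dens U x K * cint K (phi x))) => [->|K _]; last by rewrite mulrCA volcav.
under [X in _ = _ + (X - _)]eq_bigr do rewrite flux_split !mulr1.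
under [X in _ = (X + _) + _]eq_bigr do rewrite volcav.
by ring.
Qed.

Lemma entropy_inequality chi phi t : entropy_cutoff chi -> nonneg phi -> t \in `[0, T] ->
  ig 0 t (fun t => \sum_K cint K (fun x => rho t K * chi (ent t K) * c1_dt phi t x
     + chi (ent t K) * dot (mom (U t) K) (c1_grad phi t x)))
  + ig 0 t (fun t => residual (fun K => chi (ent t K)) phi t) <=
  \sum_K rho t K * chi (ent t K) * cint K (phi t) - \sum_K rho 0 K * chi (ent 0 K) * cint K (phi 0).
Proof.
move=> hchi phi0 tT; have [kap sg] := cutoff_supergradient hchi.
have cX K : ct T (fun t => chi (ent t K)).
  by apply: ct_comp; [exact: ent_ct|move=> x _; exact: (supergradient_continuous sg)].
have E t' : t' \in `[0, T] ->
    \sum_K cint K (fun x => rho t' K * chi (ent t' K) * c1_dt phi t' x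
      + chi (ent t' K) * dot (mom (U t') K) (c1_grad phi t' x)) =
    \sum_K (rho t' K * chi (ent t' K) * (cvol K * cavg K (c1_dt phi t'))
      + chi (ent t' K) * cint K (fun x => dot (mom (U t') K) (c1_grad phi t' x))).
  by move=> t'T; apply: eq_bigr => K _; rewrite cell_bulk.
have cB : ct T (fun t => \sum_K cint K (fun x => rho t K * chi (ent t K) * c1_dt phi t x
     + chi (ent t K) * dot (mom (U t) K) (c1_grad phi t x))).
  apply: (@eq_ct _ _ (fun t' => \sum_K (rho t' K * chi (ent t' K) * (cvol K * cavg K (c1_dt phi t'))
      + chi (ent t' K) * cint K (fun x => dot (mom (U t') K) (c1_grad phi t' x))))) => [t' t'T|]; first by rewrite E.
  apply: ct_sum => K; apply: ctD; last exact: ctM.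
  apply: ctM; first by apply: ctM => //; exact: rho_ct.
  by apply: ctM; [exact: ct_cst|].
have cR : ct T (fun t => residual (fun K => chi (ent t K)) phi t) by exact: (residual_ct (X := fun t K => chi (ent t K))).
rewrite -igD; [|exact: ct_itv cB|exact: ct_itv cR].
have P0 t' (K : elt M) : t' \in `[0, T] -> 0 <= cavg K (phi t').
  move=> t'T; rewrite /cavg mulr_ge0 ?invr_ge0 ?(ltW (vol0 K))//; apply: rint_ge0 => x.
  rewrite patchE; case: ifPn => // xK; apply: phi0 => //; apply: (cell_sub cM (K := K)).
  by rewrite inE in xK.
have := @entropy_balance chi kap (fun t K => cavg K (phi t)) (fun t K => cavg K (c1_dt phi t)) (fun=> 0)
  sg (@cav_ct phi) (@cav_dt_ct phi) (fun t K => @cav_derive phi K t) P0 (@ct_cst R T 0) _ t tT.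
rewrite (eq_bigr (fun K => rho t K * chi (ent t K) * cint K (phi t))); last first.
  by move=> K _; rewrite mulrCA volcav.
rewrite [X in _ - X](eq_bigr (fun K => rho 0 K * chi (ent 0 K) * cint K (phi 0))); last first.
  by move=> K _; rewrite mulrCA volcav.
move=> H; apply: le_trans (H _); last first.
  move=> t' t'T; apply: sumr_ge0 => s _; rewrite mulr_ge0 ?(ltW (farea_s_gt0 cM LP s))//.
  by apply: production_ge0 => // K; apply: P0; exact: in_cc.
rewrite le_eqVlt; apply/orP; left; apply/eqP; apply: eq_ig => t' t'T.
have t'c : t' \in `[0, T].
  by move: t'T tT; rewrite !in_itv /= => /andP[-> h1] /andP[_ /(le_trans h1)].
rewrite E// /residual big_split /= addr0.
under [X in _ = X + _]eq_bigr do rewrite mulrCA.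
by ring.
Qed.

Section Momentum.
Variables (Pm : elt M -> 'M[R]_n) (CP : R).
Hypothesis Pm_tangent : forall K (w v : 'rV[R]_n), boundary_facet Om K v -> dot (w *m Pm K) v = 0.
Hypothesis Pm_orth : forall K (w z : 'rV[R]_n),
  (forall v, boundary_facet Om K v -> dot z v = 0) -> dot z (w *m Pm K) = dot z w.
Hypothesis Pm_close : forall K (w : 'rV[R]_n) (b : R), 0 <= b ->
  (forall v, boundary_facet Om K v -> `|dot w v| <= b) -> forall i, `|(w - w *m Pm K) 0 i| <= CP * b.
Implicit Types Phi : 'I_n -> C1fun T Om.

(* The momentum equation only admits test functions without normal component at the boundary facets,
   so that the cell averages have to be projected. *)
Definition vtest Phi t (K : elt M) : 'rV[R]_n := (\row_i cavg K (Phi i t)) *m Pm K.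

Definition mresidual Phi t : R :=
  \sum_s farea_s s * (dot (outflow t s *: mom (U t) (ein s) - inflow t s *: mom (U t) (eout s))
      (jumpv (vtest Phi t) s) + avg (p t) s * dot (nrm s) (jumpv (vtest Phi t) s)
      - eps * dot (jumpv (u t) s) (jumpv (vtest Phi t) s))
  - \sum_K (\sum_i mom (U t) K 0 i * cint K (fun x => dot (u t K) (c1_grad (Phi i) t x))
      + p t K * \sum_i cint K (fun x => c1_grad (Phi i) t x 0 i)).

Lemma vtest_ct Phi K i : ct T (fun t => vtest Phi t K 0 i).
Proof.
apply: (@eq_ct _ _ (fun t => \sum_j cavg K (Phi j t) * Pm K j i)).
  by move=> t _; rewrite mxE; apply: eq_bigr => j _; rewrite mxE.
by apply: ct_sum => j; apply: ctM; [exact: cav_ct|exact: ct_cst].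
Qed.

Let ugrad_ct phi (K : elt M) : ct T (fun t => cint K (fun x => dot (u t K) (c1_grad phi t x))).
Proof.
apply: (@eq_ct _ _ (fun t => \sum_i u t K 0 i * cint K (fun x => c1_grad phi t x 0 i))).
  move=> t tT; rewrite (cint_sum LP (index_enum _) (fun i => u t K 0 i))// => i.
  exact: (@cell_grad_within _ _ _ _ _ cM phi t K i tT).
apply: ct_sum => i; apply: ctM; first exact: u_ct.
exact: (@cint_grad_continuous _ _ _ _ T0 _ cM _ LP phi K i).
Qed.

Lemma mresidual_ct Phi : ct T (mresidual Phi).
Proof.
have cj (f : R -> elt M -> 'rV[R]_n) s i : (forall K, ct T (fun t => f t K 0 i)) ->
    ct T (fun t => jumpv (f t) s 0 i).
  move=> cf; apply: (@eq_ct _ _ (fun t => f t (eout s) 0 i - f t (ein s) 0 i)).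
    by move=> t _; rewrite !mxE.
  exact: ctB.
apply: ctB; [apply: ct_sum => s|apply: ct_sum => K].
  apply: ctM; first exact: ct_cst.
  have cV i : ct T (fun t => jumpv (vtest Phi t) s 0 i) by apply: cj => K; exact: vtest_ct.
  apply: ctB; first apply: ctD.
  - apply: dot_ct => // i.
    apply: (@eq_ct _ _ (fun t => outflow t s * mom (U t) (ein s) 0 i - inflow t s * mom (U t) (eout s) 0 i)).
      by move=> t _; rewrite !mxE.
    by apply: ctB; apply: ctM; [exact: outflow_ct|exact: mom_ct|exact: inflow_ct|exact: mom_ct].
  - apply: ctM; last by apply: dot_ct => // i; exact: ct_cst.
    by apply: ctM; [apply: ctD; exact: p_ct|exact: ct_cst].
  - apply: ctM; first exact: ct_cst.
    by apply: dot_ct => // i; apply: cj => K; exact: u_ct.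
apply: ctD.
  by apply: ct_sum => i; apply: ctM; [exact: mom_ct|].
apply: ctM; first exact: p_ct.
by apply: ct_sum => i; exact: (@cint_grad_continuous _ _ _ _ T0 _ cM _ LP (Phi i) K i).
Qed.

(** The condition m . n = 0 holds at all times and can be differentiated; hence projecting the test
    function does not change the term with the time derivative. *)
Lemma ddt_mom_tangent t K v : 0 < t < T -> boundary_facet Om K v -> dot (ddt_mom U t K) v = 0.
Proof.
move=> tT Kv; have d1 : is_derive t 1 (fun t' => dot (mom (U t') K) v) (dot (ddt_mom U t K) v).
  apply: isd_sum => i; have := isdM (mom_derive tT K i) (isdC (v 0 i) t).
  by rewrite mulr0 addr0.
have d2 : is_derive t 1 (fun=> 0 : R) (dot (ddt_mom U t K) v).
  apply: (@near_eq_is_derive _ R^o R^o) d1.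
  have atT : t \in `]0, T[ by rewrite in_itv.
  apply: filterS (near_in_itvoo atT) => t' /= t'T.
  have t'cc : t' \in `[0, T] by apply: in_cc; rewrite in_itv in t'T.
  by rewrite (momE K t'cc) dotZl (u_no_flux t'cc)// mulr0.
by have [_ <-] := d2; rewrite derive_cst.
Qed.

Lemma momentum_balance Phi t : t \in `[0, T] ->
  \sum_K \sum_i mom (U t) K 0 i * cint K (Phi i t)
  - \sum_K \sum_i mom (U 0) K 0 i * cint K (Phi i 0) =
  ig 0 t (fun t => \sum_K (\sum_i mom (U t) K 0 i * cint K (c1_dt (Phi i) t)
     + (\sum_i mom (U t) K 0 i * cint K (fun x => dot (u t K) (c1_grad (Phi i) t x))
      + p t K * \sum_i cint K (fun x => c1_grad (Phi i) t x 0 i))))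
  + ig 0 t (mresidual Phi).
Proof.
move=> tT; set g := fun t => \sum_K (_ + _).
have cg : ct T g.
  apply: ct_sum => K; apply: ctD; last apply: ctD.
  - apply: ct_sum => i; apply: ctM; first exact: mom_ct.
    exact: (@cint_dt_continuous _ _ _ _ T0 _ cM _ LP (Phi i) K).
  - by apply: ct_sum => i; apply: ctM; [exact: mom_ct|].
  apply: ctM; first exact: p_ct.
  by apply: ct_sum => i; exact: (@cint_grad_continuous _ _ _ _ T0 _ cM _ LP (Phi i) K i).
rewrite -igD; [|exact: ct_itv cg|exact: ct_itv (@mresidual_ct Phi)].
apply/esym; apply: (@ct_ftc _ _ _ (fun t => \sum_K \sum_i mom (U t) K 0 i * cint K (Phi i t))) => //.
- by apply: ctD => //; exact: mresidual_ct.
- apply: ct_sum => K; apply: ct_sum => i; apply: ctM; first exact: mom_ct.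
  exact: (@cint_val_continuous _ _ _ _ T0 _ cM _ LP (Phi i) K).
move=> x xT; have xc := in_cc xT.
have D := isd_sum (index_enum (elt M)) (fun K => isd_sum (index_enum 'I_n) (fun i =>
  isdM (mom_derive xT K i) (cint_val_derive hOm cM LP (Phi i) K xT))).
move: D; set e := (X in is_derive _ _ _ X -> _) => D.
suff <- : e = g x + mresidual Phi x by [].
have nf : no_flux Om (vtest Phi x) by move=> K v Kv; exact: Pm_tangent.
rewrite /mresidual -(momentum_eq xT nf) /e /g.
rewrite [X in _ + (X - _)](eq_bigr (fun K => \sum_i ddt_mom U x K 0 i * cint K (Phi i x))); last first.
  move=> K _; rewrite Pm_orth; last by move=> v Kv; exact: ddt_mom_tangent.
  by rewrite /dot mulr_sumr; apply: eq_bigr => i _; rewrite [(\row_i0 _) 0 i]mxE mulrCA volcav.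
rewrite addrCA -sumrB -big_split /=; apply: eq_bigr => K _.
by rewrite big_split /= addrK.
exact: tT.
Qed.

Section MomentumBound.
Variable d : R.
Hypothesis diam : forall (K : elt M) x y, cell K x -> cell K y -> enorm (x - y) <= d.

(** On a boundary facet the sum over the components combines to the integral of phi . n, which
    vanishes by tangentiality. *)
Lemma green_pressure Phi t : 0 < t < T -> tangential M Phi ->
  \sum_K p t K * \sum_i cint K (fun x => c1_grad (Phi i) t x 0 i) =
  - \sum_s farea_s s * (jump (p t) s * \sum_i nrm s 0 i * face_avg (Phi i t) s).
Proof.
move=> tT tg; have tc := in_cc tT.
have cv (K : elt M) i : {within cell K, continuous (Phi i t)}.
  exact: (@cell_val_within _ _ _ _ _ cM (Phi i) t K tc).
have dG i (K : elt M) x j : sint (cell K) (L K) x ->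
    is_derive x (delta_mx 0 j) (Phi i t) (c1_grad (Phi i) t x 0 j).
  by move=> Kx; apply: c1_gradE; [rewrite in_itv|exact: (sint_Om OmO cM LP Kx)].
have G i := @mesh_green _ _ _ _ OmO cM _ LP (fun K => p t K *: delta_mx 0 i) (Phi i t) (c1_grad (Phi i) t)
  (fun K => cv K i) (fun K j => @cell_grad_within _ _ _ _ _ cM (Phi i) t K j tc) (dG i).
have E (i : 'I_n) (K : elt M) : p t K * cint K (fun x => c1_grad (Phi i) t x 0 i) =
    rint ((fun x => dot (p t K *: delta_mx 0 i) (c1_grad (Phi i) t x)) \_ (cell K)).
  rewrite -(cintZ LP); last exact: (@cell_grad_within _ _ _ _ _ cM (Phi i) t K i tc).
  by rewrite /cint; congr rint; congr (_ \_ _); apply/funext => x; rewrite dotZl dot_delta.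
under eq_bigr do rewrite mulr_sumr.
rewrite exchange_big /=; under eq_bigr => i _ do rewrite (eq_bigr _ (fun K _ => E i K)) G.
rewrite big_split /= [X in _ + X](_ : _ = 0) ?addr0.
  rewrite sumrN exchange_big /=; congr (- _); apply: eq_bigr => s _.
  rewrite !mulr_sumr; apply: eq_bigr => i _.
  by rewrite /jumpv -scalerBl dotZl dot_delta fint_avg /jump; ring.
rewrite exchange_big big1// => K _; rewrite exchange_big /= big_seq_cond big1// => v.
move=> /andP[/(mem_facets (LP K)) vK /asboolP vb]; have v1 := vK.1.
have Kv : boundary_facet Om K v by [].
have cs : {within cell K, continuous (fun x => \sum_i v 0 i * Phi i t x)}.
  by move=> x; apply: cvg_sumr => i _; apply: cvgM; [exact: cvg_cst|exact: cv].
rewrite (eq_bigr (fun i => p t K * (v 0 i * bfint K v (Phi i t)))); last first.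
  by move=> i _; rewrite dotZl dot_delta mulrA.
rewrite -mulr_sumr (_ : \sum_i _ = bfint K v (fun x => \sum_i v 0 i * Phi i t x)).
  have := @face_rint_le _ _ _ _ (LP K) v _ 0 0 v1 cs.
  rewrite !mul0r subr0 normr_le0 => hf; rewrite /bfint (eqP (hf _)) ?mulr0// => x Fx.
  rewrite subr0 -[X in `|X|](_ : dot (vval Phi t x) v = _).
    by rewrite (tg K v Kv t x tc Fx) normr0.
  by apply: eq_bigr => i _; rewrite mxE mulrC.
rewrite /bfint /face_rint -(eq_bigr _ (fun i _ => rintZ (v 0 i) (intg_slab (LP K) v1 (cv K i)))).
rewrite -rint_sum; last by move=> i _; apply: intgZ; exact: (intg_slab (LP K) v1 (cv K i)).
congr rint; apply/funext => x; rewrite patchE; case: ifPn => xK.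
  by apply: eq_bigr => i _; rewrite patchE xK.
by rewrite big1// => i _; rewrite patchE (negbTE xK) mulr0.
Qed.

Lemma facet_nonempty (K : elt M) v : facet (cell K) v -> exposed_face (cell K) v !=set0.
Proof.
move=> Kv; have [_ a0] := (facetE (LP K) v).1 Kv.
apply: contrapT => no.
have : `|face_rint v (supp (cell K) v) (cell K) (fun=> 1) - 0 * farea (cell K) v| <= 0 * farea (cell K) v.
  apply: (face_rint_le (LP K) Kv.1 (@cst_within _ _ _ 1)) => x Kx; by case: no; exists x.
rewrite !mul0r subr0 normr_le0 => /eqP h2; move: a0; by rewrite /farea h2 ltxx.

Qed.

Lemma C1normv_scale Phi (c : R) : c * C1normv Phi = \sum_i c * C1norm (Phi i).
Proof. by rewrite mulr_sumr. Qed.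

(** At a point of a boundary facet phi . n = 0, so that the normal component of the cell average is
    of the order of the oscillation of phi on the cell, and the projection moves the average by no
    more than a multiple of it. *)
Lemma vtest_close Phi t s i : 0 < t < T -> tangential M Phi ->
  `|vtest Phi t (ein s) 0 i - face_avg (Phi i t) s| <= (CP + 1) * (n%:R * d * C1normv Phi) /\
  `|vtest Phi t (eout s) 0 i - face_avg (Phi i t) s| <= (CP + 1) * (n%:R * d * C1normv Phi).
Proof.
move=> tT tg; have tc := in_cc tT; set b := n%:R * d * C1normv Phi.
have b0 j : 0 <= n%:R * d * C1norm (Phi j).
  by have [h0 _] := avg_close diam (Phi j) s tT; exact: le_trans h0.
have bE : b = \sum_j n%:R * d * C1norm (Phi j) by exact: C1normv_scale.
have bj : n%:R * d * C1norm (Phi i) <= b.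
  by rewrite bE (bigD1 i)//= lerDl sumr_ge0.
have bge0 : 0 <= b by apply: le_trans bj.
have PC (K : elt M) : `|vtest Phi t K 0 i - cavg K (Phi i t)| <= CP * b.
  have := @Pm_close K (\row_i cavg K (Phi i t)) b bge0 _ i.
  rewrite -/(vtest Phi t K) distrC !mxE; apply => v Kv.
  have [x Fx] := facet_nonempty Kv.1.
  rewrite -[X in `|X|]subr0 -(tg K v Kv t x tc Fx) -dotBl bE.
  apply: le_trans (ler_norm_sum _ _ _) _; apply: ler_sum => j _.
  rewrite normrM !mxE -[leRHS]mulr1; apply: ler_pM => //.
    by apply: (cavg_point diam) => //; have [] := Fx.
  by apply: unit_coord_le1; have [[]] := Kv.
have tri (x y z : R) : `|x - y| <= CP * b -> `|y - z| <= n%:R * d * C1norm (Phi i) ->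
    `|x - z| <= (CP + 1) * b.
  move=> h1 h2; rewrite (_ : x - z = (x - y) + (y - z)); last by ring.
  apply: le_trans (ler_normD _ _) _; rewrite mulrDl mul1r lerD//.
  exact: le_trans h2 bj.
have [h1 h2] := avg_close diam (Phi i) s tT.
by split; [exact: tri (PC _) h1|exact: tri (PC _) h2].
Qed.

Lemma mresidual_le Phi t : 0 < t < T -> tangential M Phi ->
  `|mresidual Phi t| <= (CP + 1) * (n%:R * d * C1normv Phi) *
    (\sum_i conv_defect (fun K => mom (U t) K 0 i) t
     + \sum_s farea_s s * (n%:R * `|jump (p t) s| + 2 * eps * \sum_i `|jumpv (u t) s 0 i|)).
Proof.
move=> tT tg; have tc := in_cc tT; set b := (CP + 1) * _.
pose V := vtest Phi t; pose F s : 'rV[R]_n := \row_i face_avg (Phi i t) s.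
have Vc s i : `|V (ein s) 0 i - face_avg (Phi i t) s| <= b /\ `|V (eout s) 0 i - face_avg (Phi i t) s| <= b.
  exact: vtest_close.
have nfV : no_flux Om V by move=> K v Kv; exact: Pm_tangent.
have nfp : no_flux Om (fun K => p t K *: V K) by move=> K v Kv; rewrite dotZl nfV ?mulr0.
have conv : \sum_K \sum_i mom (U t) K 0 i * cint K (fun x => dot (u t K) (c1_grad (Phi i) t x)) =
    - \sum_i \sum_s dot (jumpv (fun K => mom (U t) K 0 i *: u t K) s) (nrm s) * (farea_s s * face_avg (Phi i t) s).
  rewrite exchange_big /= -sumrN; apply: eq_bigr => i _.
  have nf : no_flux Om (fun K => mom (U t) K 0 i *: u t K).
    by move=> K v Kv; rewrite dotZl (u_no_flux tc) ?mulr0.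
  rewrite -(green_no_flux (Phi i) tT nf); apply: eq_bigr => K _.
  have cg j : {within cell K, continuous (fun x => c1_grad (Phi i) t x 0 j)}.
    exact: (@cell_grad_within _ _ _ _ _ cM (Phi i) t K j tc).
  rewrite (cint_sum LP (index_enum _) (fun j => u t K 0 j) cg).
  rewrite (cint_sum LP (index_enum _) (fun j => (mom (U t) K 0 i *: u t K) 0 j) cg) mulr_sumr.
  by apply: eq_bigr => j _; rewrite mulrA; congr (_ * _); rewrite [RHS]mxE.
have split_conv : \sum_s farea_s s * dot (outflow t s *: mom (U t) (ein s) - inflow t s *: mom (U t) (eout s)) (jumpv V s)
    = \sum_i \sum_s farea_s s * (flux (mu^~ t) (fun K => mom (U t) K 0 i) (u t) s * jump (fun K => V K 0 i) s).
  rewrite exchange_big /=; apply: eq_bigr => s _; rewrite -mulr_sumr; congr (_ * _).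
  by apply: eq_bigr => i _; rewrite flux_split /jump !mxE.
(* Completed by the vanishing sum for [p V], the pressure terms contain only jumps of the pressure
   times deviations of the test values from the face averages [F]. *)
have -> : mresidual Phi t =
   \sum_i (\sum_s farea_s s * (flux (mu^~ t) (fun K => mom (U t) K 0 i) (u t) s * jump (fun K => V K 0 i) s)
     + \sum_s dot (jumpv (fun K => mom (U t) K 0 i *: u t K) s) (nrm s) * (farea_s s * face_avg (Phi i t) s))
   + \sum_s farea_s s * (- 2^-1 * jump (p t) s * (dot (nrm s) (V (ein s) - F s) + dot (nrm s) (V (eout s) - F s))
        - eps * dot (jumpv (u t) s) (jumpv V s)).
  rewrite big_split /= -split_conv.
  set C := \sum_i \sum_s dot _ _ * _ in conv *.
  rewrite /mresidual -/V big_split /= conv green_pressure//.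
  rewrite -[LHS]subr0 -[X in _ - X = _](no_flux_sum nfp).
  transitivity (C + (\sum_s (farea_s s * (dot (outflow t s *: mom (U t) (ein s) - inflow t s *: mom (U t) (eout s)) (jumpv V s) + avg (p t) s * dot (nrm s) (jumpv V s) - eps * dot (jumpv (u t) s) (jumpv V s))
     + farea_s s * (jump (p t) s * \sum_i nrm s 0 i * face_avg (Phi i t) s)
     - farea_s s * dot (jumpv (fun K => p t K *: V K) s) (nrm s)))).
    by rewrite !(big_split, sumrN) /=; ring.
  rewrite [RHS]addrAC [LHS]addrC; congr (_ + _); rewrite -big_split /=; apply: eq_bigr => s _.
  rewrite -[\sum_i nrm s 0 i * _](_ : dot (nrm s) (F s) = _); last by apply: eq_bigr => i _; rewrite mxE.
  set x := dot (_ - _) _; set y := dot (jumpv (u t) s) _.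
  rewrite /jumpv /avg /jump !(dotC (nrm s)) !(dotBl, dotZl).
  by move: (dot (V _) _) (dot (V _) _) (dot (F s) _) => *; field.
apply: le_trans (ler_normD _ _) _; rewrite mulrDr; clearbody V; apply: lerD.
  apply: le_trans (ler_norm_sum _ _ _) _; rewrite mulr_sumr; apply: ler_sum => i _.
  by apply: conv_residual => // s; exact: Vc.
apply: le_trans (ler_norm_sum _ _ _) _; rewrite mulr_sumr; apply: ler_sum => s _.
have a0 := farea_s_gt0 cM LP s; rewrite normrM (gtr0_norm a0) mulrCA ler_wpM2l ?(ltW a0)//.
have dn (K : elt M) : (forall i, `|V K 0 i - face_avg (Phi i t) s| <= b) -> `|dot (nrm s) (V K - F s)| <= n%:R * b.
  move=> VK; apply: le_trans (ler_norm_sum _ _ _) _.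
  have -> : n%:R * b = \sum_(i < n) b by rewrite sumr_const card_ord mulr_natl.
  apply: ler_sum => i _; rewrite normrM !mxE -[leRHS]mul1r; apply: ler_pM => //.
  exact: unit_coord_le1 (nrm_unit cM s).
have h1 := dn _ (fun i => (Vc s i).1); have h2 := dn _ (fun i => (Vc s i).2).
have h3 : `|dot (jumpv (u t) s) (jumpv V s)| <= \sum_i `|jumpv (u t) s 0 i| * (2 * b).
  apply: le_trans (ler_norm_sum _ _ _) _; apply: ler_sum => i _; rewrite normrM ler_wpM2l//.
  have [v1 v2] := Vc s i.
  rewrite [jumpv V s 0 i](_ : _ = (V (eout s) 0 i - face_avg (Phi i t) s) - (V (ein s) 0 i - face_avg (Phi i t) s)); last first.
    by rewrite !mxE; ring.
  by apply: le_trans (ler_normB _ _) _; rewrite mulrDl mul1r lerD.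
apply: le_trans (ler_normB _ _) _; rewrite [leRHS]mulrDr; apply: lerD.
  rewrite 2!normrM normrN (_ : `|2^-1 : R| = 2^-1); last by rewrite ger0_norm// invr_ge0.
  rewrite [leRHS](_ : _ = 2^-1 * `|jump (p t) s| * (n%:R * b + n%:R * b)); last by field.
  by rewrite ler_wpM2l ?mulr_ge0 ?invr_ge0//; apply: le_trans (ler_normD _ _) _; exact: lerD.
have e0 : 0 <= eps by exact: powR_ge0.
rewrite normrM (ger0_norm e0) (le_trans (ler_wpM2l e0 h3))// -mulr_suml.
by rewrite le_eqVlt; apply/orP; left; apply/eqP; ring.
Qed.

End MomentumBound.
End Momentum.
End Balances.

(** * Bounds uniform in the mesh size *)

Section Uniform.
Variables (beta c rlo thup CB s0 Cc : R).
Hypothesis n03 : (0 < n <= 3)%N.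
Hypothesis beta01 : 0 <= beta < 1.
Hypothesis alpha_range : 0 < alpha < 4 / 3.
Hypothesis c0 : 0 < c.
Hypothesis h0 : 0 < h.
Hypothesis diam : forall (K : elt M) x y, cell K x -> cell K y -> enorm (x - y) <= c * h.
Hypothesis vol_lo : forall K : elt M, c^-1 * h ^+ n <= cvol K.
Hypothesis mu_bd : forall s t, t \in `[0, T] -> c^-1 * h `^ beta <= mu s t <= c.
Hypothesis rlo0 : 0 < rlo.
Hypothesis thup0 : 0 < thup.
Hypothesis rho_th_bd : forall t K, t \in `[0, T] -> rlo <= rho t K /\ th t K <= thup.
Hypothesis mass0 : \sum_K cvol K * rho 0 K <= CB.
Hypothesis energy0 : \sum_K cvol K * ener (U 0) K <= CB.
Hypothesis ent_init : forall K, s0 < ent 0 K.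
Hypothesis conc : forall (w : elt M -> R) t, 0 < t <= 1 -> (forall K, 0 <= w K) ->
  \sum_(K | Cc * \sum_K' cvol K' * w K' < t ^+ n * w K) cvol K * w K <=
  Cc * t * \sum_s farea_s s * `|jump w s|.
Hypothesis Cc0 : 0 < Cc.

Let zT : (0 : R) \in `[0, T]. Proof. by rewrite in_itv /= lexx ltW. Qed.

Lemma volume_le : \sum_(K : elt M) cvol K <= CB / rlo.
Proof.
rewrite ler_pdivlMr// mulr_suml; apply: le_trans mass0; apply: ler_sum => K _.
by rewrite ler_wpM2l ?(ltW (vol0 K))//; have [] := rho_th_bd K zT.
Qed.

Lemma CB_ge0 : 0 <= CB.
Proof. by apply: le_trans mass0; apply: sumr_ge0 => K _; rewrite mulr_ge0 ?(ltW (vol0 K)) ?(ltW (rho_gt0 K zT)). Qed.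

(** [h] may exceed 1; it is bounded by comparing the volume of one cell with that of the domain,
    which the mass and the lower density bound control. *)
Definition size_bound : R := 1 + c * (CB / rlo).

Lemma size_bound_ge1 : 1 <= size_bound.
Proof. by rewrite /size_bound lerDl mulr_ge0 ?(ltW c0)// divr_ge0 ?CB_ge0// ltW. Qed.

Lemma size_le : h <= size_bound.
Proof.
have [_ _ [x Ox] _ _] := hOm; have [cl _ _ _ _] := cM.
have [K _ _] : (\bigcup_K cell (m:=M) K) x by rewrite -cl; exact: subset_closure.
have hn : h ^+ n <= c * (CB / rlo).
  rewrite -ler_pdivrMl//; apply: le_trans (vol_lo K) _; apply: le_trans volume_le.
  by rewrite (bigD1 K)//= lerDl sumr_ge0// => K' _; exact/ltW/vol0.
have [h1|h1] := leP h 1; first exact: le_trans h1 size_bound_ge1.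
have /andP[n0 _] := n03.
apply: le_trans (ler_eXnr n0 (ltW h1)) _; apply: le_trans hn _.
by rewrite /size_bound lerDr.
Qed.

Let min_supergradient : supergradient (fun s => Num.min (s - s0) 0) (fun s => (s < s0)%R%:R).
Proof.
move=> x; split; first by case: (x < s0).
have m z : Num.min (z - s0) 0 = if z < s0 then z - s0 else 0 by rewrite /Num.min subr_lt0.
by move=> y; rewrite !m; case: (ltP x s0); case: (ltP y s0) => *; rewrite ?mulr1n ?mulr0n; lra.
Qed.

(** The integral of rho min(s - s0, 0) is zero initially and cannot decrease, while all its terms
    are nonpositive; hence each of them stays zero. *)
Lemma ent_ge t K : t \in `[0, T] -> s0 <= ent t K.
Proof.
move=> tT.
have := @entropy_balance _ _ (fun _ _ => 1) (fun _ _ => 0) (fun=> 0) min_supergradient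
  (fun K => @ct_cst R T 1) (fun K => @ct_cst R T 0) (fun t K _ => isdC 1 t) (fun _ _ _ => ler01) (@ct_cst R T 0) _ t tT.
pose f t := \sum_K cvol K * (rho t K * Num.min (ent t K - s0) 0 * 1).
rewrite -/(f t) -/(f 0) => H.
have fK t' K' : t' \in `[0, T] -> cvol K' * (rho t' K' * Num.min (ent t' K' - s0) 0 * 1) <= 0.
  move=> t'T; rewrite mulr1 mulr_ge0_le0 ?(ltW (vol0 K'))// mulr_ge0_le0 ?(ltW (rho_gt0 K' t'T))//.
  by rewrite ge_min lexx orbT.
have f0 : f 0 = 0.
  rewrite /f big1// => K' _; rewrite mulr1 (_ : Num.min _ _ = 0) ?mulr0//.
  by apply/min_idPr; rewrite subr_ge0 ltW.
have : 0 <= f t.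
  rewrite -[f t]subr0 -[X in _ - X]f0; apply: le_trans (H _); last first.
    move=> t' t'T; apply: sumr_ge0 => s _; rewrite mulr_ge0 ?(ltW (farea_s_gt0 cM LP s))//.
    exact: (production_ge0 t'T s min_supergradient (fun _ => ler01)).
  rewrite (@eq_ig _ _ _ _ (fun=> 0)) ?ig_cst ?mul0r//; first by move: tT; rewrite in_itv => /andP[].
  move=> t' _; rewrite big1 => [|K' _]; last by rewrite !mulr0.
  by rewrite big1 ?addr0// => s _; rewrite /jump subrr !mulr0.
rewrite /f (bigD1 K)//= => ft.
have : 0 <= cvol K * (rho t K * Num.min (ent t K - s0) 0 * 1).
  by apply: le_trans ft _; rewrite gerDl sumr_le0// => K' _; exact: fK.
rewrite mulr1 pmulr_rge0// pmulr_rge0 ?rho_gt0// /Num.min; case: ifPn => //; last by rewrite -leNgt subr_ge0.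
by move=> /lt_geF ->.
Qed.

(** Solves cv ln(theta) - ln(rho) = s0 for the density at the largest temperature; [tlo] solves it
    for the temperature at the smallest density. *)
Definition rhi : R := expR (cv * ln thup - s0).
Definition tlo : R := expR ((gamma - 1) * (s0 + ln rlo)).

Lemma rhi_gt0 : 0 < rhi. Proof. exact: expR_gt0. Qed.
Lemma tlo_gt0 : 0 < tlo. Proof. exact: expR_gt0. Qed.

Let cv0 : 0 < cv. Proof. by rewrite invr_gt0. Qed.

Lemma rho_le t K : t \in `[0, T] -> rho t K <= rhi.
Proof.
move=> tT; have r0 := rho_gt0 K tT; have [_ t1] := rho_th_bd K tT.
rewrite -[leLHS]lnK ?posrE// ler_expR; have := ent_ge K tT; rewrite (entE K tT) => h1.
have : cv * ln (th t K) <= cv * ln thup by rewrite ler_wpM2l ?(ltW cv0)// ler_ln ?posrE ?th_gt0.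
by lra.
Qed.

Lemma th_ge t K : t \in `[0, T] -> tlo <= th t K.
Proof.
move=> tT; have r0 := rho_gt0 K tT; have [r1 _] := rho_th_bd K tT; have t0 := th_gt0 K tT.
rewrite -[leRHS]lnK ?posrE// ler_expR -ler_pdivlMl// mulrC; have := ent_ge K tT; rewrite (entE K tT) => h1.
have : ln rlo <= ln (rho t K) by rewrite ler_ln ?posrE.
by rewrite mulrC; lra.
Qed.

Lemma ent_le t K : t \in `[0, T] -> ent t K <= cv * ln thup - ln rlo.
Proof.
move=> tT; have r0 := rho_gt0 K tT; have [r1 t1] := rho_th_bd K tT; rewrite (entE K tT).
apply: lerB; last by rewrite ler_ln ?posrE.
by rewrite ler_wpM2l ?(ltW cv0)// ler_ln ?posrE ?th_gt0.
Qed.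

Definition speed_sq t K : R := dot (u t K) (u t K).

Lemma speed_sq_ge0 t K : 0 <= speed_sq t K. Proof. exact: dotxx_ge0. Qed.

Lemma kinetic_le t : t \in `[0, T] -> \sum_K cvol K * speed_sq t K <= 2 * CB / rlo.
Proof.
move=> tT; rewrite ler_pdivlMr// mulrC -ler_pdivrMl// mulrA mulr_sumr.
apply: le_trans energy0; rewrite -(energy_cons tT); apply: ler_sum => K _.
rewrite mulrCA ler_wpM2l ?(ltW (vol0 K))// (enerE K tT).
have [r1 _] := rho_th_bd K tT; have t0 := th_gt0 K tT; have r0 := rho_gt0 K tT.
have := speed_sq_ge0 t K; rewrite /speed_sq => q0; have ct0 : 0 <= cv * th t K by rewrite mulr_ge0 ?(ltW cv0)// ltW.
rewrite -/(speed_sq t K) in q0 *; rewrite (_ : 2^-1 * rlo * _ = rlo * (2^-1 * speed_sq t K)); last by ring.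
apply: ler_pM => //; [exact: ltW|by rewrite mulr_ge0 ?invr_ge0|by rewrite lerDl].
Qed.

Definition rho_jump t s : R := `|jump (fun K => rho t K) s|.
Definition th_jump t s : R := `|jump (th t) s|.
Definition u_jump t s : R := Num.sqrt (dot (jumpv (u t) s) (jumpv (u t) s)).
(* Up to a constant, a lower bound of the entropy production at a face. *)
Definition dissip t s : R :=
  (`|nvel t s| + mu s t) * (u_jump t s ^+ 2 + rho_jump t s ^+ 2 + th_jump t s ^+ 2) + eps * u_jump t s ^+ 2.
Definition Diss t : R := \sum_s farea_s s * dissip t s.

Lemma u_jumpE t s : u_jump t s ^+ 2 = dot (jumpv (u t) s) (jumpv (u t) s).
Proof. by rewrite sqr_sqrtr// dotxx_ge0. Qed.

Lemma dissip_ge0 t s : t \in `[0, T] -> 0 <= dissip t s.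
Proof.
by move=> tT; rewrite addr_ge0// mulr_ge0 ?powR_ge0 ?sqr_ge0 ?addr_ge0 ?mu0 ?sqr_ge0.
Qed.

Lemma jumpv_ct s i : ct T (fun t => jumpv (u t) s 0 i).
Proof.
apply: (@eq_ct _ _ (fun t => u t (eout s) 0 i - u t (ein s) 0 i)); first by move=> t _; rewrite !mxE.
by apply: ctB; exact: u_ct.
Qed.

Lemma Diss_ct : ct T Diss.
Proof.
have sq f : ct T f -> ct T (fun t => f t ^+ 2) by move=> cf; exact: ctM.
have jct : forall s, ct T (fun t => u_jump t s ^+ 2).
  move=> s; apply: (@eq_ct _ _ (fun t => dot (jumpv (u t) s) (jumpv (u t) s))); first by move=> t _; rewrite u_jumpE.
  by apply: dot_ct => i; exact: jumpv_ct.
apply: ct_sum => s; apply: ctM; first exact: ct_cst.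
apply: ctD; last by apply: ctM => //; exact: ct_cst.
apply: ctM; first by apply: ctD; [apply: ct_norm; exact: nvel_ct|exact: mu_ct].
apply: ctD; first apply: ctD => //.
  by apply: sq; apply: ct_norm; apply: ctB; exact: rho_ct.
by apply: sq; apply: ct_norm; apply: ctB; exact: th_ct.
Qed.

(** The four entries are the coefficients left in the production for the squared jumps of velocity,
    temperature and density, and for the velocity penalty. *)
Definition diss_cst : R :=
  Num.min (Num.min (rlo / (2 * thup)) (rlo * cv / (4 * thup ^+ 2)))
          (Num.min (rlo / (4 * rhi ^+ 2)) thup^-1).

Lemma diss_cst_gt0 : 0 < diss_cst.
Proof.
by rewrite !lt_min !divr_gt0 ?mulr_gt0 ?invr_gt0 ?exprn_gt0 ?rhi_gt0.
Qed.

Let id_supergradient : supergradient (fun s : R => s) (fun=> 1 : R).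
Proof. by move=> x; split=> // y; lra. Qed.

Let gap_ge (x y B : R) : 0 < x -> 0 < y -> x <= B -> y <= B ->
  (x - y) ^+ 2 / (4 * B ^+ 2) <= x / y - 1 - ln (x / y).
Proof.
move=> x0 y0 xB yB; have B0 := lt_le_trans x0 xB.
have := ln_gap (divr_gt0 x0 y0); set g := x / y - 1 - _.
have -> : x / y - 1 = (x - y) / y by field; rewrite gt_eqF.
have -> : x / y + 1 = (x + y) / y by field; rewrite gt_eqF.
move=> hg; have {}hg : (x - y) ^+ 2 <= 2 * (x + y) * y * g.
  have : (x - y) ^+ 2 / y ^+ 2 * y ^+ 2 <= 2 * ((x + y) / y) * g * y ^+ 2.
    by rewrite ler_wpM2r ?sqr_ge0// -exprVn -exprMn.
  by rewrite mulfVK ?gt_eqF ?exprn_gt0// => /le_trans -> //; rewrite le_eqVlt; apply/orP; left; apply/eqP; field; rewrite gt_eqF.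
have g0 : 0 <= g.
  by rewrite -(@pmulr_rge0 _ (2 * (x + y) * y)) ?mulr_gt0 ?addr_gt0//; apply: le_trans hg; exact: sqr_ge0.
rewrite ler_pdivrMr ?mulr_gt0 ?exprn_gt0//; apply: le_trans hg _; rewrite mulrC ler_wpM2l//.
nra.
Qed.

Lemma production_ge t s : 0 < t < T ->
  diss_cst * dissip t s <= production (ent t) (fun=> 1) (fun=> 1) t s.
Proof.
move=> tT; have tc := in_cc tT.
have A0 := outflow_ge0 s tc; have B0 := inflow_ge0 s tc.
set J := dot (jumpv (u t) s) (jumpv (u t) s).
have J0 : 0 <= J := dotxx_ge0 _.
have [e1 [e2 [e3 e4]]] : diss_cst <= rlo / (2 * thup) /\ diss_cst <= rlo * cv / (4 * thup ^+ 2) /\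
   diss_cst <= rlo / (4 * rhi ^+ 2) /\ diss_cst <= thup^-1.
  by rewrite /diss_cst !ge_min !lexx !orbT.
set S := J + rho_jump t s ^+ 2 + th_jump t s ^+ 2.
have rp i o : (rho t i - rho t o) ^+ 2 = rho_jump t s ^+ 2 -> (th t i - th t o) ^+ 2 = th_jump t s ^+ 2 ->
    diss_cst * S <= rel_prod cv (rho t i) (rho t o) (ent t i) (ent t o) 1 (1 * 1 / th t o) (th t i) (th t o) J.
  move=> er et; have [ri _] := rho_th_bd i tc; have [ro tho] := rho_th_bd o tc.
  have [_ thi] := rho_th_bd i tc; have ti0 := th_gt0 i tc; have to0 := th_gt0 o tc.
  have ri0 := rho_gt0 i tc; have ro0 := rho_gt0 o tc.
  have hX : ent t i <= ent t o + 1 * (ent t i - ent t o) by lra.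
  have := @rel_prod_ge _ cv _ _ _ _ 1 1 _ _ J _ _ (ltW cv0) ri0 ro0 ti0 to0 ler01 ler01 (entE i tc) (entE o tc) hX.
  apply: le_trans.
  have g1' := gap_ge ti0 to0 thi tho; have g2' := gap_ge ro0 ri0 (rho_le o tc) (rho_le i tc).
  rewrite !mul1r /S mulrDr mulrDr addrAC mulrDr; apply: lerD; first apply: lerD.
  - apply: le_trans (ler_wpM2r J0 e1) _.
    have -> : rlo / (2 * thup) * J = rlo * (2^-1 * J / thup) by field; rewrite gt_eqF.
    apply: ler_pM => //; rewrite ?(ltW rlo0) ?mulr_ge0 ?invr_ge0 ?(ltW thup0)//.
    by rewrite ler_wpM2l ?mulr_ge0 ?invr_ge0// lef_pV2 ?posrE.
  - apply: le_trans (ler_wpM2r (sqr_ge0 _) e2) _.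
    have -> : rlo * cv / (4 * thup ^+ 2) * th_jump t s ^+ 2 = rlo * (cv * (th_jump t s ^+ 2 / (4 * thup ^+ 2))).
      by field; rewrite !gt_eqF.
    apply: ler_pM => //; first exact: ltW.
      by apply: mulr_ge0; [exact: ltW|rewrite divr_ge0 ?sqr_ge0// pmulr_rge0// sqr_ge0].
    by rewrite ler_wpM2l ?(ltW cv0)// -et.
  - apply: le_trans (ler_wpM2r (sqr_ge0 _) e3) _.
    rewrite -mulrA; apply: ler_pM => //; first exact: ltW.
      by rewrite mulr_ge0 ?sqr_ge0// invr_ge0 pmulr_rge0// sqr_ge0.
    by rewrite mulrC -er -sqrrN opprB.
have er1 : (rho t (ein s) - rho t (eout s)) ^+ 2 = rho_jump t s ^+ 2 by rewrite real_normK ?num_real// -sqrrN opprB.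
have er2 : (rho t (eout s) - rho t (ein s)) ^+ 2 = rho_jump t s ^+ 2 by rewrite real_normK ?num_real.
have et1 : (th t (ein s) - th t (eout s)) ^+ 2 = th_jump t s ^+ 2 by rewrite real_normK ?num_real// -sqrrN opprB.
have et2 : (th t (eout s) - th t (ein s)) ^+ 2 = th_jump t s ^+ 2 by rewrite real_normK ?num_real.
have S0 : 0 <= S by rewrite !addr_ge0 ?sqr_ge0.
have p1 := ler_wpM2l A0 (rp _ _ er1 et1); have p2 := ler_wpM2l B0 (rp _ _ er2 et2).
have b1 (K : elt M) : diss_cst <= 1 * 1 / th t K.
  by apply: le_trans e4 _; rewrite !mul1r lef_pV2 ?posrE ?th_gt0//; have [] := rho_th_bd K tc.
have p3 : diss_cst * (eps * J) <= eps * ((1 * 1 / th t (ein s) + 1 * 1 / th t (eout s)) / 2 * J).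
  rewrite mulrCA ler_wpM2l ?powR_ge0// ler_wpM2r//; have := b1 (ein s); have := b1 (eout s); lra.
rewrite /production /dissip u_jumpE -/J -/S mulrDr; apply: lerD p3; apply: le_trans (lerD p1 p2).
rewrite -mulrDl mulrCA ler_wpM2r ?mulr_ge0 ?(ltW diss_cst_gt0)//.
by have := mu0 s tc; rewrite /outflow /inflow; lra.
Qed.

Definition diss_bound : R := (CB * (`|cv * ln thup - ln rlo| + `|s0|)) / diss_cst.

(** The identity is unbounded, but [entropy_balance] only asks for a supergradient. The gain of
    total entropy is bounded since the entropy is bounded above along the solution and below
    initially, and the mass is conserved. *)
Lemma Diss_le : ig 0 T Diss <= diss_bound.
Proof.
have TT : T \in `[0, T] by rewrite in_itv /= lexx ltW.
rewrite ler_pdivlMr ?diss_cst_gt0// mulrC -igZ; last exact: Diss_ct.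
have := @entropy_balance _ _ (fun _ _ => 1) (fun _ _ => 0) (fun t => diss_cst * Diss t) id_supergradient
  (fun K => @ct_cst R T 1) (fun K => @ct_cst R T 0) (fun t K _ => isdC 1 t) (fun _ _ _ => ler01) _ _ T TT.
pose f t := \sum_K cvol K * (rho t K * ent t K * 1).
rewrite -/(f T) -/(f 0) => H.
apply: (@le_trans _ _ (f T - f 0)).
  apply: le_trans (H _ _); first last.
  - move=> t tT; rewrite mulr_sumr; apply: ler_sum => s _.
    by rewrite mulrCA ler_wpM2l ?production_ge// ltW// (farea_s_gt0 cM LP).
  - by apply: ctM; [exact: ct_cst|exact: Diss_ct].
  rewrite le_eqVlt; apply/orP; left; apply/eqP; apply: eq_ig => t _.
  rewrite big1 => [|K' _]; last by rewrite !mulr0.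
  by rewrite big1 ?add0r// => s _; rewrite /jump subrr !mulr0.
have mB t (X : elt M -> R) (B : R) : t \in `[0, T] -> 0 <= B -> (forall K, X K <= B) ->
    \sum_K cvol K * (rho t K * X K * 1) <= CB * B.
  move=> tT B0 XB; apply: (@le_trans _ _ ((\sum_K cvol K * rho t K) * B)).
    rewrite mulr_suml; apply: ler_sum => K _; rewrite mulr1 mulrA ler_wpM2l//.
    by rewrite mulr_ge0 ?(ltW (vol0 K)) ?(ltW (rho_gt0 K tT)).
  by rewrite ler_wpM2r// mass_cons.
rewrite mulrDr; apply: lerD.
  by apply: mB => // K; apply: le_trans (ent_le K TT) _; exact: ler_norm.
rewrite /f -sumrN (eq_bigr (fun K => cvol K * (rho 0 K * (- ent 0 K) * 1))) => [|K _]; last by ring.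
apply: mB => // K; have := ent_init K; have := ler_norm (- s0); rewrite normrN; lra.
Qed.

Definition face_speed t (s : face M) : R := Num.sqrt (speed_sq t (ein s) + speed_sq t (eout s)).

Lemma face_speedE t s : face_speed t s ^+ 2 = speed_sq t (ein s) + speed_sq t (eout s).
Proof. by rewrite sqr_sqrtr// addr_ge0 ?speed_sq_ge0. Qed.

Lemma face_speed_ge0 t s : 0 <= face_speed t s. Proof. exact: sqrtr_ge0. Qed.

Lemma u_jump_ge0 t s : 0 <= u_jump t s. Proof. exact: sqrtr_ge0. Qed.

Let sum_le t (s : face M) : dot (u t (eout s) + u t (ein s)) (u t (eout s) + u t (ein s)) <= 2 * face_speed t s ^+ 2.
Proof.
rewrite face_speedE /speed_sq (addrC (dot _ _)) -parallelogram lerDr; exact: dotxx_ge0.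
Qed.

Lemma nvel_le t s : `|nvel t s| <= face_speed t s.
Proof.
rewrite /nvel; apply: le_trans (norm_dot_sqrt _ _) _; rewrite (nrm_unit cM) sqrtr1 mulr1.
rewrite ler_wsqrtr// /avgv dotZl dotZr addrC; have := sum_le t s; rewrite face_speedE.
by have := speed_sq_ge0 t (ein s); have := speed_sq_ge0 t (eout s); lra.
Qed.

Lemma u_jump_normal t s : `|dot (jumpv (u t) s) (nrm s)| <= u_jump t s.
Proof. by apply: le_trans (norm_dot_sqrt _ _) _; rewrite (nrm_unit cM) sqrtr1 mulr1. Qed.

Lemma face_speed_coord t s i : `|u t (ein s) 0 i| <= face_speed t s /\ `|u t (eout s) 0 i| <= face_speed t s.
Proof.
by split; apply: le_trans (coord_le_sqrt _ _) _; rewrite ler_wsqrtr// ?lerDl ?lerDr speed_sq_ge0.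
Qed.

Lemma speed_sq_jump t s : `|jump (speed_sq t) s| <= 2 * (u_jump t s * face_speed t s).
Proof.
have -> : jump (speed_sq t) s = dot (jumpv (u t) s) (u t (eout s) + u t (ein s)).
  by rewrite /jump /jumpv /speed_sq dotBl !dotDr (dotC (u t (ein s)) (u t (eout s))); ring.
apply: le_trans (norm_dot_sqrt _ _) _; rewrite mulrCA ler_wpM2l ?u_jump_ge0//.
rewrite -(@ler_pXn2r _ 2) ?nnegrE ?sqrtr_ge0 ?mulr_ge0 ?face_speed_ge0// sqr_sqrtr ?dotxx_ge0//.
by apply: le_trans (sum_le t s) _; rewrite exprMn ler_wpM2r ?sqr_ge0//; lra.
Qed.

(** The first two entries are half the margins in beta < 1 and 0 < alpha. The third is a quarter of
    2 - 3 kappa = 1 - 3 alpha / 4, the exponent available on slow faces in dimension 3; it also fits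
    the margin 2 kappa - alpha of the fast cells. *)
Definition delta : R := Num.min (Num.min ((1 - beta) / 2) (alpha / 2)) ((1 / 3 - alpha / 4) * (3 / 4)).

Let delta_bounds : [/\ 2 * delta <= 1 - beta, 2 * delta <= alpha & 4 * delta <= 1 - 3 / 4 * alpha].
Proof.
have [h1 h2] : delta <= (1 - beta) / 2 /\ delta <= alpha / 2 by rewrite /delta !ge_min !lexx !orbT.
have h3 : delta <= (1 / 3 - alpha / 4) * (3 / 4) by rewrite /delta !ge_min !lexx !orbT.
by split; lra.
Qed.

Lemma delta_gt0 : 0 < delta.
Proof.
have /andP[b0 b1] := beta01; have /andP[a0 a1] := alpha_range.
by rewrite /delta !lt_min; apply/andP; split; first (apply/andP; split); lra.
Qed.

Notation D := (h `^ delta).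
Notation Hb := size_bound.
Definition power_cst : R := Hb ^+ 2 * (1 + c).
Notation A := power_cst.

Let hH : 0 < h <= Hb. Proof. by rewrite h0 size_le. Qed.
Let H1 : 1 <= Hb := size_bound_ge1.
Let H0 : 0 < Hb. Proof. exact: lt_le_trans ltr01 H1. Qed.
Let D0 : 0 <= D. Proof. exact: powR_ge0. Qed.
Let hpowD (x y : R) : h `^ (x + y) = h `^ x * h `^ y.
Proof. by rewrite powRD// (gt_eqF h0) implybT. Qed.
Let Dpow k : D ^+ k = h `^ (delta * k%:R).
Proof. by rewrite powRrM powR_mulrn. Qed.
Let hpow1 : h = h `^ 1. Proof. by rewrite powRr1// ltW. Qed.
Let HA : Hb ^+ 2 <= A. Proof. by rewrite /A ler_peMr ?sqr_ge0// lerDl ltW. Qed.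

Lemma power_cst_ge0 : 0 <= A.
Proof. by rewrite mulr_ge0 ?sqr_ge0// addr_ge0// ltW. Qed.

Lemma size_power : h <= A * D ^+ 2.
Proof.
have [h1 h2 h3] := delta_bounds; have d0 := delta_gt0; have /andP[b0 b1] := beta01.
rewrite Dpow {1}hpow1; apply: le_trans (_ : Hb ^+ 2 * h `^ (delta * 2%:R) <= _); last by rewrite ler_wpM2r ?powR_ge0.
by apply: powR_size => //; apply/andP; split; lra.
Qed.

Lemma size_power_mu s t : t \in `[0, T] -> h <= A * D ^+ 2 * mu s t.
Proof.
move=> tT; have [h1 h2 h3] := delta_bounds; have d0 := delta_gt0; have /andP[b0 b1] := beta01.
have /andP[m1 _] := mu_bd s tT; rewrite ler_pdivrMl// in m1.
have le1 : h <= Hb ^+ 2 * (D ^+ 2 * h `^ beta).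
  by rewrite Dpow -hpowD {1}hpow1; apply: powR_size => //; apply/andP; split; lra.
apply: le_trans le1 _; rewrite [leRHS](_ : _ = Hb ^+ 2 * (D ^+ 2 * ((1 + c) * mu s t))); last by rewrite /A; ring.
rewrite ler_wpM2l ?sqr_ge0// ler_wpM2l ?sqr_ge0//; apply: le_trans m1 _.
by rewrite ler_wpM2r ?mu0// lerDr.
Qed.

Lemma size_power_eps : h <= A * D ^+ 2 * eps.
Proof.
have [h1 h2 h3] := delta_bounds; have d0 := delta_gt0; have /andP[a0 a1] := alpha_range.
apply: le_trans (_ : Hb ^+ 2 * D ^+ 2 * eps <= _); last by rewrite ler_wpM2r ?powR_ge0// ler_wpM2r ?sqr_ge0.
by rewrite -mulrA Dpow -hpowD {1}hpow1; apply: powR_size => //; apply/andP; split; lra.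
Qed.

Let heps : h * eps = h `^ alpha.
Proof. by rewrite {1}hpow1 -hpowD addrC subrK. Qed.

Lemma eps_power : h * eps <= A * D ^+ 2.
Proof.
have [h1 h2 h3] := delta_bounds; have d0 := delta_gt0; have /andP[a0 a1] := alpha_range.
apply: le_trans (_ : Hb ^+ 2 * D ^+ 2 <= _); last by rewrite ler_wpM2r ?sqr_ge0.
by rewrite heps Dpow; apply: powR_size => //; apply/andP; split; lra.
Qed.

(* The length at which [concentration] is applied: the slow faces need [kappa < 2 / 3] and the fast
   ones [alpha / 2 < kappa], whence the restriction [alpha < 4 / 3]. *)
Notation kappa := (alpha / 4 + 1 / 3).
Definition scale : R := (h / Hb) `^ kappa.

Let hHb0 : 0 < h / Hb. Proof. exact: divr_gt0. Qed.
Let hHb1 : h / Hb <= 1. Proof. by rewrite ler_pdivrMr// mul1r size_le. Qed.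
Let kappa0 : 0 <= kappa. Proof. by have /andP[a0 _] := alpha_range; lra. Qed.

Lemma scale_gt0 : 0 < scale. Proof. exact: powR_gt0. Qed.

Lemma scale_le1 : scale <= 1.
Proof. have e : 1 `^ kappa = 1 :> R by rewrite powR1.
by rewrite -[leRHS]e ge0_ler_powR ?nnegrE// ltW. Qed.

Lemma scale_sqr : scale ^+ 2 <= A * D ^+ 2 * (eps * h).
Proof.
have [h1 h2 h3] := delta_bounds; have d0 := delta_gt0; have /andP[a0 a1] := alpha_range.
apply: le_trans (_ : Hb ^+ 2 * D ^+ 2 * (eps * h) <= _); last first.
  by rewrite ler_wpM2r ?mulr_ge0 ?powR_ge0 ?(ltW h0)// ler_wpM2r ?sqr_ge0.
rewrite (mulrC eps) heps -mulrA Dpow -hpowD.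
apply: le_trans (_ : h `^ (kappa * 2%:R) <= _); last by apply: powR_size => //; apply/andP; split; lra.
rewrite powRrM powR_mulrn ?powR_ge0// lerXn2r ?nnegrE ?powR_ge0//.
by rewrite ge0_ler_powR ?nnegrE ?(ltW hHb0) ?(ltW h0)// ler_pdivrMr// ler_peMr// ltW.
Qed.

(** On the slow faces h^2 |u|^2 is of order h^2 / scale^n, and 2 - 3 kappa >= 4 delta. Comparing
    powers costs [Hb ^+ 2]; the remaining [Hb ^+ 3] comes from taking powers of [h / Hb], which
    keeps [scale] at most 1. *)
Lemma scale_size : h ^+ 2 <= Hb ^+ 5 * D ^+ 4 * scale ^+ n.
Proof.
have [h1 h2 h3] := delta_bounds; have d0 := delta_gt0; have /andP[a0 a1] := alpha_range.
have /andP[n1 n3] := n03; have n3' : n%:R <= 3 :> R by rewrite ler_nat.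
have kn0 : 0 <= kappa * n%:R by rewrite mulr_ge0.
have kn : kappa * n%:R <= kappa * 3 by rewrite ler_wpM2l.
have le1 : h ^+ 2 <= Hb ^+ 2 * h `^ (delta * 4%:R + kappa * n%:R).
  rewrite -powR_mulrn ?(ltW h0)//; apply: powR_size => //; apply/andP; split; lra.
apply: le_trans le1 _; rewrite hpowD -Dpow.
rewrite [leRHS](_ : _ = Hb ^+ 2 * (D ^+ 4 * (Hb ^+ 3 * scale ^+ n))); last by ring.
rewrite ler_wpM2l ?sqr_ge0// ler_wpM2l ?exprn_ge0// /scale.
have -> : h `^ (kappa * n%:R) = Hb `^ (kappa * n%:R) * (h / Hb) `^ (kappa * n%:R).
  by rewrite -powRM ?(ltW H0) ?(ltW hHb0)// (mulrC Hb) divfK ?gt_eqF.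
rewrite (powRrM (h / Hb)) powR_mulrn ?powR_ge0// ler_wpM2r ?exprn_ge0 ?powR_ge0//.
by rewrite -powR_mulrn ?(ltW H0)// ler_powR//; lra.
Qed.

Definition face_weight t s : R := h * (1 + face_speed t s ^+ 2) + dissip t s.
Definition total_weight t : R := \sum_s farea_s s * face_weight t s.

Notation Cf := ((2 * (c + 1)) ^+ n * c).
Notation CW := (2 * CB / rlo).
Definition weight_cst : R := Cf * (CB / rlo + CW).

Let Cf0 : 0 <= Cf. Proof. by rewrite mulr_ge0 ?exprn_ge0 ?mulr_ge0 ?addr_ge0 ?(ltW c0). Qed.

Lemma CW_ge0 : 0 <= CW. Proof. by rewrite divr_ge0 ?mulr_ge0 ?CB_ge0 ?(ltW rlo0). Qed.

Let face_cells (f : elt M -> R) : (forall K, 0 <= f K) ->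
  h * \sum_s farea_s s * (f (ein s) + f (eout s)) <= Cf * \sum_K cvol K * f K.
Proof.
move=> f0; apply: le_trans (sum_faces_le OmO cM LP c0 h0 diam f0) _.
rewrite -mulrA ler_wpM2l ?exprn_ge0 ?mulr_ge0 ?addr_ge0 ?(ltW c0)// !mulr_sumr; apply: ler_sum => K _.
by rewrite mulrA ler_wpM2r// -ler_pdivrMl.
Qed.

(** By [face_cells], h times the face sum of 1 + |u|^2 is controlled by volume and kinetic energy;
    the remainder of the weight is the dissipation itself. *)
Lemma total_weight_le t : t \in `[0, T] -> total_weight t <= weight_cst + Diss t.
Proof.
move=> tT; rewrite /total_weight /face_weight (eq_bigr _ (fun s _ => mulrDr _ _ _)) big_split /= lerD2r.
under eq_bigr do rewrite mulrCA; rewrite -mulr_sumr.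
rewrite (eq_bigr (fun s => farea_s s * ((2^-1 + speed_sq t (ein s)) + (2^-1 + speed_sq t (eout s))))); last first.
  by move=> s _; rewrite face_speedE; congr (_ * _); field.
apply: le_trans (face_cells (f := fun K => 2^-1 + speed_sq t K) _) _.
  by move=> K; rewrite addr_ge0 ?speed_sq_ge0// invr_ge0.
rewrite ler_wpM2l// (eq_bigr _ (fun K _ => mulrDr _ _ _)) big_split /=; apply: lerD; last exact: kinetic_le.
apply: le_trans volume_le; apply: ler_sum => K _; have := vol0 K; lra.
Qed.

Lemma face_weight_ge0 t s : t \in `[0, T] -> 0 <= face_weight t s.
Proof. by move=> tT; rewrite addr_ge0 ?dissip_ge0// mulr_ge0 ?(ltW h0)// addr_ge0 ?sqr_ge0. Qed.

Section FaceBounds.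
Variables (t : R) (s : face M).
Hypothesis tT : t \in `[0, T].

Let am : 0 <= `|nvel t s| <= face_speed t s. Proof. by rewrite normr_ge0 nvel_le. Qed.
Let mc : 0 <= mu s t <= c. Proof. by rewrite mu0//; have /andP[] := mu_bd s tT. Qed.
Let jrt : [/\ 0 <= u_jump t s, 0 <= rho_jump t s & 0 <= th_jump t s]. Proof. by split; [exact: u_jump_ge0|exact: normr_ge0|exact: normr_ge0]. Qed.
Let A0 := power_cst_ge0.
Let c0' := ltW c0.
Let h0' := ltW h0.
Let e0 : 0 <= eps. Proof. exact: powR_ge0. Qed.

Lemma flow_jump_le x : x ^+ 2 <= u_jump t s ^+ 2 + rho_jump t s ^+ 2 + th_jump t s ^+ 2 ->
  h * (`|nvel t s| + mu s t) * x <= (1 + A * (1 + c)) * D * face_weight t s.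
Proof. by apply: face_flow_jump => //; do ?[exact: power_cst_ge0|exact: ltW|exact: size_power]. Qed.

Lemma jump_le x : x ^+ 2 <= u_jump t s ^+ 2 + rho_jump t s ^+ 2 + th_jump t s ^+ 2 ->
  h * x <= (1 + A) * D * face_weight t s.
Proof. by apply: (@face_jump _ A D c) => //; do ?[exact: power_cst_ge0|exact: ltW|exact: size_power|exact: size_power_mu]. Qed.

Lemma visc_jump_le : h * mu s t * face_speed t s * rho_jump t s <= (1 + c * A) * D * face_weight t s.
Proof. by apply: face_visc_jump => //; do ?[exact: power_cst_ge0|exact: ltW|exact: size_power]. Qed.

Lemma vel_jump_le : h * u_jump t s * face_speed t s <= (1 + A) * D * face_weight t s.
Proof. by apply: (@face_vel_jump _ A D c) => //; do ?[exact: power_cst_ge0|exact: ltW|exact: size_power_eps]. Qed.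

Lemma stress_le : h * eps * u_jump t s <= (1 + A) * D * face_weight t s.
Proof. by apply: (@face_stress _ A D c) => //; do ?[exact: power_cst_ge0|exact: ltW|exact: eps_power]. Qed.

Lemma energy_jump_le : scale * (u_jump t s * face_speed t s) <= (1 + A) * D * face_weight t s.
Proof. by apply: (@face_energy_jump _ A D c) => //; do ?[exact: power_cst_ge0|exact: ltW|exact: scale_sqr|exact/ltW/scale_gt0]. Qed.

End FaceBounds.

(** Cells above this squared speed are among those selected by [concentration] with [t = scale],
    since the cell sum of |u|^2 is at most [CW]. *)
Definition speed_threshold : R := Cc * CW / scale ^+ n.
Definition slow_cst : R := 2 * (Cc * CW) * Hb ^+ 5.

Lemma slow_cst_ge0 : 0 <= slow_cst.
Proof. by rewrite mulr_ge0 ?exprn_ge0 ?(ltW H0)// mulr_ge0// mulr_ge0 ?(ltW Cc0) ?CW_ge0. Qed.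

Let scn0 : 0 < scale ^+ n. Proof. by rewrite exprn_gt0// scale_gt0. Qed.

Lemma slow_face t s : speed_sq t (ein s) <= speed_threshold -> speed_sq t (eout s) <= speed_threshold ->
  h * face_speed t s <= (1 + slow_cst) * D ^+ 2.
Proof.
move=> hi ho; have s0' := slow_cst_ge0.
rewrite -(@ler_pXn2r _ 2) ?nnegrE ?mulr_ge0 ?face_speed_ge0 ?(ltW h0) ?addr_ge0//.
rewrite exprMn face_speedE.
apply: (@le_trans _ _ (slow_cst * D ^+ 4)); last first.
  rewrite [leRHS](_ : _ = (1 + slow_cst) ^+ 2 * D ^+ 4); last by ring.
  by rewrite ler_wpM2r ?exprn_ge0//; nra.
apply: (@le_trans _ _ (h ^+ 2 * (2 * speed_threshold))).
  by rewrite ler_wpM2l ?sqr_ge0//; lra.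
rewrite /speed_threshold !mulrA ler_pdivrMr// /slow_cst.
have k0 : 0 <= 2 * (Cc * CW) by rewrite mulr_ge0// mulr_ge0 ?(ltW Cc0) ?CW_ge0.
have := ler_wpM2l k0 scale_size; rewrite [X in X <= _ -> _](_ : _ = h ^+ 2 * 2 * Cc * 2 * CB / rlo); last by ring.
by move=> /le_trans; apply; rewrite le_eqVlt; apply/orP; left; apply/eqP; ring.
Qed.

Definition fast t K : R := if speed_threshold < speed_sq t K then speed_sq t K else 0.

Lemma fast_ge0 t K : 0 <= fast t K.
Proof. by rewrite /fast; case: ifP => // _; exact: speed_sq_ge0. Qed.

(** [concentration] is applied to |u|^2, whose jump is at most 2 |[[u]]| |u|; multiplied by [scale],
    this is D times the face weight by [energy_jump_le]. *)
Lemma fast_sum t : t \in `[0, T] -> \sum_K cvol K * fast t K <= 2 * Cc * (1 + A) * D * total_weight t.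
Proof.
move=> tT.
have sc : 0 < scale <= 1 by rewrite scale_gt0 scale_le1.
apply: (@le_trans _ _ (Cc * scale * \sum_s farea_s s * `|jump (speed_sq t) s|)).
  apply: le_trans (conc sc (speed_sq_ge0 t)); rewrite [leRHS]big_mkcond /=; apply: ler_sum => K _.
  rewrite /fast; case: ifPn => [fK|_]; last first.
    by rewrite mulr0; case: ifP => // _; rewrite mulr_ge0 ?speed_sq_ge0 ?ltW.
  rewrite ifT//; move: fK; rewrite /speed_threshold ltr_pdivrMr// (mulrC (speed_sq t K)).
  by apply: le_lt_trans; rewrite ler_wpM2l ?(ltW Cc0)// kinetic_le.
rewrite /total_weight !mulr_sumr; apply: ler_sum => s _; have a0 := farea_s_gt0 cM LP s.
rewrite mulrCA [leRHS]mulrCA ler_wpM2l ?(ltW a0)//.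
have h1 := energy_jump_le s tT; have h2 := speed_sq_jump t s.
apply: le_trans (ler_wpM2l (mulr_ge0 (ltW Cc0) (ltW scale_gt0)) h2) _.
rewrite [leLHS](_ : _ = 2 * Cc * (scale * (u_jump t s * face_speed t s))); last by ring.
rewrite [leRHS](_ : _ = 2 * Cc * ((1 + A) * D * face_weight t s)); last by ring.
by rewrite ler_wpM2l// mulr_ge0// ltW.
Qed.

(** The slow faces give [2 + slow_cst]. On the others a factor 2 compares both cells with the fast
    ones, 2 rhi bounds the contribution with the density jump, [Cf] passes from faces to cells and
    the rest is from [fast_sum]. *)
Definition hard_cst : R := 2 + slow_cst + 4 * rhi * Cf * Cc * (1 + A).

(* Interpolation fails for this term on the faces adjacent to cells of large speed; these carry little
   kinetic energy, by [concentration]. *)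
Lemma hard_term t : t \in `[0, T] ->
  h * \sum_s farea_s s * (`|nvel t s| * face_speed t s * rho_jump t s) <= hard_cst * D * total_weight t.
Proof.
move=> tT; have s0' := slow_cst_ge0; have rh0 := rhi_gt0.
apply: (@le_trans _ _ ((2 + slow_cst) * D * total_weight t +
    2 * rhi * (h * \sum_s farea_s s * (fast t (ein s) + fast t (eout s))))).
  rewrite /total_weight !mulr_sumr -big_split /=; apply: ler_sum => s _; have a0 := farea_s_gt0 cM LP s.
  rewrite mulrCA [leRHS](_ : _ = farea_s s * ((2 + slow_cst) * D * face_weight t s
     + 2 * rhi * (h * (fast t (ein s) + fast t (eout s))))); last by ring.
  rewrite ler_wpM2l ?(ltW a0)//.
  have fi := fast_ge0 t (ein s); have fo := fast_ge0 t (eout s); have Y0 := face_weight_ge0 s tT.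
  have [/andP[si so]|fst] := boolP ((speed_sq t (ein s) <= speed_threshold) && (speed_sq t (eout s) <= speed_threshold)).
    have := slow_face si so => sl.
    apply: (@le_trans _ _ ((1 + (1 + slow_cst)) * D * face_weight t s)); last first.
      by rewrite addrA -[1 + 1]/(2 : R) lerDl !mulr_ge0 ?addr_ge0 ?(ltW rh0) ?(ltW h0).
    rewrite !mulrA; apply: (@face_slow _ D c) => //; do ?[exact: power_cst_ge0|exact: ltW|exact: powR_ge0].
    - by rewrite normr_ge0 nvel_le.
    - by rewrite mu0//; have /andP[] := mu_bd s tT.
    - by rewrite addr_ge0.
  (* At least one of the two cells is fast here, and its speed exceeds that of the other if that one
     is slow. *)
  have wf : speed_sq t (ein s) + speed_sq t (eout s) <= 2 * (fast t (ein s) + fast t (eout s)).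
    move: fst fi fo; rewrite negb_and -!ltNge /fast.
    have := speed_sq_ge0 t (ein s); have := speed_sq_ge0 t (eout s).
    by case: (ltP speed_threshold (speed_sq t (ein s))) => ?; case: (ltP speed_threshold (speed_sq t (eout s))) => ? //= *; lra.
  have jrr : rho_jump t s <= rhi.
    have := rho_le (ein s) tT; have := rho_le (eout s) tT; have := rho_gt0 (ein s) tT; have := rho_gt0 (eout s) tT.
    by rewrite /rho_jump /jump ler_norml => *; apply/andP; split; lra.
  apply: (@le_trans _ _ (2 * rhi * (h * (fast t (ein s) + fast t (eout s))))); last first.
    by rewrite lerDr !mulr_ge0// addr_ge0.
  rewrite [leRHS](_ : _ = h * (2 * (fast t (ein s) + fast t (eout s)) * rhi)); last by ring.
  rewrite ler_wpM2l ?(ltW h0)//; apply: ler_pM => //; first by rewrite mulr_ge0 ?face_speed_ge0.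
    exact: normr_ge0.
  apply: le_trans wf; rewrite -face_speedE expr2 ler_wpM2r ?face_speed_ge0//; exact: nvel_le.
rewrite /hard_cst [leRHS](_ : _ = (2 + slow_cst) * D * total_weight t + 2 * rhi * (Cf * (2 * Cc * (1 + A) * D * total_weight t))); last by ring.
rewrite lerD2l ler_wpM2l ?mulr_ge0 ?(ltW rh0)//.
apply: le_trans (face_cells (fast_ge0 t)) _; rewrite ler_wpM2l//; exact: fast_sum.
Qed.

Definition conv_cst : R := 6 * (1 + A * (1 + c)) + 2 * (1 + c * A) + 2 * (1 + A) + hard_cst.

Let sq_le t s : [/\ u_jump t s ^+ 2 <= u_jump t s ^+ 2 + rho_jump t s ^+ 2 + th_jump t s ^+ 2,
  rho_jump t s ^+ 2 <= u_jump t s ^+ 2 + rho_jump t s ^+ 2 + th_jump t s ^+ 2 &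
  th_jump t s ^+ 2 <= u_jump t s ^+ 2 + rho_jump t s ^+ 2 + th_jump t s ^+ 2].
Proof. by have := sqr_ge0 (u_jump t s); have := sqr_ge0 (rho_jump t s); have := sqr_ge0 (th_jump t s); split; lra. Qed.

(** The hypotheses fit both uses: [eta] = rho chi(s), with bounded values, and [eta] a momentum
    component, whose jump contains the speed times the jump of the density. *)
Lemma conv_defect_le (eta : elt M -> R) (G : R) t : t \in `[0, T] -> 0 <= G ->
  (forall s, `|jump eta s| <= G * (rho_jump t s + th_jump t s + u_jump t s + face_speed t s * rho_jump t s)) ->
  (forall s, `|eta (ein s)| + `|eta (eout s)| <= G * (1 + face_speed t s)) ->
  h * conv_defect eta t <= G * (conv_cst * D * total_weight t).
Proof.
move=> tT G0 hj he.
apply: (@le_trans _ _ (G * ((conv_cst - hard_cst) * D * total_weight t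
   + h * \sum_s farea_s s * (`|nvel t s| * face_speed t s * rho_jump t s)))); last first.
  rewrite ler_wpM2l// [leRHS](_ : _ = (conv_cst - hard_cst) * D * total_weight t + hard_cst * D * total_weight t); last by ring.
  by rewrite lerD2l hard_term.
rewrite /total_weight /conv_defect !mulr_sumr -big_split /= mulr_sumr; apply: ler_sum => s _.
have a0 := farea_s_gt0 cM LP s.
rewrite mulrCA [leRHS](_ : _ = farea_s s * (G * ((conv_cst - hard_cst) * D * face_weight t s
     + h * `|nvel t s| * face_speed t s * rho_jump t s))); last by ring.
rewrite ler_wpM2l ?(ltW a0)//.
have hai := h0; have [s1 s2 s3] := sq_le t s.
have m0 := mu0 s tT; have j0 := u_jump_ge0 t s; have v0 := face_speed_ge0 t s.
have AB : outflow t s + inflow t s = `|nvel t s| + 2 * mu s t by rewrite /outflow /inflow; field.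
have AB0 : 0 <= `|nvel t s| + 2 * mu s t by rewrite addr_ge0// mulr_ge0.
apply: (@le_trans _ _ (G * (h * ((`|nvel t s| + 2 * mu s t) * (rho_jump t s + th_jump t s + u_jump t s + face_speed t s * rho_jump t s)
    + 2^-1 * u_jump t s * (1 + face_speed t s))))).
  rewrite mulrCA ler_wpM2l ?(ltW h0)// AB [leRHS]mulrDr; apply: lerD.
    by rewrite mulrCA ler_wpM2l.
  rewrite [leRHS](_ : _ = 2^-1 * u_jump t s * (G * (1 + face_speed t s))); last by ring.
  by apply: ler_pM; rewrite ?addr_ge0 ?mulr_ge0 ?invr_ge0// ler_wpM2l ?invr_ge0// u_jump_normal.
rewrite ler_wpM2l//.
rewrite (_ : (conv_cst - hard_cst) * D * face_weight t s = 6 * ((1 + A * (1 + c)) * D * face_weight t s) + 2 * ((1 + c * A) * D * face_weight t s)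
    + 2 * ((1 + A) * D * face_weight t s)); last by rewrite /conv_cst; ring.
apply: face_total; rewrite ?normr_ge0 ?(ltW h0)//; try exact: flow_jump_le.
- exact: visc_jump_le.
- exact: jump_le.
- exact: vel_jump_le.
by rewrite !mulr_ge0 ?face_weight_ge0// addr_ge0// power_cst_ge0.
Qed.

Lemma rate_integral (f : R -> R) (G : R) : ct T f -> 0 <= G ->
  (forall t, 0 < t < T -> `|f t| <= G * total_weight t) -> L1norm T f <= G * (weight_cst * T + diss_bound).
Proof.
move=> cf G0 fG.
apply: (@le_trans _ _ (ig 0 T (fun t => G * (weight_cst + Diss t)))).
  apply: (le_ig_interior T0).
  - exact: ct_norm.
  - by apply: ctM; [exact: ct_cst|apply: ctD; [exact: ct_cst|exact: Diss_ct]].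
  - by move=> t tT; apply: le_trans (fG t tT) _; rewrite ler_wpM2l// total_weight_le// in_cc.
have cD := Diss_ct; have cc := @ct_cst R T weight_cst.
rewrite igZ; last exact: ctD.
rewrite ler_wpM2l// igD// ig_cst ?(ltW T0)// subr0 lerD2l; exact: Diss_le.
Qed.

(** The local [X] bounds |chi| on the range of the entropy, and [kap s0] is a Lipschitz constant of
    chi on [s0, oo[. *)
Definition entropy_rate_cst (chi kap : R -> R) : R :=
  let X := `|chi s0| + `|chi (cv * ln thup - ln rlo)| in
  2 * rhi * X + rhi * (kap s0 * (cv / tlo + rlo^-1)) + X.

Let jump_ent t s : t \in `[0, T] -> `|ent t (eout s) - ent t (ein s)| <= (cv / tlo + rlo^-1) * (rho_jump t s + th_jump t s).
Proof.
move=> tT; rewrite !(entE _ tT).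
have l1 := ln_lipschitz tlo_gt0 (th_ge (eout s) tT) (th_ge (ein s) tT).
have l2 := ln_lipschitz rlo0 (proj1 (rho_th_bd (eout s) tT)) (proj1 (rho_th_bd (ein s) tT)).
rewrite (_ : _ - _ = cv * (ln (th t (eout s)) - ln (th t (ein s))) - (ln (rho t (eout s)) - ln (rho t (ein s)))); last by ring.
apply: le_trans (ler_normB _ _) _; rewrite normrM (gtr0_norm cv0).
apply: (@le_trans _ _ (cv * (th_jump t s / tlo) + rho_jump t s / rlo)).
  by apply: lerD => //; rewrite ler_wpM2l// ltW.
have r0 : 0 <= cv / tlo * rho_jump t s by rewrite mulr_ge0 ?divr_ge0 ?(ltW cv0) ?(ltW tlo_gt0)//; exact: normr_ge0.
have t0 : 0 <= rlo^-1 * th_jump t s by rewrite mulr_ge0 ?invr_ge0 ?(ltW rlo0)//; exact: normr_ge0.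
by lra.
Qed.

Lemma entropy_rate_le chi kap phi t : supergradient chi kap -> 0 < t < T ->
  `|residual (fun K => chi (ent t K)) phi t| <=
  n%:R * c * (entropy_rate_cst chi kap * conv_cst) * D * C1norm phi * total_weight t.
Proof.
move=> sg tT; have tc := in_cc tT.
have kx x : 0 <= kap x by have [] := sg x.
have mono x y : x <= y -> chi x <= chi y.
  by move=> xy; have [k0 /(_ x)] := sg y; nra.
set X := `|chi s0| + `|chi (cv * ln thup - ln rlo)|.
have rh0 := ltW rhi_gt0.
have lo0 : 0 <= cv / tlo + rlo^-1 by apply: addr_ge0; [apply: divr_ge0; [exact: ltW|exact: ltW tlo_gt0]|rewrite invr_ge0 ltW].
have chiX K : `|chi (ent t K)| <= X.
  have h1 := mono _ _ (ent_ge K tc); have h2 := mono _ _ (ent_le K tc).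
  rewrite /X ler_norml; apply/andP; split.
    by have := ler_norm (- chi s0); rewrite normrN; have := normr_ge0 (chi (cv * ln thup - ln rlo)); lra.
  by have := ler_norm (chi (cv * ln thup - ln rlo)); have := normr_ge0 (chi s0); lra.
have X0 : 0 <= X by rewrite addr_ge0.
have lipc x y : s0 <= x -> s0 <= y -> `|chi x - chi y| <= kap s0 * `|x - y|.
  move=> sx sy; have kxs := supergradient_nonincreasing sg sx; have kys := supergradient_nonincreasing sg sy.
  have [_ /(_ y) h1] := sg x; have [_ /(_ x) h2] := sg y; have kx0 := kx x; have ky0 := kx y.
  have [xy|xy] := leP x y.
    rewrite !ler0_norm ?subr_le0 ?mono//; nra.
  by rewrite !ger0_norm ?subr_ge0 ?mono ?(ltW xy)//; nra.
set G := entropy_rate_cst chi kap.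
have GE : G = 2 * rhi * X + rhi * (kap s0 * (cv / tlo + rlo^-1)) + X by [].
have k0 : 0 <= rhi * (kap s0 * (cv / tlo + rlo^-1)) by rewrite !mulr_ge0.
have G0 : 0 <= G by rewrite GE !addr_ge0// !mulr_ge0.
have rX : 0 <= rhi * X by rewrite mulr_ge0.
apply: le_trans (residual_le diam _ phi tT) _.
rewrite [leLHS](_ : _ = n%:R * c * C1norm phi * (h * conv_defect (fun K => rho t K * chi (ent t K)) t)); last by ring.
rewrite [leRHS](_ : _ = n%:R * c * C1norm phi * (G * (conv_cst * D * total_weight t))); last by ring.
rewrite ler_wpM2l ?mulr_ge0 ?(ltW c0) ?(C1norm_ge0 T0 hOm)//.
apply: conv_defect_le => // s.
- have i0 := rho_gt0 (ein s) tc; have o0 := rho_gt0 (eout s) tc.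
  rewrite /jump (_ : _ - _ = rho t (eout s) * (chi (ent t (eout s)) - chi (ent t (ein s)))
     + chi (ent t (ein s)) * (rho t (eout s) - rho t (ein s))); last by ring.
  have jr0 : 0 <= rho_jump t s by exact: normr_ge0.
  have jt0 : 0 <= th_jump t s by exact: normr_ge0.
  have j1 := jump_ent s tc; have ju0 := u_jump_ge0 t s; have vj := mulr_ge0 (face_speed_ge0 t s) jr0.
  apply: le_trans (ler_normD _ _) _; rewrite !normrM (gtr0_norm o0).
  apply: (@le_trans _ _ (rhi * (kap s0 * ((cv / tlo + rlo^-1) * (rho_jump t s + th_jump t s))) + X * rho_jump t s)).
    apply: lerD; last by apply: ler_wpM2r.
    apply: ler_pM => //; first exact: ltW; first exact: rho_le.
    by apply: le_trans (lipc _ _ (ent_ge _ tc) (ent_ge _ tc)) _; rewrite ler_wpM2l.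
  rewrite (_ : rhi * _ = rhi * (kap s0 * (cv / tlo + rlo^-1)) * (rho_jump t s + th_jump t s)); last by ring.
  apply: (@le_trans _ _ (G * (rho_jump t s + th_jump t s))); last by rewrite ler_wpM2l//; lra.
  rewrite GE; have := mulr_ge0 X0 jt0; have := mulr_ge0 rX jr0; have := mulr_ge0 rX jt0; lra.
- have b K : `|rho t K * chi (ent t K)| <= rhi * X.
    rewrite normrM (gtr0_norm (rho_gt0 K tc)); apply: ler_pM => //; first exact/ltW/rho_gt0.
    exact: rho_le.
  apply: le_trans (lerD (b _) (b _)) _; have := mulr_ge0 G0 (face_speed_ge0 t s); rewrite GE; lra.
Qed.

Lemma momentum_rate_le (Pm : elt M -> 'M[R]_n) (CP : R) (Phi : 'I_n -> C1fun T Om) t : 0 <= CP ->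
  (forall K (w v : 'rV[R]_n), boundary_facet Om K v -> dot (w *m Pm K) v = 0) ->
  (forall K (w : 'rV[R]_n) (b : R), 0 <= b ->
     (forall v, boundary_facet Om K v -> `|dot w v| <= b) -> forall i, `|(w - w *m Pm K) 0 i| <= CP * b) ->
  0 < t < T -> tangential M Phi ->
  `|mresidual Pm Phi t| <= (CP + 1) * n%:R * c *
     (n%:R * ((2 * rhi + 1) * conv_cst) + n%:R * (rhi + thup) * (1 + A) + 2 * n%:R * (1 + A))
     * D * C1normv Phi * total_weight t.
Proof.
move=> CP0 P1 P3 tT tg; have tc := in_cc tT; have rh0 := ltW rhi_gt0.
refine (le_trans (mresidual_le P1 P3 diam tT tg) _).
set S1 := \sum_i _; set S2 := \sum_s _.
rewrite [leLHS](_ : _ = (CP + 1) * n%:R * c * C1normv Phi * (h * S1 + h * S2)); last by ring.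
rewrite [leRHS](_ : _ = (CP + 1) * n%:R * c * C1normv Phi * (n%:R * ((2 * rhi + 1) * (conv_cst * D * total_weight t))
   + (n%:R * (rhi + thup) * (1 + A) + 2 * n%:R * (1 + A)) * D * total_weight t)); last by ring.
rewrite ler_wpM2l//.
  rewrite !mulr_ge0 ?addr_ge0 ?(ltW c0)//; apply: sumr_ge0 => i _; exact: (C1norm_ge0 T0 hOm).
apply: lerD.
  have nsum (x : R) : n%:R * x = \sum_(i < n) x by rewrite sumr_const card_ord mulr_natl.
  rewrite mulr_sumr nsum; apply: ler_sum => i _.
  have mE K : mom (U t) K 0 i = rho t K * u t K 0 i by rewrite (momE K tc) [LHS]mxE.
  apply: conv_defect_le => //; first by rewrite addr_ge0// mulr_ge0.
    move=> s; rewrite /jump !mE.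
    have [vi vo] := face_speed_coord t s i; have jr0 : 0 <= rho_jump t s by exact: normr_ge0.
    have jt0 : 0 <= th_jump t s by exact: normr_ge0.
    have j1 : `|u t (eout s) 0 i - u t (ein s) 0 i| <= u_jump t s.
      by have := coord_le_sqrt (jumpv (u t) s) i; rewrite /jumpv !mxE.
    have v0 := face_speed_ge0 t s; have ju0 := u_jump_ge0 t s.
    rewrite (_ : _ - _ = rho t (eout s) * (u t (eout s) 0 i - u t (ein s) 0 i)
      + u t (ein s) 0 i * (rho t (eout s) - rho t (ein s))); last by ring.
    apply: le_trans (ler_normD _ _) _; rewrite !normrM (gtr0_norm (rho_gt0 (eout s) tc)).
    apply: (@le_trans _ _ (rhi * u_jump t s + face_speed t s * rho_jump t s)).
      apply: lerD; last by rewrite ler_wpM2r.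
      by apply: ler_pM => //; [exact/ltW/rho_gt0|exact: rho_le].
    have := mulr_ge0 rh0 ju0; have := mulr_ge0 v0 jr0; have := mulr_ge0 rh0 jr0; have := mulr_ge0 rh0 jt0.
    have := mulr_ge0 rh0 (mulr_ge0 v0 jr0); lra.
  move=> s; rewrite !mE; have [vi vo] := face_speed_coord t s i; have v0 := face_speed_ge0 t s.
  have b K : `|u t K 0 i| <= face_speed t s -> `|rho t K * u t K 0 i| <= rhi * face_speed t s.
    move=> uK; rewrite normrM (gtr0_norm (rho_gt0 K tc)); apply: ler_pM => //; first exact/ltW/rho_gt0.
    exact: rho_le.
  apply: le_trans (lerD (b _ vi) (b _ vo)) _; lra.
rewrite /S2 /total_weight !mulr_sumr; apply: ler_sum => s _; have a0 := farea_s_gt0 cM LP s.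
rewrite mulrCA [leRHS]mulrCA ler_wpM2l ?(ltW a0)//.
have [s1 s2 s3] := sq_le t s; have jr0 : 0 <= rho_jump t s by exact: normr_ge0.
have jt0 : 0 <= th_jump t s by exact: normr_ge0.
have r1 := jump_le tc s2; have r2 := jump_le tc s3; have r3 := stress_le s tc.
have pj : `|jump (p t) s| <= rhi * th_jump t s + thup * rho_jump t s.
  rewrite /jump !(presE _ tc) (_ : _ - _ = rho t (eout s) * (th t (eout s) - th t (ein s))
     + th t (ein s) * (rho t (eout s) - rho t (ein s))); last by ring.
  apply: le_trans (ler_normD _ _) _.
  rewrite 2!normrM (gtr0_norm (rho_gt0 (eout s) tc)) (gtr0_norm (th_gt0 (ein s) tc)).
  by apply: lerD; rewrite ler_wpM2r ?rho_le//; have [] := rho_th_bd (ein s) tc.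
have uj : \sum_i `|jumpv (u t) s 0 i| <= n%:R * u_jump t s.
  have -> : n%:R * u_jump t s = \sum_(i < n) u_jump t s by rewrite sumr_const card_ord mulr_natl.
  by apply: ler_sum => i _; exact: coord_le_sqrt.
have e0 : 0 <= eps := powR_ge0 _ _.
apply: (@le_trans _ _ (n%:R * (rhi * (h * th_jump t s) + thup * (h * rho_jump t s)) + 2 * n%:R * (h * eps * u_jump t s))).
  rewrite mulrDr; apply: lerD.
    rewrite mulrCA ler_wpM2l//; apply: le_trans (ler_wpM2l (ltW h0) pj) _.
    by rewrite le_eqVlt; apply/orP; left; apply/eqP; ring.
  have := ler_wpM2l (mulr_ge0 (ltW h0) (mulr_ge0 (ler0n R 2) e0)) uj; rewrite -!mulrA => /le_trans; apply.
  by rewrite le_eqVlt; apply/orP; left; apply/eqP; ring.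
rewrite [leRHS](_ : _ = n%:R * (rhi * ((1 + A) * D * face_weight t s) + thup * ((1 + A) * D * face_weight t s))
   + 2 * n%:R * ((1 + A) * D * face_weight t s)); last by ring.
apply: lerD; last by rewrite ler_wpM2l.
by rewrite ler_wpM2l//; apply: lerD; rewrite ler_wpM2l// ltW.
Qed.

(** The absolute values spare a discussion of the signs of the constants, and the summand 1 makes
    the resulting constant positive. *)
Lemma rate_bound (f : R -> R) (K B : R) : ct T f -> 0 <= B ->
  (forall t, 0 < t < T -> `|f t| <= K * D * B * total_weight t) ->
  L1norm T f <= (1 + `|K| * `|weight_cst * T + diss_bound|) * D * B.
Proof.
move=> cf B0 fK; have DB : 0 <= D * B by rewrite mulr_ge0.
apply: (@le_trans _ _ (`|K| * (D * B) * (weight_cst * T + diss_bound))).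
  apply: rate_integral => // [|t tT]; first by rewrite mulr_ge0.
  have tc := in_cc tT; apply: le_trans (fK t tT) _; rewrite -!mulrA; apply: ler_wpM2r; last exact: ler_norm.
  rewrite !mulrA mulr_ge0//; apply: sumr_ge0 => s _.
  by rewrite mulr_ge0 ?face_weight_ge0// ltW// (farea_s_gt0 cM LP).
rewrite [leRHS](_ : _ = D * B + `|K| * (D * B) * `|weight_cst * T + diss_bound|); last by ring.
by rewrite ler_wpDl// ler_wpM2l ?ler_norm// mulr_ge0.
Qed.

End Uniform.

End Solution.

(** * Integrals of test functions over the mesh, and conclusion *)

Section CellIntegrals.
Context {R : realType} {n : nat} {T : R} {Om : set 'rV[R]_n}.
Variables (M : mesh R n) (L : elt M -> seq 'rV[R]_n) (t : R).
Hypothesis cM : conforming_mesh Om M.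
Hypothesis LP : forall K, polyh (cell K) (L K).
Hypothesis tT : t \in `[0, T].
Implicit Types (phi : C1fun T Om) (K : elt M).

Lemma withinZ K (a : R) (f : 'rV[R]_n -> R) : {within cell K, continuous f} ->
  {within cell K, continuous (fun x => a * f x)}.
Proof. by move=> cf x; apply: cvgM; [exact: cvg_cst|exact: cf]. Qed.

Lemma withinD K (f g : 'rV[R]_n -> R) : {within cell K, continuous f} ->
  {within cell K, continuous g} -> {within cell K, continuous (fun x => f x + g x)}.
Proof. by move=> cf cg x; apply: (@cvgD _ R^o); [exact: cf|exact: cg]. Qed.

Lemma within_sum K (I : Type) (r : seq I) (f : I -> 'rV[R]_n -> R) :
  (forall i, {within cell K, continuous f i}) -> {within cell K, continuous (fun x => \sum_(i <- r) f i x)}.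
Proof. by move=> cf x; apply: cvg_sumr => i _; exact: cf. Qed.

Let val_in phi K : {within cell K, continuous (phi t)}.
Proof. exact: (@cell_val_within _ _ _ _ _ cM phi t K tT). Qed.

Let dt_in phi K : {within cell K, continuous (c1_dt phi t)}.
Proof. exact: (@cell_dt_within _ _ _ _ _ cM phi t K tT). Qed.

Let grad_in phi K i : {within cell K, continuous (fun x => c1_grad phi t x 0 i)}.
Proof. exact: (@cell_grad_within _ _ _ _ _ cM phi t K i tT). Qed.

Let dot_grad_in phi K (m : 'rV[R]_n) : {within cell K, continuous (fun x => dot m (c1_grad phi t x))}.
Proof. by apply: (@within_sum K) => i; apply: withinZ. Qed.

Lemma intO_val (a : elt M -> R) phi :
  intO (fun K x => a K * phi t x) = \sum_K a K * cint K (phi t).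
Proof.
rewrite (intOE LP) => [|K]; last exact: withinZ.
by apply: eq_bigr => K _; rewrite (cintZ LP).
Qed.

Lemma intO_transport (a b : elt M -> R) (m : elt M -> 'rV[R]_n) phi :
  intO (fun K x => a K * c1_dt phi t x + b K * dot (m K) (c1_grad phi t x)) =
  \sum_K cint K (fun x => a K * c1_dt phi t x + b K * dot (m K) (c1_grad phi t x)).
Proof. by apply: (intOE LP) => K; apply: withinD; apply: withinZ. Qed.

Lemma intO_dot (m : elt M -> 'rV[R]_n) (Phi : 'I_n -> C1fun T Om) :
  intO (fun K x => dot (m K) (vval Phi t x)) = \sum_K \sum_i m K 0 i * cint K (Phi i t).
Proof.
have E K : (fun x => dot (m K) (vval Phi t x)) = (fun x => \sum_i m K 0 i * Phi i t x).
  by apply/funext => x; apply: eq_bigr => i _; rewrite mxE.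
rewrite (intOE LP) => [|K]; last by rewrite E; apply: (@within_sum K) => i; exact: withinZ.
by apply: eq_bigr => K _; rewrite E (cint_sum LP).
Qed.

Lemma intO_momentum (r p : elt M -> R) (m : elt M -> 'rV[R]_n) (Phi : 'I_n -> C1fun T Om) :
  intO (fun K x => dot (m K) (vdt Phi t x) + ddgrad ((r K)^-1 *: ((m K)^T *m m K)) Phi t x
    + p K * vdiv Phi t x) =
  \sum_K (\sum_i m K 0 i * cint K (c1_dt (Phi i) t)
     + (\sum_i m K 0 i * cint K (fun x => dot ((r K)^-1 *: m K) (c1_grad (Phi i) t x))
      + p K * \sum_i cint K (fun x => c1_grad (Phi i) t x 0 i))).
Proof.
have E K : (fun x => dot (m K) (vdt Phi t x) + ddgrad ((r K)^-1 *: ((m K)^T *m m K)) Phi t x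
      + p K * vdiv Phi t x) =
    (fun x => (\sum_i m K 0 i * c1_dt (Phi i) t x
      + \sum_i m K 0 i * dot ((r K)^-1 *: m K) (c1_grad (Phi i) t x))
      + \sum_i p K * c1_grad (Phi i) t x 0 i).
  apply/funext => x; rewrite /vdiv mulr_sumr; congr (_ + _ + _).
    by apply: eq_bigr => i _; rewrite mxE.
  apply: eq_bigr => i _; rewrite mulr_sumr; apply: eq_bigr => j _.
  by rewrite !mxE big_ord_recl big_ord0 !mxE; ring.
have c1 K : {within cell K, continuous (fun x => \sum_i m K 0 i * c1_dt (Phi i) t x)}.
  by apply: (@within_sum K) => i; exact: withinZ.
have c2 K : {within cell K, continuous (fun x => \sum_i m K 0 i * dot ((r K)^-1 *: m K) (c1_grad (Phi i) t x))}.
  by apply: (@within_sum K) => i; exact: withinZ.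
have c3 K : {within cell K, continuous (fun x => \sum_i p K * c1_grad (Phi i) t x 0 i)}.
  by apply: (@within_sum K) => i; exact: withinZ.
rewrite (intOE LP) => [|K]; last by rewrite E; apply: withinD => //; exact: withinD.
apply: eq_bigr => K _.
rewrite E (cintD LP (withinD (c1 K) (c2 K)) (c3 K)) (cintD LP (c1 K) (c2 K)) -addrA !(cint_sum LP)//.
by rewrite mulr_sumr.
Qed.

End CellIntegrals.

Lemma sum_le_size {R : realType} {I : Type} (r : seq I) (P : pred I) (F : I -> R) (b : R) :
  0 <= b -> (forall i, P i -> F i <= b) -> \sum_(i <- r | P i) F i <= (size r)%:R * b.
Proof.
move=> b0 Fb; elim: r => [|i r IH]; first by rewrite big_nil mul0r.
rewrite big_cons /= -natr1 mulrDl mul1r; case: ifPn => [/Fb Fi|_]; last by rewrite ler_wpDr.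
by rewrite addrC; exact: lerD.
Qed.

Theorem theorem5p1 (R : realType) (N : nat) (hN : (1 <= N <= 3)%N)
  (gamma alpha T : R) (hgamma : 1 < gamma) (hT : 0 < T)
  (Om : set 'rV[R]_N) (hOm : polyhedral_domain Om)
  (H : set R) (M : R -> mesh R N) (hM : regular_mesh_family Om H M)
  (mu : forall h : R, face (M h) -> R -> R)
  (hmu : forall h, H h -> forall s,
     {within `[0, T], continuous (mu h s)} /\
     forall t, t \in `[0, T] -> 0 <= mu h s t)
  (U0 : forall h : R, state (M h))
  (hU0 : exists2 rholow : R, 0 < rholow & forall h, H h -> forall K,
     rholow <= dens (U0 h) K /\
     0 < ener (U0 h) K - 2^-1 * dot (mom (U0 h) K) (mom (U0 h) K) / dens (U0 h) K)
  (hU0b : exists C : R, forall h, H h ->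
     intO (fun K _ => dens (U0 h) K) <= C /\ intO (fun K _ => ener (U0 h) K) <= C)
  (U : forall h : R, R -> state (M h))
  (hs0 : exists s0 : R, forall h, H h -> forall K, s0 < entropy gamma (U h 0) K)
  (hU : forall h, H h -> fv_solution gamma Om alpha h T (mu h) (U0 h) (U h)) :
  exists (e1 : R -> C1fun T Om -> R -> R)
         (e2 : R -> ('I_N -> C1fun T Om) -> R -> R)
         (e3 : R -> (R -> R) -> C1fun T Om -> R -> R),
  (forall h, H h ->
    [/\ (forall phi : C1fun T Om, L1 T (e1 h phi) /\
          forall tau, tau \in `[0, T] ->
          increment (fun t => intO (fun K x => dens (U h t) K * phi t x)) tau
          = \int[lebesgue_measure]_(t in `[0, tau])
              intO (fun K x => dens (U h t) K * c1_dt phi t x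
                               + dot (mom (U h t) K) (c1_grad phi t x))
            + \int[lebesgue_measure]_(t in `[0, tau]) e1 h phi t),
        (forall phi : 'I_N -> C1fun T Om, tangential (M h) phi ->
          L1 T (e2 h phi) /\
          forall tau, tau \in `[0, T] ->
          increment (fun t => intO (fun K x => dot (mom (U h t) K) (vval phi t x))) tau
          = \int[lebesgue_measure]_(t in `[0, tau])
              intO (fun K x =>
                dot (mom (U h t) K) (vdt phi t x)
                + ddgrad ((dens (U h t) K)^-1 *: ((mom (U h t) K)^T *m mom (U h t) K))
                    phi t x
                + pres gamma (U h t) K * vdiv phi t x)
            + \int[lebesgue_measure]_(t in `[0, tau]) e2 h phi t),
        (forall tau, tau \in `[0, T] ->
          intO (fun K _ => ener (U h tau) K) = intO (fun K _ => ener (U0 h) K))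
      & (forall (chi : R -> R) (phi : C1fun T Om), entropy_cutoff chi -> nonneg phi ->
          L1 T (e3 h chi phi) /\
          forall tau, tau \in `[0, T] ->
          increment (fun t => intO (fun K x =>
            dens (U h t) K * chi (entropy gamma (U h t) K) * phi t x)) tau
          >= \int[lebesgue_measure]_(t in `[0, tau])
               intO (fun K x =>
                 dens (U h t) K * chi (entropy gamma (U h t) K) * c1_dt phi t x
                 + chi (entropy gamma (U h t) K)
                   * dot (mom (U h t) K) (c1_grad phi t x))
             + \int[lebesgue_measure]_(t in `[0, tau]) e3 h chi phi t)]) /\
  (forall beta : R, 0 <= beta < 1 -> 0 < alpha < 4 / 3 ->
    (exists2 c : R, 0 < c & forall h, H h -> forall s t, t \in `[0, T] ->
       c^-1 * h `^ beta <= mu h s t <= c) ->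
    (exists rholow thetaup : R, [/\ 0 < rholow, 0 < thetaup &
       forall h, H h -> forall t K, t \in `[0, T] ->
         rholow <= dens (U h t) K /\ temp gamma (U h t) K <= thetaup]) ->
    exists2 delta : R, 0 < delta &
      [/\ (exists2 c : R, 0 < c & forall h, H h -> forall phi,
             L1norm T (e1 h phi) <= c * h `^ delta * C1norm phi),
          (exists2 c : R, 0 < c & forall h, H h -> forall phi, tangential (M h) phi ->
             L1norm T (e2 h phi) <= c * h `^ delta * C1normv phi)
        & (forall chi, entropy_cutoff chi ->
             exists2 c : R, 0 < c & forall h, H h -> forall phi, nonneg phi ->
             L1norm T (e3 h chi phi) <= c * h `^ delta * C1norm phi)]).
Proof.
have [Nn hNn] := boundary_normals hOm.
have [CT CT0 hT'] := tangential_proj_unif Nn.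
have [Cc Cc0 hconc] := concentration hOm.
have [hH [cm cm0 hcm]] := hM.
(* The error functionals are given for all h at once, so that a projection is chosen beforehand on
   every cell; the predicate selects the normals of its boundary facets. *)
pose Pm h (K : elt (M h)) := sval (cid (hT' (fun v => `[<boundary_facet Om K v>]))).
have Pm_spec h (K : elt (M h)) := svalP (cid (hT' (fun v => `[<boundary_facet Om K v>]))).
have Pt h : H h -> forall (K : elt (M h)) (w v : 'rV[R]_N), boundary_facet Om K v -> dot (w *m Pm h K) v = 0.
  move=> hh K w v Kv; have [P1 _ _] := Pm_spec h K; apply: P1; last exact/asboolP.
  exact: hNn (hH h hh).2 _ _ Kv.
have Po h : H h -> forall (K : elt (M h)) (w z : 'rV[R]_N),
    (forall v, boundary_facet Om K v -> dot z v = 0) -> dot z (w *m Pm h K) = dot z w.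
  by move=> hh K w z zK; have [_ P2 _] := Pm_spec h K; apply: P2 => v _ /asboolP; exact: zK.
have Pc h : H h -> forall (K : elt (M h)) (w : 'rV[R]_N) (b : R), 0 <= b ->
    (forall v, boundary_facet Om K v -> `|dot w v| <= b) ->
    forall i, `|(w - w *m Pm h K) 0 i| <= CT * (size Nn)%:R * b.
  move=> hh K w b b0 wb i; have [_ _ P3] := Pm_spec h K; apply: le_trans (P3 w i) _.
  by rewrite -mulrA ler_wpM2l// sum_le_size// => v /asboolP; exact: wb.
have LPex h : H h -> exists L : elt (M h) -> seq 'rV[R]_N, forall K, polyh (cell K) (L K).
  move=> hh; have [_ [_ hp _ _ _]] := hH h hh.
  have /choice[L LP] : forall K : elt (M h), exists L, polyh (cell K) L.
    by move=> K; have [p1 p2] := hp K; exact: polytope_polyh.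
  by exists L.
have vol0 h : H h -> forall K : elt (M h), 0 < cvol K.
  move=> hh K; have [L LP] := LPex h hh; have [_ hv _] := hcm h hh.
  have /andP[v1 _] := hv K; rewrite -(cell_vol LP); apply: lt_le_trans v1.
  by rewrite mulr_gt0 ?invr_gt0// exprn_gt0//; have [] := hH h hh.
have muct h : H h -> forall s, ct T (mu h s) by move=> hh s; have [] := hmu h hh s.
have mu0 h : H h -> forall s t, t \in `[0, T] -> 0 <= mu h s t by move=> hh s t; have [_] := hmu h hh s; apply.
exists (fun h phi t => residual (mu h) (U h) (fun=> 1) phi t),
  (fun h Phi t => mresidual gamma alpha h (mu h) (U h) (Pm h) Phi t),
  (fun h chi phi t => residual (mu h) (U h) (fun K => chi (entropy gamma (U h t) K)) phi t).
have sub (t tau : R) : tau \in `[0, T] -> t \in `[0, tau] -> t \in `[0, T].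
  by rewrite !in_itv /= => /andP[_ h1] /andP[-> /le_trans->].
have zT : (0 : R) \in `[0, T] by rewrite in_itv /= lexx ltW.
have ct1 h : H h -> forall phi : C1fun T Om, ct T (residual (mu h) (U h) (fun=> 1) phi).
  move=> hh phi; have [L LP] := LPex h hh; have cM := (hH h hh).2.
  exact: (@residual_ct _ _ _ _ _ _ _ _ _ _ _ _ hT cM LP (muct h hh) (hU h hh) (fun _ _ => 1) phi (fun _ => @ct_cst R T 1)).
have ct2 h : H h -> forall Phi : 'I_N -> C1fun T Om, ct T (mresidual gamma alpha h (mu h) (U h) (Pm h) Phi).
  move=> hh Phi; have [L LP] := LPex h hh; have cM := (hH h hh).2.
  exact: (@mresidual_ct _ _ _ _ _ _ _ _ _ _ _ _ hT cM LP (muct h hh) (hU h hh) (Pm h) Phi).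
have ct3 h : H h -> forall chi (phi : C1fun T Om), entropy_cutoff chi ->
    ct T (fun t => residual (mu h) (U h) (fun K => chi (entropy gamma (U h t) K)) phi t).
  move=> hh chi phi hchi; have [L LP] := LPex h hh; have cM := (hH h hh).2.
  have [kap sg] := cutoff_supergradient hchi.
  apply: (@residual_ct _ _ _ _ _ _ _ _ _ _ _ _ hT cM LP (muct h hh) (hU h hh) (fun t K => chi (entropy gamma (U h t) K)) phi) => K.
  apply: ct_comp => [|x _]; last exact: (supergradient_continuous sg).
  exact: (@ent_ct _ _ _ _ _ _ _ _ _ _ _ (hU h hh) K).
split.
  move=> h hh; have [L LP] := LPex h hh; have cM := (hH h hh).2; have v0 := vol0 h hh.
  have sol := hU h hh; have mct := muct h hh; have mu0h := mu0 h hh.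
  have U00 : U h 0 = U0 h by case: sol.
  split.
  - move=> phi; split; first exact: continuous_itv_integrable (ct1 h hh phi).
    move=> tau tauT.
    have := mass_balance hT hOm cM LP v0 mct sol phi tauT.
    rewrite /increment !(intO_val cM LP)// => ->; congr (_ + _).
    apply: eq_ig => t t1; have tT := sub _ _ tauT t1.
    have := intO_transport cM LP tT (fun K => dens (U h t) K) (fun=> 1) (fun K => mom (U h t) K) phi.
    under [in X in X = _ -> _]eq_fun do under eq_fun do rewrite mul1r.
    by under [in X in _ = X -> _]eq_bigr do under eq_fun do rewrite mul1r.
  - move=> Phi tg; split; first exact: continuous_itv_integrable (ct2 h hh Phi).
    move=> tau tauT.
    have := momentum_balance hT hOm cM LP v0 mct sol (Pt h hh) (Po h hh) Phi tauT.
    rewrite /increment !(intO_dot cM LP)// => ->; congr (_ + _).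
    apply: eq_ig => t t1; have tT := sub _ _ tauT t1.
    by rewrite (intO_momentum cM LP tT).
  - by move=> tau tauT; rewrite !(intO_cst LP) (energy_cons cM LP sol tauT) U00.
  - move=> chi phi hchi phi0; split; first exact: continuous_itv_integrable (ct3 h hh chi phi hchi).
    move=> tau tauT.
    have := entropy_inequality hgamma hT hOm cM LP v0 mu0h mct sol hchi phi0 tauT.
    rewrite /increment !(intO_val cM LP _ (fun K => _ * _))//; apply: le_trans.
    rewrite le_eqVlt; apply/orP; left; apply/eqP; congr (_ + _).
    apply: eq_ig => t t1; have tT := sub _ _ tauT t1.
    exact: (intO_transport cM LP tT _ _ _ phi).
move=> beta hbeta halpha [cv cv0 hcv] [rlo [thup [rlo0 thup0 hrt]]].
have [CB hCB] := hU0b; have [s0 hs] := hs0.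
(* One constant for the mesh and for the viscosity; here [cv] is the viscosity bound of the
   hypothesis, not the specific heat. *)
pose c := cm + cv; have c0 : 0 < c by rewrite addr_gt0.
have inv1 : c^-1 <= cm^-1 by rewrite lef_pV2 ?posrE// lerDl ltW.
have inv2 : c^-1 <= cv^-1 by rewrite lef_pV2 ?posrE// lerDr ltW.
have n03 : (0 < N <= 3)%N by [].
have h0 h : H h -> 0 < h by move=> /hH[].
have diam h : H h -> forall (K : elt (M h)) x y, cell K x -> cell K y -> enorm (x - y) <= c * h.
  move=> hh K x y Kx Ky; have [d _ _] := hcm h hh; apply: le_trans (d K x y Kx Ky) _.
  by rewrite ler_wpM2r ?(ltW (h0 h hh))// lerDl ltW.
have vlo h : H h -> forall K : elt (M h), c^-1 * h ^+ N <= cvol K.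
  move=> hh K; have [L LP] := LPex h hh; have [_ hv _] := hcm h hh.
  have /andP[v1 _] := hv K; rewrite -(cell_vol LP); apply: le_trans v1.
  by rewrite ler_wpM2r// exprn_ge0// ltW// h0.
have mub h : H h -> forall s t, t \in `[0, T] -> c^-1 * h `^ beta <= mu h s t <= c.
  move=> hh s t tT; have /andP[m1 m2] := hcv h hh s t tT; apply/andP; split.
    by apply: le_trans m1; rewrite ler_wpM2r ?powR_ge0.
  by apply: le_trans m2 _; rewrite lerDr ltW.
have U00 h : H h -> U h 0 = U0 h by move=> hh; case: (hU h hh).
have mass0 h : H h -> \sum_K cvol K * dens (U h 0) K <= CB.
  by move=> hh; have [L LP] := LPex h hh; rewrite U00// -(intO_cst LP); have [] := hCB h hh.
have energy0 h : H h -> \sum_K cvol K * ener (U h 0) K <= CB.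
  by move=> hh; have [L LP] := LPex h hh; rewrite U00// -(intO_cst LP); have [] := hCB h hh.
have cnc h L : H h -> (forall K : elt (M h), polyh (cell K) (L K)) -> forall (w : elt (M h) -> R) t, 0 < t <= 1 -> (forall K, 0 <= w K) ->
    \sum_(K | Cc * \sum_K' cvol K' * w K' < t ^+ N * w K) cvol K * w K <=
    Cc * t * \sum_s farea_s s * `|jump w s|.
  by move=> hh LP w t t1 w0; exact: (hconc _ _ _ _ (hH h hh).2 LP).
(* The constants are built from data independent of h and of the test function, before h is
   introduced. *)
pose B := `|weight_cst (n := N) c rlo CB * T + diss_bound gamma rlo thup CB s0|.
pose CC := conv_cst (n := N) gamma c rlo thup CB s0 Cc.
have dpos := delta_gt0 hbeta halpha; have B0 : 0 <= B by exact: normr_ge0.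
exists (delta alpha beta) => //; split.
(* The continuity error is the entropy error for the constant cutoff 1 with supergradient 0. *)
- pose K := N%:R * c * (entropy_rate_cst gamma rlo thup s0 (fun=> 1) (fun=> 0) * CC).
  exists (1 + `|K| * B); first by rewrite ltr_wpDr// mulr_ge0 ?normr_ge0.
  move=> h hh phi; have [L LP] := LPex h hh; have cM := (hH h hh).2.
  apply: (rate_bound hgamma hT hOm cM LP (vol0 h hh) (mu0 h hh) (muct h hh) (hU h hh) c0 (h0 h hh) (diam h hh) (vlo h hh) rlo0 thup0 (hrt h hh) (mass0 h hh) (energy0 h hh) (hs h hh)).
  + exact: ct1.
  + exact: (C1norm_ge0 hT hOm).
  move=> t tT; apply: (entropy_rate_le hgamma hT hOm cM LP (vol0 h hh) (mu0 h hh) (muct h hh) (hU h hh) n03 hbeta halpha c0 (h0 h hh) (diam h hh) (vlo h hh) (mub h hh) rlo0 thup0 (hrt h hh) (mass0 h hh) (energy0 h hh) (hs h hh) (cnc h L hh LP) Cc0 (chi := fun=> 1) (kap := fun=> 0)) => //.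
  by move=> x; split=> // y; rewrite mul0r addr0.
- pose CP := CT * (size Nn)%:R; have CP0 : 0 <= CP by rewrite mulr_ge0.
  pose A := power_cst c rlo CB; pose rh := rhi gamma thup s0.
  pose K := (CP + 1) * N%:R * c *
     (N%:R * ((2 * rh + 1) * CC) + N%:R * (rh + thup) * (1 + A) + 2 * N%:R * (1 + A)).
  exists (1 + `|K| * B); first by rewrite ltr_wpDr// mulr_ge0 ?normr_ge0.
  move=> h hh phi tg; have [L LP] := LPex h hh; have cM := (hH h hh).2.
  apply: (rate_bound hgamma hT hOm cM LP (vol0 h hh) (mu0 h hh) (muct h hh) (hU h hh) c0 (h0 h hh) (diam h hh) (vlo h hh) rlo0 thup0 (hrt h hh) (mass0 h hh) (energy0 h hh) (hs h hh)).
  + exact: ct2.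
  + by apply: sumr_ge0 => i _; exact: (C1norm_ge0 hT hOm).
  move=> t tT.
  exact: (momentum_rate_le hgamma hT hOm cM LP (vol0 h hh) (mu0 h hh) (muct h hh) (hU h hh) n03 hbeta halpha c0 (h0 h hh) (diam h hh) (vlo h hh) (mub h hh) rlo0 thup0 (hrt h hh) (mass0 h hh) (energy0 h hh) (hs h hh) (cnc h L hh LP) Cc0 CP0 (Pt h hh) (Pc h hh) tT tg).
- move=> chi hchi; have [kap sg] := cutoff_supergradient hchi.
  pose K := N%:R * c * (entropy_rate_cst gamma rlo thup s0 chi kap * CC).
  exists (1 + `|K| * B); first by rewrite ltr_wpDr// mulr_ge0 ?normr_ge0.
  move=> h hh phi phi0; have [L LP] := LPex h hh; have cM := (hH h hh).2.
  apply: (rate_bound hgamma hT hOm cM LP (vol0 h hh) (mu0 h hh) (muct h hh) (hU h hh) c0 (h0 h hh) (diam h hh) (vlo h hh) rlo0 thup0 (hrt h hh) (mass0 h hh) (energy0 h hh) (hs h hh)).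
  + exact: ct3.
  + exact: (C1norm_ge0 hT hOm).
  move=> t tT.
  exact: (entropy_rate_le hgamma hT hOm cM LP (vol0 h hh) (mu0 h hh) (muct h hh) (hU h hh) n03 hbeta halpha c0 (h0 h hh) (diam h hh) (vlo h hh) (mub h hh) rlo0 thup0 (hrt h hh) (mass0 h hh) (energy0 h hh) (hs h hh) (cnc h L hh LP) Cc0 phi sg tT).
Qed.
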